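(* Let $\Omega\subseteq\mathbb H$ be a basic domain, let $\omega$ be a vectorial class on $\Omega$, and let $g\in\mathcal{SR}_\omega(\Omega)$ be a nonvanishing function. Then the following hold. (a) If $\omega=[0]$, a necessary and sufficient condition for the existence of a $*$-logarithm of $g$ on $\Omega$ belonging to $\mathcal{SR}_{[0]}(\Omega)=\mathcal{SR}_{\mathbb R}(\Omega)$ is $g(\Omega\cap\mathbb R)\subset(0,+\infty)$. (b) If $\omega\neq[0]$ and either $Z(\omega)=\varnothing$ or $\mathbb S Z(\omega)=\Omega$, then a $*$-logarithm of $g$ on $\Omega$ belonging to $\mathcal{SR}_\omega(\Omega)$ always exists. (c) If $\omega\neq[0]$ and $Z(\omega)$ is discrete, a sufficient condition for the existence of a $*$-logarithm of $g$ on $\Omega$ belonging to $\mathcal{SR}_\omega(\Omega)$ is the validity of both inclusions $$\sqrt{g^s}(\Omega\cap\mathbb R)\subset(0,+\infty)\qquad\text{and}\qquad \frac{g_0}{\sqrt{g^s}}(\Omega)\subset\mathbb H\setminus(-\infty,-1],$$ where $g^s=g_0^2+g_v^s$ is the symmetrization of $g$ and $\sqrt{g^s}\in\mathcal{SR}_{\mathbb R}(\Omega)$ is a slice-regular, slice-preserving square root of $g^s$.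
   Context: Domains. $\mathbb H$ is the skew field of quaternions, $\mathbb S=\{q\in\mathbb H: q^2=-1\}$, $\mathbb C_I=\mathbb R+I\mathbb R$ for $I\in\mathbb S$, and $\Omega_I=\Omega\cap\mathbb C_I$. A domain is a connected open set. An open set $\Omega$ is axially symmetric if $x+Iy\in\Omega$ ($x,y\in\mathbb R$, $I\in\mathbb S$) implies $x+\mathbb Sy\subset\Omega$. For an axially symmetric domain, $\Omega_I$ is either connected and meets $\mathbb R$ (symmetric slice domain), or $\Omega\cap\mathbb R=\varnothing$ and $\Omega_I$ has two components swapped by conjugation (product domain). $\Omega$ is basic if it is an axially symmetric domain and every connected component of $\Omega_I$ is simply connected for one (hence all) $I$. For $W\subset\mathbb H$, $\mathbb SW$ denotes the axially symmetric hull of $W$, i.e. the union of the spheres $\mathbb S_p=x+\mathbb Sy$ over $p=x+Iy\in W$. Slice-regular functions. Let $\Omega$ be axially symmetric open. Let $\mathbb H_{\mathbb C}=\mathbb H+\iota\mathbb H$ be the complexification ($\iota^2=-1$, $\iota$ central, with involution $\overline{x+\iota y}=x-\iota y$), and $\Omega_\iota=\{x+\iota y: x,y\in\mathbb R,\ x+Iy\in\Omega\}$. A stem function is $F=F_1+\iota F_2:\Omega_\iota\to\mathbb H_{\mathbb C}$ with $F(\bar z)=\overline{F(z)}$; it induces the slice function $f(x+Jy)=F_1(x+\iota y)+JF_2(x+\iota y)$, $J\in\mathbb S$. $f$ is slice-regular if $F$ is holomorphic; $\mathcal{SR}(\Omega)$ is the set of slice-regular functions. The $*$-product $f*g$ is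 the slice function induced by the pointwise product $FG$. $f\in\mathcal{SR}(\Omega)$ is slice-preserving if $f(\Omega_I)\subset\mathbb C_I$ for all $I$; these form $\mathcal{SR}_{\mathbb R}(\Omega)$. With $1,i,j,k$ the standard basis, every $f\in\mathcal{SR}(\Omega)$ is uniquely $f=f_0+f_1i+f_2j+f_3k=f_0+f_v$ with $f_l\in\mathcal{SR}_{\mathbb R}(\Omega)$; $f_0$ is the scalar part, $f_v$ the vectorial part, $f^c=f_0-f_v$, and the symmetrization is $f^s=f*f^c=f_0^2+f_1^2+f_2^2+f_3^2$ (so $f_v^s=f_1^2+f_2^2+f_3^2$). $f$ is vectorial if $f_0=0$; vectorial functions form $\mathcal{SR}^v(\Omega)$. $*$-logarithm. $\exp_*(f)=\sum_{n\ge0}f^{*n}/n!$. A $*$-logarithm of $g$ on $\Omega$ is an $f\in\mathcal{SR}(\Omega)$ with $\exp_*(f)=g$ on $\Omega$. Vectorial classes. On an axially symmetric domain $V$, $f_v,g_v\in\mathcal{SR}^v(V)$ are linearly dependent over $\mathcal{SR}_{\mathbb R}(V)$ if $af_v+bg_v=0$ for some $a,b\in\mathcal{SR}_{\mathbb R}(V)$ not both identically zero. Vectorial functions $f_v,g_v$, each defined on an axially symmetric domain containing $p$, are equivalent at $p$ if they are linearly dependent on some axially symmetric neighborhood (domain) of $p$. This is an equivalence relation on vectorial functions not identically zero near $p$; $[f_v]_p$ is the class, and $[0]_p$ is the class of the zero function. A vectorial class on $\Omega$ is a map $\omega$ assigning to each $p\in\Omega$ a class $\omega(p)$ of vectorial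 functions at $p$, such that whenever $\omega(p)=[f_v]_p$ with $f_v\in\mathcal{SR}^v(V_p)$ and $\omega(q)=[g_v]_q$ with $g_v\in\mathcal{SR}^v(V_q)$, where $V_p,V_q\subset\Omega$ are axially symmetric domains containing $p,q$, one has $[f_v]_{\tilde p}=[g_v]_{\tilde p}$ for all $\tilde p\in V_p\cap V_q$. $\mathcal{SR}_\omega(\Omega)$ is the set of $g\in\mathcal{SR}(\Omega)$ whose vectorial part $g_v$ belongs to $\omega(p)$ at every $p\in\Omega$; since the zero function is linearly dependent with every vectorial function, $\mathcal{SR}_{\mathbb R}(\Omega)\subset\mathcal{SR}_\omega(\Omega)$ for every $\omega$, and $\mathcal{SR}_{[0]}(\Omega)=\mathcal{SR}_{\mathbb R}(\Omega)$. Zero set. For $\omega\ne[0]$, a minimal representative of $\omega$ on an axially symmetric open $U\subset\Omega$ is a vectorial function $w$ on $U$ representing $\omega$ on $U$ and having neither real zeros nor spherical zeros (whole spheres $a+\mathbb Sb$, $b>0$, of zeros). Two minimal representatives on the same set have the same zeros. $Z(\omega)$ is the union of the zero sets $w^{-1}(0)$ over all minimal representatives $w$ of $\omega$ on axially symmetric open subsets of $\Omega$. $Z([0])=\varnothing$. *)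

(* Defs.v *)
From HB Require Import structures.
From mathcomp Require Import all_boot all_order all_algebra.
From mathcomp Require Import complex.
From mathcomp Require Import all_classical all_reals all_analysis.
From mathcomp Require Import ring lra.

Set Implicit Arguments.
Unset Strict Implicit.
Unset Printing Implicit Defensive.

Import Order.TTheory GRing.Theory Num.Theory numFieldNormedType.Exports.

Local Open Scope classical_set_scope.
Local Open Scope ring_scope.
Local Open Scope complex_scope.

HB.instance Definition _ (R : rcfType) := NormedModule.copy R[i] R[i]^o.

(* The coordinates of a quaternion are those in the basis 1, i, j, k.  The
   skew field H is [quat R], and its complexification H + iota H is
   [quat R[i]], where iota is the scalar ['i] of R[i]. *)
Definition quat (K : Type) : Type := 'rV[K]_4.

HB.instance Definition _ (K : choiceType) := Choice.copy (quat K) 'rV[K]_4.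
HB.instance Definition _ (K : zmodType) :=
  GRing.Zmodule.copy (quat K) 'rV[K]_4.
HB.instance Definition _ (K : pzRingType) :=
  GRing.Lmodule.copy (quat K) 'rV[K]_4.
HB.instance Definition _ (K : numFieldType) :=
  NormedModule.copy (quat K) 'rV[K]_4.

Definition mkquat (K : pzRingType) (a b c d : K) : quat K :=
  \row_(l < 4) [:: a; b; c; d]`_l.

Section QuaternionRing.
Variable K : comNzRingType.
Implicit Types p q r : quat K.

Lemma quatP p q : p 0 0 = q 0 0 -> p 0 1 = q 0 1 -> p 0 2 = q 0 2 ->
  p 0 3 = q 0 3 -> p = q.
Proof.
move=> e0 e1 e2 e3; apply/rowP => -[[|[|[|[|//]]]] i].
- by rewrite (_ : Ordinal i = 0) //; apply: val_inj.
- by rewrite (_ : Ordinal i = 1) //; apply: val_inj.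
- by rewrite (_ : Ordinal i = 2) //; apply: val_inj.
- by rewrite (_ : Ordinal i = 3) //; apply: val_inj.
Qed.

Definition quat1 : quat K := mkquat 1 0 0 0.

Definition mulq p q : quat K := mkquat
  (p 0 0 * q 0 0 - p 0 1 * q 0 1 - p 0 2 * q 0 2 - p 0 3 * q 0 3)
  (p 0 0 * q 0 1 + p 0 1 * q 0 0 + p 0 2 * q 0 3 - p 0 3 * q 0 2)
  (p 0 0 * q 0 2 - p 0 1 * q 0 3 + p 0 2 * q 0 0 + p 0 3 * q 0 1)
  (p 0 0 * q 0 3 + p 0 1 * q 0 2 - p 0 2 * q 0 1 + p 0 3 * q 0 0).

Let mulqA : associative mulq.
Proof. by move=> p q r; apply: quatP; rewrite !mxE /= ?mxE /=; ring. Qed.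

Let mul1q : left_id quat1 mulq.
Proof. by move=> p; apply: quatP; rewrite !mxE /=; ring. Qed.

Let mulq1 : right_id quat1 mulq.
Proof. by move=> p; apply: quatP; rewrite !mxE /=; ring. Qed.

Let mulqDl : left_distributive mulq +%R.
Proof. by move=> p q r; apply: quatP; rewrite !mxE /=; ring. Qed.

Let mulqDr : right_distributive mulq +%R.
Proof. by move=> p q r; apply: quatP; rewrite !mxE /=; ring. Qed.

Let quat1_neq0 : quat1 != 0.
Proof.
by apply/eqP => /rowP/(_ 0); rewrite !mxE /=; apply/eqP; rewrite oner_eq0.
Qed.

HB.instance Definition _ := GRing.Zmodule_isNzRing.Build (quat K)
  mulqA mul1q mulq1 mulqDl mulqDr quat1_neq0.

Let scaleqAl (a : K) p q : a *: (p * q) = (a *: p) * q.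
Proof. by apply: quatP; rewrite !mxE /= ?mxE; ring. Qed.

HB.instance Definition _ := GRing.Lmodule_isLalgebra.Build K (quat K) scaleqAl.

Let scaleqAr (a : K) p q : a *: (p * q) = p * (a *: q).
Proof. by apply: quatP; rewrite !mxE /= ?mxE; ring. Qed.

HB.instance Definition _ := GRing.Lalgebra_isAlgebra.Build K (quat K) scaleqAr.

Definition qi : quat K := mkquat 0 1 0 0.
Definition qj : quat K := mkquat 0 0 1 0.
Definition qk : quat K := mkquat 0 0 0 1.

Definition conjq p : quat K := mkquat (p 0 0) (- p 0 1) (- p 0 2) (- p 0 3).

Definition sqnormq p : K :=
  p 0 0 ^+ 2 + p 0 1 ^+ 2 + p 0 2 ^+ 2 + p 0 3 ^+ 2.

Lemma mulq_conj p : p * conjq p = (sqnormq p)%:A.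
Proof. by apply: quatP; rewrite !mxE /= ?mxE /= /sqnormq; ring. Qed.

Lemma mul_conjq p : conjq p * p = (sqnormq p)%:A.
Proof. by apply: quatP; rewrite !mxE /= ?mxE /= /sqnormq; ring. Qed.

Lemma sqnormqM p q : sqnormq (p * q) = sqnormq p * sqnormq q.
Proof. by rewrite /sqnormq !mxE /=; ring. Qed.

Lemma sqnormq1 : sqnormq 1 = 1.
Proof. by rewrite /sqnormq !mxE /=; ring. Qed.

End QuaternionRing.

Arguments qi {K}.
Arguments qj {K}.
Arguments qk {K}.

Section QuaternionUnit.
Variable K : comUnitRingType.
Implicit Types p q : quat K.

Let unitq : pred (quat K) := [pred p | sqnormq p \is a GRing.unit].

Definition invq p : quat K :=
  if unitq p then (sqnormq p)^-1 *: conjq p else p.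

Let mulVq : {in unitq, left_inverse 1 invq *%R}.
Proof.
move=> p; rewrite inE => up.
by rewrite /invq ifT // -scalerAl mul_conjq scalerA mulVr // scale1r.
Qed.

Let mulqV : {in unitq, right_inverse 1 invq *%R}.
Proof.
move=> p; rewrite inE => up.
by rewrite /invq ifT // -scalerAr mulq_conj scalerA mulVr // scale1r.
Qed.

Let unitqP p q : q * p = 1 /\ p * q = 1 -> unitq p.
Proof.
case=> _ /(congr1 (@sqnormq K)); rewrite sqnormqM sqnormq1 => pq1.
by apply/unitrP; exists (sqnormq q); split=> //; rewrite mulrC.
Qed.

Let invq_out : {in [predC unitq], invq =1 id}.
Proof. by move=> p np; rewrite /invq ifN. Qed.

HB.instance Definition _ := GRing.NzRing_hasMulInverse.Build (quat K)
  mulVq mulqV unitqP invq_out.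

End QuaternionUnit.

Section Domains.
Variable R : realType.
Local Notation H := (quat R).
Implicit Types (W V : set H) (I J q : H).

Definition imunit : set H := [set I | I ^+ 2 = -1].

Definition real_axis : set H := range (fun x : R => x%:A).

Definition cslice I : set H := [set q | exists x y : R, q = x%:A + y *: I].

Definition axially_symmetric V := forall (x y : R) I, imunit I ->
  V (x%:A + y *: I) -> forall J, imunit J -> V (x%:A + y *: J).

Definition axial_open V := axially_symmetric V /\ open V.

Definition axial_domain V := axial_open V /\ connected V.

Definition axial_hull W : set H := [set q | exists (x y : R) I J,
  [/\ imunit I, imunit J, W (x%:A + y *: I) & q = x%:A + y *: J]].

Definition simply_connected (T : topologicalType) (A : set T) :=
  let I01 := `[(0 : R), 1]%classic in
  [/\ A !=set0,
      forall a b, A a -> A b -> exists c : R -> T,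
        [/\ {within I01, continuous c}, c @` I01 `<=` A, c 0 = a & c 1 = b]
    & forall c : R -> T, {within I01, continuous c} -> c @` I01 `<=` A ->
        c 0 = c 1 ->
        exists h : R * R -> T,
          [/\ {within I01 `*` I01, continuous h}, h @` (I01 `*` I01) `<=` A,
              forall t, I01 t -> h (0, t) = c t,
              forall t, I01 t -> h (1, t) = c 0
            & forall s, I01 s -> h (s, 0) = c 0 /\ h (s, 1) = c 0]].

Definition basic_domain V := axial_domain V /\
  exists2 I, imunit I & forall q, (V `&` cslice I) q ->
    simply_connected (connected_component (V `&` cslice I) q).

End Domains.

Section SliceRegular.
Variable R : realType.
Local Notation H := (quat R).
Local Notation HC := (quat R[i]).
Implicit Types (V : set H) (f g : H -> H) (F : R[i] -> HC) (z : R[i]).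

Definition mapq (K L : Type) (u : K -> L) (q : quat K) : quat L := map_mx u q.

Definition iota_domain V : set R[i] :=
  [set z | exists2 I : H, imunit I & V ((complex.Re z)%:A + complex.Im z *: I)].

Definition stem_function V F := forall z, iota_domain V z ->
  F (conjc z) = mapq (@conjc R) (F z).

Definition holomorphic (D : set R[i]) F := forall z, D z -> derivable F z 1.

Definition induces V F f := forall (x y : R) (J : H), imunit J ->
  V (x%:A + y *: J) ->
  f (x%:A + y *: J) =
    mapq (@complex.Re R) (F (x +i* y)) + J * mapq (@complex.Im R) (F (x +i* y)).

Definition slice_regular V f := exists F,
  [/\ stem_function V F, holomorphic (iota_domain V) F & induces V F f].

(* The stem function inducing a slice function is unique ([stem_unique]); it
   is recovered from the values on the slice C_i. *)
Definition stem f : R[i] -> HC := fun z =>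
  let: x +i* y := z in
  let a := f (x%:A + y *: qi) in let b := f (x%:A - y *: qi) in
  mapq (real_complex R) (2^-1 *: (a + b))
  + 'i *: mapq (real_complex R) (- 2^-1 *: (qi * (a - b))).

(* The function induced by a stem function ([slice_ofP]).  At a real point
   [y = 0], so the coefficient of the imaginary part of the stem function,
   which vanishes there, is read as 0. *)
Definition slice_of F : H -> H := fun q =>
  let y := Num.sqrt (q 0 1 ^+ 2 + q 0 2 ^+ 2 + q 0 3 ^+ 2) in
  let J : H := y^-1 *: mkquat 0 (q 0 1) (q 0 2) (q 0 3) in
  mapq (@complex.Re R) (F (q 0 0 +i* y)) + J * mapq (@complex.Im R) (F (q 0 0 +i* y)).

Definition star f g : H -> H := slice_of (fun z => stem f z * stem g z).

Definition starpow f (n : nat) : H -> H := iter n (star f) (fun=> 1).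

Definition star_exp f : H -> H := fun q =>
  limn (series (fun n => n`!%:R^-1 *: starpow f n q)).

Definition star_log V g f := slice_regular V f /\ forall q, V q -> star_exp f q = g q.

Definition slice_preserving V f := slice_regular V f /\
  forall (I q : H), imunit I -> (V `&` cslice I) q -> cslice I (f q).

(* [component l f], for l = 0, 1, 2, 3, is the slice-preserving function f_l of
   the decomposition f = f_0 + f_1 i + f_2 j + f_3 k ([component_unique]). *)
Definition component (l : 'I_4) f : H -> H :=
  slice_of (fun z => (stem f z 0 l)%:A).

Definition scalar_part f : H -> H := component 0 f.

Definition vector_part f : H -> H := fun q =>
  component 1 f q * qi + component 2 f q * qj + component 3 f q * qk.

Definition star_conj f : H -> H := fun q => scalar_part f q - vector_part f q.

Definition symmetrization f : H -> H := star f (star_conj f).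

Definition vectorial V f :=
  slice_regular V f /\ forall q, V q -> scalar_part f q = 0.

End SliceRegular.

Section SliceRegularTheory.
Variable R : realType.
Local Notation H := (quat R).
Local Notation HC := (quat R[i]).
Implicit Types (V : set H) (f g : H -> H) (F : R[i] -> HC) (z : R[i]).

Lemma imunitP (J : H) : imunit J ->
  J 0 0 = 0 /\ J 0 1 ^+ 2 + J 0 2 ^+ 2 + J 0 3 ^+ 2 = 1.
Proof.
rewrite /imunit /= expr2 => JJ.
have E l : (J * J) 0 l = (- 1 : H) 0 l by rewrite JJ.
have := E 0; have := E 1; have := E 2; have := E 3; rewrite !mxE /= => e3 e2 e1 e0.
have J0 : J 0 0 = 0.
  apply/eqP; apply: contraT => J0; exfalso.
  have z (t : R) : J 0 0 * t + t * J 0 0 = 0 -> t = 0.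
    rewrite (mulrC t) -mulr2n => /eqP; rewrite mulrn_eq0 mulf_eq0 (negbTE J0) /=.
    by move/eqP.
  have z1 : J 0 1 = 0 by apply: z; lra.
  have z2 : J 0 2 = 0 by apply: z; lra.
  have z3 : J 0 3 = 0 by apply: z; lra.
  have := sqr_ge0 (J 0 0); rewrite z1 z2 z3 in e0; lra.
split=> //; rewrite J0 in e0; lra.
Qed.

Lemma imunit_qi : imunit (qi : H).
Proof. by apply: quatP; rewrite expr2 !mxE /= ?mxE /=; ring. Qed.

Lemma imunit_qj : imunit (qj : H).
Proof. by apply: quatP; rewrite expr2 !mxE /= ?mxE /=; ring. Qed.

Lemma imunitN (J : H) : imunit J -> imunit (- J).
Proof. by rewrite /imunit /= sqrrN. Qed.

Lemma quatC_split (q : HC) :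
  mapq (real_complex R) (mapq (@complex.Re R) q)
  + 'i *: mapq (real_complex R) (mapq (@complex.Im R) q) = q.
Proof. by apply/rowP => l; rewrite !mxE -complexE. Qed.

Lemma stem_unique V F f z : axially_symmetric V -> induces V F f ->
  iota_domain V z -> stem f z = F z.
Proof.
case: z => x y symV iF [I uI VI] /=.
have Vi := symV x y I uI VI qi imunit_qi.
have Vj := symV x y I uI VI (- qi) (imunitN imunit_qi).
have := iF _ _ _ (imunitN imunit_qi) Vj; rewrite scalerN => ->.
rewrite (iF _ _ _ imunit_qi Vi) -[RHS]quatC_split.
set a := mapq _ (F _); set b := mapq (complex.Im (R:=R)) _.
have half (u : H) : 2^-1 *: (u + u) = u.
  rewrite scalerDr -scalerDl (_ : 2^-1 + 2^-1 = 1 :> R) ?scale1r //.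
  by field.
have e : a + qi * b - (a - qi * b) = qi * b + qi * b.
  by rewrite opprB addrC addrA subrK.
rewrite mulNr e addrACA subrr addr0 half mulrDr mulrA.
by rewrite -expr2 imunit_qi mulN1r scaleNr -scalerN opprD opprK half.
Qed.

Lemma mapq_Re_conj (q : HC) :
  mapq (@complex.Re R) (mapq (@conjc R) q) = mapq (@complex.Re R) q.
Proof. by apply/rowP => l; rewrite !mxE; case: (q 0 l). Qed.

Lemma mapq_Im_conj (q : HC) :
  mapq (@complex.Im R) (mapq (@conjc R) q) = - mapq (@complex.Im R) q.
Proof. by apply/rowP => l; rewrite !mxE; case: (q 0 l). Qed.

Lemma slice_ofP V F : stem_function V F -> induces V F (slice_of F).
Proof.
move=> sF x y J uJ VJ; have [J0 J1] := imunitP uJ.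
rewrite /slice_of.
have q0 : (x%:A + y *: J : H) 0 0 = x by rewrite !mxE /= J0; ring.
have ql (l : 'I_4) : l != 0 -> (x%:A + y *: J : H) 0 l = y * J 0 l.
  by case: l => [[|[|[|[|//]]]] i] // _; rewrite !mxE /=; ring.
rewrite q0 !ql //.
have -> : (y * J 0 1) ^+ 2 + (y * J 0 2) ^+ 2 + (y * J 0 3) ^+ 2 = y ^+ 2.
  by rewrite -[RHS]mulr1 -J1; ring.
rewrite sqrtr_sqr.
have -> : mkquat 0 (y * J 0 1) (y * J 0 2) (y * J 0 3) = y *: J.
  by apply: quatP; rewrite !mxE /= ?J0; ring.
have sFc : F (x -i* y) = mapq (@conjc R) (F (x +i* y)) by apply: (sF (x +i* y)); exists J.
rewrite scalerA; case: (ltgtP y 0) => y0.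
- rewrite ltr0_norm // sFc invrN mulNr mulVf ?lt_eqF // scaleN1r.
  by rewrite mapq_Re_conj mapq_Im_conj mulrNN.
- by rewrite gtr0_norm // mulVf ?gt_eqF // scale1r.
- move: sFc; rewrite y0 oppr0 normr0 => sFc.
  have -> : mapq (@complex.Im R) (F (x +i* 0)) = 0.
    apply/rowP => l; have := congr1 (fun q : HC => q 0 l) sFc; rewrite !mxE.
    by case: (F _ 0 l) => a b [] /=; lra.
  by rewrite !mulr0.
Qed.

Lemma slice_polar (q : H) : exists x y (J : H), imunit J /\ q = x%:A + y *: J.
Proof.
pose s := q 0 1 ^+ 2 + q 0 2 ^+ 2 + q 0 3 ^+ 2.
have s0 : 0 <= s by rewrite !addr_ge0 // sqr_ge0.
have sE : Num.sqrt s ^+ 2 = s by rewrite sqr_sqrtr.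
have [y0|y0] := eqVneq (Num.sqrt s) 0.
  exists (q 0 0), 0, qi; split; first exact: imunit_qi.
  have {}s0 : s = 0 by rewrite -sE y0 expr0n.
  have := sqr_ge0 (q 0 1); have := sqr_ge0 (q 0 2); have := sqr_ge0 (q 0 3).
  rewrite /s in s0 => h3 h2 h1.
  have /eqP : q 0 1 ^+ 2 = 0 by lra.
  have /eqP : q 0 2 ^+ 2 = 0 by lra.
  have /eqP : q 0 3 ^+ 2 = 0 by lra.
  rewrite !sqrf_eq0 => /eqP e3 /eqP e2 /eqP e1.
  by apply: quatP; rewrite !mxE /= ?e1 ?e2 ?e3; ring.
exists (q 0 0), (Num.sqrt s).
exists ((Num.sqrt s)^-1 *: mkquat 0 (q 0 1) (q 0 2) (q 0 3)); split.
  rewrite /imunit /= expr2 -scalerAl -scalerAr scalerA -expr2 exprVn sE.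
  have -> : mkquat 0 (q 0 1) (q 0 2) (q 0 3) * mkquat 0 (q 0 1) (q 0 2) (q 0 3)
      = - s *: 1 :> H.
    by apply: quatP; rewrite !mxE /= ?mxE /= /s; ring.
  rewrite scalerA mulrN mulVf ?scaleN1r //.
  by apply: contraNneq y0 => ->; rewrite sqrtr0.
by rewrite scalerA divff // scale1r; apply: quatP; rewrite !mxE /=; ring.
Qed.

Lemma induces_inj V F f f' : induces V F f -> induces V F f' ->
  forall q, V q -> f q = f' q.
Proof.
move=> iF iF' q; have [x [y [J [uJ ->]]]] := slice_polar q.
by move=> Vq; rewrite (iF _ _ _ uJ Vq) (iF' _ _ _ uJ Vq).
Qed.

Lemma eq_in_induces V F F' f : (forall z, iota_domain V z -> F z = F' z) ->
  induces V F f -> induces V F' f.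
Proof.
by move=> FF' iF x y J uJ VJ; rewrite -FF' ?iF //; exists J.
Qed.

Lemma iota_domain_conj V z : axially_symmetric V -> iota_domain V z -> iota_domain V (conjc z).
Proof.
move=> symV [I uI VI]; exists (- I); first exact: imunitN.
by case: z VI => x y /=; rewrite scaleNr scalerN opprK.
Qed.

Lemma induces_stem V F f : axially_symmetric V -> stem_function V F ->
  induces V F f -> stem_function V (stem f) /\ induces V (stem f) f.
Proof.
move=> symV sF iF; split.
  move=> z Vz; rewrite !(stem_unique symV iF) //; first exact: sF.
  exact: iota_domain_conj.
by apply: (eq_in_induces _ iF) => z Vz; rewrite (stem_unique symV iF).
Qed.

Lemma cslice_qi (q : H) : cslice qi q -> q 0 2 = 0 /\ q 0 3 = 0.
Proof. by case=> x [y ->]; split; rewrite !mxE /=; ring. Qed.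

Lemma cslice_qj (q : H) : cslice qj q -> q 0 1 = 0 /\ q 0 3 = 0.
Proof. by case=> x [y ->]; split; rewrite !mxE /=; ring. Qed.

Lemma qi_crd (a b : H) : (a + qi * b) 0 2 = a 0 2 - b 0 3 /\
  (a + qi * b) 0 3 = a 0 3 + b 0 2.
Proof. by split; rewrite !mxE /=; ring. Qed.

Lemma qj_crd (a b : H) : (a + qj * b) 0 1 = a 0 1 + b 0 3 /\
  (a + qj * b) 0 3 = a 0 3 - b 0 1.
Proof. by split; rewrite !mxE /=; ring. Qed.

Lemma qiN_crd (a b : H) : (a + - qi * b) 0 2 = a 0 2 + b 0 3 /\
  (a + - qi * b) 0 3 = a 0 3 - b 0 2.
Proof. by split; rewrite !mxE /=; ring. Qed.

Lemma qjN_crd (a b : H) : (a + - qj * b) 0 1 = a 0 1 - b 0 3 /\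
  (a + - qj * b) 0 3 = a 0 3 + b 0 1.
Proof. by split; rewrite !mxE /=; ring. Qed.

Lemma stem_slice_preserving V f z : axially_symmetric V ->
  slice_preserving V f -> iota_domain V z -> stem f z = (stem f z 0 0)%:A.
Proof.
move=> symV [[F [sF _ iF]] pf] Vz; have [_ {}iF] := induces_stem symV sF iF.
have [I uI] := Vz; case: z Vz => x y Vz VI; rewrite /= in VI.
set G := stem f (x +i* y).
pose a := mapq (@complex.Re R) G; pose b := mapq (@complex.Im R) G.
have pJ J (s : H) : imunit J -> imunit s -> s = J \/ s = - J -> cslice J (a + s * b).
  move=> uJ us sJ; have Vs := symV x y I uI VI s us.
  rewrite /a /b /G -(iF _ _ _ us Vs); apply: pf => //; split=> //.
  by case: sJ => ->; [exists x, y|exists x, (- y); rewrite scalerN scaleNr].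
have [/cslice_qi + /cslice_qi] := (pJ qi qi imunit_qi imunit_qi (or_introl erefl),
  pJ qi (- qi) imunit_qi (imunitN imunit_qi) (or_intror erefl)).
have [/cslice_qj + /cslice_qj] := (pJ qj qj imunit_qj imunit_qj (or_introl erefl),
  pJ qj (- qj) imunit_qj (imunitN imunit_qj) (or_intror erefl)).
have [-> ->] := qi_crd a b; have [-> ->] := qiN_crd a b.
have [-> ->] := qj_crd a b; have [-> ->] := qjN_crd a b.
move=> [e1 e2] [e3 e4] [e5 e6] [e7 e8]; clear pJ; clearbody G.
have z (l : 'I_4) : l != 0 -> a 0 l = 0 /\ b 0 l = 0.
  case: l => [[|[|[|[|//]]]] i] // _.
  - by rewrite (_ : Ordinal i = 1); [split; lra|exact: val_inj].
  - by rewrite (_ : Ordinal i = 2); [split; lra|exact: val_inj].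
  - by rewrite (_ : Ordinal i = 3); [split; lra|exact: val_inj].
have z' (l : 'I_4) : l != 0 -> G 0 l = 0.
  by move=> /z; rewrite !mxE; case: (G 0 l) => ? ? /= [-> ->].
apply: quatP.
- by rewrite !mxE mulr1.
- by transitivity (0 : R[i]); [exact: z'|rewrite !mxE mulr0].
- by transitivity (0 : R[i]); [exact: z'|rewrite !mxE mulr0].
- by transitivity (0 : R[i]); [exact: z'|rewrite !mxE mulr0].
Qed.

Lemma derivable_coord F (l : 'I_4) z : derivable F z 1 ->
  derivable (fun t => (F t 0 l)%:A : HC) z 1.
Proof.
rewrite /derivable => /cvg_ex[/= d cd].
apply/cvg_ex; exists ((d 0 l)%:A : HC).
set q := (fun h => h^-1 *: _) in cd.
rewrite (_ : (fun h => _) = (fun u : R[i] => u *: (1 : HC)) \o (fun u : HC => u 0 l) \o q); last first.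
  by apply/funext => h /=; rewrite !mxE -scalerBl scalerA.
apply: (@cvg_comp _ _ _ q (fun u : HC => (u 0 l)%:A : HC) _ _ _ cd).
apply: (@cvg_comp _ _ _ (fun u : HC => u 0 l) (fun c : R[i] => c%:A : HC)).
  exact: (@coord_continuous R[i] 1 4 0 l d).
exact: (@scalel_continuous _ HC 1).
Qed.

Lemma cscalar_stem V F (l : 'I_4) : stem_function V F ->
  stem_function V (fun z => (F z 0 l)%:A).
Proof.
move=> sF z Vz; rewrite sF //; apply/rowP => m; rewrite !mxE.
by case: (F z 0 l) => u v; case: m => [[|[|[|[|//]]]] i] /=; congr Complex; ring.
Qed.

Lemma component_induces V F f (l : 'I_4) : axially_symmetric V ->
  stem_function V F -> induces V F f ->
  induces V (fun z => (F z 0 l)%:A) (component l f).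
Proof.
move=> symV sF iF; have [sf _] := induces_stem symV sF iF.
have := slice_ofP (cscalar_stem l sf).
apply: eq_in_induces => z Vz; by rewrite (stem_unique symV iF Vz).
Qed.

Lemma component_slice_preserving V f (l : 'I_4) : axially_symmetric V ->
  slice_regular V f -> slice_preserving V (component l f).
Proof.
move=> symV [F [sF hF iF]]; have iC := component_induces l symV sF iF.
split.
  exists (fun z => (F z 0 l)%:A); split; [exact: (cscalar_stem l sF)| |exact: iC].
  by move=> z Vz; exact: (derivable_coord (hF z Vz)).
move=> I q uI [Vq [x [y qE]]]; rewrite qE in Vq *; rewrite (iC _ _ _ uI Vq).
move: (F _ 0 l) => c.
exists (complex.Re c), (complex.Im c).
by case: c => u v; apply: quatP; rewrite !mxE /=; ring.
Qed.

Lemma quat_basis (q : H) :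
  q = (q 0 0)%:A + (q 0 1 *: qi + q 0 2 *: qj + q 0 3 *: qk).
Proof. by apply: quatP; rewrite !mxE /=; ring. Qed.

Lemma mapq_algc (c : R[i]) : mapq (@complex.Re R) c%:A = (complex.Re c)%:A /\
  mapq (@complex.Im R) c%:A = (complex.Im c)%:A.
Proof. by case: c => u v; split; apply: quatP; rewrite !mxE /=; ring. Qed.

Lemma slice_value_sum (z : HC) (J : H) :
  let A l := mapq (@complex.Re R) (z 0 l)%:A
    + J * mapq (@complex.Im R) (z 0 l)%:A in
  mapq (@complex.Re R) z + J * mapq (@complex.Im R) z
  = A 0 + (A 1 * qi + A 2 * qj + A 3 * qk).
Proof.
rewrite /=.
rewrite [mapq _ z in LHS]quat_basis [mapq (@complex.Im R) z in LHS]quat_basis.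
have e l : mapq (@complex.Re R) z 0 l = complex.Re (z 0 l) by rewrite mxE.
have e' l : mapq (@complex.Im R) z 0 l = complex.Im (z 0 l) by rewrite mxE.
rewrite !e !e' !(mapq_algc _).1 !(mapq_algc _).2.
rewrite !mulrDl -!mulrA !mulr_algl !mulrDr.
rewrite addrACA; congr (_ + _).
by rewrite addrACA; congr (_ + _); rewrite addrACA.
Qed.

Lemma component_sum V f (q : H) : axially_symmetric V -> slice_regular V f ->
  V q -> f q = scalar_part f q + vector_part f q.
Proof.
move=> symV [F [sF hF iF]]; have [x [y [J [uJ ->]]]] := slice_polar q => Vq.
rewrite /scalar_part /vector_part (iF _ _ _ uJ Vq).
by rewrite !(component_induces _ symV sF iF uJ Vq) slice_value_sum.
Qed.

Lemma component_unique V f (fl : 'I_4 -> H -> H) (l : 'I_4) (q : H) :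
  axially_symmetric V -> (forall l, slice_preserving V (fl l)) ->
  (forall q, V q -> f q = fl 0 q + fl 1 q * qi + fl 2 q * qj + fl 3 q * qk) ->
  V q -> component l f q = fl l q.
Proof.
move=> symV pl fE Vq.
pose F : R[i] -> HC := fun z => \row_m stem (fl m) z 0 0.
have sl m : stem_function V (stem (fl m)) /\ induces V (stem (fl m)) (fl m).
  by have [[G [sG _ iG]] _] := pl m; exact: (induces_stem symV sG iG).
have sF : stem_function V F.
  by move=> z Vz; apply/rowP => m; rewrite !mxE (sl m).1 // mxE.
have FE z m : iota_domain V z -> (F z 0 m)%:A = stem (fl m) z.
  by move=> Vz; rewrite mxE -(stem_slice_preserving symV (pl m) Vz).
have iF : induces V F f.
  move=> x y J uJ VJ; rewrite fE //.
  have Vz : iota_domain V (x +i* y) by exists J.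
  have E m : fl m (x%:A + y *: J) =
      mapq (@complex.Re R) (F (x +i* y) 0 m)%:A
      + J * mapq (@complex.Im R) (F (x +i* y) 0 m)%:A.
    by rewrite ((sl m).2 _ _ _ uJ VJ) -FE.
  have := slice_value_sum (F (x +i* y)) J.
  by cbv zeta beta; rewrite -!E => ->; rewrite !addrA.
apply: (induces_inj (component_induces l symV sF iF)) Vq.
by apply: eq_in_induces (sl l).2 => z Vz; rewrite FE.
Qed.
Lemma mapq_conjM (u v : HC) :
  mapq (@conjc R) (u * v) = mapq (@conjc R) u * mapq (@conjc R) v.
Proof.
apply: quatP; rewrite !mxE /= ?mxE.
all: rewrite -!/(conjc _) ?(rmorphB, rmorphD, rmorphM) //=.
Qed.

Lemma stem_star V f g z : axially_symmetric V -> slice_regular V f ->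
  slice_regular V g -> iota_domain V z ->
  stem (star f g) z = stem f z * stem g z.
Proof.
move=> symV [F [sF _ iF]] [G [sG _ iG]].
have [sf _] := induces_stem symV sF iF.
have [sg _] := induces_stem symV sG iG.
have sfg : stem_function V (fun z => stem f z * stem g z).
  by move=> t Vt; rewrite sf // sg // mapq_conjM.
exact: (stem_unique symV (slice_ofP sfg)).
Qed.

Lemma eq_slice_preserving V f g : (forall q, V q -> f q = g q) ->
  slice_preserving V f -> slice_preserving V g.
Proof.
move=> fg [[F [sF hF iF]] pf]; split.
  exists F; split=> // x y J uJ VJ.
  by rewrite -fg // (iF _ _ _ uJ VJ).
by move=> I q uI Iq; rewrite -fg; [exact: pf|case: Iq].
Qed.

Lemma slice_preserving0 V : slice_preserving V (fun=> 0).
Proof.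
split.
  exists (fun=> 0); split.
  - by move=> z _; apply/rowP => m; rewrite !mxE conjc0.
  - by move=> z _; exact: derivable_cst.
  - move=> x y J _ _; have e u : u 0 = 0 -> mapq u (0 : HC) = 0 :> H.
      by move=> u0; apply/rowP => m; rewrite !mxE.
    by rewrite !e // mulr0 addr0.
by move=> I q _ _; exists 0, 0; rewrite !scale0r addr0.
Qed.

End SliceRegularTheory.

Section VectorialClasses.
Variable R : realType.
Local Notation H := (quat R).
Implicit Types (V W U : set H) (f g w : H -> H) (p q : H).

(* The factors a and b being slice-preserving, their *-products with f and g are
   pointwise products. *)
Definition lindep V f g := exists a b : H -> H,
  [/\ slice_preserving V a, slice_preserving V b,
      ~ forall q, V q -> a q = 0 /\ b q = 0
    & forall q, V q -> a q * f q + b q * g q = 0].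

(* A vectorial function is a function paired with its domain; its values off
   the domain are irrelevant. *)
Definition vfun : Type := (set H * (H -> H))%type.

Definition vfun_at p (v : vfun) :=
  [/\ axial_domain v.1, v.1 p & vectorial v.1 v.2].

Definition vequiv p (v w : vfun) := exists W,
  [/\ axial_domain W, W p, W `<=` v.1 `&` w.1 & lindep W v.2 w.2].

Definition vanishes_at p (v : vfun) := exists W,
  [/\ axial_domain W, W p, W `<=` v.1 & forall q, W q -> v.2 q = 0].

(* Zero is linearly dependent with every function, so the zero germ is
   separated from the others by hand. *)
Definition vclass p (v : vfun) : set vfun :=
  [set w | [/\ vfun_at p w, vequiv p v w & vanishes_at p v <-> vanishes_at p w]].

Definition class0 p : set vfun := vclass p (setT, fun=> 0).

Definition vectorial_class V (om : H -> set vfun) :=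
  (forall p, V p -> exists2 v, vfun_at p v & om p = vclass p v) /\
  (forall p q (v w : vfun), V p -> V q ->
     vfun_at p v -> v.1 `<=` V -> om p = vclass p v ->
     vfun_at q w -> w.1 `<=` V -> om q = vclass q w ->
     forall p', (v.1 `&` w.1) p' -> vclass p' v = vclass p' w).

Definition is_class0 V (om : H -> set vfun) :=
  forall p, V p -> om p = class0 p.

Definition SR_class V om g := slice_regular V g /\ forall p, V p ->
  om p (V, vector_part g) \/ vanishes_at p (V, vector_part g).

Lemma SR_class0 V om f : axial_domain V -> is_class0 V om ->
  SR_class V om f <-> slice_preserving V f.
Proof.
move=> [[symV oV] cV] om0; split.
  case=> srf fom.
  apply: (@eq_slice_preserving _ _ (scalar_part f)); last first.
    exact: component_slice_preserving.
  move=> q Vq; rewrite (component_sum symV srf Vq).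
  suff [W [_ Wq _ /(_ q Wq)/= ->]] : vanishes_at q (V, vector_part f).
    by rewrite addr0.
  case: (fom q Vq) => //; rewrite om0 // => -[_ _ [+ _]]; apply.
  by exists V; split=> //; split.
move=> pf; split; first by case: pf.
move=> p Vp; right; exists V; split=> // q Vq.
pose fl (l : 'I_4) := if l == 0 then f else fun=> 0 : H.
have flE l : component l f q = fl l q.
  apply: (@component_unique _ V f fl l q) => //.
    by move=> m; rewrite /fl; case: eqP => // _; exact: slice_preserving0.
  by move=> t Vt; rewrite /fl /= !mul0r !addr0.
by rewrite /= /vector_part !flE /fl /= !mul0r !addr0.
Qed.

Definition represents U w (om : H -> set vfun) := forall p, U p ->
  exists V, [/\ V `<=` U, vfun_at p (V, w) & om p = vclass p (V, w)].

Definition minimal_rep V om U w :=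
  [/\ axial_open U, U `<=` V, vectorial U w & represents U w om] /\
  [/\ forall x : R, U x%:A -> w x%:A <> 0
    & forall a b : R, 0 < b ->
        ~ (forall I : H, imunit I ->
             U (a%:A + b *: I) /\ w (a%:A + b *: I) = 0)].

Definition class_zeros V om : set H := [set p | ~ is_class0 V om /\
  exists U w, [/\ minimal_rep V om U w, U p & w p = 0]].

End VectorialClasses.

(* Main.v *)
(* Let F = F_0 + F_v be the stem function of f and mu^2 = - F_v^s.  The stem
   function of exp_*(f) is e^{F_0} (cosh mu + (sinh mu / mu) F_v), so that a
   *-logarithm of g is a holomorphic, conjugation-symmetric solution F of a
   pointwise equation on the stem domain.  The solutions at a point form a
   discrete fibre, with local holomorphic solutions through each of them, and
   the components of the stem domain are simply connected: monodromy gives a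
   global solution, and conjugation symmetry is imposed at a real point.

   If omega = [0], this is the ordinary logarithm.  If Z(omega) is empty, then
   locally g_v = h S, where S is a minimal representative normalized by
   S^s = 1, and the equation for F_v = phi S splits into
   exp(F_0 +- iota phi) = g_0 +- iota h.  If S Z(omega) = Omega, then Omega has
   no real points and g_v^s = 0, so that F = log g_0 + g_v / g_0.  In (c), put
   r = sqrt(g^s) and c = g_0 / r; then F = log r + psi(c) g_v / r, where
   psi(cosh t) = t / sinh t is holomorphic off (-oo, -1].

   A minimal representative comes from a local one by dividing out the highest
   possible power of z - z_0.  This rests on Cauchy's formula, obtained from
   Goursat's argument in the logarithmic coordinate: the mean of a holomorphic
   function over a circle does not depend on the radius. *)

Require Import Defs.
From HB Require Import structures.
From mathcomp Require Import all_boot all_order all_algebra.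
From mathcomp Require Import complex.
From mathcomp Require Import all_classical all_reals all_analysis.
From mathcomp Require Import ring lra.

Set Implicit Arguments.
Unset Strict Implicit.
Unset Printing Implicit Defensive.

Import Order.TTheory GRing.Theory Num.Theory numFieldNormedType.Exports.

Local Open Scope classical_set_scope.
Local Open Scope ring_scope.
Local Open Scope complex_scope.

(** * Complex derivatives *)

(** When Z(omega) is empty, S^s = 1 fixes S only up to sign, so local choices of S need not match on
    overlaps. Rather than globalizing S first, the monodromy argument runs on quaternionic stem
    values y whose exponential is the value of g and whose vector part lies on the complex line
    spanned by the class at that point. This line is canonical, and a local S serves only as a
    coordinate in which the equation splits. The fibres are uniformly separated: logarithms of one
    number at distance less than 1 agree, and |S_1| + |S_2| + |S_3| >= 1 carries this bound over to
    quaternionic values.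

    Connectedness is given for Omega, whose spheres correspond to the points of the stem domain in
    the closed upper half-plane. Identity principles therefore move inside that half-plane, and the
    lower one is reached by conjugation.

    In (c), the vector part of F is g_v times a scalar without zeros, which keeps it in the class.
    The delicate point is c = 1, where no holomorphic root of c^2 - 1 exists: psi is shown to be
    continuous there and the singularity is removed. *)

Section ComplexDerivative.
Variable R : realType.
Local Notation C := R[i].
Local Notation nm := (@Normc.normc R).
Implicit Types (f g : C -> C) (z w h d : C).

Lemma nmD z w : nm (z + w) <= nm z + nm w.
Proof. exact: le_normcD. Qed.

Lemma nmN z : nm (- z) = nm z.
Proof. exact: normcN. Qed.

Lemma nmB z w : nm (z - w) = nm (w - z).
Proof. by rewrite -nmN opprB. Qed.

Lemma nmM z w : nm (z * w) = nm z * nm w.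
Proof. exact: Normc.normcM. Qed.

Lemma nmV z : nm z^-1 = (nm z)^-1.
Proof. exact: Normc.normcV. Qed.

Lemma nm_ge0 z : 0 <= nm z.
Proof. by case: z => x y; rewrite /= sqrtr_ge0. Qed.

Lemma nm0 : nm 0 = 0.
Proof. exact: Normc.normc0. Qed.

Lemma nm1 : nm 1 = 1.
Proof. exact: Normc.normc1. Qed.

Lemma nm_eq0 z : (nm z == 0) = (z == 0).
Proof. by apply/eqP/eqP => [/Normc.eq0_normc //|->]; exact: nm0. Qed.

Lemma nm_gt0 z : (0 < nm z) = (z != 0).
Proof. by rewrite lt_def nm_ge0 andbT nm_eq0. Qed.

Lemma nmX z n : nm (z ^+ n) = nm z ^+ n.
Proof. by elim: n => [|n IH]; rewrite ?expr0 ?nm1 // !exprS nmM IH. Qed.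

Lemma nm_real (x : R) : nm x%:C = `|x|.
Proof. by rewrite /= expr0n /= addr0 sqrtr_sqr. Qed.

Lemma nm_realB (x y : R) : nm (x%:C - y%:C) = `|x - y|.
Proof. by rewrite -rmorphB nm_real. Qed.

Lemma nm_conj z : nm (conjc z) = nm z.
Proof. by case: z => x y /=; rewrite sqrrN. Qed.

Lemma nm_sqr z : nm z ^+ 2 = complex.Re z ^+ 2 + complex.Im z ^+ 2.
Proof. by case: z => x y /=; rewrite sqr_sqrtr // addr_ge0 // sqr_ge0. Qed.

Lemma Re_le_nm z : `|complex.Re z| <= nm z.
Proof.
rewrite -(@ler_pXn2r _ 2) ?nnegrE ?nm_ge0 //.
by rewrite nm_sqr real_normK ?num_real // lerDl sqr_ge0.
Qed.

Lemma Im_le_nm z : `|complex.Im z| <= nm z.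
Proof.
rewrite -(@ler_pXn2r _ 2) ?nnegrE ?nm_ge0 //.
by rewrite nm_sqr real_normK ?num_real // lerDr sqr_ge0.
Qed.

Lemma nm_le_ReIm z : nm z <= `|complex.Re z| + `|complex.Im z|.
Proof.
rewrite -(@ler_pXn2r _ 2) ?nnegrE ?nm_ge0 ?addr_ge0 //.
rewrite nm_sqr sqrrD !real_normK ?num_real // addrAC lerDl mulrn_wge0 //.
Qed.

Lemma nmB_ge z w : nm z - nm w <= nm (z - w).
Proof. by have := nmD (z - w) w; rewrite subrK; lra. Qed.

Definition ccont f z := forall e : R, 0 < e ->
  exists2 r : R, 0 < r & forall w, nm (w - z) < r -> nm (f w - f z) < e.

(** Stated with the real-valued modulus and without quotients, so that estimates are settled by real
    arithmetic; [dquot_lim] identifies it with the limit of difference quotients. *)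
Definition cder f z d := forall e : R, 0 < e -> exists2 r : R, 0 < r &
  forall w, nm (w - z) < r -> nm (f w - f z - d * (w - z)) <= e * nm (w - z).

Lemma cder_cont f z d : cder f z d -> ccont f z.
Proof.
move=> fd e e0; have [r r0 fr] := fd 1 ltr01.
have D0 : 0 < 1 + nm d by have := nm_ge0 d; lra.
exists (Num.min r (e / (1 + nm d))); first by rewrite lt_min r0 divr_gt0.
move=> w; rewrite lt_min ltr_pdivlMr // => /andP[/fr wr we].
have := nmD (f w - f z - d * (w - z)) (d * (w - z)); rewrite subrK nmM.
nra.
Qed.

Lemma ccontD f g z : ccont f z -> ccont g z -> ccont (fun w => f w + g w) z.
Proof.
move=> fc gc e e0; have e2 : 0 < e / 2 by lra.
have [r r0 fr] := fc _ e2; have [s s0 gs] := gc _ e2.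
exists (Num.min r s); first by rewrite lt_min r0.
move=> w; rewrite lt_min => /andP[/fr h1 /gs h2].
have := nmD (f w - f z) (g w - g z); rewrite addrACA -opprD; lra.
Qed.

Lemma ccont_comp f g z : ccont f z -> ccont g (f z) -> ccont (fun w => g (f w)) z.
Proof.
move=> fc gc e /gc[r r0 gr]; have [s s0 fs] := fc r r0.
by exists s => // w /fs /gr.
Qed.

Lemma ccont_cst c z : ccont (fun=> c) z.
Proof. by move=> e e0; exists 1 => // w _; rewrite subrr nm0. Qed.

Lemma ccont_id z : ccont id z.
Proof. by move=> e e0; exists e. Qed.

Lemma ccontM f g z : ccont f z -> ccont g z -> ccont (fun w => f w * g w) z.
Proof.
move=> fc gc e e0.
pose K := 1 + nm (f z) + nm (g z).
have K0 : 1 <= K by have := nm_ge0 (f z); have := nm_ge0 (g z); rewrite /K; lra.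
have eK : 0 < Num.min 1 (e / (2 * K)) by rewrite lt_min ltr01 divr_gt0 //; lra.
have [r r0 fr] := fc _ eK; have [s s0 gs] := gc _ eK.
exists (Num.min r s); first by rewrite lt_min r0.
move=> w; rewrite lt_min => /andP[/fr h1 /gs h2].
have -> : f w * g w - f z * g z =
  (f w - f z) * (g w - g z) + ((f w - f z) * g z + f z * (g w - g z)) by ring.
apply: le_lt_trans (nmD _ _) _; rewrite nmM.
have h3 := nmD ((f w - f z) * g z) (f z * (g w - g z)).
rewrite !nmM in h3.
move: h1 h2; rewrite !lt_min ltr_pdivlMr ?ltr_pdivlMr; [|lra|lra].
move=> /andP[a1 a2] /andP[b1 b2].
have := nm_ge0 (f z); have := nm_ge0 (g z).
have := nm_ge0 (f w - f z); have := nm_ge0 (g w - g z).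
move: a1 a2 b1 b2 h3; rewrite /K.
move: (nm (f w - f z)) (nm (g w - g z)) (nm (f z)) (nm (g z)) => a b p q.
move=> ? ? ? ? ? ? ? ? ?.
nra.
Qed.

Lemma ccont_neq0 f z : ccont f z -> f z != 0 ->
  exists2 r : R, 0 < r & forall w, nm (w - z) < r -> nm (f z) / 2 < nm (f w).
Proof.
move=> fc fz; have e0 : 0 < nm (f z) / 2 by rewrite divr_gt0 // nm_gt0.
have [r r0 fr] := fc _ e0; exists r => // w /fr.
by rewrite nmB => h; have := nmB_ge (f z) (f z - f w); rewrite subKr; lra.
Qed.

Lemma ccontV f z : ccont f z -> f z != 0 -> ccont (fun w => (f w)^-1) z.
Proof.
move=> fc fz e e0; have [r r0 fr] := ccont_neq0 fc fz.
have a0 : 0 < nm (f z) by rewrite nm_gt0.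
have e1 : 0 < e * nm (f z) ^+ 2 / 2 by rewrite divr_gt0 // mulr_gt0 // exprn_gt0.
have [s s0 fs] := fc _ e1.
exists (Num.min r s); first by rewrite lt_min r0.
move=> w; rewrite lt_min => /andP[/fr h1 /fs h2].
have fw : f w != 0 by rewrite -nm_gt0; lra.
have -> : (f w)^-1 - (f z)^-1 = - (f w - f z) / (f w * f z).
  by field; rewrite fw fz.
rewrite nmM nmN nmV nmM ltr_pdivrMr; last by rewrite mulr_gt0 ?nm_gt0.
apply: (lt_le_trans h2).
rewrite expr2 -!mulrA ler_pM2l // [leRHS]mulrC ler_pM2l //; lra.
Qed.

Lemma cder_cst c z : cder (fun=> c) z 0.
Proof.
move=> e e0; exists 1 => // w _; rewrite subrr mul0r subr0 nm0.
by rewrite mulr_ge0 ?nm_ge0 // ltW.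
Qed.

Lemma cder_id z : cder id z 1.
Proof.
move=> e e0; exists 1 => // w _; rewrite mul1r subrr nm0.
by rewrite mulr_ge0 ?nm_ge0 // ltW.
Qed.

Lemma cderD f g z d d' : cder f z d -> cder g z d' ->
  cder (fun w => f w + g w) z (d + d').
Proof.
move=> fd gd e e0; have e2 : 0 < e / 2 by lra.
have [r r0 fr] := fd _ e2; have [s s0 gs] := gd _ e2.
exists (Num.min r s); first by rewrite lt_min r0.
move=> w; rewrite lt_min => /andP[/fr h1 /gs h2].
have -> : f w + g w - (f z + g z) - (d + d') * (w - z) =
  (f w - f z - d * (w - z)) + (g w - g z - d' * (w - z)) by ring.
by apply: le_trans (nmD _ _) _; lra.
Qed.

Lemma cderM f g z d d' : cder f z d -> cder g z d' ->
  cder (fun w => f w * g w) z (d * g z + f z * d').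
Proof.
move=> fd gd e e0.
pose K := 1 + nm (f z) + nm (g z) + nm d'.
have K0 : 1 <= K.
  by have := nm_ge0 (f z); have := nm_ge0 (g z); have := nm_ge0 d'; rewrite /K; lra.
have eK : 0 < e / (3 * K) by rewrite divr_gt0 //; lra.
have e1 : 0 < Num.min 1 (e / (3 * K)) by rewrite lt_min ltr01.
have [r r0 fr] := fd _ eK; have [s s0 gs] := gd _ e1.
have [t t0 ft] := cder_cont fd eK.
exists (Num.min t (Num.min r s)); first by rewrite !lt_min r0 t0.
move=> w; rewrite !lt_min => /and3P[/ft h3 /fr h1 /gs h2].
have -> : f w * g w - f z * g z - (d * g z + f z * d') * (w - z) =
  (f w - f z - d * (w - z)) * g z + (f z * (g w - g z - d' * (w - z)) +
   ((f w - f z) * (g w - g z - d' * (w - z)) + (f w - f z) * (d' * (w - z)))) by ring.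
apply: le_trans (nmD _ _) _.
apply: le_trans (lerD (lexx _) (nmD _ _)) _.
apply: le_trans (lerD (lexx _) (lerD (lexx _) (nmD _ _))) _.
rewrite !nmM.
set n := nm (w - z) in h1 h2 *.
set A := nm (f w - f z - _) in h1 *; set B := nm (g w - g z - _) in h2 *.
have n0 : 0 <= n by exact: nm_ge0.
have B1 : B <= n.
  by apply: le_trans h2 _; rewrite ler_piMl // ge_min lexx.
have B2 : B <= e / (3 * K) * n.
  by apply: le_trans h2 _; rewrite ler_wpM2r // ge_min lexx orbT.
move: h1 h3 B2; set k := e / _ => h1 h3 B2.
have kK : 3 * (k * K) = e by rewrite /k; field; rewrite gt_eqF //; lra.
have p1 : A * nm (g z) <= k * n * nm (g z) by rewrite ler_wpM2r ?nm_ge0.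
have p2 : nm (f z) * B <= nm (f z) * (k * n) by rewrite ler_wpM2l ?nm_ge0.
have p3 : nm (f w - f z) * B <= k * n by rewrite ler_pM ?nm_ge0 // ltW.
have p4 : nm (f w - f z) * (nm d' * n) <= k * (nm d' * n).
  by rewrite ler_wpM2r ?mulr_ge0 ?nm_ge0 // ltW.
have -> : e * n = 3 * (k * K) * n by rewrite kK.
have kn : 0 <= k * n by rewrite mulr_ge0 // ltW.
have q0 := nm_ge0 (f z); have q1 := nm_ge0 (g z); have q2 := nm_ge0 d'.
rewrite /K; nra.
Qed.

Lemma cder_comp f g z d d' : cder f z d -> cder g (f z) d' ->
  cder (fun w => g (f w)) z (d' * d).
Proof.
move=> fd gd e e0.
have D0 := nm_ge0 d; have D0' := nm_ge0 d'.
have e1 : 0 < e / (2 * (1 + nm d)) by rewrite divr_gt0 //; lra.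
have e2 : 0 < Num.min 1 (e / (2 * (1 + nm d'))).
  by rewrite lt_min ltr01 divr_gt0 //; lra.
have [s s0 gs] := gd _ e1.
have [r r0 fr] := fd _ e2.
have [t t0 ft] := cder_cont fd s0.
exists (Num.min t r); first by rewrite !lt_min r0 t0.
move=> w; rewrite !lt_min => /andP[/ft /gs h3 /fr h1].
have -> : g (f w) - g (f z) - d' * d * (w - z) =
  (g (f w) - g (f z) - d' * (f w - f z)) + d' * (f w - f z - d * (w - z)) by ring.
apply: le_trans (nmD _ _) _; rewrite nmM.
set n := nm (w - z) in h1 *; have n0 : 0 <= n by exact: nm_ge0.
have h4 : nm (f w - f z) <= (1 + nm d) * n.
  have := nmD (f w - f z - d * (w - z)) (d * (w - z)); rewrite subrK nmM -/n => h5.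
  have h6 : nm (f w - f z - d * (w - z)) <= n.
    by apply: le_trans h1 _; rewrite ler_piMl // ge_min lexx.
  by lra.
have h5 : nm (g (f w) - g (f z) - d' * (f w - f z)) <= e / 2 * n.
  apply: le_trans h3 _; apply: le_trans (ler_wpM2l (ltW e1) h4) _.
  by rewrite mulrA; apply: ler_wpM2r => //; rewrite le_eqVlt; apply/orP; left;
    apply/eqP; field; rewrite gt_eqF //; lra.
have h6 : nm d' * nm (f w - f z - d * (w - z)) <= e / 2 * n.
  apply: le_trans (ler_wpM2l D0' h1) _; rewrite mulrA; apply: ler_wpM2r => //.
  have : Num.min 1 (e / (2 * (1 + nm d'))) <= e / (2 * (1 + nm d')) by rewrite ge_min lexx orbT.
  move/(ler_wpM2l D0')/le_trans; apply.
  rewrite mulrA ler_pdivrMr; last lra.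
  nra.
lra.
Qed.

Lemma cder_inv z : z != 0 -> cder (fun w => w^-1) z (- z ^- 2).
Proof.
move=> z0 e e0.
have a0 : 0 < nm z by rewrite nm_gt0.
have [r r0 zr] := ccont_neq0 (@ccont_id z) z0.
have e1 : 0 < e * nm z ^+ 3 / 2 by rewrite divr_gt0 // mulr_gt0 // exprn_gt0.
exists (Num.min r (e * nm z ^+ 3 / 2)); first by rewrite lt_min r0.
move=> w; rewrite lt_min => /andP[/zr wz we].
have w0 : w != 0 by rewrite -nm_gt0 /= in wz *; lra.
have -> : w^-1 - z^-1 - - z ^- 2 * (w - z) = (w - z) * (w - z) / (z ^+ 2 * w).
  by field; rewrite w0 z0.
rewrite nmM (nmM (w - z)) nmV (nmM (z ^+ 2)) nmX -mulrA mulrC ler_wpM2r ?nm_ge0 //.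
rewrite ler_pdivrMr ?mulr_gt0 ?exprn_gt0 ?nm_gt0 //.
apply: le_trans (ltW we) _; rewrite -mulrA ler_pM2l // exprSr -mulrA.
by rewrite ler_pM2l ?exprn_gt0 // ltW.
Qed.

Lemma cderV f z d : f z != 0 -> cder f z d ->
  cder (fun w => (f w)^-1) z (- f z ^- 2 * d).
Proof. by move=> fz fd; apply: (cder_comp fd (cder_inv fz)). Qed.

Lemma cder_near f g z d (r : R) : 0 < r ->
  (forall w, nm (w - z) < r -> g w = f w) -> cder f z d -> cder g z d.
Proof.
move=> r0 fg fd e /fd[s s0 fs]; exists (Num.min r s); first by rewrite lt_min r0.
move=> w; rewrite lt_min => /andP[/fg -> /fs]; rewrite fg //.
by rewrite subrr nm0.
Qed.

Lemma ccont_near f g z (r : R) : 0 < r ->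
  (forall w, nm (w - z) < r -> g w = f w) -> ccont f z -> ccont g z.
Proof.
move=> r0 fg fd e /fd[s s0 fs]; exists (Num.min r s); first by rewrite lt_min r0.
move=> w; rewrite lt_min => /andP[/fg -> /fs]; rewrite fg //.
by rewrite subrr nm0.
Qed.

Lemma cderZ c f z d : cder f z d -> cder (fun w => c * f w) z (c * d).
Proof. by move=> fd; have := cderM (cder_cst c z) fd; rewrite mul0r add0r. Qed.

Lemma cderN f z d : cder f z d -> cder (fun w => - f w) z (- d).
Proof.
move=> /(cderZ (-1)); rewrite mulN1r; apply: (cder_near ltr01) => w _.
by rewrite mulN1r.
Qed.

Lemma cderB f g z d d' : cder f z d -> cder g z d' ->
  cder (fun w => f w - g w) z (d - d').
Proof. by move=> fd /cderN gd; exact: cderD. Qed.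

Definition chol f z := exists d, cder f z d.

Lemma chol_cont f z : chol f z -> ccont f z.
Proof. by case=> d; exact: cder_cont. Qed.

Lemma chol_cst c z : chol (fun=> c) z.
Proof. by exists 0; exact: cder_cst. Qed.

Lemma chol_id z : chol id z.
Proof. by exists 1; exact: cder_id. Qed.

Lemma cholD f g z : chol f z -> chol g z -> chol (fun w => f w + g w) z.
Proof. by move=> [d fd] [d' gd]; exists (d + d'); exact: cderD. Qed.

Lemma cholB f g z : chol f z -> chol g z -> chol (fun w => f w - g w) z.
Proof. by move=> [d fd] [d' gd]; exists (d - d'); exact: cderB. Qed.

Lemma cholN f z : chol f z -> chol (fun w => - f w) z.
Proof. by move=> [d fd]; exists (- d); exact: cderN. Qed.

Lemma cholM f g z : chol f z -> chol g z -> chol (fun w => f w * g w) z.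
Proof. by move=> [d fd] [d' gd]; exists (d * g z + f z * d'); exact: cderM. Qed.

Lemma cholV f z : f z != 0 -> chol f z -> chol (fun w => (f w)^-1) z.
Proof. by move=> fz [d fd]; exists (- f z ^- 2 * d); exact: cderV. Qed.

Lemma chol_div f g z : g z != 0 -> chol f z -> chol g z ->
  chol (fun w => f w / g w) z.
Proof. by move=> gz hf hg; apply: cholM => //; exact: cholV. Qed.

Lemma cholX f n z : chol f z -> chol (fun w => f w ^+ n) z.
Proof.
move=> hf; elim: n => [|n IH]; first exact: chol_cst.
have [d fd] := cholM hf IH; exists d.
by apply: (cder_near ltr01) fd => w _; rewrite exprS.
Qed.

Lemma chol_comp f g z : chol f z -> chol g (f z) -> chol (fun w => g (f w)) z.
Proof. by move=> [d fd] [d' gd]; exists (d' * d); exact: cder_comp. Qed.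

Lemma chol_near f g z (r : R) : 0 < r ->
  (forall w, nm (w - z) < r -> g w = f w) -> chol f z -> chol g z.
Proof. by move=> r0 fg [d fd]; exists d; exact: (cder_near r0 fg fd). Qed.

Lemma chol_conj f z : chol f (conjc z) -> chol (fun w => conjc (f (conjc w))) z.
Proof.
move=> [d fd]; exists (conjc d) => e e0; have [r r0 fr] := fd e e0.
exists r => // w wr.
have E u : conjc w - conjc u = conjc (w - u) by rewrite rmorphB.
have := fr (conjc w); rewrite E !nm_conj => /(_ wr).
by rewrite -(nm_conj (_ - _)) !(rmorphB, rmorphM) /= !conjcK.
Qed.

(** Since E expands to first order at [s z] with nonzero slope e, increments of s are bounded by
    those of the composite, hence by a multiple of |w - z|; the derivative is then d / e. Continuity
    of s brings [s w] into the range of the expansion. Holomorphy of the logarithm comes from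
    here. *)
Lemma chol_lift (E s : C -> C) z e :
  cder E (s z) e -> e != 0 -> ccont s z ->
  chol (fun w => E (s w)) z -> chol s z.
Proof.
move=> Ed e0 sc [d phid]; exists (d / e) => t t0.
have a0 : 0 < nm e by rewrite nm_gt0.
have D0 := nm_ge0 d.
(* The first bound lets half of |e| |s w - s z| be absorbed. As this yields |e| |s w - s z| <= 2
   (|d| + 1) |w - z|, the second bound makes the error at most half of t |e| |w - z|. *)
have k0 : 0 < Num.min (nm e / 2) (t * nm e ^+ 2 / (2 * (2 * (nm d + 1)))).
  by rewrite lt_min !divr_gt0 ?mulr_gt0 ?exprn_gt0 //; lra.
have [q q0 Eq] := Ed _ k0.
have [p p0 sp] := sc _ q0.
have t1 : 0 < Num.min 1 (t * nm e / 2) by rewrite lt_min ltr01 divr_gt0 ?mulr_gt0.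
have [u u0 phiu] := phid _ t1.
exists (Num.min p u); first by rewrite lt_min p0.
move=> w; rewrite lt_min => /andP[/sp /Eq h1 /phiu h2].
set n := nm (w - z) in h2 *; set m := nm (s w - s z) in h1 *.
have n0 : 0 <= n by exact: nm_ge0.
have m0 : 0 <= m by exact: nm_ge0.
have h3 : nm (E (s w) - E (s z)) <= (nm d + 1) * n.
  have := nmD (E (s w) - E (s z) - d * (w - z)) (d * (w - z)).
  rewrite subrK nmM -/n => h5.
  have h6 : nm (E (s w) - E (s z) - d * (w - z)) <= n.
    by apply: le_trans h2 _; rewrite ler_piMl // ge_min lexx.
  by lra.
have h4 : nm e * m <= 2 * (nm d + 1) * n.
  have := nmB_ge (e * (s w - s z)) (E (s w) - E (s z)); rewrite (nmB (e * _)) nmM -/m => h5.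
  have h6 : nm (E (s w) - E (s z) - e * (s w - s z)) <= nm e / 2 * m.
    by apply: le_trans h1 _; rewrite ler_wpM2r // ge_min lexx.
  by lra.
have -> : s w - s z - d / e * (w - z) =
  e^-1 * (E (s w) - E (s z) - d * (w - z) - (E (s w) - E (s z) - e * (s w - s z))).
  by field.
rewrite nmM nmV mulrC ler_pdivrMr //.
apply: le_trans (nmD _ _) _; rewrite nmN.
have h5 : nm (E (s w) - E (s z) - d * (w - z)) <= t * nm e / 2 * n.
  by apply: le_trans h2 _; rewrite ler_wpM2r // ge_min lexx orbT.
have h6 : nm (E (s w) - E (s z) - e * (s w - s z)) <= t * nm e / 2 * n.
  apply: le_trans h1 _.
  apply: (@le_trans _ _ (t * nm e ^+ 2 / (2 * (2 * (nm d + 1))) * m)).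
    by rewrite ler_wpM2r // ge_min lexx orbT.
  have -> : t * nm e ^+ 2 / (2 * (2 * (nm d + 1))) * m
    = t * nm e / (2 * (2 * (nm d + 1))) * (nm e * m) by ring.
  apply: le_trans (ler_wpM2l _ h4) _.
    by rewrite ltW // divr_gt0 ?mulr_gt0 //; lra.
  rewrite le_eqVlt; apply/orP; left; apply/eqP; field.
  by rewrite gt_eqF //; lra.
lra.
Qed.
End ComplexDerivative.

(** * Paths in the complex plane and the mean value inequality *)

Section RealDerivative.
Variable R : realType.
Local Notation C := R[i].
Local Notation nm := (@Normc.normc R).
Implicit Types (f g : R -> R) (t : R).

Lemma rderP f t d : is_derive t 1 f d <-> forall e : R, 0 < e ->
  exists2 r : R, 0 < r & forall s, `|s - t| < r ->
    `|f s - f t - d * (s - t)| <= e * `|s - t|.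
Proof.
split.
  move=> [df fd] e e0.
  have : (fun h : R => h^-1 *: (f (h *: 1 + t) - f t)) @ 0^' --> d.
    by rewrite -fd; exact: df.
  move=> /cvgrPdist_lt /(_ e e0).
  move=> /nbhs_ballP[r /= r0 fr]; exists r => // s sr.
  have [->|st] := eqVneq s t; first by rewrite !subrr mulr0 subr0 normr0 mulr0.
  have st0 : s - t != 0 by rewrite subr_eq0.
  have := fr (s - t); rewrite /ball /= sub0r normrN => /(_ sr st0).
  rewrite -[_%R *: 1]/((s - t) * 1) mulr1 subrK -[_ *: _]/((s - t)^-1 * _) => /ltW h.
  have -> : f s - f t - d * (s - t) = - (s - t) * (d - (s - t)^-1 * (f s - f t)).
    by field.
  by rewrite normrM normrN mulrC ler_wpM2r.
move=> H.
have L : (fun h : R => h^-1 *: (f (h *: 1 + t) - f t)) @ 0^' --> d.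
  apply/cvgrPdist_le => e e0; have [r r0 fr] := H e e0.
  apply/nbhs_ballP; exists r => //= h.
  rewrite /ball /= sub0r normrN => hr h0.
  have := fr (h + t); rewrite addrK => /(_ hr).
  rewrite -[h *: 1]/(h * 1) mulr1 -[_ *: _]/(h^-1 * _) => h1.
  have -> : d - h^-1 * (f (h + t) - f t) = - h^-1 * (f (h + t) - f t - d * h).
    by field.
  by rewrite normrM normrN normfV mulrC ler_pdivrMr ?normr_gt0.
have D : derivable f t 1 by apply/cvg_ex; exists d; exact: L.
split => //.
by apply: cvg_lim L; exact: norm_hausdorff.
Qed.

Lemma is_derive_cont f t d : is_derive t 1 f d -> {for t, continuous f}.
Proof. by move=> [df _]; apply: differentiable_continuous; exact/derivable1_diffP. Qed.

Lemma rder_le f g (f' g' : R -> R) (a b : R) : a <= b ->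
  (forall t, a <= t <= b -> is_derive t 1 f (f' t)) ->
  (forall t, a <= t <= b -> is_derive t 1 g (g' t)) ->
  (forall t, a <= t <= b -> f' t <= g' t) ->
  f b - f a <= g b - g a.
Proof.
move=> ab fd gd fg.
have [->|nab] := eqVneq a b; first by rewrite !subrr.
have {nab}ab : a < b by rewrite lt_neqAle nab.
have hd t : a <= t <= b -> is_derive t 1 (fun s => g s - f s) (g' t - f' t).
  by move=> h; apply: is_deriveB; [exact: gd|exact: fd].
have [||c cab E] := @MVT R (fun s => g s - f s) (fun t => g' t - f' t) a b ab.
- by move=> t /[!in_itv]/= /andP[/ltW h1 /ltW h2]; apply: hd; rewrite h1 h2.
- apply: continuous_in_subspaceT => t; rewrite inE /= in_itv /= => h.
  by apply: (@is_derive_cont _ t (g' t - f' t)); exact: hd.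
have : 0 <= g' c - f' c.
  by rewrite subr_ge0; apply: fg; move: cab; rewrite in_itv /= => /andP[/ltW -> /ltW ->].
move=> h; have : 0 <= (g' c - f' c) * (b - a) by rewrite mulr_ge0 // subr_ge0 ltW.
by rewrite -E; lra.
Qed.

(** Coordinatewise, so that the mean value theorem and the fundamental theorem of calculus apply to
    real functions; [pderP] gives the first-order form. *)
Definition pder (u : R -> C) t (d : C) :=
  is_derive t 1 (fun s => complex.Re (u s)) (complex.Re d) /\
  is_derive t 1 (fun s => complex.Im (u s)) (complex.Im d).

Lemma cReD (z w : C) : complex.Re (z + w) = complex.Re z + complex.Re w.
Proof. by case: z; case: w. Qed.

Lemma cImD (z w : C) : complex.Im (z + w) = complex.Im z + complex.Im w.
Proof. by case: z; case: w. Qed.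

Lemma cReN (z : C) : complex.Re (- z) = - complex.Re z.
Proof. by case: z. Qed.

Lemma cImN (z : C) : complex.Im (- z) = - complex.Im z.
Proof. by case: z. Qed.

Lemma cReM (z w : C) : complex.Re (z * w) =
  complex.Re z * complex.Re w - complex.Im z * complex.Im w.
Proof. by case: z; case: w. Qed.

Lemma cImM (z w : C) : complex.Im (z * w) =
  complex.Re z * complex.Im w + complex.Im z * complex.Re w.
Proof. by case: z => a b; case: w => c d /=; rewrite addrC. Qed.

Lemma pder_eq u t d d' : pder u t d -> d = d' -> pder u t d'.
Proof. by move=> ? <-. Qed.

Lemma pder_ext u v t d : (forall s, u s = v s) -> pder u t d -> pder v t d.
Proof. by move=> uv; rewrite (_ : u = v) //; exact/funext. Qed.

Lemma pderD u v t d d' : pder u t d -> pder v t d' ->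
  pder (fun s => u s + v s) t (d + d').
Proof.
move=> [h1 h2] [h3 h4]; split.
  rewrite cReD; rewrite (_ : (fun s => _) = (fun s => complex.Re (u s) + complex.Re (v s))).
    exact: is_deriveD.
  by apply/funext => s; rewrite cReD.
rewrite cImD; rewrite (_ : (fun s => _) = (fun s => complex.Im (u s) + complex.Im (v s))).
  exact: is_deriveD.
by apply/funext => s; rewrite cImD.
Qed.

Lemma pderZ c u t d : pder u t d -> pder (fun s => c * u s) t (c * d).
Proof.
move=> [h1 h2]; split.
  rewrite cReM; rewrite (_ : (fun s => _) =
    (fun s => complex.Re c * complex.Re (u s) - complex.Im c * complex.Im (u s))).
    by apply: is_deriveB; exact: is_deriveZ.
  by apply/funext => s; rewrite cReM.
rewrite cImM; rewrite (_ : (fun s => _) =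
  (fun s => complex.Re c * complex.Im (u s) + complex.Im c * complex.Re (u s))).
  by apply: is_deriveD; exact: is_deriveZ.
by apply/funext => s; rewrite cImM.
Qed.

Lemma pderB u v t d d' : pder u t d -> pder v t d' ->
  pder (fun s => u s - v s) t (d - d').
Proof.
move=> ud /(pderZ (-1)) vd; have := pderD ud vd; rewrite mulN1r.
by apply: pder_ext => s; rewrite mulN1r.
Qed.

(** A complex path has no mean value theorem, so its real and imaginary parts are dominated
    separately. This is the origin of the factor 2 in the integral estimates. *)
Lemma pder_dom u (u' : R -> C) (g g' : R -> R) (a b : R) : a <= b ->
  (forall t, a <= t <= b -> pder u t (u' t)) ->
  (forall t, a <= t <= b -> is_derive t 1 g (g' t)) ->
  (forall t, a <= t <= b -> nm (u' t) <= g' t) ->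
  nm (u b - u a) <= 2 * (g b - g a).
Proof.
move=> ab ud gd ug.
have Ngd t : a <= t <= b -> is_derive t 1 (fun s => - g s) (- g' t).
  by move=> /gd h; exact: is_deriveN.
have h1 := rder_le ab (fun t h => (ud t h).1) gd
  (fun t h => le_trans (ler_norm _) (le_trans (Re_le_nm _) (ug t h))).
have h3 := rder_le ab (fun t h => (ud t h).2) gd
  (fun t h => le_trans (ler_norm _) (le_trans (Im_le_nm _) (ug t h))).
have h2 : - g b - - g a <= complex.Re (u b) - complex.Re (u a).
  apply: (rder_le ab Ngd (fun t h => (ud t h).1)) => t h.
  rewrite lerNl; apply: le_trans (ug t h).
  by apply: le_trans (Re_le_nm _); rewrite -normrN ler_norm.
have h4 : - g b - - g a <= complex.Im (u b) - complex.Im (u a).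
  apply: (rder_le ab Ngd (fun t h => (ud t h).2)) => t h.
  rewrite lerNl; apply: le_trans (ug t h).
  by apply: le_trans (Im_le_nm _); rewrite -normrN ler_norm.
apply: le_trans (nm_le_ReIm _) _; rewrite cReD cReN cImD cImN.
have h5 : `|complex.Re (u b) - complex.Re (u a)| <= g b - g a by rewrite ler_norml; lra.
have h6 : `|complex.Im (u b) - complex.Im (u a)| <= g b - g a by rewrite ler_norml; lra.
lra.
Qed.

Lemma pder_le u (u' : R -> C) (M a b : R) : a <= b ->
  (forall t, a <= t <= b -> pder u t (u' t)) ->
  (forall t, a <= t <= b -> nm (u' t) <= M) ->
  nm (u b - u a) <= 2 * M * (b - a).
Proof.
move=> ab ud uM.
have K t : is_derive t 1 (fun s => M * s) M.
  by have := @is_deriveZ _ _ _ (@id R) M t 1 1 (is_derive_id t 1); rewrite /GRing.scale /= mulr1.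
have := pder_dom ab ud (fun t _ => K t) uM.
by rewrite -mulrBr mulrA.
Qed.

Lemma pderP u t d : pder u t d <-> forall e : R, 0 < e ->
  exists2 r : R, 0 < r & forall s, `|s - t| < r ->
    nm (u s - u t - d * (s - t)%:C) <= e * `|s - t|.
Proof.
split=> [[/rderP h1 /rderP h2] e e0|H].
  have e2 : 0 < e / 2 by lra.
  have [r r0 fr] := h1 _ e2; have [q q0 fq] := h2 _ e2.
  exists (Num.min r q); first by rewrite lt_min r0.
  move=> s; rewrite lt_min => /andP[/fr a1 /fq a2].
  apply: le_trans (nm_le_ReIm _) _.
  rewrite !cReD !cImD !cReN !cImN cReM cImM /= !mulr0 subr0 add0r; lra.
split; apply/rderP => e /H[r r0 fr]; exists r => // s /fr; apply: le_trans.
  apply: le_trans (Re_le_nm _).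
  by rewrite !cReD !cReN cReM /= !mulr0 subr0.
apply: le_trans (Im_le_nm _).
by rewrite !cImD !cImN cImM /= !mulr0 add0r.
Qed.

Lemma pder_comp (f : C -> C) u t d d' : cder f (u t) d' -> pder u t d ->
  pder (fun s => f (u s)) t (d' * d).
Proof.
move=> fd /pderP ud; apply/pderP => e e0.
have D0 := nm_ge0 d; have D0' := nm_ge0 d'.
have e1 : 0 < e / (2 * (1 + nm d)) by rewrite divr_gt0 //; lra.
have e2 : 0 < Num.min 1 (e / (2 * (1 + nm d'))).
  by rewrite lt_min ltr01 divr_gt0 //; lra.
have [s s0 gs] := fd _ e1.
have [r r0 fr] := ud _ e2.
have q0 : 0 < Num.min r (s / (1 + nm d)) by rewrite lt_min r0 divr_gt0 //; lra.
exists (Num.min r (s / (1 + nm d))) => // w.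
rewrite lt_min ltr_pdivlMr; last lra.
move=> /andP[/fr h1 wr].
set n := `|w - t| in h1 wr *; have n0 : 0 <= n by exact: normr_ge0.
have nE : nm (w - t)%:C = n by exact: nm_real.
have h4 : nm (u w - u t) <= (1 + nm d) * n.
  have := nmD (u w - u t - d * (w - t)%:C) (d * (w - t)%:C); rewrite subrK nmM nE => h5.
  have h6 : nm (u w - u t - d * (w - t)%:C) <= n.
    by apply: le_trans h1 _; rewrite ler_piMl // ge_min lexx.
  by lra.
have h3 : nm (u w - u t) < s by apply: le_lt_trans h4 _; lra.
have -> : f (u w) - f (u t) - d' * d * (w - t)%:C =
  (f (u w) - f (u t) - d' * (u w - u t)) + d' * (u w - u t - d * (w - t)%:C) by ring.
apply: le_trans (nmD _ _) _; rewrite nmM.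
have h5 : nm (f (u w) - f (u t) - d' * (u w - u t)) <= e / 2 * n.
  apply: le_trans (gs _ h3) _; apply: le_trans (ler_wpM2l (ltW e1) h4) _.
  by rewrite mulrA; apply: ler_wpM2r => //; rewrite le_eqVlt; apply/orP; left;
    apply/eqP; field; rewrite gt_eqF //; lra.
have h6 : nm d' * nm (u w - u t - d * (w - t)%:C) <= e / 2 * n.
  apply: le_trans (ler_wpM2l D0' h1) _; rewrite mulrA; apply: ler_wpM2r => //.
  have : Num.min 1 (e / (2 * (1 + nm d'))) <= e / (2 * (1 + nm d')) by rewrite ge_min lexx orbT.
  move/(ler_wpM2l D0')/le_trans; apply.
  rewrite mulrA ler_pdivrMr; last lra.
  nra.
lra.
Qed.

Lemma pder_line (a b : C) t : pder (fun s => a + s%:C * b) t b.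
Proof.
apply/pderP => e e0; exists 1 => // s _.
have -> : a + s%:C * b - (a + t%:C * b) - b * (s - t)%:C = 0.
  by rewrite rmorphB /=; ring.
by rewrite nm0 mulr_ge0 // ltW.
Qed.

End RealDerivative.

(** * The complex exponential and the principal logarithm *)

Section ComplexExponential.
Variable R : realType.
Local Notation C := R[i].
Local Notation nm := (@Normc.normc R).
Implicit Types (z w u : C).

Definition cexp z : C :=
  (expR (complex.Re z) * cos (complex.Im z)) +i* (expR (complex.Re z) * sin (complex.Im z)).

Lemma cexpD z w : cexp (z + w) = cexp z * cexp w.
Proof.
apply/eqP; rewrite eq_complex cReM cImM /= cReD cImD expRD cosD sinD.
by apply/andP; split; apply/eqP; ring.
Qed.

Lemma cexp0 : cexp 0 = 1.
Proof. by rewrite /cexp /= expR0 cos0 sin0 mulr1 mulr0. Qed.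

Lemma cexp_real (x : R) : cexp x%:C = (expR x)%:C.
Proof. by rewrite /cexp /= cos0 sin0 mulr1 mulr0. Qed.

Lemma cexpNr z : cexp z * cexp (- z) = 1.
Proof. by rewrite -cexpD subrr cexp0. Qed.

Lemma cexp_neq0 z : cexp z != 0.
Proof. by apply/eqP => h; have := cexpNr z; rewrite h mul0r => /esym/eqP; rewrite oner_eq0. Qed.

Lemma cexpN z : cexp (- z) = (cexp z)^-1.
Proof. by have := cexp_neq0 z => h; apply: (mulfI h); rewrite cexpNr divff. Qed.

Lemma cexpB z w : cexp (z - w) = cexp z / cexp w.
Proof. by rewrite cexpD cexpN. Qed.

Lemma cexpX z n : cexp (n%:R * z) = cexp z ^+ n.
Proof.
elim: n => [|n IH]; first by rewrite mul0r cexp0.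
by rewrite -natr1 mulrDl mul1r cexpD IH exprSr.
Qed.

Lemma cexp_conj z : cexp (conjc z) = conjc (cexp z).
Proof. by case: z => x y; rewrite /cexp /= cosN sinN mulrN. Qed.

Lemma nm_cexp z : nm (cexp z) = expR (complex.Re z).
Proof.
apply/eqP; rewrite -(@eqrXn2 _ 2) ?nm_ge0 ?expR_ge0 // nm_sqr /=.
by rewrite !exprMn -mulrDr cos2Dsin2 mulr1.
Qed.

(** The first-order expansions of exp, cos and sin at 0 combine to the derivative 1 at 0, and the
    functional equation transports it to z. *)
Lemma cder_exp z : cder cexp z (cexp z).
Proof.
have D0 : cder cexp 0 1.
  have /rderP hE : is_derive (0 : R) 1 expR 1.
    by apply: is_derive_eq; rewrite expR0.
  have /rderP hC : is_derive (0 : R) 1 cos 0.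
    by apply: is_derive_eq; rewrite sin0 oppr0.
  have /rderP hS : is_derive (0 : R) 1 sin 1.
    by apply: is_derive_eq; rewrite cos0.
  move=> e e0; have e8 : 0 < Num.min 1 (e / 8) by rewrite lt_min ltr01; lra.
  have [p p0 Ep] := hE _ e8; have [q q0 Cq] := hC _ e8; have [r r0 Sr] := hS _ e8.
  exists (Num.min (Num.min 1 (e / 16)) (Num.min p (Num.min q r))).
    by rewrite !lt_min ltr01 p0 q0 r0 andbT; lra.
  move=> w; rewrite !lt_min !subr0 mul1r => /andP[/andP[w1 w2] /and3P[w3 w4 w5]].
  have hx := Re_le_nm w; have hy := Im_le_nm w.
  have n0 := nm_ge0 w.
  have {Ep} := Ep (complex.Re w); have {Cq} := Cq (complex.Im w).
  have {Sr} := Sr (complex.Im w).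
  rewrite !subr0 expR0 cos0 sin0 mul0r !mul1r subr0.
  move=> /(_ (le_lt_trans hy w5)) S1 /(_ (le_lt_trans hy w4)) C1 /(_ (le_lt_trans hx w3)) E1.
  set m : R := Num.min 1 (e / 8) in S1 C1 E1 e8.
  have m1 : m <= 1 by rewrite /m ge_min lexx.
  have me : m <= e / 8 by rewrite /m ge_min lexx orbT.
  rewrite cexp0.
  apply: le_trans (nm_le_ReIm _) _; rewrite !cReD !cImD !cReN !cImN /= oppr0 addr0.
  rewrite subr0 in C1.
  move: hx hy S1 C1 E1; set x := complex.Re w; set y := complex.Im w => hx hy S1 C1 E1.
  have -> : expR x * cos y - 1 - x = (expR x - 1 - x) + (expR x * (cos y - 1)) by ring.
  have -> : expR x * sin y - y = (expR x * (sin y - y)) + (expR x - 1) * y by ring.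
  have X1 : expR x <= 3.
    have := ler_norm (expR x - 1 - x); have := ler_norm x; have := normr_ge0 x; nra.
  have X0 : 0 <= expR x by exact: expR_ge0.
  have X2 : `|expR x - 1| <= 2 * nm w.
    have -> : expR x - 1 = (expR x - 1 - x) + x by ring.
    by apply: le_trans (ler_normD _ _) _; have := normr_ge0 x; nra.
  have A1 : `|expR x * (cos y - 1)| <= 3 * (e / 8 * nm w).
    rewrite normrM ger0_norm //; apply: ler_pM => //.
    apply: le_trans C1 _; apply: ler_pM => //; lra.
  have A2 : `|expR x * (sin y - y)| <= 3 * (e / 8 * nm w).
    rewrite normrM ger0_norm //; apply: ler_pM => //.
    apply: le_trans S1 _; apply: ler_pM => //; lra.
  have A3 : `|(expR x - 1) * y| <= (e / 8) * nm w.
    rewrite normrM; apply: le_trans (ler_pM _ _ X2 hy) _ => //.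
    by rewrite ler_wpM2r //; lra.
  have A4 : `|expR x - 1 - x| <= e / 8 * nm w.
    by apply: le_trans E1 _; apply: ler_pM => //; lra.
  have := ler_normD (expR x - 1 - x) (expR x * (cos y - 1)).
  have := ler_normD (expR x * (sin y - y)) ((expR x - 1) * y).
  lra.
have h1 : cder (fun w => w - z) z 1.
  by have := cderB (cder_id z) (cder_cst z z); rewrite subr0.
have D0' : cder cexp (z - z) 1 by rewrite subrr.
have := cderZ (cexp z) (cder_comp h1 D0'); rewrite !mulr1.
by apply: (cder_near ltr01) => w _; rewrite -cexpD addrC subrK.
Qed.

Lemma chol_exp (f : C -> C) z : chol f z -> chol (fun w => cexp (f w)) z.
Proof. by move=> hf; apply: (chol_comp hf); exists (cexp (f z)); exact: cder_exp. Qed.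

Definition exp_sum (n : nat) z : C := \sum_(0 <= k < n) (k`!%:R)^-1 * z ^+ k.

Lemma cder_exp_sum n z : cder (exp_sum n.+1) z (exp_sum n z).
Proof.
have X k : cder (fun w => w ^+ k.+1) z (k.+1%:R * z ^+ k).
  elim: k => [|k IH]; first by rewrite mulr1; exact: cder_id.
  have := cderM IH (cder_id z) => h.
  have -> : k.+2%:R * z ^+ k.+1 = k.+1%:R * z ^+ k * z + z ^+ k.+1 * 1.
    by rewrite mulr1 -mulrA -exprSr -natr1 mulrDl mul1r.
  by apply: (cder_near ltr01) h => w _; rewrite exprSr.
elim: n => [|n IH].
  rewrite /exp_sum big_nil; apply: (cder_near ltr01) (cder_cst 1 z) => w _.
  by rewrite big_nat1 fact0 invr1 mul1r.
have := cderD IH (cderZ ((n.+1)`!%:R^-1) (X n)) => h.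
rewrite [X in cder _ _ X](_ : _ = exp_sum n z + n.+1`!%:R^-1 * (n.+1%:R * z ^+ n)).
  by apply: (cder_near ltr01) h => w _; rewrite /exp_sum [LHS]big_nat_recr.
rewrite /exp_sum big_nat_recr //=; congr (_ + _).
rewrite factS natrM mulrA; congr (_ * _); rewrite invfM mulrAC mulVf ?mul1r //.
Qed.

(** Along the segment from 0 to z, the derivative of the remainder of index n + 1 is z times the
    remainder of index n, so the bound follows by induction from the mean value inequality. The
    factor 2 there turns |z| into 2 |z|. *)
Lemma exp_taylor n z : nm (cexp z - exp_sum n z) <=
  expR `|complex.Re z| * (n`!%:R^-1 * (2 * nm z) ^+ n).
Proof.
set M := expR _; set a := 2 * nm z.
have M0 : 0 <= M by exact: expR_ge0.
have a0 : 0 <= a by rewrite mulr_ge0 // nm_ge0.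
pose rem n (s : R) := cexp (s%:C * z) - exp_sum n (s%:C * z).
suff H (s : R) : 0 <= s <= 1 -> nm (rem n s) <= M * (n`!%:R^-1 * (a * s) ^+ n).
  have := H 1; rewrite /rem mulr1 rmorph1 mul1r; apply.
  by rewrite ler01 lexx.
have L (t : R) : pder (fun s : R => s%:C * z) t z.
  by apply: pder_ext (pder_line 0 z t) => s'; rewrite add0r.
have remd k t : pder (rem k.+1) t (z * rem k t).
  have := pderB (pder_comp (cder_exp _) (L t)) (pder_comp (cder_exp_sum k _) (L t)).
  by move/pder_eq; apply; rewrite /rem mulrBr; congr (_ - _); exact: mulrC.
elim: n s => [|n IH] s /andP[s0 s1].
  rewrite /rem /exp_sum big_nil subr0 fact0 invr1 expr0 !mulr1.
  rewrite nm_cexp ler_expR cReM /= mul0r subr0.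
  apply: le_trans (ler_norm _) _; rewrite normrM ger0_norm //.
  by rewrite ler_piMl.
have rem0 : rem n.+1 0 = 0.
  rewrite /rem rmorph0 mul0r cexp0 /exp_sum big_nat_recl // fact0 invr1 expr0 mul1r.
  by rewrite big1 ?addr0 ?subrr // => i _; rewrite expr0n /= mulr0.
(* The factor 1/2 makes the bound 2 (g s - g 0) of [pder_dom] the claimed one, without eating into
   the 2 |z| already allowed for. *)
pose g (t : R) := M / 2 * (n.+1`!%:R^-1 * (a * t) ^+ n.+1).
pose g' (t : R) := M / 2 * (n`!%:R^-1 * (a * t) ^+ n * a).
have gd (t : R) : is_derive t 1 g (g' t).
  have h1 : is_derive t 1 (fun t : R => a * t) a.
    by have := @is_deriveZ _ _ _ (@id R) a t 1 1 (is_derive_id t 1); rewrite /GRing.scale /= mulr1.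
  have h2 := @is_deriveX _ _ _ n.+1 t 1 a h1.
  have h3 := @is_deriveZ _ _ _ _ (M / 2 * n.+1`!%:R^-1) t 1 _ h2.
  have -> : g = (M / 2 * n.+1`!%:R^-1) \*: ((fun t : R => a * t) ^+ n.+1).
    by apply/funext => x; rewrite /g mulrA [RHS]/(_ * _) exprfctE.
  apply: (is_derive_eq h3); rewrite /g' /GRing.scale /= factS natrM invfM.
  rewrite -mulr_natl; field.
  by rewrite !pnatr_eq0 -lt0n fact_gt0 addrC natr1 pnatr_eq0.
have := @pder_dom _ (rem n.+1) (fun t => z * rem n t) g g' 0 s s0
  (fun t _ => remd n t) (fun t _ => gd t).
rewrite rem0 subr0 => H; apply: le_trans (H _) _ => [t /andP[t0 ts]|].
  rewrite nmM /g'.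
  have -> : M / 2 * (n`!%:R^-1 * (a * t) ^+ n * a) = nm z * (M * (n`!%:R^-1 * (a * t) ^+ n)).
    by rewrite /a; field; rewrite pnatr_eq0 -lt0n fact_gt0.
  rewrite ler_wpM2l ?nm_ge0 //; apply: IH; rewrite t0; exact: le_trans ts s1.
rewrite /g mulr0 expr0n /= !mulr0 subr0 le_eqVlt; apply/orP; left; apply/eqP.
by field; rewrite pnatr_eq0 -lt0n fact_gt0.
Qed.

Definition clim (x : nat -> C) z := forall e : R, 0 < e ->
  exists N, forall n, (N <= n)%N -> nm (x n - z) < e.

Lemma clim_exp z : clim (fun n => exp_sum n z) (cexp z).
Proof.
move=> e e0; set M := expR `|complex.Re z|.
have M0 : 0 < M by exact: expR_gt0.
have := cvg_series_cvg_0 (is_cvg_series_exp_coeff (2 * nm z)).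
move=> /cvgrPdist_lt /(_ (e / M) (divr_gt0 e0 M0))[N _ NP].
exists N => n /NP /=; rewrite sub0r normrN ger0_norm; last first.
  by rewrite /exp_coeff /= divr_ge0 // exprn_ge0 // mulr_ge0 // nm_ge0.
rewrite ltr_pdivlMr // => h; rewrite nmB.
by apply: le_lt_trans (exp_taylor n z) _; move: h; rewrite /exp_coeff /= mulrC [_ / _]mulrC.
Qed.

Lemma cexp_eq1 z : nm z < 1 -> cexp z = 1 -> z = 0.
Proof.
move=> z1 E.
have := nm_cexp z; rewrite E nm1 => /esym/(congr1 (@ln R)); rewrite expRK ln1 => x0.
have := congr1 (@complex.Re R) E; rewrite /= x0 expR0 mul1r => cy.
have y0 : `|complex.Im z| = 0.
  apply: (@cos_inj R).
  - rewrite in_itv /= normr_ge0 /=; apply: le_trans (Im_le_nm z) _.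
    by apply: ltW; apply: lt_le_trans z1 _; have := @pi_ge2 R; lra.
  - by rewrite in_itv /= lexx pi_ge0.
  - by rewrite cos_norm cy cos0.
by apply/eqP; rewrite eq_complex /= x0 eqxx /= -normr_eq0 y0.
Qed.

(** The radius 1 is the uniform separation of logarithms that is later fed to the monodromy
    theorem. *)
Lemma cexp_inj_near z w : nm (z - w) < 1 -> cexp z = cexp w -> z = w.
Proof.
move=> zw E; apply/eqP; rewrite -subr_eq0; apply/eqP; apply: cexp_eq1 => //.
by rewrite cexpB E divff // cexp_neq0.
Qed.

(** The plane without (-oo, 0]: the sum vanishes exactly on that ray. *)
Definition slit u := 0 < nm u + complex.Re u.

Lemma slitPn u : ~~ slit u -> complex.Im u = 0 /\ complex.Re u <= 0.
Proof.
rewrite /slit -leNgt => h.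
have := nm_sqr u; have := nm_ge0 u => n0 E.
have x0 : complex.Re u <= 0 by lra.
split=> //; apply/eqP; rewrite -sqrf_eq0; apply/eqP.
by have := sqr_ge0 (complex.Im u); nra.
Qed.

(** The half-angle formula arg u = 2 atan (Im u / (|u| + Re u)) covers the slit plane without case
    distinction, its denominator being positive there. *)
Definition clog u : C := (ln (nm u)) +i* (2 * atan (complex.Im u / (nm u + complex.Re u))).

Lemma slit_neq0 u : slit u -> u != 0.
Proof. by apply: contraL => /eqP ->; rewrite /slit nm0 /= addr0 ltxx. Qed.

Lemma clogK u : slit u -> cexp (clog u) = u.
Proof.
move=> su; have u0 := slit_neq0 su; have n0 : 0 < nm u by rewrite nm_gt0.
rewrite /cexp /clog /= lnK ?posrE //.
rewrite mulr_natl cos_mulr2n sin_mulr2n; set t := _ / _.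
have T0 : 0 < 1 + t ^+ 2 by rewrite ltr_pwDl // sqr_ge0.
have c2 : cos (atan t) ^+ 2 = (1 + t ^+ 2)^-1.
  by rewrite cos_atan exprVn sqr_sqrtr // ltW.
have cs : cos (atan t) * sin (atan t) = t / (1 + t ^+ 2).
  have tE := atanK t; rewrite /tan in tE.
  have c0 : cos (atan t) != 0 by rewrite cos_atan invr_eq0 sqrtr_eq0 -ltNge.
  have -> : sin (atan t) = t * cos (atan t) by rewrite -[X in _ = X * _]tE divfK.
  by rewrite -c2; ring.
rewrite c2 cs; have := nm_sqr u; rewrite /slit in su.
move: T0; rewrite {c2 cs}/t => T0.
move: su n0 T0; case: u u0 => x y u0; set n := nm _; rewrite /= => su n0 T0 E.
(* A consequence of x^2 + y^2 = n^2; it reduces the half-angle expressions to x / n and y / n. *)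
have H : (n + x) ^+ 2 + y ^+ 2 = 2 * n * (n + x) by rewrite sqrrD mulr2n; nra.
have H' : (1 + (y / (n + x)) ^+ 2)^-1 = (n + x) / (2 * n).
  have -> : 1 + (y / (n + x)) ^+ 2 = ((n + x) ^+ 2 + y ^+ 2) / (n + x) ^+ 2.
    by field; rewrite gt_eqF.
  by rewrite H; field; rewrite !gt_eqF.
rewrite H' !mulr2n; congr Complex; first by field; rewrite !gt_eqF.
by field; rewrite !gt_eqF.
Qed.

Lemma clog1 : clog 1 = 0.
Proof. by rewrite /clog nm1 /= ln1 mul0r atan0 mulr0. Qed.

Lemma clogV u : slit u -> clog u^-1 = - clog u.
Proof.
move=> su; have u0 := slit_neq0 su; have n0 : 0 < nm u by rewrite nm_gt0.
rewrite /clog nmV.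
have -> : complex.Re u^-1 = complex.Re u / nm u ^+ 2 by rewrite nm_sqr; case: u {su u0 n0}.
have -> : complex.Im u^-1 = - complex.Im u / nm u ^+ 2.
  by rewrite nm_sqr; case: u {su u0 n0} => x y /=; rewrite mulNr.
have -> : - complex.Im u / nm u ^+ 2 / ((nm u)^-1 + complex.Re u / nm u ^+ 2) =
  - (complex.Im u / (nm u + complex.Re u)).
  rewrite /slit in su; field; rewrite !gt_eqF //.
by rewrite lnV ?posrE // atanN mulrN.
Qed.

Lemma clog_conj u : clog (conjc u) = conjc (clog u).
Proof.
rewrite /clog nm_conj; case: u => x y; rewrite /= mulNr atanN mulrN //.
Qed.

Lemma slit_open u : slit u -> exists2 r : R, 0 < r & forall w, nm (w - u) < r -> slit w.
Proof.
rewrite /slit => su; exists ((nm u + complex.Re u) / 2); first by lra.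
move=> w wu; have := nmB_ge u (u - w); rewrite subKr => h.
have := Re_le_nm (u - w); rewrite cReD cReN => h2.
have := ler_norm (complex.Re u - complex.Re w).
by rewrite nmB in wu; lra.
Qed.

Lemma ccont_real (f : C -> R) (phi : R -> R) u :
  ccont (fun w => (f w)%:C) u -> {for f u, continuous phi} ->
  ccont (fun w => (phi (f w))%:C) u.
Proof.
move=> fc phic e e0; move/cvgrPdist_lt/(_ e e0)/nbhs_ballP: phic => [d d0 dP].
have [r r0 fr] := fc d d0; exists r => // w /fr.
rewrite !nm_realB => h; rewrite distrC.
by apply: dP; rewrite /ball /= distrC.
Qed.

Lemma ccont_Re u : ccont (fun w => (complex.Re w)%:C) u.
Proof.
move=> e e0; exists e => // w h; rewrite nm_realB.
by apply: le_lt_trans h; apply: le_trans (Re_le_nm _); rewrite cReD cReN.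
Qed.

Lemma ccont_Im u : ccont (fun w => (complex.Im w)%:C) u.
Proof.
move=> e e0; exists e => // w h; rewrite nm_realB.
by apply: le_lt_trans h; apply: le_trans (Im_le_nm _); rewrite cImD cImN.
Qed.

Lemma ccont_nm u : ccont (fun w => (nm w)%:C) u.
Proof.
move=> e e0; exists e => // w h; rewrite nm_realB.
apply: le_lt_trans h; rewrite ler_norml nmB_ge andbT lerNl opprB nmB.
exact: nmB_ge.
Qed.

Lemma ccont_log u : slit u -> ccont clog u.
Proof.
move=> su; have u0 := slit_neq0 su.
have h1 : ccont (fun w => (ln (nm w))%:C) u.
  apply: ccont_real; first exact: ccont_nm.
  by apply: continuous_ln; rewrite nm_gt0.
have h2 : ccont (fun w => (complex.Im w / (nm w + complex.Re w))%:C) u.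
  have H : ccont (fun w => (nm w)%:C + (complex.Re w)%:C) u.
    by apply: ccontD; [exact: ccont_nm|exact: ccont_Re].
  have := ccontM (@ccont_Im u) (ccontV H _).
  rewrite -rmorphD /= => /(_ _); move=> h.
  have h' : ccont (fun w => (complex.Im w)%:C * ((nm w)%:C + (complex.Re w)%:C)^-1) u.
    by apply: h; apply/eqP => /complexI h0; move: su; rewrite /slit h0 ltxx.
  apply: (ccont_near ltr01) h' => w _.
  by rewrite rmorphM fmorphV rmorphD.
have h3 := ccont_real h2 (@continuous_atan R _).
have h4 := ccontD h1 (ccontM (ccont_cst (2 * 'i) u) h3).
apply: (ccont_near ltr01) h4 => w _.
by rewrite /clog; apply/eqP; rewrite eq_complex /=; apply/andP; split; apply/eqP; ring.
Qed.

(** A continuous right inverse of the exponential, whose derivative never vanishes, is holomorphic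
    by [chol_lift]. *)
Lemma chol_log u : slit u -> chol clog u.
Proof.
move=> su; have [r r0 rP] := slit_open su.
apply: (chol_lift (cder_exp _)); [exact: cexp_neq0|exact: ccont_log|].
by apply: (chol_near r0) (chol_id u) => w /rP /clogK.
Qed.

Lemma cexp_surj u : u != 0 -> exists z, cexp z = u.
Proof.
move=> u0; have [su|/slitPn[y0 x0]] := boolP (slit u); first by exists (clog u); exact: clogK.
exists ((ln (- complex.Re u)) +i* pi).
have x1 : 0 < - complex.Re u.
  rewrite oppr_gt0 lt_neqAle x0 andbT; apply: contra u0 => /eqP x1.
  by rewrite eq_complex x1 y0 !eqxx.
rewrite /cexp /= lnK ?posrE // cospi sinpi mulr0 mulrN1 opprK.
by case: u y0 {u0 x0 x1} => x y /= ->.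
Qed.

(* Composing with multiplication by [f z0 ^-1] brings the value at [z0] to 1,
   where the principal logarithm is holomorphic. *)
Lemma local_log (f : C -> C) (z0 : C) (r : R) : 0 < r ->
  (forall z, nm (z - z0) < r -> chol f z) -> f z0 != 0 ->
  exists2 s : R, 0 < s <= r & exists l : C -> C, forall z, nm (z - z0) < s ->
    chol l z /\ cexp (l z) = f z.
Proof.
move=> r0 hf f0; have [a aE] := cexp_surj f0.
have hq : ccont (fun z => f z / f z0) z0.
  apply: ccontM; last exact: ccont_cst.
  by apply: chol_cont; apply: hf; rewrite subrr nm0.
have [s s0 sP] := hq _ (ltr01).
exists (Num.min s r); first by rewrite lt_min s0 r0 ge_min lexx orbT.
exists (fun z => a + clog (f z / f z0)) => z; rewrite lt_min => /andP[/sP zs zr].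
rewrite divff // in zs.
have sl : slit (f z / f z0).
  rewrite /slit; move: zs; set q := f z / _ => zs.
  have := Re_le_nm (q - 1); rewrite cReD cReN /= => h1.
  have := ler_norm (- (complex.Re q - 1)); rewrite normrN => h2.
  by have := nm_ge0 q; lra.
split.
  apply: cholD; first exact: chol_cst.
  apply: (@chol_comp _ (fun z => f z / f z0) (@clog)); last exact: chol_log.
  by apply: cholM; [exact: hf|exact: chol_cst].
by rewrite cexpD clogK // aE mulrC divfK.
Qed.

End ComplexExponential.

(** * Cauchy's formula and division by powers of z - z0 *)

Section SquareInduction.
Variable R : realType.

Lemma half_pow_lt (e : R) : 0 < e -> exists n, 2^-1 ^+ n < e.
Proof.
move=> e0; have : geometric 1 (2^-1 : R) @ \oo --> 0.
  by apply: cvg_geometric; rewrite ger0_norm //; lra.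
move=> /cvgrPdist_lt /(_ e e0)[n _ /(_ n (leqnn n))] /=.
by rewrite /geometric /= mul1r sub0r normrN ger0_norm ?exprn_ge0 //; exists n.
Qed.

(* Nested squares shrink to a point, where the local hypothesis applies. *)
Lemma square_induct (P : R -> R -> R -> Prop) :
  (forall s t d, 0 < d -> P s t (d / 2) -> P (s + d / 2) t (d / 2) ->
     P s (t + d / 2) (d / 2) -> P (s + d / 2) (t + d / 2) (d / 2) -> P s t d) ->
  (forall x y, 0 <= x <= 1 -> 0 <= y <= 1 -> exists2 eta : R, 0 < eta &
     forall s t d, 0 < d < eta -> s <= x <= s + d -> t <= y <= t + d ->
       0 <= s -> s + d <= 1 -> 0 <= t -> t + d <= 1 -> P s t d) ->
  P 0 0 1.
Proof.
move=> HS HB; apply: contrapT => NP.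
pose h n : R := 2^-1 ^+ n.
have h0 n : 0 < h n by rewrite exprn_gt0.
have hS n : h n.+1 = h n / 2 by rewrite /h exprSr.
have step (n : nat) (p : R * R) : exists q : R * R, ~ P p.1 p.2 (h n) ->
    [/\ ~ P q.1 q.2 (h n.+1), p.1 <= q.1, q.1 + h n.+1 <= p.1 + h n, p.2 <= q.2 &
        q.2 + h n.+1 <= p.2 + h n].
  have := h0 n; have [H|NPp] := pselect (P p.1 p.2 (h n)); first by exists p.
  move=> hn; rewrite hS; case: p NPp => s t /= NPp.
  have [H1|H1] := pselect (P s t (h n / 2)); last by exists (s, t) => _ /=; split=> //; lra.
  have [H2|H2] := pselect (P (s + h n / 2) t (h n / 2)).
    have [H3|H3] := pselect (P s (t + h n / 2) (h n / 2)).
      have [H4|H4] := pselect (P (s + h n / 2) (t + h n / 2) (h n / 2)).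
        by case: NPp; exact: HS.
      by exists (s + h n / 2, t + h n / 2) => _ /=; split=> //; lra.
    by exists (s, t + h n / 2) => _ /=; split=> //; lra.
  by exists (s + h n / 2, t) => _ /=; split=> //; lra.
pose nxt n p := projT1 (cid (step n p)).
pose sq := fix sq n : R * R := if n is m.+1 then nxt m (sq m) else (0, 0).
have sqP n : ~ P (sq n).1 (sq n).2 (h n).
  elim: n => [|n IH]; first by rewrite /h expr0.
  by rewrite /= /nxt; case: cid => q /= /(_ IH)[].
have sqN n : [/\ (sq n).1 <= (sq n.+1).1, (sq n.+1).1 + h n.+1 <= (sq n).1 + h n,
    (sq n).2 <= (sq n.+1).2 & (sq n.+1).2 + h n.+1 <= (sq n).2 + h n].
  by rewrite [sq n.+1]/(nxt n (sq n)) /nxt; case: cid => q /= /(_ (sqP n))[].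
(* Left ends increase and right ends decrease, so the supremum of the left ends lies in every
   interval. *)
have mono (u : nat -> R) : (forall n, u n <= u n.+1) ->
    (forall n, u n.+1 + h n.+1 <= u n + h n) ->
    exists x, forall n, u n <= x <= u n + h n.
  move=> u1 u2.
  have uD n k : u n <= u (n + k)%N by elim: k => [|k IH]; rewrite ?addn0 // addnS; exact: le_trans (u1 _).
  have uH n k : u (n + k)%N + h (n + k)%N <= u n + h n.
    by elim: k => [|k IH]; rewrite ?addn0 // addnS; exact: le_trans IH.
  have ub n m : u m <= u n + h n.
    have [/subnK <-|/ltnW/subnK <-] := leqP n m.
      by rewrite addnC; apply: le_trans (uH n (m - n)%N); rewrite lerDl ltW.
    by rewrite addnC; apply: le_trans (uD m (n - m)%N) _; rewrite lerDl ltW.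
  exists (sup (range u)) => n; apply/andP; split.
    by apply: ub_le_sup; [exists (u 0%N + h 0%N) => _ [m _ <-]|exists n].
  by apply: ge_sup; [exists (u 0%N), 0%N|move=> _ [m _ <-]].
have [x xP] := mono (fun n => (sq n).1) (fun n => let: And4 a _ _ _ := sqN n in a)
  (fun n => let: And4 _ a _ _ := sqN n in a).
have [y yP] := mono (fun n => (sq n).2) (fun n => let: And4 _ _ a _ := sqN n in a)
  (fun n => let: And4 _ _ _ a := sqN n in a).
have bnd n : [/\ 0 <= (sq n).1, (sq n).1 + h n <= 1, 0 <= (sq n).2 & (sq n).2 + h n <= 1].
  elim: n => [|n [a b c d]]; first by rewrite /h expr0 /= add0r.
  have [e f g i] := sqN n; split.
  - exact: le_trans e.
  - exact: le_trans b.
  - exact: le_trans g.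
  - exact: le_trans d.
have x01 : 0 <= x <= 1 by have := xP 0%N; rewrite /h expr0 /= add0r.
have y01 : 0 <= y <= 1 by have := yP 0%N; rewrite /h expr0 /= add0r.
have [eta eta0 etaP] := HB x y x01 y01.
have [n hn] := half_pow_lt eta0.
have [a b c d] := bnd n.
by apply: (sqP n); apply: etaP => //; rewrite h0.
Qed.

(** Compactness of [[0, 1]] by bisection: the property concerns the interval with left end s and
    length d, is stable under joining halves, and holds on short intervals around each point. It is
    the planar bisection with one coordinate ignored. *)
Lemma unit_induct (P : R -> R -> Prop) :
  (forall s d, 0 < d -> P s (d / 2) -> P (s + d / 2) (d / 2) -> P s d) ->
  (forall x, 0 <= x <= 1 -> exists2 eta : R, 0 < eta &
     forall s d, 0 < d < eta -> s <= x <= s + d -> 0 <= s -> s + d <= 1 -> P s d) ->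
  P 0 1.
Proof.
move=> HS HB; apply: (@square_induct (fun s t d => P s d)).
  by move=> s t d d0 h1 h2 _ _; exact: HS.
move=> x y x01 y01; have [eta eta0 etaP] := HB x x01.
by exists eta => // s t d *; exact: etaP.
Qed.

End SquareInduction.

(** * Integrals of complex functions over the unit interval *)

Section Primitive.
Variable R : realType.
Local Notation C := R[i].
Local Notation nm := (@Normc.normc R).
Implicit Types (g G u : R -> C) (f q k : C -> C).

Lemma nm_tri (a b c : C) : nm (a - b) <= nm (a - c) + nm (b - c).
Proof.
have -> : a - b = (a - c) - (b - c) by rewrite opprB addrA subrK.
by apply: le_trans (nmD _ _) _; rewrite nmN.
Qed.

Definition pcont g (t : R) := forall e : R, 0 < e -> exists2 r : R, 0 < r &
  forall s, `|s - t| < r -> nm (g s - g t) < e.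

Lemma pcont_ReIm g t : pcont g t ->
  {for t, continuous (fun s => complex.Re (g s))} /\
  {for t, continuous (fun s => complex.Im (g s))}.
Proof.
move=> gt; split; apply/cvgrPdist_lt => e e0; have [r r0 rP] := gt e e0.
  apply/nbhs_ballP; exists r => //= s; rewrite /ball /= distrC => /rP; apply: le_lt_trans.
  by rewrite distrC; apply: le_trans (Re_le_nm _); rewrite cReD cReN.
apply/nbhs_ballP; exists r => //= s; rewrite /ball /= distrC => /rP; apply: le_lt_trans.
by rewrite distrC; apply: le_trans (Im_le_nm _); rewrite cImD cImN.
Qed.

Lemma pcont_comp f u t : ccont f (u t) -> pcont u t -> pcont (fun s => f (u s)) t.
Proof.
by move=> fc uc e /fc[r r0 rP]; have [s s0 sP] := uc r r0; exists s => // v /sP /rP.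
Qed.

Lemma pder_pcont g t d : pder g t d -> pcont g t.
Proof.
move=> /pderP gd e e0; have [r r0 rP] := gd 1 ltr01.
have D0 := nm_ge0 d.
have q0 : 0 < Num.min r (e / (2 * (1 + nm d))) by rewrite lt_min r0 divr_gt0 //; lra.
exists (Num.min r (e / (2 * (1 + nm d)))) => // s.
rewrite lt_min ltr_pdivlMr; last lra.
move=> /andP[/rP h1 h2].
have := nmD (g s - g t - d * (s - t)%:C) (d * (s - t)%:C); rewrite subrK nmM nm_real.
have := normr_ge0 (s - t); nra.
Qed.

Definition prim (m : R) g (t : R) : C :=
  Rintegral lebesgue_measure `[m, t] (fun s => complex.Re (g s)) +i*
  Rintegral lebesgue_measure `[m, t] (fun s => complex.Im (g s)).

Lemma prim_pder m g t : (forall s, pcont g s) -> m < t -> pder (prim m g) t (g t).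
Proof.
move=> gc mt.
have H (phi : R -> R) : (forall s, {for s, continuous phi}) ->
    is_derive t 1 (fun x => Rintegral lebesgue_measure `[m, x] phi) (phi t).
  move=> phic.
  have t1 : t < t + 1 by rewrite ltrDl.
  have intp : lebesgue_measure.-integrable `[m, t + 1] (EFin \o phi).
    apply: continuous_compact_integrable; first exact: segment_compact.
    by apply: continuous_subspaceT => s; exact: phic.
  have [h1 h2] := continuous_FTC1_closed t1 intp mt (phic t).
  by split; [exact: h1|rewrite -h2 derive1E].
by split; apply: H => s; have [] := pcont_ReIm (gc s).
Qed.

(** The integral over [[0, 1]]. The base point -1 lies strictly to the left, so that [prim] is
    differentiable at 0 as well. *)
Definition cint g := prim (-1) g 1 - prim (-1) g 0.

Lemma pder0_const G (a b : R) : a <= b -> (forall t, a <= t <= b -> pder G t 0) -> G b = G a.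
Proof.
move=> ab Gd; have := pder_le ab Gd (fun t _ => (lexx (nm 0))).
rewrite nm0 mulr0 mul0r => h; apply/eqP; rewrite -subr_eq0 -nm_eq0.
by rewrite eq_le h nm_ge0.
Qed.

Lemma cintE g G : (forall s, pcont g s) -> (forall t, 0 <= t <= 1 -> pder G t (g t)) ->
  cint g = G 1 - G 0.
Proof.
move=> gc Gd; rewrite /cint.
suff E : prim (-1) g 1 - G 1 = prim (-1) g 0 - G 0.
  by rewrite -[prim (-1) g 1](subrK (G 1)) E; ring.
apply: (@pder0_const (fun t => prim (-1) g t - G t)) => // t /[dup] /andP[t0 _] t01.
have m1 : -1 < t by lra.
by have := pderB (prim_pder gc m1) (Gd t t01); rewrite subrr.
Qed.

Lemma cint_pder g : (forall s, pcont g s) -> forall t, 0 <= t <= 1 ->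
  pder (prim (-1) g) t (g t).
Proof. by move=> gc t /andP[t0 _]; apply: prim_pder => //; lra. Qed.

Lemma pcontD g u t : pcont g t -> pcont u t -> pcont (fun s => g s + u s) t.
Proof.
move=> fc gc e e0; have e2 : 0 < e / 2 by lra.
have [r r0 fr] := fc _ e2; have [s s0 gs] := gc _ e2.
exists (Num.min r s); first by rewrite lt_min r0.
move=> w; rewrite lt_min => /andP[/fr h1 /gs h2].
have := nmD (g w - g t) (u w - u t); rewrite addrACA -opprD; lra.
Qed.

Lemma pcontZ c g t : pcont g t -> pcont (fun s => c * g s) t.
Proof.
move=> gc; apply: (pcont_comp _ gc).
by apply: ccontM; [exact: ccont_cst|exact: ccont_id].
Qed.

Lemma cintD g u : (forall s, pcont g s) -> (forall s, pcont u s) ->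
  cint (fun t => g t + u t) = cint g + cint u.
Proof.
move=> gc uc; rewrite (@cintE _ (fun t => prim (-1) g t + prim (-1) u t)).
- by rewrite /cint; ring.
- by move=> s; exact: pcontD.
- by move=> t t01; apply: pderD; exact: cint_pder.
Qed.

Lemma cintZ c g : (forall s, pcont g s) -> cint (fun t => c * g t) = c * cint g.
Proof.
move=> gc; rewrite (@cintE _ (fun t => c * prim (-1) g t)).
- by rewrite /cint; ring.
- by move=> s; exact: pcontZ.
- by move=> t t01; apply: pderZ; exact: cint_pder.
Qed.

Lemma cintB g u : (forall s, pcont g s) -> (forall s, pcont u s) ->
  cint (fun t => g t - u t) = cint g - cint u.
Proof.
move=> gc uc; have nE v : (fun t => - v t) = (fun t => -1 * v t :> C).
  by apply/funext => t; rewrite mulN1r.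
rewrite (cintD gc); last by move=> s; rewrite nE; exact: pcontZ.
by rewrite nE cintZ // mulN1r.
Qed.

Lemma cint_cst c : cint (fun=> c) = c.
Proof.
rewrite (@cintE _ (fun t => 0 + t%:C * c)); first by rewrite rmorph1 rmorph0; ring.
  by move=> s e e0; exists 1 => // v _; rewrite subrr nm0.
by move=> t _; exact: pder_line.
Qed.

Lemma cint_le g (M : R) : (forall s, pcont g s) ->
  (forall t, 0 <= t <= 1 -> nm (g t) <= M) -> nm (cint g) <= 2 * M.
Proof.
move=> gc gM; have := pder_le ler01 (cint_pder gc) gM.
by rewrite subr0 mulr1.
Qed.

Lemma eq_cint g u : (forall t, g t = u t) -> cint g = cint u.
Proof. by move=> /funext ->. Qed.

End Primitive.

(** * Goursat's lemma, Cauchy's formula and removable singularities *)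

Section Cauchy.
Variable R : realType.
Local Notation C := R[i].
Local Notation nm := (@Normc.normc R).
Implicit Types (g G u : R -> C) (f q k : C -> C).

(** The affine approximation A of k has the primitive B, whose contributions around the
    parallelogram cancel. On each of the four sides the remainder k - A is at most e W d over a
    length of at most W d, and the mean value inequality doubles the product. *)
Lemma goursat_estimate k (om z0 D : C) (e r W x0 x1 y0 y1 d : R)
    (H0 H1 V0 V1 : R -> C) :
  0 < e -> (forall w, nm (w - z0) < r -> nm (k w - k z0 - D * (w - z0)) <= e * nm (w - z0)) ->
  x0 <= x1 -> y0 <= y1 -> x1 - x0 <= W * d -> nm om * (y1 - y0) <= W * d -> W * d < r ->
  0 <= W * d ->
  (forall x y, x0 <= x <= x1 -> y0 <= y <= y1 -> nm (x%:C + y%:C * om - z0) <= W * d) ->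
  (forall x, x0 <= x <= x1 -> pder H0 x (k (x%:C + y0%:C * om))) ->
  (forall x, x0 <= x <= x1 -> pder H1 x (k (x%:C + y1%:C * om))) ->
  (forall y, y0 <= y <= y1 -> pder V0 y (k (x0%:C + y%:C * om))) ->
  (forall y, y0 <= y <= y1 -> pder V1 y (k (x1%:C + y%:C * om))) ->
  nm ((H0 x1 - H0 x0) + om * (V1 y1 - V1 y0) - (H1 x1 - H1 x0) - om * (V0 y1 - V0 y0))
    <= 8 * e * (W * d) ^+ 2.
Proof.
move=> e0 kP x01 y01 Wx Wy Wr W0 near H0d H1d V0d V1d.
pose A z : C := k z0 + D * (z - z0).
pose B z : C := k z0 * z + D / 2 * ((z - z0) * (z - z0)).
have Bd z : cder B z (A z).
  have h1 : cder (fun w => w - z0) z 1.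
    by have := cderB (cder_id z) (cder_cst z0 z); rewrite subr0.
  have := cderD (cderZ (k z0) (cder_id z)) (cderZ (D / 2) (cderM h1 h1)).
  by rewrite [X in cder _ _ X](_ : _ = A z) // /A; field.
have E x y : x0 <= x <= x1 -> y0 <= y <= y1 ->
    nm (k (x%:C + y%:C * om) - A (x%:C + y%:C * om)) <= e * (W * d).
  move=> hx hy; have n1 := near x y hx hy; rewrite /A opprD addrA.
  by apply: le_trans (kP _ (le_lt_trans n1 Wr)) _; rewrite ler_pM2l.
have Hor Hf y : y0 <= y <= y1 ->
    (forall x, x0 <= x <= x1 -> pder Hf x (k (x%:C + y%:C * om))) ->
    nm ((Hf x1 - B (x1%:C + y%:C * om)) - (Hf x0 - B (x0%:C + y%:C * om)))
      <= 2 * e * (W * d) ^+ 2.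
  move=> hy Hd; have Hd' x : x0 <= x <= x1 ->
      pder (fun x => Hf x - B (x%:C + y%:C * om)) x
        (k (x%:C + y%:C * om) - A (x%:C + y%:C * om)).
    move=> hx; apply: pderB; first exact: Hd.
    have L : pder (fun x : R => x%:C + y%:C * om) x 1.
      by apply: pder_ext (pder_line (y%:C * om) 1 x) => s; rewrite mulr1 addrC.
    by have := pder_comp (Bd _) L; rewrite mulr1.
  apply: le_trans (pder_le x01 Hd' (fun x hx => E x y hx hy)) _.
  have : e * (W * d) * (x1 - x0) <= e * (W * d) * (W * d).
    by rewrite ler_wpM2l // mulr_ge0 // ltW.
  by rewrite expr2; lra.
have Ver Vf x : x0 <= x <= x1 ->
    (forall y, y0 <= y <= y1 -> pder Vf y (k (x%:C + y%:C * om))) ->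
    nm ((om * Vf y1 - B (x%:C + y1%:C * om)) - (om * Vf y0 - B (x%:C + y0%:C * om)))
      <= 2 * e * (W * d) ^+ 2.
  move=> hx Vd; have Vd' y : y0 <= y <= y1 ->
      pder (fun y => om * Vf y - B (x%:C + y%:C * om)) y
        (om * (k (x%:C + y%:C * om) - A (x%:C + y%:C * om))).
    move=> hy; rewrite mulrBr; apply: pderB; first exact: pderZ (Vd _ hy).
    by have := pder_comp (Bd _) (pder_line x%:C om y); rewrite mulrC.
  have E' y : y0 <= y <= y1 -> nm (om * (k (x%:C + y%:C * om) - A (x%:C + y%:C * om)))
      <= nm om * (e * (W * d)).
    by move=> hy; rewrite nmM ler_wpM2l ?nm_ge0 // E.
  apply: le_trans (pder_le y01 Vd' E') _.
  have : e * (W * d) * (nm om * (y1 - y0)) <= e * (W * d) * (W * d).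
    by rewrite ler_wpM2l // mulr_ge0 // ltW.
  by rewrite expr2; lra.
have a1 : x0 <= x1 <= x1 by rewrite x01 lexx.
have a0 : x0 <= x0 <= x1 by rewrite x01 lexx.
have b1 : y0 <= y1 <= y1 by rewrite y01 lexx.
have b0 : y0 <= y0 <= y1 by rewrite y01 lexx.
have := Hor H0 y0 b0 H0d; have := Hor H1 y1 b1 H1d.
have := Ver V0 x0 a0 V0d; have := Ver V1 x1 a1 V1d.
set p1 := (X in nm X <= _); set p2 := (X in _ -> nm X <= _ -> _).
set p3 := (X in _ -> _ -> nm X <= _ -> _); set p4 := (X in _ -> _ -> _ -> nm X <= _ -> _).
move=> h1 h2 h3 h4.
have -> : (H0 x1 - H0 x0) + om * (V1 y1 - V1 y0) - (H1 x1 - H1 x0) - om * (V0 y1 - V0 y0)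
  = (p4 + p1) - (p3 + p2) by rewrite /p1 /p2 /p3 /p4; ring.
have := nmD (p4 + p1) (- (p3 + p2)); rewrite nmN.
have := nmD p4 p1; have := nmD p3 p2; lra.
Qed.

(** Bisection shows that the boundary integral over the parallelogram with sides b - a and om
    vanishes, and periodicity cancels its two horizontal sides. *)
Lemma goursat_periodic k (om : C) (a b : R) : a <= b -> om != 0 ->
  (forall x y, a <= x <= b -> chol k (x%:C + y%:C * om)) ->
  (forall w, k (w + om) = k w) ->
  cint (fun y => k (a%:C + y%:C * om)) = cint (fun y => k (b%:C + y%:C * om)).
Proof.
move=> ab om0 hk per.
(* Clamping makes the integrands continuous on the whole line, as [prim_pder] demands, without
   changing them over [[a, b]]. *)
pose cl x : R := Num.max a (Num.min b x).
have clab x : a <= cl x <= b by rewrite /cl le_max lexx ge_max ab ge_min lexx.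
have clE x : a <= x <= b -> cl x = x.
  by move=> /andP[h1 h2]; rewrite /cl (min_idPr h2) (max_idPr h1).
have clL x x' : `|cl x - cl x'| <= `|x - x'|.
  have cll v : v <= a -> cl v = a.
    by move=> h; rewrite /cl (min_idPr (le_trans h ab)) (max_idPl h).
  have clr v : b <= v -> cl v = b.
    by move=> h; rewrite /cl (min_idPl h) (max_idPr ab).
  have := ler_norm (x - x'); have := ler_norm (- (x - x')); rewrite normrN ler_norml.
  have [h1|h1] := leP x a; have [h2|h2] := leP x' a; rewrite ?(cll _ h1) ?(cll _ h2);
    try (by move=> *; apply/andP; split; lra).
  - have [h3|h3] := leP b x'; first by rewrite (clr _ h3) => *; apply/andP; split; lra.
    by rewrite (clE x') ?(ltW h2) ?(ltW h3) // => *; apply/andP; split; lra.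
  - have [h3|h3] := leP b x; first by rewrite (clr _ h3) => *; apply/andP; split; lra.
    by rewrite (clE x) ?(ltW h1) ?(ltW h3) // => *; apply/andP; split; lra.
  have [h3|h3] := leP b x; have [h4|h4] := leP b x'; rewrite ?(clr _ h3) ?(clr _ h4);
    try rewrite (clE x) ?(ltW h1) ?(ltW h3) //; try rewrite (clE x') ?(ltW h2) ?(ltW h4) //; by move=> *; apply/andP; split; lra.
pose K x y := k ((cl x)%:C + y%:C * om).
have KE x y : a <= x <= b -> K x y = k (x%:C + y%:C * om) by move=> h; rewrite /K clE.
have Kx y x : pcont (fun x => K x y) x.
  apply: (@pcont_comp _ k (fun x => (cl x)%:C + y%:C * om)).
    by apply: chol_cont; exact: hk.
  move=> e e0; exists e => // s h; rewrite opprD addrACA subrr addr0 nm_realB.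
  exact: le_lt_trans (clL _ _) h.
have Ky x y : pcont (fun y => K x y) y.
  apply: (@pcont_comp _ k (fun y => (cl x)%:C + y%:C * om)).
    by apply: chol_cont; exact: hk.
  exact: pder_pcont (pder_line _ _ _).
pose Hh y := prim (a - 1) (fun x => K x y); pose Vv x := prim (-1) (fun y => K x y).
have Hd y x : a <= x <= b -> pder (Hh y) x (k (x%:C + y%:C * om)).
  move=> hx; have : a - 1 < x by lra.
  by move=> /(prim_pder (Kx y))/pder_eq; apply; exact: KE.
have Vd x y : a <= x <= b -> 0 <= y -> pder (Vv x) y (k (x%:C + y%:C * om)).
  move=> hx hy; have : -1 < y by lra.
  by move=> /(prim_pder (Ky x))/pder_eq; apply; exact: KE.
pose J x0 x1 y0 y1 := (Hh y0 x1 - Hh y0 x0) + om * (Vv x1 y1 - Vv x1 y0)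
  - (Hh y1 x1 - Hh y1 x0) - om * (Vv x0 y1 - Vv x0 y0).
have Jadd x0 x1 x2 y0 y1 y2 : J x0 x2 y0 y2 =
    (J x0 x1 y0 y1 + J x1 x2 y0 y1) + (J x0 x1 y1 y2 + J x1 x2 y1 y2).
  by rewrite /J; move: (Hh y0) (Hh y1) (Hh y2) (Vv x0) (Vv x1) (Vv x2); clear => *; ring.
pose X s := a + s * (b - a).
have J0 : J a b 0 1 = 0.
  apply/eqP; rewrite -nm_eq0; apply/eqP/le_anti; rewrite nm_ge0 andbT.
  apply/ler_addgt0Pl => e e0; rewrite addr0.
  (* The premises, trivial for the unit square, are the bounds on a cell that the induction has to
     carry along. *)
  suff : 0 <= (0 : R) -> 0 + 1 <= (1 : R) -> 0 <= (0 : R) -> 0 + 1 <= (1 : R) ->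
      nm (J (X 0) (X (0 + 1)) 0 (0 + 1)) <= e * 1 ^+ 2.
    by rewrite add0r /X mul0r addr0 mul1r addrC subrK expr1n mulr1; apply.
  apply: (@square_induct R (fun s t d => 0 <= s -> s + d <= 1 -> 0 <= t -> t + d <= 1 ->
      nm (J (X s) (X (s + d)) t (t + d)) <= e * d ^+ 2)).
    move=> s t d d0; have h2 (v : R) : v + d / 2 + d / 2 = v + d by field.
    rewrite !h2 => P1 P2 P3 P4 s0 s1 t0 t1.
    have [a1 a2] : s + d / 2 <= 1 /\ t + d / 2 <= 1 by clear -s1 t1 d0; split; lra.
    have [a3 a4] : 0 <= s + d / 2 /\ 0 <= t + d / 2 by clear -s0 t0 d0; split; lra.
    have {}P1 := P1 s0 a1 t0 a2; have {}P2 := P2 a3 s1 t0 a2.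
    have {}P3 := P3 s0 a1 a4 t1; have {}P4 := P4 a3 s1 a4 t1.
    have e4 : e * d ^+ 2 = 4 * (e * (d / 2) ^+ 2) by field.
    rewrite e4 (Jadd _ (X (s + d / 2)) _ _ (t + d / 2)).
    move: P1 P2 P3 P4; move: (J _ _ _ _) (J _ _ _ _) (J _ _ _ _) (J _ _ _ _) (e * (d / 2) ^+ 2).
    clear => j4 j3 j2 j1 v.
    by have := nmD (j1 + j2) (j3 + j4); have := nmD j1 j2; have := nmD j3 j4; lra.
  move=> x y x01 y01.
  have Xab s : 0 <= s <= 1 -> a <= X s <= b by rewrite /X => /andP[? ?]; apply/andP; split; nra.
  have [D kD] := hk (X x) y (Xab x x01).
  pose W := (b - a) + nm om.
  have om1 : 0 < nm om by rewrite nm_gt0.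
  have W0 : 0 < W by rewrite /W; lra.
  (* Cancels the factor 8 W^2 of [goursat_estimate], where W d bounds the extent of a cell of size
     d. *)
  have e1 : 0 < e / (8 * W ^+ 2) by rewrite divr_gt0 // mulr_gt0 // exprn_gt0.
  have [r r0 rP] := kD _ e1.
  exists (r / W); first by rewrite divr_gt0.
  move=> s t d /andP[d0]; rewrite ltr_pdivlMr // => dr sx ty s0 s1 t0 t1.
  have s01 : 0 <= s <= 1 by lra.
  have sd01 : 0 <= s + d <= 1 by lra.
  have Xs : X (s + d) - X s = d * (b - a) by rewrite /X; ring.
  have inab v : X s <= v <= X (s + d) -> a <= v <= b.
    by have := Xab _ s01; have := Xab _ sd01; lra.
  have -> : e * d ^+ 2 = 8 * (e / (8 * W ^+ 2)) * (W * d) ^+ 2 by field; rewrite gt_eqF.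
  move=> _ _ _ _; apply: (goursat_estimate e1 rP).
  - by rewrite -subr_ge0 Xs mulr_ge0 ?(ltW d0) ?subr_ge0.
  - by lra.
  - by rewrite Xs /W; nra.
  - by rewrite addrC addKr /W; nra.
  - by rewrite mulrC.
  - by rewrite mulr_ge0 ?(ltW W0) ?(ltW d0).
  - move=> x' y' hx hy.
    have -> : x'%:C + y'%:C * om - ((X x)%:C + y%:C * om) = (x'%:C - (X x)%:C) + (y'%:C - y%:C) * om.
      by ring.
    apply: le_trans (nmD _ _) _; rewrite nmM !nm_realB.
    have h1 : `|x' - X x| <= d * (b - a).
      have : X s <= X x <= X (s + d) by rewrite /X; apply/andP; split; nra.
      by rewrite ler_norml; lra.
    have h2 : `|y' - y| <= d by rewrite ler_norml; lra.
    by rewrite /W; have := nm_ge0 om; nra.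
  - by move=> v hv; apply: Hd; exact: inab.
  - by move=> v hv; apply: Hd; exact: inab.
  - by move=> v hv; apply: Vd; [exact: Xab|lra].
  - by move=> v hv; apply: Vd; [exact: Xab|lra].
have HhE : Hh 1 = Hh 0.
  congr prim; apply/funext => x; rewrite /K rmorph1 rmorph0 mul1r mul0r addr0; exact: per.
have VE x : a <= x <= b -> cint (fun y => k (x%:C + y%:C * om)) = Vv x 1 - Vv x 0.
  by move=> hx; rewrite /cint /Vv /K clE.
rewrite !VE ?lexx ?ab //; apply: (mulfI om0).
by move: J0; rewrite /J HhE => h; apply/eqP; rewrite -subr_eq0; apply/eqP; rewrite -[RHS]oppr0 -h; ring.
Qed.

Definition period : C := 0 +i* (pi *+ 2).

Lemma cexp_period : cexp period = 1.
Proof. by rewrite /cexp /= expR0 !mul1r mulr2n cosDpi sinDpi cospi sinpi opprK oppr0. Qed.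

Definition e1 (t : R) : C := cexp (t%:C * period).

Lemma nm_e1 t : nm (e1 t) = 1.
Proof. by rewrite nm_cexp cReM /= mul0r mulr0 subr0 expR0. Qed.

Lemma e1_cont t : pcont e1 t.
Proof.
apply: (@pcont_comp _ (@cexp R)); first exact: cder_cont (cder_exp _).
apply: pder_pcont; apply: pder_ext (pder_line 0 period t) => s; by rewrite add0r.
Qed.

(** The contour integral of q(z) / z over the circle, divided by 2 pi i; accordingly Cauchy's kernel
    takes the form z / (z - w). *)
Definition cmean q (rho : R) := cint (fun t => q (rho%:C * e1 t)).

Lemma pcont_circle q rho t : ccont q (rho%:C * e1 t) -> pcont (fun t => q (rho%:C * e1 t)) t.
Proof.
move=> qc; apply: (@pcont_comp _ q (fun t => rho%:C * e1 t)) => //.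
by apply: pcontZ; exact: e1_cont.
Qed.

Lemma cmean_annulus q (rho rho' : R) : 0 < rho -> rho <= rho' ->
  (forall z, rho <= nm z <= rho' -> chol q z) -> cmean q rho = cmean q rho'.
Proof.
move=> r0 rr hq.
have r0' : 0 < rho' by exact: lt_le_trans rr.
have per0 : period != 0.
  by rewrite /period eq_complex /= eqxx /= mulrn_eq0 /= gt_eqF // pi_gt0.
have lnE (v : R) t : 0 < v -> cexp ((ln v)%:C + t%:C * period) = v%:C * e1 t.
  by move=> v0; rewrite cexpD cexp_real lnK.
have lr : ln rho <= ln rho' by rewrite ler_ln // posrE.
have H := @goursat_periodic (fun w => q (cexp w)) period (ln rho) (ln rho') lr per0.
rewrite /cmean (eq_cint (u := fun y => q (cexp ((ln rho)%:C + y%:C * period)))); last first.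
  by move=> t; rewrite lnE.
rewrite H.
- by apply: eq_cint => t; rewrite lnE.
- move=> x y /andP[x1 x2]; apply: chol_comp; first by exists (cexp (x%:C + y%:C * period)); exact: cder_exp.
  apply: hq; rewrite nm_cexp cReD cReM /= mul0r mulr0 subr0 addr0.
  have h1 : expR (ln rho) <= expR x by rewrite ler_expR.
  have h2 : expR x <= expR (ln rho') by rewrite ler_expR.
  by move: h1 h2; rewrite (lnK r0) (lnK r0') => -> ->.
- by move=> w; rewrite cexpD cexp_period mulr1.
Qed.

Lemma circle_unif q (rho : R) : (forall t, ccont q (rho%:C * e1 t)) ->
  forall e : R, 0 < e -> exists2 d : R, 0 < d & forall rho' t, `|rho' - rho| < d ->
    0 <= t <= 1 -> nm (q (rho'%:C * e1 t) - q (rho%:C * e1 t)) < e.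
Proof.
move=> qc e e0.
suff [d d0 dP] : exists2 d : R, 0 < d & forall rho' t, `|rho' - rho| < d ->
    0 <= t <= 0 + 1 -> nm (q (rho'%:C * e1 t) - q (rho%:C * e1 t)) < e.
  by exists d => // rho' t h; rewrite -[X in _ <= t <= X]add0r; exact: dP.
apply: (@unit_induct R (fun s d' => exists2 d : R, 0 < d & forall rho' t, `|rho' - rho| < d ->
    s <= t <= s + d' -> nm (q (rho'%:C * e1 t) - q (rho%:C * e1 t)) < e)).
  move=> s d d0 [p p0 pP] [r r0 rP]; exists (Num.min p r); first by rewrite lt_min p0.
  move=> rho' t; rewrite lt_min => /andP[h1 h2] h3.
  have [h4|h4] := lerP t (s + d / 2); first by apply: pP => //; lra.
  by apply: rP => //; lra.
move=> x x01; have e2 : 0 < e / 2 by lra.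
have [r r0 rP] := qc x _ e2.
have k0 : 0 < r / (2 * (`|rho| + 1)).
  by rewrite divr_gt0 // mulr_gt0 //; have := normr_ge0 rho; lra.
have [s s0 sP] := @e1_cont x _ k0.
exists s => // s' d' /andP[d0 ds] hx _ _.
exists (r / 2); first by lra.
move=> rho' t hr ht.
have te : nm (e1 t - e1 x) < r / (2 * (`|rho| + 1)).
  by apply: sP; rewrite ltr_norml; lra.
have R1 : 0 <= `|rho| by exact: normr_ge0.
have te' : (`|rho| + 1) * nm (e1 t - e1 x) < r / 2.
  move: te; rewrite ltr_pdivlMr; last lra.
  by move=> h; rewrite ltr_pdivlMr //; lra.
have close v : `|v - rho| < r / 2 -> nm (v%:C * e1 t - rho%:C * e1 x) < r.
  move=> hv; have -> : v%:C * e1 t - rho%:C * e1 x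
    = (v%:C - rho%:C) * e1 t + rho%:C * (e1 t - e1 x) by ring.
  apply: le_lt_trans (nmD _ _) _; rewrite !nmM nm_realB nm_e1 nm_real mulr1.
  have := nm_ge0 (e1 t - e1 x); nra.
have h1 := rP _ (close rho' hr).
have h2 : nm (q (rho%:C * e1 t) - q (rho%:C * e1 x)) < e / 2.
  by apply: rP; apply: close; rewrite subrr normr0; lra.
by apply: le_lt_trans (nm_tri _ _ (q (rho%:C * e1 x))) _; lra.
Qed.

(** Radius 0 is included: there the mean is the value at the centre, from which [mean_value]
    starts. *)
Lemma cmean_cont q (r rho : R) : 0 <= rho < r ->
  (forall z, nm z < r -> ccont q z) ->
  forall e : R, 0 < e -> exists2 d : R, 0 < d & forall rho', 0 <= rho' < r -> `|rho' - rho| < d ->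
    nm (cmean q rho' - cmean q rho) < e.
Proof.
move=> rr qc e e0; have e4 : 0 < e / 4 by lra.
have pc v : 0 <= v < r -> forall t, pcont (fun t => q (v%:C * e1 t)) t.
  move=> /andP[v0 vr] t; apply: pcont_circle; apply: qc.
  by rewrite nmM nm_e1 mulr1 nm_real ger0_norm.
have qc' t : ccont q (rho%:C * e1 t).
  by apply: qc; rewrite nmM nm_e1 mulr1 nm_real ger0_norm; case/andP: rr.
have [d d0 dP] := circle_unif qc' e4.
exists d => // rho' rr' hd; rewrite /cmean -cintB; [|exact: pc|exact: pc].
apply: le_lt_trans (_ : 2 * (e / 4) < _); last by lra.
apply: cint_le => [s|t t01]; last by apply: ltW; exact: dP.
by have := pcontD (pc _ rr' s) (pcontZ (-1) (pc _ rr s)); under eq_fun do rewrite mulN1r.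
Qed.

Lemma nm_small z : (forall e : R, 0 < e -> nm z < e) -> z = 0.
Proof.
move=> h; apply/eqP; rewrite -nm_eq0; apply/eqP/le_anti; rewrite nm_ge0 andbT.
by apply/ler_addgt0Pl => e e0; rewrite addr0 ltW // h.
Qed.

(* The circle mean is constant on both sides of the radius of the exceptional
   point [w0], and continuous there. *)
Lemma mean_value q (w0 : C) (r rho : R) : 0 <= rho < r ->
  (forall z, nm z < r -> ccont q z) ->
  (forall z, nm z < r -> z != w0 -> chol q z) ->
  cmean q rho = q 0.
Proof.
move=> rr qc hq.
have q00 : cmean q 0 = q 0.
  rewrite /cmean (eq_cint (u := fun=> q 0)); first exact: cint_cst.
  by move=> t; rewrite rmorph0 mul0r.
set sg := nm w0.
have low (v : R) : 0 <= v -> v < r -> v < sg -> cmean q v = q 0.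
  move=> v0 vr vs; have [->//|v00] := eqVneq v 0.
  have {v00}v0 : 0 < v by rewrite lt_def v00.
  rewrite -q00; apply/eqP; rewrite -subr_eq0; apply/eqP/nm_small => e e0.
  have zr : 0 <= (0 : R) < r by rewrite lexx (lt_trans v0).
  have [d d0 dP] := cmean_cont zr qc e0.
  pose v' := Num.min v (d / 2).
  have v'0 : 0 < v' by rewrite lt_min v0; lra.
  have v'v : v' <= v by rewrite ge_min lexx.
  have v'd : v' <= d / 2 by rewrite ge_min lexx orbT.
  rewrite -(cmean_annulus v'0 v'v).
    by apply: dP; [lra|rewrite subr0 ger0_norm; lra].
  move=> z /andP[_ zv]; apply: hq; first by lra.
  by apply/eqP => zw; rewrite zw -/sg in zv; clear zw; lra.
have mid : 0 < sg < r -> cmean q sg = q 0.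
  move=> /andP[s0 sr]; apply/eqP; rewrite -subr_eq0; apply/eqP/nm_small => e e0.
  have zr : 0 <= sg < r by rewrite ltW.
  have [d d0 dP] := cmean_cont zr qc e0.
  pose v := Num.max 0 (sg - d / 2).
  have v0 : 0 <= v by rewrite le_max lexx.
  have v1 : sg - d / 2 <= v by rewrite le_max lexx orbT.
  have v2 : v < sg by rewrite gt_max s0; lra.
  rewrite -(low v) //; last by lra.
  by rewrite nmB; apply: dP; [lra|rewrite ltr_norml; lra].
have sgE : sg < r -> cmean q sg = q 0.
  move=> sr; have [s0|s0] := ltrP 0 sg; first by apply: mid; rewrite s0.
  by have -> : sg = 0 by apply/le_anti; rewrite s0 nm_ge0.
case/andP: rr => r0 rr.
have [h|h|h] := ltgtP rho sg; first exact: low; last by rewrite h; apply: sgE; rewrite -h.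
rewrite -sgE; last by lra.
apply/eqP; rewrite -subr_eq0; apply/eqP/nm_small => e e0.
have sg0 : 0 <= sg by exact: nm_ge0.
have zr : 0 <= sg < r by rewrite sg0; lra.
have [d d0 dP] := cmean_cont zr qc e0.
pose v := Num.min rho (sg + d / 2).
have v1 : sg < v by rewrite lt_min h; lra.
have v2 : v <= rho by rewrite ge_min lexx.
have v3 : v <= sg + d / 2 by rewrite ge_min lexx orbT.
rewrite -(@cmean_annulus q v rho) //; last 2 first.
- by lra.
- move=> z /andP[z1 z2]; apply: hq; first by lra.
  by apply/eqP => zw; have := lt_le_trans v1 z1; rewrite zw ltxx.
by apply: dP; [lra|rewrite ltr_norml; lra].
Qed.

(** The mean is the same over all larger circles, on which the kernel tends uniformly to 1. *)
Lemma mean_kernel (w : C) (rho : R) : nm w < rho ->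
  cmean (fun z => z / (z - w)) rho = 1.
Proof.
move=> wr; have w0 := nm_ge0 w.
have hz z : nm w < nm z -> z - w != 0.
  by move=> h; rewrite subr_eq0; apply: contraTneq h => ->; rewrite ltxx.
have hq z : nm w < nm z -> chol (fun z => z / (z - w)) z.
  move=> /hz h; apply: chol_div => //; first exact: chol_id.
  by apply: cholB; [exact: chol_id|exact: chol_cst].
apply/eqP; rewrite -subr_eq0; apply/eqP/nm_small => e e0.
(* Large enough for |w / (z - w)| <= e / 4 on the circle of radius v. *)
pose v := rho + 4 * nm w / e.
have ve : 0 <= 4 * nm w / e by rewrite divr_ge0 ?mulr_ge0 // ltW.
have v1 : rho <= v by rewrite lerDl.
rewrite (@cmean_annulus _ rho v) //; last 2 first.
- by lra.
- by move=> z /andP[z1 _]; apply: hq; lra.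
have v0 : 0 < v by lra.
have nv t : nm (v%:C * e1 t) = v by rewrite nmM nm_e1 mulr1 nm_real gtr0_norm.
have pc t : pcont (fun t => v%:C * e1 t / (v%:C * e1 t - w)) t.
  apply: (@pcont_circle (fun z => z / (z - w))); apply: chol_cont; apply: hq; rewrite nv; lra.
rewrite /cmean -(cint_cst 1) -cintB //; last first.
  by move=> s e' e'0; exists 1 => // s' _; rewrite subrr nm0.
apply: le_lt_trans (_ : 2 * (e / 4) < _); last by lra.
apply: cint_le => [s|t _].
  have pc1 : pcont (fun=> -1 : C) s by move=> e' e'0; exists 1 => // s' _; rewrite subrr nm0.
  exact: pcontD (pc s) pc1.
have z0 : v%:C * e1 t - w != 0 by apply: hz; rewrite nv; lra.
have -> : v%:C * e1 t / (v%:C * e1 t - w) - 1 = w / (v%:C * e1 t - w) by field.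
have n1 := nmB_ge (v%:C * e1 t) w; rewrite nv in n1.
rewrite nmM nmV ler_pdivrMr; last by lra.
have : e * v = e * rho + 4 * nm w by rewrite /v; field; rewrite gt_eqF.
nra.
Qed.

(** The mean value property is applied to z times the difference quotient of f at w. Completed by
    the derivative, the quotient is continuous at w, the one point where its holomorphy is not yet
    available, and the product vanishes at 0. *)
Lemma cauchy_formula f (w : C) (r rho : R) : nm w < rho < r ->
  (forall z, nm z < r -> chol f z) ->
  cmean (fun z => f z * (z / (z - w))) rho = f w.
Proof.
move=> /andP[wr rr] hf; have w0 := nm_ge0 w.
have [d fd] := hf w (lt_trans wr rr).
pose sl z : C := if z == w then d else (f z - f w) / (z - w).
have slc : ccont sl w.
  move=> e e0; have e2 : 0 < e / 2 by lra.
  have [s s0 sP] := fd _ e2; exists s => // z /sP h.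
  rewrite {2}/sl eqxx /sl; case: eqVneq => [_|zw]; first by rewrite subrr nm0.
  have zw0 : z - w != 0 by rewrite subr_eq0.
  have -> : (f z - f w) / (z - w) - d = (f z - f w - d * (z - w)) / (z - w) by field.
  rewrite nmM nmV; apply: le_lt_trans (_ : e / 2 < e); last by lra.
  by rewrite ler_pdivrMr // nm_gt0.
have slh z : nm z < r -> z != w -> chol sl z.
  move=> zr zw; have zw0 : z - w != 0 by rewrite subr_eq0.
  have : chol (fun z => (f z - f w) / (z - w)) z.
    by apply: chol_div => //; apply: cholB; [exact: hf|exact: chol_cst|exact: chol_id|exact: chol_cst].
  apply: (@chol_near _ _ _ _ (nm (z - w))); first by rewrite nm_gt0.
  move=> u; rewrite /sl; case: eqVneq => // ->; by rewrite nmB ltxx.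
pose q z := z * sl z.
have qh z : nm z < r -> z != w -> chol q z.
  by move=> zr zw; apply: cholM; [exact: chol_id|exact: slh].
have qc z : nm z < r -> ccont q z.
  move=> zr; have [->|zw] := eqVneq z w; last by apply: chol_cont; exact: qh.
  by apply: ccontM => //; exact: ccont_id.
have rho0 : 0 <= rho < r by lra.
have := mean_value rho0 qc qh; rewrite {2}/q mul0r => m0.
have nv t : nm (rho%:C * e1 t) = rho by rewrite nmM nm_e1 mulr1 nm_real ger0_norm; lra.
have zw t : rho%:C * e1 t - w != 0.
  rewrite subr_eq0; apply/eqP => h; have := nv t; rewrite h => h2; rewrite h2 ltxx in wr.
  by [].
have pk t : pcont (fun t => rho%:C * e1 t / (rho%:C * e1 t - w)) t.
  apply: (@pcont_circle (fun z => z / (z - w))); apply: chol_cont.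
  by apply: chol_div => //; [exact: chol_id|apply: cholB; [exact: chol_id|exact: chol_cst]].
have pf t : pcont (fun t => f (rho%:C * e1 t) * (rho%:C * e1 t / (rho%:C * e1 t - w))) t.
  apply: (@pcont_circle (fun z => f z * (z / (z - w)))); apply: chol_cont.
  apply: cholM; first by apply: hf; rewrite nv.
  by apply: chol_div => //; [exact: chol_id|apply: cholB; [exact: chol_id|exact: chol_cst]].
have E : cmean q rho = cmean (fun z => f z * (z / (z - w))) rho - f w * cmean (fun z => z / (z - w)) rho.
  rewrite /cmean -cintZ // -cintB //; last by move=> s; exact: pcontZ.
  apply: eq_cint => t; move: (zw t); move: (rho%:C * e1 t) => z zn.
  have zw' : (z == w) = false by rewrite -subr_eq0; exact: negbTE.
  by rewrite /q /sl zw' -mulrBl mulrCA.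
by move: m0; rewrite E mean_kernel // mulr1 => /eqP; rewrite subr_eq0 => /eqP.
Qed.

Lemma pcont_bounded g : (forall t, pcont g t) ->
  exists2 M : R, 0 <= M & forall t, 0 <= t <= 1 -> nm (g t) <= M.
Proof.
move=> gc.
suff [M M0 MP] : exists2 M : R, 0 <= M & forall t, 0 <= t <= 0 + 1 -> nm (g t) <= M.
  by exists M => // t t01; apply: MP; rewrite add0r.
apply: (@unit_induct R (fun s d => exists2 M : R, 0 <= M & forall t, s <= t <= s + d -> nm (g t) <= M)).
  move=> s d d0 [M M0 MP] [N N0 NP]; exists (M + N); first by rewrite addr_ge0.
  move=> t ht; have [h4|h4] := lerP t (s + d / 2).
    by apply: le_trans (MP t _) _; lra.
  by apply: le_trans (NP t _) _; lra.
move=> x x01; have [r r0 rP] := gc x 1 ltr01.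
exists r => // s d /andP[d0 dr] sx _ _; exists (nm (g x) + 1).
  by have := nm_ge0 (g x); lra.
move=> t ht; have := rP t; rewrite ltr_norml => h.
have {}h : nm (g t - g x) < 1 by apply: h; lra.
by have := nmD (g t - g x) (g x); rewrite subrK; lra.
Qed.

(** Since the mean of f is f 0 = 0 and z / (z - w) - 1 = w / (z - w), Cauchy's formula reads f w = w
    K w, with K w the mean of f z / (z - w). The derivative of K at 0 comes from the expansion 1 /
    (z - w) = 1 / z + w / z^2 + w^2 / (z^2 (z - w)); away from 0 the quotient f z / z is holomorphic
    at once. *)
Lemma division_at0 f (r : R) : 0 < r -> (forall z, nm z < r -> chol f z) -> f 0 = 0 ->
  exists2 g : C -> C, (forall z, nm z < r -> chol g z) &
    forall z, nm z < r -> f z = z * g z.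
Proof.
move=> r0 hf f0; pose rho := r / 2.
have rho0 : 0 < rho by rewrite /rho; lra.
have rhor : rho < r by rewrite /rho; lra.
have nv t : nm (rho%:C * e1 t) = rho by rewrite nmM nm_e1 mulr1 nm_real gtr0_norm.
have z0 t : rho%:C * e1 t != 0 by rewrite -nm_gt0 nv.
have zw w t : nm w < rho -> rho%:C * e1 t - w != 0.
  by move=> wr; rewrite subr_eq0; apply/eqP => h; have := nv t; rewrite h => h2; rewrite h2 ltxx in wr.
have pf t : pcont (fun t => f (rho%:C * e1 t)) t.
  by apply: pcont_circle; apply: chol_cont; apply: hf; rewrite nv.
have pc (h : C -> C) t : chol h (rho%:C * e1 t) ->
    pcont (fun t => f (rho%:C * e1 t) * h (rho%:C * e1 t)) t.
  move=> hh; apply: (@pcont_circle (fun z => f z * h z)); apply: ccontM.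
    by apply: chol_cont; apply: hf; rewrite nv.
  exact: chol_cont.
have ch w t : nm w < rho -> chol (fun z => (z - w)^-1) (rho%:C * e1 t).
  move=> wr; apply: cholV; first exact: zw.
  by apply: cholB; [exact: chol_id|exact: chol_cst].
pose K w := cmean (fun z => f z * (z - w)^-1) rho.
have pK w t : nm w < rho -> pcont (fun t => f (rho%:C * e1 t) * (rho%:C * e1 t - w)^-1) t.
  by move=> wr; apply: (pc (fun z => (z - w)^-1)); exact: ch.
have rr w : nm w < rho -> nm w < rho < r by move=> ->.
have fK w : nm w < rho -> f w = w * K w.
  move=> wr; have := cauchy_formula (rr _ wr) hf => <-.
  have n00 : nm 0 < rho by rewrite nm0.
  have := cauchy_formula (rr _ n00) hf; rewrite f0 => F0.
  rewrite -[LHS]subr0 -F0 /K /cmean -cintZ; last by move=> s; exact: pK.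
  rewrite -cintB.
  - apply: eq_cint => t; move: (zw w t wr) (z0 t); move: (rho%:C * e1 t) => z zn zn0.
    by rewrite subr0 divff //; move: (f z) => a; field.
  - move=> s; apply: (pc (fun z => z / (z - w))); apply: cholM; [exact: chol_id|exact: ch].
  - move=> s; apply: (pc (fun z => z / (z - 0))); apply: cholM; [exact: chol_id|].
    by apply: ch; rewrite nm0.
exists (fun z => if z == 0 then K 0 else f z / z); last first.
  move=> z zr; case: eqVneq => [->|z00]; first by rewrite mul0r f0.
  by rewrite mulrC divfK.
move=> z zr; have [->|z00] := eqVneq z 0; last first.
  have := chol_div z00 (hf _ zr) (chol_id z).
  apply: (@chol_near _ _ _ _ (nm z)); first by rewrite nm_gt0.
  by move=> w; case: eqVneq => // ->; rewrite nmB subr0 ltxx.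
suff : chol K 0.
  apply: (@chol_near _ _ _ _ rho) => // w; rewrite subr0 => wr.
  by case: eqVneq => [->//|w0]; rewrite fK // mulrC mulKf.
have [M M0 MP] := pcont_bounded pf.
pose K1 := cmean (fun z => f z * (z ^+ 2)^-1) rho.
exists K1 => e e0.
have p2 s : pcont (fun t => f (rho%:C * e1 t) * ((rho%:C * e1 t) ^+ 2)^-1) s.
  apply: (pc (fun z => (z ^+ 2)^-1)); apply: cholV; first by rewrite expf_neq0.
  by apply: cholX; exact: chol_id.
(* For |w| <= rho / 2 the last kernel is at most 2 / rho^3 on the circle, and [cint_le] doubles the
   estimate. *)
pose c := 4 * M / rho ^+ 3.
have c0 : 0 <= c by rewrite divr_ge0 ?mulr_ge0 ?exprn_ge0 // ltW.
exists (Num.min (rho / 2) (e / (c + 1))).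
  by rewrite lt_min !divr_gt0 //; lra.
move=> w; rewrite subr0 lt_min => /andP[wr]; rewrite ltr_pdivlMr; last by lra.
move=> we.
have wr' : nm w < rho by lra.
have n00 : nm 0 < rho by rewrite nm0.
have p3 s : pcont (fun t => f (rho%:C * e1 t) *
    (((rho%:C * e1 t) ^+ 2)^-1 * (rho%:C * e1 t - w)^-1)) s.
  apply: (pc (fun z => (z ^+ 2)^-1 * (z - w)^-1)); apply: cholM; last exact: ch.
  apply: cholV; first by rewrite expf_neq0.
  by apply: cholX; exact: chol_id.
have -> : K w - K 0 - K1 * w =
    w ^+ 2 * cint (fun t => f (rho%:C * e1 t) *
    (((rho%:C * e1 t) ^+ 2)^-1 * (rho%:C * e1 t - w)^-1)).
  rewrite [K1 * w]mulrC /K /K1 /cmean -!cintZ // -!cintB //.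
  - apply: eq_cint => t; move: (zw w t wr') (z0 t); move: (rho%:C * e1 t) => u zn zn0.
    by rewrite subr0; move: (f u) => a; field; rewrite zn zn0.
  - move=> s; have := pcontD (pK _ s wr') (pcontZ (-1) (pK _ s n00)).
    by under eq_fun do rewrite mulN1r.
  - by move=> s; exact: pcontZ.
  - by move=> s; exact: pK.
  - by move=> s; exact: pK.
rewrite nmM nmX.
have B : nm (cint (fun t => f (rho%:C * e1 t) *
    (((rho%:C * e1 t) ^+ 2)^-1 * (rho%:C * e1 t - w)^-1))) <= 2 * (2 * M / rho ^+ 3).
  apply: cint_le => // t t01; rewrite nmM nmM !nmV nmX nv.
  have n1 := nmB_ge (rho%:C * e1 t) w; rewrite nv in n1.
  have n2 : rho / 2 <= nm (rho%:C * e1 t - w) by lra.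
  have -> : 2 * M / rho ^+ 3 = M * ((rho ^+ 2)^-1 * (rho / 2)^-1) by field; rewrite gt_eqF.
  apply: ler_pM => //; first exact: nm_ge0.
  - by rewrite mulr_ge0 ?invr_ge0 ?exprn_ge0 ?nm_ge0 // ltW.
  - exact: MP.
  rewrite ler_wpM2l ?invr_ge0 ?exprn_ge0 ?(ltW rho0) //.
  by rewrite lef_pV2 ?posrE //; lra.
have n0 := nm_ge0 w.
have {}B : nm (cint (fun t => f (rho%:C * e1 t) *
    (((rho%:C * e1 t) ^+ 2)^-1 * (rho%:C * e1 t - w)^-1))) <= c.
  by apply: le_trans B _; rewrite /c; lra.
rewrite expr2 -mulrA mulrCA mulrC ler_wpM2r //.
apply: le_trans (ler_wpM2l n0 B) _; lra.
Qed.

(** Cauchy's formula for g on a circle of radius rho between |w| and r bounds |f w| by (|w| / rho)^n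
    times a constant independent of n. *)
Lemma flat_zero f (r : R) : 0 < r ->
  (forall n : nat, exists2 g : C -> C, (forall z, nm z < r -> chol g z) &
    forall z, nm z < r -> f z = z ^+ n * g z) ->
  forall w, nm w < r -> f w = 0.
Proof.
move=> r0 H w wr; pose rho := (nm w + r) / 2; have w0 := nm_ge0 w.
have rho0 : 0 < rho by rewrite /rho; lra.
have rhor : rho < r by rewrite /rho; lra.
have wrho : nm w < rho by rewrite /rho; lra.
have nv t : nm (rho%:C * e1 t) = rho by rewrite nmM nm_e1 mulr1 nm_real gtr0_norm.
have hf z : nm z < r -> chol f z.
  have [g hg fg] := H 0%N => zr; have [d gd] := hg z zr; exists d.
  apply: (@cder_near _ g f z d (r - nm z)) => //; first by lra.
  move=> u h; rewrite fg ?mul1r //.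
  by have := nmD (u - z) z; rewrite subrK; lra.
have pf t : pcont (fun t => f (rho%:C * e1 t)) t.
  by apply: pcont_circle; apply: chol_cont; apply: hf; rewrite nv.
have [M M0 MP] := pcont_bounded pf.
pose c := 2 * (M * (rho / (rho - nm w))).
have c0 : 0 <= c by rewrite mulr_ge0 // mulr_ge0 // divr_ge0 //; lra.
have B n : nm (f w) <= (nm w / rho) ^+ n * c.
  have [g hg fg] := H n; rewrite fg // nmM nmX expr_div_n -mulrA.
  rewrite ler_wpM2l ?exprn_ge0 //.
  have rr : nm w < rho < r by rewrite wrho.
  rewrite -(cauchy_formula rr hg).
  have -> : (rho ^+ n)^-1 * c = 2 * (M / rho ^+ n * (rho / (rho - nm w))) by rewrite /c; ring.
  have zw t : rho%:C * e1 t - w != 0.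
    rewrite subr_eq0; apply/eqP => h; have := nv t; rewrite h => h2; rewrite h2 ltxx in wrho.
    by [].
  apply: cint_le => [s|t t01].
    apply: (@pcont_circle (fun z => g z * (z / (z - w)))); apply: chol_cont.
    apply: cholM; first by apply: hg; rewrite nv.
    by apply: chol_div => //; [exact: chol_id|apply: cholB; [exact: chol_id|exact: chol_cst]].
  rewrite !nmM nmV nm_e1 mulr1 nm_real (gtr0_norm rho0).
  have n1 := nmB_ge (rho%:C * e1 t) w; rewrite nv in n1.
  apply: ler_pM; [exact: nm_ge0|by rewrite divr_ge0 ?nm_ge0 ?(ltW rho0)| |].
    have := MP t t01; rewrite fg ?nv // nmM nmX nv => h.
    by rewrite ler_pdivlMr ?exprn_gt0 // mulrC.
  by rewrite ler_pM2l // lef_pV2 ?posrE //; lra.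
apply: nm_small => e e0.
have q1 : `|nm w / rho| < 1.
  have q0 : 0 <= nm w / rho by apply: divr_ge0 => //; exact: ltW.
  by rewrite ger0_norm // ltr_pdivrMr // mul1r.
have := cvg_geometric c q1 => /cvgrPdist_lt /(_ e e0)[n _ /(_ n (leqnn n))] /=.
rewrite /geometric /= sub0r normrN => h; apply: le_lt_trans (B n) _.
by rewrite mulrC; apply: le_lt_trans h; exact: ler_norm.
Qed.

Lemma chol_shift f z z0 : chol f (z + z0) -> chol (fun w => f (w + z0)) z.
Proof.
move=> hf; apply: (@chol_comp _ (fun w => w + z0) f) => //.
by apply: cholD; [exact: chol_id|exact: chol_cst].
Qed.

(** A whole family is divided by one common power, so that the coordinates of a stem function, or
    the two coefficients of a linear relation, do not all vanish at z0. If no such power existed,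
    every member would be flat at z0, hence zero. *)
Lemma order_family (I : Type) (F : I -> C -> C) (z0 : C) (r : R) : 0 < r ->
  (forall i z, nm (z - z0) < r -> chol (F i) z) ->
  (forall i z, nm (z - z0) < r -> F i z = 0) \/
  exists n (G : I -> C -> C), [/\ forall i z, nm (z - z0) < r -> chol (G i) z,
    forall i z, nm (z - z0) < r -> F i z = (z - z0) ^+ n * G i z &
    exists i, G i z0 != 0].
Proof.
move=> r0 hF.
have [Hn|Hn] := pselect (exists n (G : I -> C -> C), [/\ forall i z, nm (z - z0) < r -> chol (G i) z,
    forall i z, nm (z - z0) < r -> F i z = (z - z0) ^+ n * G i z &
    exists i, G i z0 != 0]); [by right|left].
have D n : exists2 G : I -> C -> C, (forall i z, nm (z - z0) < r -> chol (G i) z) &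
    forall i z, nm (z - z0) < r -> F i z = (z - z0) ^+ n * G i z.
  elim: n => [|n [G hG FG]].
    by exists F => // i z zr; rewrite mul1r.
  have G0 i : G i z0 = 0.
    by apply/eqP; apply: contrapT => /negP G0; apply: Hn; exists n, G; split=> //; exists i.
  have dv i : exists g : C -> C, (forall z, nm z < r -> chol g z) /\
      forall z, nm z < r -> G i (z + z0) = z * g z.
    have [||g hg gE] := @division_at0 (fun z => G i (z + z0)) r r0; last by exists g.
      by move=> z zr; apply: chol_shift; apply: hG; rewrite addrK.
    by rewrite add0r.
  pose g i := projT1 (cid (dv i)).
  exists (fun i z => g i (z - z0)) => i z zr; rewrite /g; case: cid => h [hh hE] /=.
    by apply: chol_shift; apply: hh.
  by rewrite FG // exprSr -mulrA -hE // subrK.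
move=> i w wr.
have := @flat_zero (fun z => F i (z + z0)) r r0 _ (w - z0) wr.
rewrite subrK; apply => n; have [G hG FG] := D n.
exists (fun z => G i (z + z0)) => z zr.
  by apply: chol_shift; apply: hG; rewrite addrK.
by rewrite FG addrK.
Qed.

(** The function w^2 f (w + z0) has derivative 0 at 0 by continuity alone, so it is holomorphic on
    the whole disc; dividing twice by w gives back f together with its value at z0. *)
Lemma removable f (z0 : C) (r : R) : 0 < r -> ccont f z0 ->
  (forall z, nm (z - z0) < r -> z != z0 -> chol f z) -> chol f z0.
Proof.
move=> r0 fc hf.
pose G w := w * (w * f (w + z0)).
have hf' w : nm w < r -> w != 0 -> chol (fun w => f (w + z0)) w.
  move=> wr w0; apply: chol_shift; apply: hf; first by rewrite addrK.
  by rewrite -subr_eq0 addrK.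
have c0 : ccont (fun w => f (w + z0)) 0.
  apply: (@ccont_comp _ (fun w => w + z0) f); last by rewrite add0r.
  by apply: ccontD; [exact: ccont_id|exact: ccont_cst].
have G1 : cder G 0 0.
  have c1 : ccont (fun w => w * f (w + z0)) 0 by apply: ccontM => //; exact: ccont_id.
  move=> e /c1[s s0 sP]; exists s => // w /sP.
  rewrite /G !mul0r !subr0 => h.
  by rewrite nmM mulrC ler_wpM2r ?nm_ge0 // ltW.
have hG w : nm w < r -> chol G w.
  move=> wr; have [->|w0] := eqVneq w 0; first by exists 0.
  by do 2 (apply: cholM; first exact: chol_id); exact: hf'.
have [g hg gE] := division_at0 r0 hG (mul0r _).
have gE' w : nm w < r -> w != 0 -> g w = w * f (w + z0).
  by move=> wr w0; apply: (mulfI w0); rewrite -gE.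
have g0 : g 0 = 0.
  have gc : ccont g 0 by apply: chol_cont; apply: hg; rewrite nm0.
  have c1 : ccont (fun w => w * f (w + z0)) 0 by apply: ccontM => //; exact: ccont_id.
  apply: nm_small => e e0; have e2 : 0 < e / 2 by lra.
  have [s s0 sP] := gc _ e2; have [t t0 tP] := c1 _ e2.
  pose m := Num.min r (Num.min s t) / 2.
  have m0 : 0 < m by rewrite divr_gt0 // !lt_min r0 s0 t0.
  have [m1 m2 m3] : [/\ m < r, m < s & m < t].
    have : m < Num.min r (Num.min s t) by rewrite ltr_pdivrMr // mulr_natr mulr2n ltrDl !lt_min r0 s0.
    by rewrite !lt_min => /and3P[].
  have nmm : nm m%:C = m by rewrite nm_real gtr0_norm.
  have mm0 : m%:C != 0 by rewrite -nm_gt0 nmm.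
  have := sP m%:C; have := tP m%:C; rewrite !subr0 nmm mul0r subr0 -gE' ?nmm //.
  move=> /(_ m3) h1 /(_ m2) h2.
  have := nmD (g m%:C) (- (g m%:C - g 0)); rewrite opprB addrC subrK nmB; lra.
have [k hk kE] := division_at0 r0 hg g0.
have kE' w : nm w < r -> w != 0 -> k w = f (w + z0).
  by move=> wr w0; apply: (mulfI w0); rewrite -gE' // kE.
have k0 : k 0 = f z0.
  have kc : ccont k 0 by apply: chol_cont; apply: hk; rewrite nm0.
  apply/eqP; rewrite -subr_eq0; apply/eqP/nm_small => e e0; have e2 : 0 < e / 2 by lra.
  have [s s0 sP] := kc _ e2; have [t t0 tP] := c0 _ e2.
  pose m := Num.min r (Num.min s t) / 2.
  have m0 : 0 < m by rewrite divr_gt0 // !lt_min r0 s0 t0.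
  have [m1 m2 m3] : [/\ m < r, m < s & m < t].
    have : m < Num.min r (Num.min s t) by rewrite ltr_pdivrMr // mulr_natr mulr2n ltrDl !lt_min r0 s0.
    by rewrite !lt_min => /and3P[].
  have nmm : nm m%:C = m by rewrite nm_real gtr0_norm.
  have mm0 : m%:C != 0 by rewrite -nm_gt0 nmm.
  have := sP m%:C; have := tP m%:C; rewrite !subr0 nmm add0r -kE' ?nmm //.
  move=> /(_ m3) h1 /(_ m2) h2.
  have := nmD (k m%:C - f z0) (- (k m%:C - k 0)); rewrite nmN.
  have -> : k m%:C - f z0 - (k m%:C - k 0) = k 0 - f z0 by ring.
  lra.
have : chol (fun w => k (w - z0)) z0.
  by apply: chol_shift; rewrite subrr; apply: hk; rewrite nm0.
apply: (chol_near r0) => w wr; have [->|w0] := eqVneq w z0; first by rewrite subrr k0.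
by rewrite kE' ?subrK // subr_eq0.
Qed.

End Cauchy.

(** * Monodromy *)

Section Monodromy.
Variable R : realType.
Local Notation C := R[i].
Local Notation nm := (@Normc.normc R).
Variables (Y : zmodType) (n : Y -> R).
Hypothesis n0 : n 0 = 0.
Hypothesis nN : forall y, n (- y) = n y.
Hypothesis nD : forall y y', n (y + y') <= n y + n y'.
Implicit Types (c : R -> C) (u v : R -> Y) (t : R).

Lemma itv_induct (P : R -> R -> Prop) (a b : R) : a < b ->
  (forall s d, 0 < d -> P s (d / 2) -> P (s + d / 2) (d / 2) -> P s d) ->
  (forall x, a <= x <= b -> exists2 eta : R, 0 < eta &
     forall s d, 0 < d < eta -> s <= x <= s + d -> a <= s -> s + d <= b -> P s d) ->
  P a (b - a).
Proof.
move=> ab HS HB; have l0 : 0 < b - a by rewrite subr_gt0.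
suff : P (a + 0 * (b - a)) (1 * (b - a)) by rewrite mul0r addr0 mul1r.
apply: (@unit_induct R (fun s d => P (a + s * (b - a)) (d * (b - a)))).
  move=> s d d0 h1 h2; apply: HS; first by rewrite mulr_gt0.
    by rewrite mulrAC.
  by move: h2; rewrite mulrDl addrA mulrAC.
move=> x /andP[x0 x1].
have xab : a <= a + x * (b - a) <= b by apply/andP; split; nra.
have [eta eta0 etaP] := HB _ xab.
exists (eta / (b - a)); first by rewrite divr_gt0.
move=> s d /andP[d0]; rewrite ltr_pdivlMr // => dE /andP[s1 s2] s0 sd.
apply: etaP; first by rewrite mulr_gt0.
- by apply/andP; split; nra.
- by nra.
- by nra.
Qed.

Definition ycont u t := forall e : R, 0 < e -> exists2 r : R, 0 < r &
  forall s, `|s - t| < r -> n (u s - u t) < e.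

Definition scont (s : C -> Y) (z : C) := forall e : R, 0 < e -> exists2 r : R, 0 < r &
  forall w, nm (w - z) < r -> n (s w - s z) < e.

Lemma nB y y' : n (y - y') = n (y' - y).
Proof. by rewrite -nN opprB. Qed.

Lemma n_tri (a b c : Y) : n (a - b) <= n (a - c) + n (b - c).
Proof.
have -> : a - b = (a - c) - (b - c) by rewrite opprB addrA subrK.
by apply: le_trans (nD _ _) _; rewrite nN.
Qed.

Lemma ycontD u v t : ycont u t -> ycont v t -> ycont (fun s => u s + v s) t.
Proof.
move=> fc gc e e0; have e2 : 0 < e / 2 by lra.
have [r r0 fr] := fc _ e2; have [s s0 gs] := gc _ e2.
exists (Num.min r s); first by rewrite lt_min r0.
move=> w; rewrite lt_min => /andP[/fr h1 /gs h2].
have := nD (u w - u t) (v w - v t); rewrite addrACA -opprD; lra.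
Qed.

Lemma ycont_cst y t : ycont (fun=> y) t.
Proof. by move=> e e0; exists 1 => // s _; rewrite subrr n0. Qed.

Definition rcont (f : R -> R) t := forall e : R, 0 < e -> exists2 r : R, 0 < r &
  forall s, `|s - t| < r -> `|f s - f t| < e.

Lemma lip_rcont (f : R -> R) (K : R) t : 0 < K ->
  (forall s s', `|f s - f s'| <= K * `|s - s'|) -> rcont f t.
Proof.
move=> K0 fK e e0; exists (e / K); first by rewrite divr_gt0.
move=> s; rewrite ltr_pdivlMr // => h; apply: le_lt_trans (fK _ _) _.
by rewrite mulrC.
Qed.

Lemma ycont_comp u (f : R -> R) t : rcont f t -> ycont u (f t) -> ycont (fun s => u (f s)) t.
Proof. by move=> fc uc e /uc[r /fc[s s0 sP] rP]; exists s => // w /sP /rP. Qed.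

Lemma pcont_rcomp c (f : R -> R) t : rcont f t -> pcont c (f t) -> pcont (fun s => c (f s)) t.
Proof. by move=> fc uc e /uc[r /fc[s s0 sP] rP]; exists s => // w /sP /rP. Qed.

Lemma scont_comp (s : C -> Y) c t : pcont c t -> scont s (c t) -> ycont (fun x => s (c x)) t.
Proof. by move=> fc uc e /uc[r /fc[d d0 dP] rP]; exists d => // w /dP /rP. Qed.

(** Paths and lifts on an interval are extended to the line by constants, so that continuity can be
    demanded at every real number and pieces can be glued by addition. *)
Definition clamp (a b t : R) : R := Num.max a (Num.min b t).

Lemma clamp_in a b t : a <= b -> a <= clamp a b t <= b.
Proof. by move=> ab; rewrite /clamp le_max lexx ge_max ab ge_min lexx. Qed.

Lemma clampE a b t : a <= t <= b -> clamp a b t = t.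
Proof. by move=> /andP[h1 h2]; rewrite /clamp (min_idPr h2) (max_idPr h1). Qed.

Lemma clamp_lo a b t : a <= b -> t <= a -> clamp a b t = a.
Proof. by move=> ab h; rewrite /clamp (min_idPr (le_trans h ab)) (max_idPl h). Qed.

Lemma clamp_hi a b t : a <= b -> b <= t -> clamp a b t = b.
Proof. by move=> ab h; rewrite /clamp (min_idPl h) (max_idPr ab). Qed.

Lemma clamp_lip a b s t : a <= b -> `|clamp a b s - clamp a b t| <= `|s - t|.
Proof.
move=> ab; have := ler_norm (s - t); have := ler_norm (- (s - t)); rewrite normrN ler_norml.
have [h1|h1] := leP s a; have [h2|h2] := leP t a; rewrite ?(clamp_lo ab h1) ?(clamp_lo ab h2);
  try (by move=> *; apply/andP; split; lra).
- have [h3|h3] := leP b t; first by rewrite (clamp_hi ab h3) => *; apply/andP; split; lra.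
  by rewrite (@clampE a b t) ?(ltW h2) ?(ltW h3) // => *; apply/andP; split; lra.
- have [h3|h3] := leP b s; first by rewrite (clamp_hi ab h3) => *; apply/andP; split; lra.
  by rewrite (@clampE a b s) ?(ltW h1) ?(ltW h3) // => *; apply/andP; split; lra.
have [h3|h3] := leP b s; have [h4|h4] := leP b t; rewrite ?(clamp_hi ab h3) ?(clamp_hi ab h4);
  try rewrite (@clampE a b s) ?(ltW h1) ?(ltW h3) //;
  try rewrite (@clampE a b t) ?(ltW h2) ?(ltW h4) //; by move=> *; apply/andP; split; lra.
Qed.

Lemma clamp_affine_rcont a b (k l : R) t : a <= b -> rcont (fun t => clamp a b (k * t + l)) t.
Proof.
move=> ab; apply: (@lip_rcont _ (`|k| + 1)); first by have := normr_ge0 k; lra.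
move=> s s'; apply: le_trans (clamp_lip _ _ ab) _.
have -> : k * s + l - (k * s' + l) = k * (s - s') by ring.
by rewrite normrM ler_wpM2r // lerDl.
Qed.

Lemma clamp_rcont a b t : a <= b -> rcont (clamp a b) t.
Proof.
by move=> ab; apply: (@lip_rcont _ 1) => // s s'; rewrite mul1r; exact: clamp_lip.
Qed.

(** [Fib z] is the set of admissible values over z and [Good] stands for holomorphy at a point. With
    separation [eps] uniform and, by [Fib_local], a section over a whole disc through every value,
    the fibres behave like those of a covering. *)
Variables (X : set C) (Fib : C -> set Y) (Good : (C -> Y) -> C -> Prop).
Hypothesis Good_cont : forall s z, Good s z -> scont s z.
Hypothesis Good_local : forall s s' z (r : R), 0 < r ->
  (forall w, nm (w - z) < r -> s' w = s w) -> Good s z -> Good s' z.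
Variable eps : R.
Hypothesis eps_gt0 : 0 < eps.
Hypothesis Fib_discrete : forall z y y', X z -> Fib z y -> Fib z y' -> n (y - y') < eps -> y = y'.
Hypothesis Fib_local : forall z, X z -> exists r : R, [/\ 0 < r,
  forall w, nm (w - z) < r -> X w & forall w y, nm (w - z) < r -> Fib w y ->
    exists s : C -> Y, s w = y /\ forall w', nm (w' - z) < r -> Fib w' (s w') /\ Good s w'].

(** Near x neither lift moves by as much as eps / 4. If they agree somewhere there, they stay within
    eps of each other, and the separation of the fibres forces equality. *)
Lemma lift_unique c u v (a b t0 : R) :
  (forall t, a <= t <= b -> X (c t)) ->
  (forall t, a <= t <= b -> [/\ Fib (c t) (u t), Fib (c t) (v t), ycont u t & ycont v t]) ->
  a <= t0 <= b -> u t0 = v t0 -> forall t, a <= t <= b -> u t = v t.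
Proof.
move=> Xc H t0ab E; have ab : a <= b by case/andP: t0ab; exact: le_trans.
have [eab|nab] := eqVneq a b.
  move=> t tab; suff -> : t = t0 by [].
  by rewrite -eab in tab t0ab; apply/le_anti; lra.
have {nab}lab : a < b by rewrite lt_neqAle nab.
suff H1 : forall t t', a <= t <= a + (b - a) -> a <= t' <= a + (b - a) -> u t = v t -> u t' = v t'.
  by move=> t tab; apply: (H1 t0) => //; rewrite addrC subrK.
apply: (@itv_induct (fun s d => forall t t', s <= t <= s + d -> s <= t' <= s + d ->
    u t = v t -> u t' = v t') a b lab).
  move=> s d d0 h1 h2.
  have mid1 : s <= s + d / 2 <= s + d / 2 by lra.
  have mid2 : s + d / 2 <= s + d / 2 <= s + d / 2 + d / 2 by lra.
  have hM t : s <= t <= s + d -> u t = v t <-> u (s + d / 2) = v (s + d / 2).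
    move=> ht; have [h4|h4] := lerP t (s + d / 2).
      have ht' : s <= t <= s + d / 2 by lra.
      by split; exact: h1.
    have ht' : s + d / 2 <= t <= s + d / 2 + d / 2 by lra.
    by split; exact: h2.
  by move=> t t' /hM a1 /hM a2 /a1 /a2.
move=> x xab; have [_ _ uc vc] := H x xab.
have e4 : 0 < eps / 4 by rewrite divr_gt0.
have [r r0 rP] := uc _ e4; have [q q0 qP] := vc _ e4.
exists (Num.min r q); first by rewrite lt_min r0.
move=> s d; rewrite lt_min => /andP[d0 /andP[dr dq]] sx sa sb t t' ht ht' ut.
have [f1 f2 _ _] : [/\ Fib (c t') (u t'), Fib (c t') (v t'), ycont u t' & ycont v t'] by apply: H; lra.
apply: (Fib_discrete _ f1 f2); first by apply: Xc; lra.
have b1 : n (u t' - u x) < eps / 4 by apply: rP; rewrite ltr_norml; lra.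
have b2 : n (v t' - v x) < eps / 4 by apply: qP; rewrite ltr_norml; lra.
have b3 : n (u t - u x) < eps / 4 by apply: rP; rewrite ltr_norml; lra.
have b4 : n (v t - v x) < eps / 4 by apply: qP; rewrite ltr_norml; lra.
have b5 : n (u x - v x) < eps / 2.
  have b6 : n (v x - u t) < eps / 4 by rewrite ut nB.
  by have := n_tri (u x) (v x) (u t); rewrite (nB (u x) (u t)); clear ut; lra.
clear ut.
have := n_tri (u t') (v t') (v x); have := n_tri (u t') (v x) (u x); rewrite (nB (v x)); lra.
Qed.

Lemma path_lift c y : (forall t, pcont c t) -> (forall t, 0 <= t <= 1 -> X (c t)) ->
  Fib (c 0) y -> exists u, [/\ u 0 = y, forall t, ycont u t &
    forall t, 0 <= t <= 1 -> Fib (c t) (u t)].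
Proof.
move=> cc Xc; suff : 0 <= (0 : R) -> 0 + 1 <= (1 : R) -> forall y, Fib (c 0) y ->
    exists u, [/\ u 0 = y, forall t, ycont u t & forall t, 0 <= t <= 0 + 1 -> Fib (c t) (u t)].
  by rewrite !add0r => /(_ (lexx _) (lexx _)) H; exact: H.
apply: (@unit_induct R (fun s d => 0 <= s -> s + d <= 1 -> forall y, Fib (c s) y ->
    exists u, [/\ u s = y, forall t, ycont u t & forall t, s <= t <= s + d -> Fib (c t) (u t)])).
  move=> s d d0 h1 h2 s0 sd z fz.
  have hm1 : s + d / 2 <= 1 by lra.
  have [u [us uc uF]] := h1 s0 hm1 z fz.
  have sm : s <= s + d / 2 <= s + d / 2 by lra.
  have h0 : 0 <= s + d / 2 by lra.
  have h3 : s + d / 2 + d / 2 <= 1 by lra.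
  have [v [vs vc vF]] := h2 h0 h3 _ (uF _ sm).
  set m := s + d / 2 in us uc uF vs vc vF sm h0 h3 *.
  have sm' : s <= m by lra.
  have md : m <= s + d by rewrite /m; lra.
  (* Gluing by addition: up to m the second summand is zero, and from m on the first one stays at
     [u m], which is subtracted. *)
  exists (fun t => u (clamp s m t) + (v (clamp m (s + d) t) + - u m)); split.
  - rewrite (clamp_lo sm' (lexx s)) us (clamp_lo md sm') vs.
    by rewrite subrr addr0.
  - move=> t; apply: ycontD.
      by apply: ycont_comp (uc _); exact: clamp_rcont.
    apply: ycontD; last exact: ycont_cst.
    by apply: ycont_comp (vc _); exact: clamp_rcont.
  - move=> t ts; have [h4|/ltW h4] := lerP t m.
      rewrite (clamp_lo md h4) vs subrr addr0 clampE; last by lra.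
      by apply: uF; lra.
    rewrite (clamp_hi sm' h4) clampE; last by lra.
    have mdE : m + d / 2 = s + d by rewrite /m; field.
    by rewrite addrC subrK; apply: vF; clear vs us; rewrite mdE; lra.
move=> x x01; have [r [r0 rX rF]] := Fib_local (Xc x x01).
have [q q0 qP] := cc x r r0.
exists q => // s d /andP[d0 dq] sx s0 sd _ _ z fz.
have near t : s <= t <= s + d -> nm (c t - c x) < r.
  by move=> ht; apply: qP; rewrite ltr_norml; lra.
have ss : s <= s <= s + d by rewrite lexx lerDl ltW.
have sd' : s <= s + d by lra.
have [sg [sgE sgP]] := rF _ _ (near s ss) fz.
exists (fun t => sg (c (clamp s (s + d) t))); split.
- by rewrite clampE.
- move=> t; apply: (@scont_comp sg (fun t => c (clamp s (s + d) t))).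
    by apply: pcont_rcomp (cc _); exact: clamp_rcont.
  by apply: Good_cont; apply: (sgP _ _).2; apply: near; exact: clamp_in.
- by move=> t ts; rewrite clampE //; apply: (sgP _ _).1; exact: near.
Qed.

(** The end value of a lift depends continuously on the path and on the initial value, because over
    a short interval all nearby lifts follow one and the same local section. With discrete fibres,
    end values become locally constant in a homotopy. *)
Lemma lift_stable c u : (forall t, pcont c t) -> (forall t, 0 <= t <= 1 -> X (c t)) ->
  (forall t, ycont u t) -> (forall t, 0 <= t <= 1 -> Fib (c t) (u t)) ->
  forall eta : R, 0 < eta -> exists de th : R, [/\ 0 < de, 0 < th &
    forall c' u', (forall t, pcont c' t) -> (forall t, 0 <= t <= 1 -> X (c' t)) ->
      (forall t, ycont u' t) -> (forall t, 0 <= t <= 1 -> Fib (c' t) (u' t)) ->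
      (forall t, 0 <= t <= 1 -> nm (c' t - c t) < de) -> n (u' 0 - u 0) < th ->
      n (u' 1 - u 1) < eta].
Proof.
move=> cc Xc uc uF.
suff : 0 <= (0 : R) -> 0 + 1 <= (1 : R) -> forall eta : R, 0 < eta -> exists de th : R, [/\ 0 < de, 0 < th &
    forall c' u', (forall t, pcont c' t) -> (forall t, 0 <= t <= 1 -> X (c' t)) ->
      (forall t, ycont u' t) -> (forall t, 0 <= t <= 1 -> Fib (c' t) (u' t)) ->
      (forall t, 0 <= t <= 1 -> nm (c' t - c t) < de) -> n (u' 0 - u 0) < th ->
      n (u' (0 + 1) - u (0 + 1)) < eta].
  by rewrite !add0r => /(_ (lexx _) (lexx _)).
apply: (@unit_induct R (fun s d => 0 <= s -> s + d <= 1 -> forall eta : R, 0 < eta ->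
    exists de th : R, [/\ 0 < de, 0 < th &
    forall c' u', (forall t, pcont c' t) -> (forall t, 0 <= t <= 1 -> X (c' t)) ->
      (forall t, ycont u' t) -> (forall t, 0 <= t <= 1 -> Fib (c' t) (u' t)) ->
      (forall t, 0 <= t <= 1 -> nm (c' t - c t) < de) -> n (u' s - u s) < th ->
      n (u' (s + d) - u (s + d)) < eta])).
  move=> s d d0 h1 h2 s0 sd eta eta0.
  have hm0 : 0 <= s + d / 2 by lra.
  have hm1 : s + d / 2 <= 1 by lra.
  have hm2 : s + d / 2 + d / 2 <= 1 by lra.
  have [d2 [t2 [d20 t20 P2]]] := h2 hm0 hm2 eta eta0.
  have [d1 [t1 [d10 t10 P1]]] := h1 s0 hm1 t2 t20.
  exists (Num.min d1 d2), t1; split=> //; first by rewrite lt_min d10.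
  move=> c' u' cc' Xc' uc' uF' cd ut.
  have -> : s + d = s + d / 2 + d / 2 by field.
  apply: (P2 c') => // [t /cd|]; first by rewrite lt_min => /andP[].
  by apply: (P1 c') => // t /cd; rewrite lt_min => /andP[].
move=> x x01; have [r [r0 rX rF]] := Fib_local (Xc x x01).
have nx : nm (c x - c x) < r by rewrite subrr nm0.
have [sg [sgE sgP]] := rF _ _ nx (uF x x01).
have sgc : scont sg (c x) by apply: Good_cont; exact: (sgP _ nx).2.
have e8 : 0 < eps / 8 by rewrite divr_gt0.
have [r1 r10 r1P] := sgc _ e8.
have [q q0 qP] := uc x _ e8.
have m0 : 0 < Num.min r r1 / 2 by rewrite divr_gt0 // lt_min r0.
have [p p0 pP] := cc x _ m0.
exists (Num.min p q); first by rewrite lt_min p0.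
move=> s d; rewrite lt_min => /andP[d0 /andP[dp dq]] sx s0 sd _ _ eta eta0.
have near t : s <= t <= s + d -> nm (c t - c x) < Num.min r r1 / 2.
  by move=> ht; apply: pP; rewrite ltr_norml; lra.
have nearu t : s <= t <= s + d -> n (u t - u x) < eps / 8.
  by move=> ht; apply: qP; rewrite ltr_norml; lra.
have half : Num.min r r1 / 2 + Num.min r r1 / 2 = Num.min r r1 by field.
have sin t : s <= t <= s + d -> 0 <= t <= 1 by lra.
have nearc t : s <= t <= s + d -> nm (c t - c x) < r /\ nm (c t - c x) < r1.
  move=> /near h; have : nm (c t - c x) < Num.min r r1 by lra.
  by rewrite lt_min => /andP.
have uE t : s <= t <= s + d -> u t = sg (c t).
  move=> ht; have [a1 a2] := nearc t ht.
  apply: (Fib_discrete (Xc t (sin t ht)) (uF t (sin t ht)) (sgP _ a1).1).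
  have := n_tri (u t) (sg (c t)) (u x); have := nearu t ht.
  by have := r1P _ a2; rewrite sgE; lra.
have sdi : s <= s + d <= s + d by lra.
have ssi : s <= s <= s + d by lra.
have sgc2 : scont sg (c (s + d)) by apply: Good_cont; exact: (sgP _ (nearc _ sdi).1).2.
have [r2 r20 r2P] := sgc2 _ eta0.
exists (Num.min (Num.min r r1 / 2) r2), (eps / 8); split=> //; first by rewrite lt_min m0.
move=> c' u' cc' Xc' uc' uF' cd us.
have nearc' t : s <= t <= s + d -> nm (c' t - c x) < r /\ nm (c' t - c x) < r1.
  move=> ht; have h1 := near t ht; have := cd t (sin t ht); rewrite lt_min => /andP[h2 _].
  have := nmD (c' t - c t) (c t - c x); rewrite addrA subrK => h3.
  have : nm (c' t - c x) < Num.min r r1 by lra.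
  by rewrite lt_min => /andP.
have u's : u' s = sg (c' s).
  have [a1 a2] := nearc' s ssi.
  apply: (Fib_discrete (Xc' s (sin s ssi)) (uF' s (sin s ssi)) (sgP _ a1).1).
  have := r1P _ a2; rewrite sgE.
  have := n_tri (u' s) (sg (c' s)) (u x); have := nearu s ssi.
  have := nD (u' s - u s) (u s - u x); rewrite addrA subrK; lra.
have u'E : u' (s + d) = sg (c' (s + d)).
  apply: (@lift_unique c' u' (fun t => sg (c' t)) s (s + d) s) => //.
    by move=> t /sin; exact: Xc'.
  move=> t ht; have [a1 a2] := nearc' t ht; split.
  - exact: uF' (sin _ ht).
  - exact: (sgP _ a1).1.
  - exact: uc'.
  - by apply: scont_comp => //; apply: Good_cont; exact: (sgP _ a1).2.
rewrite u'E uE //; apply: r2P.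
by have := cd (s + d) (sin _ sdi); rewrite lt_min => /andP[].
Qed.

(** Paths and homotopies are defined for all real parameters, with continuity in epsilon form;
    [simply_conn_embed] derives this from the notion with subspace topologies. *)
Definition simply_conn := 
  (forall a b, X a -> X b -> exists c, [/\ forall t, pcont c t,
     forall t, 0 <= t <= 1 -> X (c t), c 0 = a & c 1 = b]) /\
  (forall c, (forall t, pcont c t) -> (forall t, 0 <= t <= 1 -> X (c t)) -> c 0 = c 1 ->
     exists h : R -> R -> C, [/\
       forall s t (e : R), 0 < e -> exists2 r : R, 0 < r & forall s' t',
         `|s' - s| < r -> `|t' - t| < r -> nm (h s' t' - h s t) < e,
       forall s t, 0 <= s <= 1 -> 0 <= t <= 1 -> X (h s t),
       forall t, 0 <= t <= 1 -> h 0 t = c t,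
       forall t, 0 <= t <= 1 -> h 1 t = c 0 &
       forall s, 0 <= s <= 1 -> h s 0 = c 0 /\ h s 1 = c 0]).

Hypothesis X_sc : simply_conn.

(** All paths of the homotopy end at the same point, so the end values of their lifts from [u 0] lie
    in one discrete fibre and are locally constant in s. At s = 1 the path is constant, and so is
    its lift. *)
Lemma loop_lift c u : (forall t, pcont c t) -> (forall t, 0 <= t <= 1 -> X (c t)) ->
  c 0 = c 1 -> (forall t, ycont u t) -> (forall t, 0 <= t <= 1 -> Fib (c t) (u t)) ->
  u 1 = u 0.
Proof.
move=> cc Xc c01 uc uF; have [h [hc hX h0 h1 hs]] := X_sc.2 c cc Xc c01.
have z01 : 0 <= (0 : R) <= 1 by rewrite lexx ler01.
have o01 : 0 <= (1 : R) <= 1 by rewrite lexx ler01.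
have hcc s t : pcont (h s) t.
  move=> e e0; have [r r0 rP] := hc s t e e0; exists r => // t' ht.
  by apply: rP => //; rewrite subrr normr0.
have F0 s : 0 <= s <= 1 -> Fib (h s 0) (u 0) by move=> /hs[-> _]; exact: uF.
(* Off [[0, 1]] the zero path is only a default. *)
pose L s : R -> Y := if pselect (0 <= s <= 1) is left H then
  projT1 (cid (path_lift (hcc s) (fun t => hX s t H) (F0 s H))) else fun=> 0.
have LP s : 0 <= s <= 1 -> [/\ L s 0 = u 0, forall t, ycont (L s) t &
    forall t, 0 <= t <= 1 -> Fib (h s t) (L s t)].
  by move=> s01; rewrite /L; case: pselect => // H; case: cid => w [].
clearbody L.
have unif s : 0 <= s <= 1 -> forall e : R, 0 < e -> exists2 r : R, 0 < r &
    forall s' t, `|s' - s| < r -> 0 <= t <= 1 -> nm (h s' t - h s t) < e.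
  move=> s01 e e0.
  suff [d d0 dP] : exists2 d : R, 0 < d & forall s' t, `|s' - s| < d ->
      0 <= t <= 0 + 1 -> nm (h s' t - h s t) < e.
    by exists d => // s' t h'; rewrite -[X in _ <= t <= X]add0r; exact: dP.
  apply: (@unit_induct R (fun a d' => exists2 d : R, 0 < d & forall s' t, `|s' - s| < d ->
      a <= t <= a + d' -> nm (h s' t - h s t) < e)).
    move=> a d d0 [p p0 pP] [r r0 rP]; exists (Num.min p r); first by rewrite lt_min p0.
    move=> rho' t; rewrite lt_min => /andP[h1' h2'] h3.
    have [h4|h4] := lerP t (a + d / 2); first by apply: pP => //; lra.
    by apply: rP => //; lra.
  move=> x x01; have e2 : 0 < e / 2 by lra.
  have [r r0 rP] := hc s x _ e2.
  exists r => // a d /andP[d0 dr] ax _ _; exists r => // s' t hs' ht.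
  apply: le_lt_trans (nm_tri _ _ (h s x)) _.
  have tx : `|t - x| < r by rewrite ltr_norml; lra.
  have := rP s' t hs' tx; have := rP s t; rewrite subrr normr0 => /(_ r0 tx); lra.
have loc x : 0 <= x <= 1 -> exists2 r : R, 0 < r & forall s, 0 <= s <= 1 -> `|s - x| < r ->
    L s 1 = L x 1.
  move=> x01; have [Lx0 Lxc LxF] := LP x x01.
  have [de [th [de0 th0 dP]]] := lift_stable (hcc x) (fun t => hX x t x01) Lxc LxF eps_gt0.
  have [r r0 rP] := unif x x01 de de0.
  exists r => // s s01 sx; have [Ls0 Lsc LsF] := LP s s01.
  have h1x : h s 1 = h x 1 by rewrite (hs s s01).2 (hs x x01).2.
  apply: (Fib_discrete (hX s 1 s01 o01) (LsF 1 o01)); first by rewrite h1x; exact: LxF.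
  apply: (dP (h s)) => //; first by move=> t; exact: hX.
    by move=> t t01; exact: rP.
  by rewrite Ls0 Lx0 subrr n0.
have E : L 0 1 = L 1 1.
  rewrite -[X in _ = L X 1]add0r.
  suff : 0 <= (0 : R) -> 0 + 1 <= (1 : R) -> L 0 1 = L (0 + 1) 1 by apply; rewrite ?add0r.
  apply: (@unit_induct R (fun s d => 0 <= s -> s + d <= 1 -> L s 1 = L (s + d) 1)).
    move=> s d d0 h1' h2' s0 sd; rewrite h1' //; last by lra.
    by rewrite h2'; [congr (L _ 1); field|lra|lra].
  move=> x x01; have [r r0 rP] := loc x x01; exists r => // s d /andP[d0 dr] sx s0 sd _ _.
  by rewrite (rP s) ?(rP (s + d)) //; rewrite ?ltr_norml; lra.
have [L00 L0c L0F] := LP 0 z01; have [L10 L1c L1F] := LP 1 o01.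
have -> : u 1 = L 0 1.
  apply: (@lift_unique c u (L 0) 0 1 0) => // t t01; split=> //; first exact: uF.
  by rewrite -h0 //; exact: L0F.
rewrite E -L10; apply: (@lift_unique (h 1) (L 1) (fun=> L 1 0) 0 1 0) => //.
  by move=> t; exact: hX.
move=> t t01; split=> //; [exact: L1F| |exact: ycont_cst].
by rewrite h1 // L10; exact: uF.
Qed.

Variables (x0 : C) (y0 : Y).
Hypothesis x0X : X x0.
Hypothesis y0F : Fib x0 y0.

(** The relation of analytic continuation of y0 along a path. *)
Definition endpoint x y := exists c u, [/\ forall t, pcont c t,
  forall t, 0 <= t <= 1 -> X (c t), c 0 = x0 /\ c 1 = x, forall t, ycont u t &
  (forall t, 0 <= t <= 1 -> Fib (c t) (u t)) /\ u 0 = y0 /\ u 1 = y].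

Lemma endpoint_ex x : X x -> exists y, endpoint x y.
Proof.
move=> Xx; have [c [cc Xc c0 c1]] := X_sc.1 _ _ x0X Xx.
have [|u [u0 uc uF]] := path_lift cc Xc (y := y0); first by rewrite c0.
by exists (u 1), c, u.
Qed.

(** Following the first path and returning along the second gives a loop, whose lift closes up by
    [loop_lift]; its two halves are the first lift and the reversed second one, and they meet over
    x. *)
Lemma endpoint_unique x y y' : endpoint x y -> endpoint x y' -> y = y'.
Proof.
move=> [c1 [u1 [c1c X1 [c10 c11] u1c [F1 [u10 u11]]]]].
move=> [c2 [u2 [c2c X2 [c20 c21] u2c [F2 [u20 u21]]]]].
have l01 : (0 : R) <= 1 by exact: ler01.
(* Both paths are at x when t = 1/2, so subtracting x once glues them by addition. *)
pose c t := c1 (clamp 0 1 (2 * t + 0)) + (c2 (clamp 0 1 (- 2 * t + 2)) + - 1 * x).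
have cE1 t : 0 <= t <= 2^-1 -> c t = c1 (2 * t).
  move=> ht; rewrite /c (@clamp_hi _ _ (- 2 * t + 2)) //; last by lra.
  by rewrite c21 mulN1r subrr !addr0 clampE //; lra.
have cE2 t : 2^-1 <= t <= 1 -> c t = c2 (2 - 2 * t).
  move=> ht; rewrite /c (@clamp_hi _ _ (2 * t + 0)) //; last by lra.
  rewrite c11 mulN1r addrCA subrr addr0 clampE; last by lra.
  by rewrite mulNr addrC.
have cc t : pcont c t.
  apply: pcontD; first by apply: pcont_rcomp (c1c _); exact: clamp_affine_rcont.
  apply: pcontD; first by apply: pcont_rcomp (c2c _); exact: clamp_affine_rcont.
  by move=> e e0; exists 1 => // s _; rewrite subrr nm0.
have Xc t : 0 <= t <= 1 -> X (c t).
  move=> t01; have [h|/ltW h] := lerP t 2^-1; first by rewrite cE1; [apply: X1|]; lra.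
  by rewrite cE2; [apply: X2|]; lra.
have c0 : c 0 = x0 by rewrite cE1 ?mulr0 ?c10 //; lra.
have c1' : c 1 = x0 by rewrite cE2 ?mulr1 ?subrr ?c20 //; lra.
have [|U [U0 Uc UF]] := path_lift cc Xc (y := y0); first by rewrite c0.
have U1 : U 1 = U 0 by apply: loop_lift cc Xc _ Uc UF; rewrite c0.
have r1 t : rcont (fun t => 2 * t) t.
  by apply: (@lip_rcont _ 2) => // s s'; rewrite -mulrBr normrM ger0_norm.
have r2 t : rcont (fun t => 2 - 2 * t) t.
  apply: (@lip_rcont _ 2) => // s s'.
  have -> : 2 - 2 * s - (2 - 2 * s') = 2 * (s' - s) by ring.
  by rewrite normrM ger0_norm // distrC.
have A1 : U 2^-1 = u1 1.
  have -> : u1 1 = u1 (2 * 2^-1) by congr u1; field.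
  apply: (@lift_unique c U (fun t => u1 (2 * t)) 0 2^-1 0).
  - by move=> t ht; apply: Xc; lra.
  - move=> t ht; split=> //; [by apply: UF; lra| |].
      by rewrite cE1 //; apply: F1; lra.
    exact: ycont_comp.
  - by rewrite lexx invr_ge0; lra.
  - by rewrite mulr0 u10.
  - by lra.
have A2 : U 2^-1 = u2 1.
  have -> : u2 1 = u2 (2 - 2 * 2^-1) by congr u2; field.
  apply: (@lift_unique c U (fun t => u2 (2 - 2 * t)) 2^-1 1 1).
  - by move=> t ht; apply: Xc; lra.
  - move=> t ht; split=> //; [by apply: UF; lra| |].
      by rewrite cE2 //; apply: F2; lra.
    by apply: (@ycont_comp u2 (fun t => 2 - 2 * t)).
  - by lra.
  - by rewrite mulr1 subrr u20 U1.
  - by lra.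
by rewrite -u11 -u21 -A1.
Qed.

(** The path to x is prolonged by the segment from x to w, over which the local section through y
    provides the lift. *)
Lemma endpoint_local x y : endpoint x y -> X x -> exists2 r : R, 0 < r &
  exists s : C -> Y, [/\ s x = y, forall w, nm (w - x) < r -> endpoint w (s w) &
    forall w, nm (w - x) < r -> Good s w].
Proof.
move=> [c [u [cc Xc [c0 c1] uc [uF [u0 u1]]]]] Xx.
have l01 : (0 : R) <= 1 by exact: ler01.
have o01 : 0 <= (1 : R) <= 1 by rewrite lexx ler01.
have [r [r0 rX rF]] := Fib_local Xx.
have xx : nm (x - x) < r by rewrite subrr nm0.
have Fy : Fib x y by rewrite -u1 -c1; exact: uF.
have [s [sE sP]] := rF x y xx Fy.
exists r => //; exists s; split=> // w wr; last exact: (sP w wr).2.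
pose c' t := c (clamp 0 1 (2 * t + 0)) + (w - x) * (clamp 0 1 (2 * t + - 1))%:C.
pose g t := x + (w - x) * (clamp 0 1 (2 * t + - 1))%:C.
have gr t : nm (g t - x) < r.
  rewrite /g addrC addKr nmM nm_real.
  have /andP[h0 h1] := @clamp_in 0 1 (2 * t + - 1) l01.
  by rewrite ger0_norm //; apply: le_lt_trans wr; rewrite ler_piMr ?nm_ge0.
have cl0 t : pcont (fun t => (w - x) * (clamp 0 1 (2 * t + - 1))%:C) t.
  apply: pcontZ => e e0.
  have [d d0 dP] := @clamp_affine_rcont 0 1 2 (-1) t l01 e e0.
  by exists d => // t' /dP; rewrite nm_realB.
have gc t : pcont g t.
  by apply: pcontD => // e e0; exists 1 => // s' _; rewrite subrr nm0.
pose u' t := u (clamp 0 1 (2 * t + 0)) + (s (g t) + - y).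
have half1 t : 0 <= t <= 2^-1 -> c' t = c (2 * t) /\ u' t = u (2 * t).
  move=> ht; rewrite /c' /u' /g (@clamp_lo _ _ (2 * t + - 1)) //; last by lra.
  rewrite rmorph0 mulr0 !addr0 sE subrr addr0 clampE //; lra.
have half2 t : 2^-1 <= t <= 1 -> c' t = g t /\ u' t = s (g t).
  move=> ht; rewrite /c' /u' (@clamp_hi _ _ (2 * t + 0)) //; last by lra.
  by split; [rewrite c1|rewrite u1 addrC subrK].
have g1 : g 1 = w.
  rewrite /g clamp_hi //; last by lra.
  by rewrite rmorph1 mulr1 addrC subrK.
exists c', u'; split.
- move=> t; apply: pcontD => //.
  by apply: pcont_rcomp (cc _); exact: clamp_affine_rcont.
- move=> t t01; have [h|/ltW h] := lerP t 2^-1.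
    by rewrite (half1 t _).1; [apply: Xc|]; lra.
  by rewrite (half2 t _).1; [exact: rX|lra].
- split; first by rewrite (half1 0 _).1 ?mulr0 //; lra.
  by rewrite (half2 1 _).1 ?g1 //; lra.
- move=> t; apply: ycontD.
    by apply: ycont_comp (uc _); exact: clamp_affine_rcont.
  apply: ycontD; last exact: ycont_cst.
  by apply: scont_comp => //; apply: Good_cont; exact: (sP _ (gr t)).2.
- split; [|split].
  + move=> t t01; have [h|/ltW h] := lerP t 2^-1.
      have ht : 0 <= t <= 2^-1 by rewrite h andbT; case/andP: t01.
      by have [-> ->] := half1 t ht; apply: uF; lra.
    have ht : 2^-1 <= t <= 1 by rewrite h; case/andP: t01.
    by have [-> ->] := half2 t ht; exact: (sP _ (gr t)).1.
  + by rewrite (half1 0 _).2 ?mulr0 //; lra.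
  + by rewrite (half2 1 _).2 ?g1 //; lra.
Qed.

(** The end value over x does not depend on the path, so an arbitrary choice of paths defines a
    section; near x it agrees with the local section of [endpoint_local]. *)
Theorem monodromy : exists s : C -> Y, s x0 = y0 /\ forall x, X x -> Fib x (s x) /\ Good s x.
Proof.
pose s x : Y := if pselect (X x) is left Xx then projT1 (cid (endpoint_ex Xx)) else 0.
have sP x : X x -> endpoint x (s x).
  by move=> Xx; rewrite /s; case: pselect => // H; case: cid.
have z01 : 0 <= (0 : R) <= 1 by rewrite lexx ler01.
exists s; split.
  apply: (endpoint_unique (sP _ x0X)).
  exists (fun=> x0), (fun=> y0); split=> //.
    by move=> t e e0; exists 1 => // t' _; rewrite subrr nm0.
  by move=> t; exact: ycont_cst.
move=> x Xx; have [r r0 [sg [sgE sgP sgG]]] := endpoint_local (sP x Xx) Xx.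
split.
  have [c [u [_ _ [_ c1] _ [uF [_ u1]]]]] := sP x Xx.
  by rewrite -u1 -c1; apply: uF; rewrite lexx ler01.
have xr : nm (x - x) < r by rewrite subrr nm0.
have [q [q0 qX _]] := Fib_local Xx.
apply: (@Good_local sg s x (Num.min r q)) (sgG x xr); first by rewrite lt_min r0.
by move=> w; rewrite lt_min => /andP[wr /qX Xw]; apply: (endpoint_unique (sP w Xw)); exact: sgP.
Qed.

Lemma section_unique (s s' : C -> Y) :
  (forall x, X x -> [/\ Fib x (s x), Fib x (s' x), scont s x & scont s' x]) ->
  s x0 = s' x0 -> forall x, X x -> s x = s' x.
Proof.
move=> H E x Xx; have [c [cc Xc c0 c1]] := X_sc.1 _ _ x0X Xx.
have z01 : 0 <= (0 : R) <= 1 by rewrite lexx ler01.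
have o01 : 0 <= (1 : R) <= 1 by rewrite lexx ler01.
rewrite -c1; apply: (@lift_unique c (fun t => s (c t)) (fun t => s' (c t)) 0 1 0) => //.
  move=> t t01; have [h1 h2 h3 h4] := H _ (Xc t t01).
  by split=> //; exact: scont_comp.
by rewrite c0.
Qed.

End Monodromy.

(** * Stem domains *)

Section EpsilonDelta.
Variable R : realType.
Local Notation C := R[i].
Local Notation H := (quat R).
Local Notation HC := (quat R[i]).
Local Notation nm := (@Normc.normc R).
Implicit Types (z w : C) (F : C -> HC).

Lemma cnbhsP z (A : set C) :
  nbhs z A <-> exists2 r : R, 0 < r & forall w, nm (w - z) < r -> A w.
Proof.
split=> [/nbhs_ballP[e e0 eA]|[r r0 rA]].
  (* In the partial order of R[i], a positive radius has imaginary part 0. *)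
  have : (0 : C) < e by exact: e0.
  rewrite ltcE => /andP[/eqP eI eR]; exists (complex.Re e) => // w h; apply: eA.
  suff : `|z - w| < e by [].
  have -> : e = (complex.Re e)%:C by case: e eI {e0 eR h} => a b /= ->.
  by rewrite ltcR -/(nm _) nmB.
apply/nbhs_ballP; exists r%:C; first by rewrite /= ltcR.
move=> w /= h; apply: rA; rewrite nmB -ltcR; exact: h.
Qed.

Lemma qnbhsP (q : H) (A : set H) :
  nbhs q A <-> exists2 r : R, 0 < r & forall p : H, (forall l, `|p 0 l - q 0 l| < r) -> A p.
Proof.
split=> [/nbhs_ballP[e e0 eA]|[r r0 rA]].
  exists e => // p h; apply: eA; split=> // i l.
  by rewrite (ord1 i) /ball /= distrC; exact: h.
apply/nbhs_ballP; exists r => // p [_ h]; apply: rA => l.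
by rewrite distrC; exact: h.
Qed.

Lemma dquot_lim (f : C -> C) z d :
  cder f z d <-> (fun h : C => h^-1 *: (f (h *: 1 + z) - f z)) @ 0^' --> d.
Proof.
split=> [fd A /cnbhsP[r r0 rA]|L e e0].
  have r2 : 0 < r / 2 by lra.
  have [s s0 sP] := fd _ r2.
  apply/cnbhsP; exists s => // h; rewrite subr0 => hs h0.
  apply: rA; apply: le_lt_trans (_ : r / 2 < r); last by lra.
  have := sP (h + z); rewrite addrK => /(_ hs).
  rewrite -[h *: 1]/(h * 1) mulr1 -[_ *: _]/(h^-1 * _) => h1.
  have -> : h^-1 * (f (h + z) - f z) - d = h^-1 * (f (h + z) - f z - d * h).
    by rewrite [RHS]mulrBr (mulrC d) mulKf.
  by rewrite nmM nmV mulrC ler_pdivrMr ?nm_gt0.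
have /cnbhsP[s s0 sP] : nbhs (0 : C) (fun h => h != 0 -> nm (h^-1 * (f (h * 1 + z) - f z) - d) < e).
  by apply: (L (fun u => nm (u - d) < e)); apply/cnbhsP; exists e.
exists s => // w ws.
have [->|wz] := eqVneq w z; first by rewrite !subrr mulr0 subr0 nm0 mulr0.
have wz0 : w - z != 0 by rewrite subr_eq0.
have := sP (w - z); rewrite subr0 mulr1 subrK => /(_ ws wz0) /ltW h1.
have -> : f w - f z - d * (w - z) = (w - z) * ((w - z)^-1 * (f w - f z) - d).
  by rewrite [RHS]mulrBr mulVKf // [d * _]mulrC.
by rewrite nmM mulrC ler_wpM2r ?nm_ge0.
Qed.

(** The bridge from derivatives of quaternion-valued functions to four scalar ones; neighbourhoods
    of a row vector are generated by products of neighbourhoods of its entries. *)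
Lemma derivable_quatP F z :
  derivable F z 1 <-> forall l, chol (fun t => F t 0 l) z.
Proof.
split=> [/cvg_ex[/= d cd] l|hF].
  exists (d 0 l); apply/dquot_lim => A Al.
  have Al' : nbhs d [set M : HC | A (M 0 l)] by exact: (@coord_continuous C 1 4 0 l d A Al).
  have L : \forall h \near (0 : C)^', A ((h^-1 *: (F (h *: 1 + z) - F z)) 0 l) := cd _ Al'.
  by apply: (filterS _ L) => h; rewrite !mxE.
pose d : HC := \row_l projT1 (cid (hF l)).
have dP l : cder (fun t => F t 0 l) z (d 0 l) by rewrite mxE; case: cid.
apply/cvg_ex; exists d => A [P PA AP].
have P' l : nbhs (d 0 l) (P 0 l) by exact: PA.
have H l : \forall h \near (0 : C)^', P 0 l (h^-1 *: (F (h *: 1 + z) 0 l - F z 0 l)) :=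
  (dquot_lim (fun t => F t 0 l) z (d 0 l)).1 (dP l) _ (P' l).
have H4 := filterI (filterI (H 0) (H 1)) (filterI (H 2) (H 3)).
suff : \forall h \near (0 : C)^', A (h^-1 *: (F (h *: 1 + z) - F z)) by [].
apply: (filterS _ (H4 _ _ _)) => h [[h0 h1] [h2 h3]]; apply: AP => i l; rewrite (ord1 i) !mxE.
case: l => [[|[|[|[|//]]]] il].
- by rewrite (_ : Ordinal il = 0) //; exact: val_inj.
- by rewrite (_ : Ordinal il = 1) //; exact: val_inj.
- by rewrite (_ : Ordinal il = 2) //; exact: val_inj.
- by rewrite (_ : Ordinal il = 3) //; exact: val_inj.
Qed.

(** For an imaginary unit J, the ring isomorphism from the complex numbers onto the slice C_J. *)
Definition embed (J : H) z : H := (complex.Re z)%:A + complex.Im z *: J.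

Lemma embed_coord J z l : imunit J ->
  embed J z 0 l = complex.Re z * (l == 0)%:R + complex.Im z * J 0 l.
Proof.
by move=> _; rewrite !mxE; case: l => [[|[|[|[|//]]]] il].
Qed.

Lemma imunit_coord (J : H) l : imunit J -> `|J 0 l| <= 1.
Proof.
move=> /imunitP[J0 J1].
have := sqr_ge0 (J 0 1); have := sqr_ge0 (J 0 2); have := sqr_ge0 (J 0 3) => h3 h2 h1.
suff : J 0 l ^+ 2 <= 1 by rewrite -real_normK ?num_real // expr_le1.
case: l => [[|[|[|[|//]]]] il].
- by rewrite (_ : Ordinal il = 0) ?J0 ?expr0n ?ler01 //; exact: val_inj.
- by rewrite (_ : Ordinal il = 1); [lra|exact: val_inj].
- by rewrite (_ : Ordinal il = 2); [lra|exact: val_inj].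
- by rewrite (_ : Ordinal il = 3); [lra|exact: val_inj].
Qed.

Lemma embed_lip J z w l : imunit J -> `|embed J w 0 l - embed J z 0 l| <= 2 * nm (w - z).
Proof.
move=> uJ; rewrite !embed_coord //.
have -> : complex.Re w * (l == 0)%:R + complex.Im w * J 0 l -
  (complex.Re z * (l == 0)%:R + complex.Im z * J 0 l) =
  complex.Re (w - z) * (l == 0)%:R + complex.Im (w - z) * J 0 l.
  by rewrite cReD cImD cReN cImN; ring.
apply: le_trans (ler_normD _ _) _; rewrite !normrM.
have h1 := Re_le_nm (w - z); have h2 := Im_le_nm (w - z); have h3 := imunit_coord l uJ.
have h4 : `|(l == 0)%:R : R| <= 1 by case: (l == 0); rewrite ?normr1 ?normr0 ?ler01.
have h5 : `|complex.Re (w - z)| * `|(l == 0)%:R : R| <= nm (w - z) * 1 by apply: ler_pM.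
have h6 : `|complex.Im (w - z)| * `|J 0 l| <= nm (w - z) * 1 by apply: ler_pM.
lra.
Qed.

Lemma embed_nbhs J z (A : set H) : imunit J -> nbhs (embed J z) A ->
  exists2 r : R, 0 < r & forall w, nm (w - z) < r -> A (embed J w).
Proof.
move=> uJ /qnbhsP[r r0 rA]; exists (r / 2); first by lra.
move=> w h; apply: rA => l; apply: le_lt_trans (embed_lip _ _ _ uJ) _; lra.
Qed.

Definition unembed (J q : H) : C :=
  q 0 0 +i* (q 0 1 * J 0 1 + q 0 2 * J 0 2 + q 0 3 * J 0 3).

Lemma embedK J : imunit J -> cancel (embed J) (unembed J).
Proof.
move=> uJ z; have [J0 J1] := imunitP uJ.
rewrite /unembed !embed_coord //= J0.
apply/eqP; rewrite eq_complex /= !mulr1 !mulr0 addr0 eqxx /=; apply/eqP.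
by rewrite !add0r -[RHS]mulr1 -J1; ring.
Qed.

Lemma unembedK J q : imunit J -> cslice J q -> embed J (unembed J q) = q.
Proof.
by move=> uJ [x [y ->]]; rewrite -[_ + _]/(embed J (x +i* y)) embedK.
Qed.

Lemma unembed_lip (J p q : H) (r : R) : imunit J -> (forall l, `|p 0 l - q 0 l| < r) ->
  nm (unembed J p - unembed J q) <= 4 * r.
Proof.
move=> uJ h; apply: le_trans (nm_le_ReIm _) _; rewrite cReD cImD cReN cImN /=.
have P l : `|(p 0 l - q 0 l) * J 0 l| <= r.
  rewrite normrM -[r]mulr1; apply: ler_pM => //; [exact: ltW|exact: imunit_coord].
have h0 := ltW (h 0); have := P 1; have := P 2; have := P 3.
have -> : p 0 1 * J 0 1 + p 0 2 * J 0 2 + p 0 3 * J 0 3 -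
  (q 0 1 * J 0 1 + q 0 2 * J 0 2 + q 0 3 * J 0 3) = (p 0 1 - q 0 1) * J 0 1 +
  ((p 0 2 - q 0 2) * J 0 2 + (p 0 3 - q 0 3) * J 0 3) by ring.
have := ler_normD ((p 0 1 - q 0 1) * J 0 1) ((p 0 2 - q 0 2) * J 0 2 + (p 0 3 - q 0 3) * J 0 3).
have := ler_normD ((p 0 2 - q 0 2) * J 0 2) ((p 0 3 - q 0 3) * J 0 3).
lra.
Qed.

Lemma iota_domainP (V : set H) z J : axially_symmetric V -> imunit J ->
  iota_domain V z <-> V (embed J z).
Proof.
move=> sV uJ; split=> [[I uI VI]|VJ]; last by exists J.
exact: (sV _ _ _ uI VI _ uJ).
Qed.

Lemma iota_domain_open (V : set H) z : axial_open V -> iota_domain V z ->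
  exists2 r : R, 0 < r & forall w, nm (w - z) < r -> iota_domain V w.
Proof.
move=> [sV oV] /(iota_domainP _ sV (@imunit_qi R)) Vz.
have nV : nbhs (embed qi z) V by apply: open_nbhs_nbhs.
have [r r0 rP] := embed_nbhs (@imunit_qi R) nV.
by exists r => // w /rP /(iota_domainP _ sV (@imunit_qi R)).
Qed.

(* The point of the closed upper half plane representing the sphere through q. *)
Definition sphere_point (q : H) : C :=
  q 0 0 +i* Num.sqrt (q 0 1 ^+ 2 + q 0 2 ^+ 2 + q 0 3 ^+ 2).

Lemma sphere_point_embed J z : imunit J ->
  sphere_point (embed J z) = complex.Re z +i* `|complex.Im z|.
Proof.
move=> uJ; have [J0 J1] := imunitP uJ.
rewrite /sphere_point !embed_coord //= J0 mulr0 addr0 mulr1 !mulr0 !add0r.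
rewrite !exprMn -!mulrDr J1 mulr1 sqrtr_sqr //.
Qed.

Lemma sphere_point_upper q : 0 <= complex.Im (sphere_point q).
Proof. exact: sqrtr_ge0. Qed.

Lemma sphere_point_polar q : exists2 J, imunit J & q = embed J (sphere_point q).
Proof.
have [x [y [J [uJ qE]]]] := slice_polar q.
have -> : q = embed J (x +i* y) by [].
rewrite sphere_point_embed //=.
have [y0|y0] := ger0P y; first by exists J.
by exists (- J); [exact: imunitN|rewrite /embed /= scalerN scaleNr opprK].
Qed.

Lemma sphere_point_iota (V : set H) q : V q -> iota_domain V (sphere_point q).
Proof. by have [J uJ {1}->] := sphere_point_polar q; exists J. Qed.

Lemma sphere_point_cont q (A : set C) : nbhs (sphere_point q) A ->
  nbhs q [set p | A (sphere_point p)].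
Proof.
move=> /cnbhsP[r r0 rA].
have cc l : {for q, continuous (fun p : H => p 0 l)} by exact: coord_continuous.
pose f (p : H) : R := Num.sqrt (p 0 1 ^+ 2 + p 0 2 ^+ 2 + p 0 3 ^+ 2).
have fc : {for q, continuous f}.
  apply: (@continuous_comp _ _ _ (fun p : H => p 0 1 ^+ 2 + p 0 2 ^+ 2 + p 0 3 ^+ 2)); last exact: sqrt_continuous.
  have X l : {for q, continuous (fun p : H => p 0 l ^+ 2)}.
    by apply: (@continuous_comp _ _ _ (fun p : H => p 0 l) (fun x : R => x ^+ 2)) => //; exact: exprn_continuous.
  exact: (continuousD (continuousD (X 1) (X 2)) (X 3)).
have r2 : 0 < r / 2 by lra.
have := cc 0 => /cvgrPdist_lt /(_ _ r2) h0.
move: fc => /cvgrPdist_lt /(_ _ r2) h1.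
apply: filterS (filterI h0 h1) => p [p0 p1]; apply: rA.
apply: le_lt_trans (nm_le_ReIm _) _; rewrite cReD cImD cReN cImN /= -!/(f _).
by rewrite distrC (distrC (f p)); move: p0 p1 => /=; lra.
Qed.

(** Only V is known to be connected, and its spheres correspond to the points of the stem domain in
    the closed upper half-plane; a locally constant predicate there pulls back to an open and closed
    subset of V. On a product domain it could not be carried across to the lower half-plane. *)
Lemma iota_connected (V : set H) (E : set C) : axial_domain V ->
  (forall z, iota_domain V z -> exists2 r : R, 0 < r & forall w, nm (w - z) < r -> (E w <-> E z)) ->
  forall z w, iota_domain V z -> iota_domain V w -> 0 <= complex.Im z -> 0 <= complex.Im w ->
    E z -> E w.
Proof.
move=> [[sV oV] cV] lE z w Dz Dw z0 w0 Ez.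
have spE u : 0 <= complex.Im u -> sphere_point (embed qi u) = u.
  by move=> u0; rewrite (sphere_point_embed _ (@imunit_qi R)) ger0_norm //; case: u {u0}.
pose B := V `&` [set q | E (sphere_point q)].
have nb q : V q -> exists2 N, nbhs q N & forall p, N p -> (E (sphere_point p) <-> E (sphere_point q)).
  move=> Vq; have [r r0 rP] := lE _ (sphere_point_iota Vq).
  exists [set p | nm (sphere_point p - sphere_point q) < r] => [|p /rP //].
  by apply: (@sphere_point_cont q (fun u => nm (u - sphere_point q) < r)); apply/cnbhsP; exists r.
have oE (P : set H) : (forall q, V q -> exists2 N, nbhs q N & forall p, N p -> (P p <-> P q)) ->
    open (V `&` P).
  move=> nP; rewrite openE => q [Vq Pq]; have [N Nq NP] := nP q Vq.
  have Nq' := open_nbhs_nbhs (conj oV Vq).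
  by apply: filterS (filterI Nq Nq') => p [/NP h1 Vp]; split=> //; apply/h1.
have BV : B = V.
  apply: cV.
  - exists (embed qi z); split; first exact/(iota_domainP _ sV (@imunit_qi R)).
    by rewrite /= spE.
  - exists B; first exact: oE.
    by apply/seteqP; split=> q; [case=> Vq Eq; split|case=> _ []].
  - exists (~` (V `&` [set q | ~ E (sphere_point q)])).
      apply: open_closedC; apply: oE => q Vq; have [N Nq NP] := nb q Vq.
      by exists N => // p /NP h; split=> h1 /h h2; apply: h1.
    apply/seteqP; split=> q; first by case=> Vq Eq; split=> // -[_].
    by case=> Vq /= h; split=> //; apply: contrapT => nE; apply: h.
have : V (embed qi w) by exact/(iota_domainP _ sV (@imunit_qi R)).
by rewrite -BV => -[_ /=]; rewrite spE.
Qed.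

End EpsilonDelta.

(** * Monodromy with conjugation symmetry on a basic domain *)

Section SymmetricMonodromy.
Variable R : realType.
Local Notation C := R[i].
Local Notation H := (quat R).
Local Notation HC := (quat R[i]).
Local Notation nm := (@Normc.normc R).

Lemma within_nbhs (T : topologicalType) (c : R -> T) (t : R) (A : set T) :
  {within `[(0 : R), 1]%classic, continuous c} -> 0 <= t <= 1 -> nbhs (c t) A ->
  exists2 r : R, 0 < r & forall s, 0 <= s <= 1 -> `|s - t| < r -> A (c s).
Proof.
move=> /subspace_continuousP cc t01 nA.
have tI : `[(0 : R), 1]%classic t by rewrite /= in_itv.
have : nbhs t [set s | `[(0 : R), 1]%classic s -> A (c s)] := cc t tI A nA.
move=> /nbhs_ballP[r r0 rP]; exists r => // s s01 st; apply: rP; last by rewrite /= in_itv.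
by rewrite /ball /= distrC.
Qed.

Lemma within_nbhs2 (T : topologicalType) (h : R * R -> T) (s t : R) (A : set T) :
  {within `[(0 : R), 1]%classic `*` `[(0 : R), 1]%classic, continuous h} ->
  0 <= s <= 1 -> 0 <= t <= 1 -> nbhs (h (s, t)) A ->
  exists2 r : R, 0 < r & forall s' t', 0 <= s' <= 1 -> 0 <= t' <= 1 ->
    `|s' - s| < r -> `|t' - t| < r -> A (h (s', t')).
Proof.
move=> /subspace_continuousP hc s01 t01 nA.
have stI : (`[(0 : R), 1]%classic `*` `[(0 : R), 1]%classic) (s, t) by split; rewrite /= in_itv.
have : nbhs (s, t) [set p | (`[(0 : R), 1]%classic `*` `[(0 : R), 1]%classic) p -> A (h p)] :=
  hc (s, t) stI A nA.
move=> [[P Q] /= [/nbhs_ballP[p p0 pP] /nbhs_ballP[q q0 qQ]] PQ].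
exists (Num.min p q); first by rewrite lt_min p0.
move=> s' t' s01' t01'; rewrite !lt_min => /andP[sp _] /andP[_ tq].
apply: (PQ (s', t')); last by split; rewrite /= in_itv.
by split; [apply: pP|apply: qQ]; rewrite /ball /= distrC.
Qed.

Lemma simply_conn_embed J (A : set H) : imunit J -> A `<=` cslice J ->
  simply_connected R A -> simply_conn [set z | A (embed J z)].
Proof.
move=> uJ AJ [_ Ap Ah].
have z1 : (0 : R) <= 1 by exact: ler01.
have z01 : 0 <= (0 : R) <= 1 by rewrite lexx z1.
have o01 : 0 <= (1 : R) <= 1 by rewrite lexx z1.
have cE (t : R) : 0 <= t <= 1 -> clamp 0 1 t = t by exact: clampE.
have AE q : A q -> embed J (unembed J q) = q by move=> /AJ; exact: unembedK.
have nbq (q : H) (e : R) : 0 < e -> nbhs q [set p : H | nm (unembed J p - unembed J q) < e].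
  move=> e0; apply/qnbhsP; exists (e / 8); first by lra.
  by move=> p h; apply: le_lt_trans (unembed_lip uJ h) _; lra.
split.
  move=> a b Aa Ab; have [c [cc cA c0 c1]] := Ap _ _ Aa Ab.
  have cA' t : A (c (clamp 0 1 t)).
    by apply: cA; exists (clamp 0 1 t) => //; rewrite /= in_itv /=; exact: clamp_in.
  exists (fun t => unembed J (c (clamp 0 1 t))); split.
  - move=> t e e0.
    have [r r0 rP] := within_nbhs cc (@clamp_in R 0 1 t z1) (nbq _ _ e0).
    exists r => // s st; apply: rP; first exact: clamp_in.
    exact: le_lt_trans (clamp_lip _ _ z1) st.
  - by move=> t _ /=; rewrite AE.
  - by rewrite cE // c0 embedK.
  - by rewrite cE // c1 embedK.
move=> c cc Xc c01.
have cc' : {within `[(0 : R), 1]%classic, continuous (embed J \o c)}.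
  apply: continuous_subspaceT => t A' nA'.
  have [r r0 rP] := embed_nbhs uJ nA'.
  have [d d0 dP] := cc t r r0.
  apply/nbhs_ballP; exists d => // s; rewrite /ball /= distrC => /dP /rP //.
have [||h [hc hA h0 h1 hs]] := Ah _ cc'; [|by rewrite /= c01|].
  by move=> _ [t + <-]; rewrite /= in_itv /= => t01; exact: Xc.
have hA' s t : A (h (clamp 0 1 s, clamp 0 1 t)).
  apply: hA; exists (clamp 0 1 s, clamp 0 1 t) => //.
  by split; rewrite /= in_itv /=; exact: clamp_in.
have I01 (t : R) : 0 <= t <= 1 -> `[(0 : R), 1]%classic t by rewrite /= in_itv.
exists (fun s t => unembed J (h (clamp 0 1 s, clamp 0 1 t))); split.
- move=> s t e e0.
  have [r r0 rP] := within_nbhs2 hc (@clamp_in R 0 1 s z1) (@clamp_in R 0 1 t z1) (nbq _ _ e0).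
  exists r => // s' t' ss' tt'; apply: rP; try exact: clamp_in.
    exact: le_lt_trans (clamp_lip _ _ z1) ss'.
  exact: le_lt_trans (clamp_lip _ _ z1) tt'.
- by move=> s t _ _ /=; rewrite AE.
- by move=> t t01; rewrite !cE // h0 ?I01 //= embedK.
- by move=> t t01; rewrite !cE // h1 ?I01 //= embedK.
- move=> s s01; rewrite !cE //; have [-> ->] := hs s (I01 s s01).
  by rewrite /= embedK.
Qed.

(** The set is one component of the slice, carried to the stem plane. By [iota_connected] it
    contains the part in the closed upper half-plane; if V has a real point, the same argument for
    the conjugate predicate reaches the lower part. *)
Lemma basic_component (V : set H) : basic_domain V -> V !=set0 ->
  exists X : set C, [/\ simply_conn X,
    forall z, X z -> exists2 r : R, 0 < r & forall w, nm (w - z) < r -> X w,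
    X !=set0 /\ X `<=` iota_domain V,
    forall z, iota_domain V z -> 0 <= complex.Im z -> X z &
    (exists x : R, iota_domain V x%:C) -> forall z, iota_domain V z -> X z].
Proof.
move=> [dV [J uJ scV]] [q0 Vq0]; have [[sV oV] cV] := dV.
have z1 : (0 : R) <= 1 by exact: ler01.
pose z0 := sphere_point q0.
have Dz0 : iota_domain V z0 by exact: sphere_point_iota.
have Vz0 : (V `&` cslice J) (embed J z0).
  by split; [exact/(iota_domainP _ sV uJ)|exists (complex.Re z0), (complex.Im z0)].
pose K := connected_component (V `&` cslice J) (embed J z0).
pose X := [set z | K (embed J z)].
have KV : K `<=` V `&` cslice J by exact: connected_component_sub.
have locX z : iota_domain V z -> exists2 r : R, 0 < r & forall w, nm (w - z) < r -> (X w <-> X z).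
  move=> Dz; have [r r0 rP] := iota_domain_open (conj sV oV) Dz.
  exists r => // w wr.
  (* A segment inside a disc of the stem domain stays in one component of the slice, so membership
     in X is locally constant. *)
  pose c (t : R) := embed J (z + t%:C * (w - z)).
  have cin (t : R) : 0 <= t <= 1 -> (V `&` cslice J) (c t).
    move=> /andP[t0 t1]; split; last by exists (complex.Re (z + t%:C * (w - z))), (complex.Im (z + t%:C * (w - z))).
    apply/(iota_domainP _ sV uJ); apply: rP; rewrite addrC addKr nmM nm_real ger0_norm //.
    by apply: le_lt_trans wr; rewrite ler_piMl ?nm_ge0.
  have ccon : connected (c @` `[(0 : R), 1]%classic).
    apply: connected_continuous_connected; first exact: segment_connected.
    apply: continuous_subspaceT => t A' nA'.
    have [d d0 dP] := embed_nbhs uJ nA'.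
    have [e e0 eP] := pder_pcont (pder_line z (w - z) t) d0.
    by apply/nbhs_ballP; exists e => // s; rewrite /ball /= distrC => /eP /dP.
  have csub : c @` `[(0 : R), 1]%classic `<=` V `&` cslice J.
    by move=> _ [t + <-]; rewrite /= in_itv /=; exact: cin.
  have c0 : c 0 = embed J z by rewrite /c mul0r addr0.
  have c1 : c 1 = embed J w by rewrite /c mul1r addrC subrK.
  have m0 : (c @` `[(0 : R), 1]%classic) (embed J z).
    by exists 0 => //; rewrite /= in_itv /= lexx.
  have m1 : (c @` `[(0 : R), 1]%classic) (embed J w).
    by exists 1 => //; rewrite /= in_itv /= lexx z1.
  have zw := connected_component_max m0 csub ccon m1.
  split=> h; apply: connected_component_trans h _ => //.
  exact: connected_component_sym.
have Xz0 : X z0 by exact: connected_component_refl.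
have z0i : 0 <= complex.Im z0 by exact: sphere_point_upper.
have Xup z : iota_domain V z -> 0 <= complex.Im z -> X z.
  by move=> Dz zi; apply: (iota_connected dV locX Dz0).
exists X; split.
- apply: simply_conn_embed => //; last exact: scV.
  by move=> q /KV[].
- move=> z Xz; have Dz : iota_domain V z.
    by apply/(iota_domainP _ sV uJ); have [] := KV _ Xz.
  have [r r0 rP] := locX z Dz; exists r => // w /rP h; exact/h.
- split; first by exists z0.
  by move=> z Xz; apply/(iota_domainP _ sV uJ); have [] := KV _ Xz.
- exact: Xup.
move=> [x Dx] z Dz; have [zi|zi] := lerP 0 (complex.Im z); first exact: Xup.
have Dzc : iota_domain V (conjc z) by exact: iota_domain_conj.
have locX' u : iota_domain V u ->
    exists2 r : R, 0 < r & forall w, nm (w - u) < r -> (X (conjc w) <-> X (conjc u)).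
  move=> Du; have [r r0 rP] := locX _ (iota_domain_conj sV Du).
  by exists r => // w wr; apply: rP; rewrite -rmorphB nm_conj.
have := @iota_connected _ V (fun u => X (conjc u)) dV locX' x%:C (conjc z) Dx Dzc.
rewrite conjcK; apply => //; last by rewrite conjc_real; exact: Xup.
by case: (z) zi => a b /=; rewrite oppr_ge0 => /ltW.
Qed.

Definition qn (y : HC) : R := nm (y 0 0) + nm (y 0 1) + nm (y 0 2) + nm (y 0 3).

Lemma qn0 : qn 0 = 0.
Proof. by rewrite /qn !mxE nm0 !addr0. Qed.

Lemma qnN y : qn (- y) = qn y.
Proof. by rewrite /qn !mxE !nmN. Qed.

Lemma qnD y y' : qn (y + y') <= qn y + qn y'.
Proof.
rewrite /qn !mxE.
have := nmD (y 0 0) (y' 0 0); have := nmD (y 0 1) (y' 0 1).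
have := nmD (y 0 2) (y' 0 2); have := nmD (y 0 3) (y' 0 3); lra.
Qed.

Lemma qn_coord (y : HC) l : nm (y 0 l) <= qn y.
Proof.
have := nm_ge0 (y 0 0); have := nm_ge0 (y 0 1); have := nm_ge0 (y 0 2); have := nm_ge0 (y 0 3).
rewrite /qn; case: l => [[|[|[|[|//]]]] il].
- by rewrite (_ : Ordinal il = 0); [lra|exact: val_inj].
- by rewrite (_ : Ordinal il = 1); [lra|exact: val_inj].
- by rewrite (_ : Ordinal il = 2); [lra|exact: val_inj].
- by rewrite (_ : Ordinal il = 3); [lra|exact: val_inj].
Qed.

Definition qhol (s : C -> HC) z := forall l, chol (fun t => s t 0 l) z.

Lemma qhol_cont s z : qhol s z -> scont qn s z.
Proof.
move=> hs e e0; have e4 : 0 < e / 4 by lra.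
have [r0 r00 P0] := chol_cont (hs 0) e4; have [r1 r10 P1] := chol_cont (hs 1) e4.
have [r2 r20 P2] := chol_cont (hs 2) e4; have [r3 r30 P3] := chol_cont (hs 3) e4.
exists (Num.min (Num.min r0 r1) (Num.min r2 r3)); first by rewrite !lt_min r00 r10 r20.
move=> w; rewrite !lt_min => /andP[/andP[/P0 h0 /P1 h1] /andP[/P2 h2 /P3 h3]].
by rewrite /qn !mxE; lra.
Qed.

Lemma qhol_near s s' z (r : R) : 0 < r ->
  (forall w, nm (w - z) < r -> s' w = s w) -> qhol s z -> qhol s' z.
Proof. by move=> r0 ss hs l; apply: (chol_near r0) (hs l) => w /ss ->. Qed.

Lemma mapq_conjK (y : HC) : mapq (@conjc R) (mapq (@conjc R) y) = y.
Proof. by apply/rowP => l; rewrite !mxE conjcK. Qed.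

Lemma qhol_conj s z : qhol s (conjc z) -> qhol (fun w => mapq (@conjc R) (s (conjc w))) z.
Proof.
move=> hs l; have [d hd] := chol_conj (hs l); exists d.
by apply: (cder_near ltr01) hd => w _; rewrite mxE.
Qed.

(** With a real point, the section through a value fixed by conjugation coincides with its own
    conjugate, since both take this value there. Without one, the stem domain misses the real axis,
    and the section on the upper half is reflected to the lower half. *)
Theorem symmetric_monodromy (V : set H) (Fib : C -> set HC) (eps : R) :
  basic_domain V -> 0 < eps ->
  (forall z y y', iota_domain V z -> Fib z y -> Fib z y' -> qn (y - y') < eps -> y = y') ->
  (forall z, iota_domain V z -> exists2 r : R, 0 < r &
    forall w y, nm (w - z) < r -> Fib w y -> exists s : C -> HC, s w = y /\
      forall w', nm (w' - z) < r -> Fib w' (s w') /\ qhol s w') ->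
  (forall z y, iota_domain V z -> Fib z y -> Fib (conjc z) (mapq (@conjc R) y)) ->
  (forall z, iota_domain V z -> exists y, Fib z y) ->
  (forall x : R, iota_domain V x%:C -> exists2 y, Fib x%:C y & mapq (@conjc R) y = y) ->
  exists F : C -> HC, [/\ stem_function V F, holomorphic (iota_domain V) F &
    forall z, iota_domain V z -> Fib z (F z)].
Proof.
move=> bV eps0 disc loc sym ne re; have [[[sV oV] cV] _] := bV.
have [V0|/set0P/negP/negPn/eqP V0] := pselect (V !=set0); last first.
  exists (fun=> 0); split=> z [I _]; by rewrite V0.
have [X [scX oX [[z0 Xz0] XD] Xup Xre]] := basic_component bV V0.
have disc' z y y' : X z -> Fib z y -> Fib z y' -> qn (y - y') < eps -> y = y'.
  by move=> /XD; exact: disc.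
have loc' z : X z -> exists r : R, [/\ 0 < r, forall w, nm (w - z) < r -> X w &
    forall w y, nm (w - z) < r -> Fib w y -> exists s : C -> HC, s w = y /\
      forall w', nm (w' - z) < r -> Fib w' (s w') /\ qhol s w'].
  move=> Xz; have [r r0 rP] := oX z Xz; have [q q0 qP] := loc z (XD _ Xz).
  exists (Num.min r q); split; first by rewrite lt_min r0.
    by move=> w; rewrite lt_min => /andP[/rP].
  move=> w y; rewrite lt_min => /andP[_ wq] /(qP w y wq)[s [sE sP]].
  by exists s; split=> // w'; rewrite lt_min => /andP[_ /sP].
have mono := @monodromy R HC qn qn0 qnN qnD X Fib qhol qhol_cont qhol_near eps eps0 disc' loc' scX.
have [[x Dx]|Xr] := pselect (exists x : R, iota_domain V x%:C).
  have DX z : iota_domain V z -> X z by apply: Xre; exists x.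
  have [y Fy yE] := re x Dx.
  have [s [sx sP]] := mono _ _ (DX _ Dx) Fy.
  pose s' z := mapq (@conjc R) (s (conjc z)).
  have s'P z : X z -> Fib z (s' z) /\ qhol s' z.
    move=> /XD/(iota_domain_conj sV) Dz; have [h1 h2] := sP _ (DX _ Dz).
    by split; [have := sym _ _ Dz h1; rewrite conjcK|exact: qhol_conj].
  have ss' : forall z, X z -> s z = s' z.
    apply: (@section_unique R HC qn qnN qnD X Fib eps eps0 disc' scX _ (DX _ Dx)).
      move=> z Xz; have [h1 h2] := sP z Xz; have [h3 h4] := s'P z Xz.
      by split=> //; exact: qhol_cont.
    by rewrite /s' conjc_real sx yE.
  exists s; split.
  - by move=> z /DX/ss' ->; rewrite /s' mapq_conjK.
  - by move=> z /DX/sP[_ hz]; apply/derivable_quatP.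
  - by move=> z /DX/sP[].
have Dn z : iota_domain V z -> complex.Im z != 0.
  move=> Dz; apply/eqP => z0'; apply: Xr; exists (complex.Re z).
  by case: z z0' Dz => a b /= ->.
have [y Fy] := ne _ (XD _ Xz0).
have [s [_ sP]] := mono _ _ Xz0 Fy.
pose F z := if 0 < complex.Im z then s z else mapq (@conjc R) (s (conjc z)).
have cIm z : complex.Im (conjc z) = - complex.Im z by case: z.
have FP z : iota_domain V z -> Fib z (F z) /\ qhol F z.
  move=> Dz; have := Dn z Dz; rewrite neq_lt => /orP[zi|zi].
    have Dzc := iota_domain_conj sV Dz.
    have Xzc : X (conjc z) by apply: Xup => //; rewrite cIm oppr_ge0 ltW.
    have [h1 h2] := sP _ Xzc.
    have Fz : F z = mapq (@conjc R) (s (conjc z)) by rewrite /F ltNge (ltW zi).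
    split; first by rewrite Fz; have := sym _ _ Dzc h1; rewrite conjcK.
    apply: (@qhol_near (fun w => mapq (@conjc R) (s (conjc w))) F z (- complex.Im z)).
    - by rewrite oppr_gt0.
    - move=> w wz; rewrite /F ifF //; apply/negbTE; rewrite -leNgt.
      have := Im_le_nm (w - z); rewrite cImD cImN => h3.
      by have := ler_norm (complex.Im w - complex.Im z); lra.
    - exact: qhol_conj.
  have [h1 h2] := sP _ (Xup z Dz (ltW zi)).
  split; first by rewrite /F zi.
  apply: (@qhol_near s F z (complex.Im z)) => // w wz; rewrite /F ifT //.
  have := Im_le_nm (w - z); rewrite cImD cImN => h3.
  by have := ler_norm (- (complex.Im w - complex.Im z)); rewrite normrN; lra.
exists F; split.
- move=> z Dz; rewrite /F cIm oppr_gt0 conjcK.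
  have := Dn z Dz; rewrite neq_lt => /orP[zi|zi].
    by rewrite zi ltNge (ltW zi) /= mapq_conjK.
  by rewrite zi ltNge (ltW zi).
- by move=> z /FP[_ hz]; apply/derivable_quatP.
- by move=> z /FP[].
Qed.

End SymmetricMonodromy.

(** * The *-exponential on stem functions *)

Section StarExponential.
Variable R : realType.
Local Notation C := R[i].
Local Notation H := (quat R).
Local Notation HC := (quat R[i]).
Local Notation nm := (@Normc.normc R).
Implicit Types (V : set H) (f g : H -> H) (F G : C -> HC) (z mu : C) (y : HC) (J : H).

Definition slice_val J y : H := mapq (@complex.Re R) y + J * mapq (@complex.Im R) y.

Lemma slice_valD J y y' : slice_val J (y + y') = slice_val J y + slice_val J y'.
Proof. by rewrite /slice_val; apply: quatP; rewrite !mxE /= ?mxE !(cReD, cImD); ring. Qed.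

Lemma slice_valZ J (a : R) y : slice_val J (a%:C *: y) = a *: slice_val J y.
Proof.
rewrite /slice_val scalerDr scalerAr; congr (_ + _ * _).
  by apply/rowP => l; rewrite !mxE cReM /= mul0r subr0.
by apply/rowP => l; rewrite !mxE cImM /= mul0r addr0.
Qed.

Lemma slice_val_scalar J (c : C) : slice_val J c%:A = embed J c.
Proof.
rewrite /slice_val (mapq_algc c).1 (mapq_algc c).2 -[(complex.Im c)%:A]/(_ *: 1).
by rewrite -scalerAr mulr1.
Qed.

Lemma slice_val_scalarM J (c : C) y : imunit J ->
  slice_val J (c *: y) = embed J c * slice_val J y.
Proof.
move=> uJ; rewrite /slice_val /embed mulrDl mulrDr mulrDr !mulr_algl -!scalerAl.
have -> : J * (J * mapq (@complex.Im R) y) = - mapq (@complex.Im R) y.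
  by rewrite mulrA -expr2 uJ mulN1r.
have -> : mapq (@complex.Re R) (c *: y) = complex.Re c *: mapq (@complex.Re R) y
    - complex.Im c *: mapq (@complex.Im R) y.
  by apply/rowP => l; rewrite !mxE cReM.
have -> : mapq (@complex.Im R) (c *: y) = complex.Re c *: mapq (@complex.Im R) y
    + complex.Im c *: mapq (@complex.Re R) y.
  by apply/rowP => l; rewrite !mxE cImM.
by rewrite mulrDr -!scalerAr scalerN addrACA; congr (_ + _); rewrite addrC.
Qed.

Lemma slice_val_le J y l : imunit J -> `|slice_val J y 0 l| <= 2 * qn y.
Proof.
move=> uJ; have [J0 J1] := imunitP uJ.
have h1 := imunit_coord 1 uJ; have h2 := imunit_coord 2 uJ; have h3 := imunit_coord 3 uJ.
have P a m : `|J 0 a| <= 1 -> `|J 0 a * complex.Im (y 0 m)| <= nm (y 0 m).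
  move=> hJ; rewrite normrM -[leRHS]mul1r; apply: ler_pM => //; exact: Im_le_nm.
have R0 m : `|complex.Re (y 0 m)| <= nm (y 0 m) by exact: Re_le_nm.
have T (u a b c : R) m : `|u| <= nm (y 0 m) -> nm (y 0 m) <= qn y ->
    `|a| + `|b| + `|c| <= qn y -> `|u + (a + b + c)| <= 2 * qn y.
  move=> hu hm hs; apply: le_trans (ler_normD _ _) _.
  have := ler_normD (a + b) c; have := ler_normD a b; lra.
have n0 := nm_ge0 (y 0 0); have n1 := nm_ge0 (y 0 1).
have n2 := nm_ge0 (y 0 2); have n3 := nm_ge0 (y 0 3).
case: l => [[|[|[|[|//]]]] il].
- rewrite (_ : Ordinal il = 0); last exact: val_inj.
  rewrite /slice_val !mxE /= ?mxE J0 mul0r.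
  have -> : 0 - J 0 1 * complex.Im (y 0 1) - J 0 2 * complex.Im (y 0 2) - J 0 3 * complex.Im (y 0 3)
    = - (J 0 1 * complex.Im (y 0 1)) + - (J 0 2 * complex.Im (y 0 2)) + - (J 0 3 * complex.Im (y 0 3)) by ring.
  apply: (T _ _ _ _ 0 (R0 0)); rewrite ?qn_coord // !normrN /qn.
  by have := P 1 1 h1; have := P 2 2 h2; have := P 3 3 h3; lra.
- rewrite (_ : Ordinal il = 1); last exact: val_inj.
  rewrite /slice_val !mxE /= ?mxE J0 mul0r.
  have -> : 0 + J 0 1 * complex.Im (y 0 0) + J 0 2 * complex.Im (y 0 3) - J 0 3 * complex.Im (y 0 2)
    = J 0 1 * complex.Im (y 0 0) + J 0 2 * complex.Im (y 0 3) + - (J 0 3 * complex.Im (y 0 2)) by ring.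
  apply: (T _ _ _ _ 1 (R0 1)); rewrite ?qn_coord // !normrN /qn.
  by have := P 1 0 h1; have := P 2 3 h2; have := P 3 2 h3; lra.
- rewrite (_ : Ordinal il = 2); last exact: val_inj.
  rewrite /slice_val !mxE /= ?mxE J0 mul0r.
  have -> : 0 - J 0 1 * complex.Im (y 0 3) + J 0 2 * complex.Im (y 0 0) + J 0 3 * complex.Im (y 0 1)
    = - (J 0 1 * complex.Im (y 0 3)) + J 0 2 * complex.Im (y 0 0) + J 0 3 * complex.Im (y 0 1) by ring.
  apply: (T _ _ _ _ 2 (R0 2)); rewrite ?qn_coord // !normrN /qn.
  by have := P 1 3 h1; have := P 2 0 h2; have := P 3 1 h3; lra.
- rewrite (_ : Ordinal il = 3); last exact: val_inj.
  rewrite /slice_val !mxE /= ?mxE J0 mul0r.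
  have -> : 0 + J 0 1 * complex.Im (y 0 2) - J 0 2 * complex.Im (y 0 1) + J 0 3 * complex.Im (y 0 0)
    = J 0 1 * complex.Im (y 0 2) + - (J 0 2 * complex.Im (y 0 1)) + J 0 3 * complex.Im (y 0 0) by ring.
  apply: (T _ _ _ _ 3 (R0 3)); rewrite ?qn_coord // !normrN /qn.
  by have := P 1 2 h1; have := P 2 1 h2; have := P 3 0 h3; lra.
Qed.

Lemma induces_val V F f J z : induces V F f -> imunit J -> V (embed J z) ->
  f (embed J z) = slice_val J (F z).
Proof. by move=> iF uJ VJ; case: z VJ => x w VJ; rewrite (iF _ _ _ uJ VJ). Qed.

Definition qvec (K : pzRingType) (y : quat K) : quat K := mkquat 0 (y 0 1) (y 0 2) (y 0 3).

(** The stem value of f_v^s. Over the complex numbers it is a quadratic form with isotropic vectors,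
    so it may vanish when the vector part does not. *)
Definition qvnorm (K : pzRingType) (y : quat K) : K := y 0 1 ^+ 2 + y 0 2 ^+ 2 + y 0 3 ^+ 2.

Lemma qsplit y : y = (y 0 0)%:A + qvec y.
Proof. by apply: quatP; rewrite !mxE /=; ring. Qed.

Lemma sqnormq_split y : sqnormq y = y 0 0 ^+ 2 + qvnorm y.
Proof. by rewrite /sqnormq /qvnorm !addrA. Qed.

Lemma qvec_sqr y : qvec y * qvec y = (- qvnorm y)%:A.
Proof. by rewrite /qvec /qvnorm; apply: quatP; rewrite !mxE /= ?mxE /=; ring. Qed.

(** As (qvec y)^2 = mu^2, powers of y are computed as for a matrix with eigenvalues y_0 + mu and y_0
    - mu. The last clause covers the double eigenvalue mu = 0, where the difference quotient becomes
    a derivative. *)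
Lemma qpow y mu n : mu ^+ 2 = - qvnorm y -> exists2 q : C,
  y ^+ n = (((y 0 0 + mu) ^+ n + (y 0 0 - mu) ^+ n) / 2)%:A + q *: qvec y &
  2 * mu * q = (y 0 0 + mu) ^+ n - (y 0 0 - mu) ^+ n /\
  (mu = 0 -> q = n%:R * y 0 0 ^+ n.-1).
Proof.
move=> hmu; elim: n => [|n [q yn [q1 q2]]].
  exists 0; last by rewrite mulr0 !expr0 subrr mul0r.
  by rewrite !expr0 scale0r addr0 (_ : (1 + 1) / 2 = 1 :> C) ?scale1r //; field.
set a := y 0 0 in yn q1 q2 *.
set p := ((a + mu) ^+ n + (a - mu) ^+ n) / 2 in yn.
exists (p + a * q).
  rewrite exprS yn [X in X * _]qsplit -/a mulrDl !mulrDr.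
  have -> : ((a + mu) ^+ n.+1 + (a - mu) ^+ n.+1) / 2 = a * p + q * mu ^+ 2.
    have -> : q * mu ^+ 2 = 2 * mu * q * mu / 2 by field.
    by rewrite q1 /p !exprS; field.
  rewrite !mulr_algl mulr_algr -scalerAr qvec_sqr -hmu !scalerA !scalerDl.
  by rewrite [p *: _ + _]addrC addrACA [(a * q) *: _ + _]addrC.
split.
  rewrite mulrDr.
  have -> : 2 * mu * (a * q) = a * (2 * mu * q) by ring.
  by rewrite q1 /p !exprS; field.
move=> m0; rewrite q2 // /p m0 subr0 addr0.
case: n {yn q1 q2 p} => [|n] /=; first by rewrite !expr0; field.
by rewrite -[n.+2%:R]natr1 -[n.+1%:R]natr1 [a ^+ n.+1]exprS; field.
Qed.

Definition qexp_sum n y : HC := \sum_(0 <= k < n) (k`!%:R)^-1 *: y ^+ k.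

Definition ccosh mu : C := (cexp mu + cexp (- mu)) / 2.

(* [sinh mu / mu], with its value at the removable singularity. *)
Definition csinhc mu : C := if mu == 0 then 1 else (cexp mu - cexp (- mu)) / (2 * mu).

Lemma ccoshN mu : ccosh (- mu) = ccosh mu.
Proof. by rewrite /ccosh opprK addrC. Qed.

Lemma csinhcN mu : csinhc (- mu) = csinhc mu.
Proof.
rewrite /csinhc oppr_eq0; case: eqVneq => // m0; rewrite opprK.
by field.
Qed.

(** The choice of the square root is immaterial, both functions of mu being even ([qexpE]). *)
Definition qexp y : HC :=
  let mu := sqrtc (- qvnorm y) in
  cexp (y 0 0) *: ((ccosh mu)%:A + csinhc mu *: qvec y).

Lemma qexpE y mu : mu ^+ 2 = - qvnorm y ->
  qexp y = cexp (y 0 0) *: ((ccosh mu)%:A + csinhc mu *: qvec y).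
Proof.
move=> hmu; rewrite /qexp.
have : mu ^+ 2 == sqrtc (- qvnorm y) ^+ 2 by rewrite sqr_sqrtc hmu.
by rewrite eqf_sqr => /orP[/eqP ->//|/eqP ->]; rewrite ccoshN csinhcN.
Qed.

Lemma climD x x' a a' : clim x a -> clim x' a' -> clim (fun n => x n + x' n) (a + a' : C).
Proof.
move=> h h' e e0; have e2 : 0 < e / 2 by lra.
have [N NP] := h _ e2; have [M MP] := h' _ e2.
exists (maxn N M) => n; rewrite geq_max => /andP[/NP h1 /MP h2].
by rewrite opprD addrACA; apply: le_lt_trans (nmD _ _) _; lra.
Qed.

Lemma climZ c x a : clim x a -> clim (fun n => c * x n) (c * a : C).
Proof.
move=> h e e0; have k0 : 0 < nm c + 1 by have := nm_ge0 c; lra.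
have [N NP] := h _ (divr_gt0 e0 k0).
exists N => n /NP; rewrite ltr_pdivlMr // => h1; rewrite -mulrBr nmM.
by have := nm_ge0 (x n - a); have := nm_ge0 c; nra.
Qed.

Lemma clim_ext x x' (a : C) : (forall n, x n = x' n) -> clim x a -> clim x' a.
Proof. by move=> /funext ->. Qed.

Lemma exp_sumS n z : exp_sum n.+1 z = exp_sum n z + n`!%:R^-1 * z ^+ n.
Proof. by rewrite /exp_sum big_nat_recr. Qed.

Lemma qexp_sumS n y : qexp_sum n.+1 y = qexp_sum n y + n`!%:R^-1 *: y ^+ n.
Proof. by rewrite /qexp_sum big_nat_recr. Qed.

Lemma qexp_sum_split y mu n : mu ^+ 2 = - qvnorm y -> exists2 q : C,
  qexp_sum n y = ((exp_sum n (y 0 0 + mu) + exp_sum n (y 0 0 - mu)) / 2)%:A + q *: qvec y &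
  2 * mu * q = exp_sum n (y 0 0 + mu) - exp_sum n (y 0 0 - mu) /\
  (mu = 0 -> q = exp_sum n.-1 (y 0 0)).
Proof.
move=> hmu; elim: n => [|n [q yn [q1 q2]]].
  exists 0; rewrite /qexp_sum /exp_sum !big_nil; last by rewrite mulr0 subrr.
  by rewrite addr0 mul0r !scale0r addr0.
have [u un [u1 u2]] := qpow n hmu.
exists (q + n`!%:R^-1 * u).
  rewrite qexp_sumS yn un !exp_sumS; move: (exp_sum n _) (exp_sum n _) (_ ^+ n) (_ ^+ n) => s t s' t'.
  rewrite scalerDr !scalerA addrACA -!scalerDl; congr (_ *: _ + _).
  by move: (n`!%:R^-1) => v; field.
rewrite !exp_sumS; split; first by rewrite mulrDr q1 mulrCA u1; ring.
move=> m0; rewrite q2 // u2 //; case: n {yn q1 q2 un u1 u2} => [|n] /=.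
  by rewrite mul0r mulr0 addr0.
rewrite exp_sumS; congr (_ + _).
rewrite factS natrM invfM -mulrA mulrCA; congr (_ * _).
by rewrite mulrA mulVf ?mul1r // pnatr_eq0.
Qed.

Lemma clim_qexp y l : clim (fun n => qexp_sum n y 0 l) (qexp y 0 l).
Proof.
pose mu := sqrtc (- qvnorm y); have hmu : mu ^+ 2 = - qvnorm y by rewrite sqr_sqrtc.
pose q n := projT1 (cid2 (qexp_sum_split n hmu)).
have qP n : qexp_sum n y = ((exp_sum n (y 0 0 + mu) + exp_sum n (y 0 0 - mu)) / 2)%:A + q n *: qvec y.
  by rewrite /q; case: cid2.
have q1 n : 2 * mu * q n = exp_sum n (y 0 0 + mu) - exp_sum n (y 0 0 - mu).
  by rewrite /q; case: cid2 => ? /= _ [].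
have q2 n : mu = 0 -> q n = exp_sum n.-1 (y 0 0).
  by rewrite /q; case: cid2 => ? /= _ [].
have qlim : clim q (cexp (y 0 0) * csinhc mu).
  rewrite /csinhc; case: eqVneq => [m0|m0].
    (* For the double eigenvalue, the coefficient in the partial sum of index n is the scalar sum of
       index n - 1, hence [N.+1]. *)
    move=> e e0; have [N NP] := clim_exp (y 0 0) e0.
    by exists N.+1 => -[//|n] nN; rewrite q2 //= mulr1; exact: NP.
  have h : clim (fun n => (2 * mu)^-1 * (exp_sum n (y 0 0 + mu) + (-1) * exp_sum n (y 0 0 - mu)))
      ((2 * mu)^-1 * (cexp (y 0 0 + mu) + (-1) * cexp (y 0 0 - mu))).
    by apply: climZ; apply: climD; [|apply: climZ]; exact: clim_exp.
  have -> : cexp (y 0 0) * ((cexp mu - cexp (- mu)) / (2 * mu)) =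
      (2 * mu)^-1 * (cexp (y 0 0 + mu) + (-1) * cexp (y 0 0 - mu)).
    by rewrite !cexpD; ring.
  apply: (clim_ext _ h) => n; rewrite mulN1r -q1.
  by rewrite mulKf // mulf_neq0 // pnatr_eq0.
have plim : clim (fun n => (exp_sum n (y 0 0 + mu) + exp_sum n (y 0 0 - mu)) / 2)
    (cexp (y 0 0) * ccosh mu).
  have h : clim (fun n => 2^-1 * (exp_sum n (y 0 0 + mu) + exp_sum n (y 0 0 - mu)))
      (2^-1 * (cexp (y 0 0 + mu) + cexp (y 0 0 - mu))).
    by apply: climZ; apply: climD; exact: clim_exp.
  have -> : cexp (y 0 0) * ccosh mu = 2^-1 * (cexp (y 0 0 + mu) + cexp (y 0 0 - mu)).
    by rewrite /ccosh !cexpD; ring.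
  by apply: (clim_ext _ h) => n; rewrite mulrC.
have -> : qexp y 0 l = (1 : HC) 0 l * (cexp (y 0 0) * ccosh mu) +
    qvec y 0 l * (cexp (y 0 0) * csinhc mu).
  rewrite /qexp -/mu mxE mxE (mxE _ _ _ l) [X in _ + X]mxE.
  by move: ((1 : HC) 0 l) (qvec y 0 l) => u v; ring.
have := climD (climZ ((1 : HC) 0 l) plim) (climZ (qvec y 0 l) qlim).
by apply: clim_ext => n; rewrite qP [RHS]mxE; congr (_ + _); rewrite [RHS]mxE mulrC.
Qed.

Lemma stem_starpow V f n : axially_symmetric V -> stem_function V (stem f) ->
  stem_function V (fun z => stem f z ^+ n) /\ induces V (fun z => stem f z ^+ n) (starpow f n).
Proof.
move=> sV sf; have sfn k : stem_function V (fun z => stem f z ^+ k).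
  elim: k => [|k IH] z Dz.
    by apply: quatP; rewrite !expr0 !mxE; apply/eqP; rewrite eq_complex /= ?oppr0 !eqxx.
  by rewrite !exprS mapq_conjM -(IH z Dz) -(sf z Dz).
split=> //; elim: n => [|n IH].
  by move=> x y J uJ VJ; apply: quatP; rewrite !expr0 !mxE /= ?mxE /=; ring.
have h := slice_ofP (sfn n.+1).
have E z : iota_domain V z -> stem f z * stem (starpow f n) z = stem f z ^+ n.+1.
  by move=> Dz; rewrite (stem_unique sV IH Dz) exprS.
have sfn' : stem_function V (fun z => stem f z * stem (starpow f n) z).
  by move=> z Dz; rewrite !E //; [exact: sfn|exact: iota_domain_conj].
exact: (eq_in_induces E (slice_ofP sfn')).
Qed.

(** The *-powers of f are induced by the pointwise powers of its stem function, and taking slice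
    values is real-linear and continuous, so it commutes with the exponential series. *)
Lemma star_expE V f z J : axially_symmetric V -> stem_function V (stem f) ->
  imunit J -> iota_domain V z -> star_exp f (embed J z) = slice_val J (qexp (stem f z)).
Proof.
move=> sV sf uJ Dz; have VJ := (iota_domainP z sV uJ).1 Dz.
have E n : series (fun n => n`!%:R^-1 *: starpow f n (embed J z)) n =
    slice_val J (qexp_sum n (stem f z)).
  elim: n => [|n IH].
    rewrite /series /qexp_sum /= !big_nil.
    by rewrite /slice_val; apply: quatP; rewrite !mxE /= ?mxE /=; ring.
  rewrite qexp_sumS slice_valD -IH [LHS]/series /= big_nat_recr //=; congr (_ + _).
  rewrite (induces_val (stem_starpow n sV sf).2 uJ VJ) -slice_valZ.
  by rewrite fmorphV rmorph_nat.
rewrite /star_exp; apply: cvg_lim; first exact: norm_hausdorff.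
move=> A /qnbhsP[r r0 rA].
(* Four coordinates and the factor 2 of [slice_val_le] leave a bound of r / 2. *)
have e0 : 0 < r / 16 by lra.
have [N0 P0] := clim_qexp (stem f z) 0 e0; have [N1 P1] := clim_qexp (stem f z) 1 e0.
have [N2 P2] := clim_qexp (stem f z) 2 e0; have [N3 P3] := clim_qexp (stem f z) 3 e0.
exists (maxn (maxn N0 N1) (maxn N2 N3)) => // n /=.
rewrite !geq_max => /andP[/andP[/P0 h0 /P1 h1] /andP[/P2 h2 /P3 h3]].
apply: rA => l.
have -> : series (fun n => n`!%:R^-1 *: starpow f n (embed J z)) n 0 l -
    slice_val J (qexp (stem f z)) 0 l =
    slice_val J (qexp_sum n (stem f z) - qexp (stem f z)) 0 l.
  rewrite E -[qexp (stem f z) in RHS]scale1r -scaleNr -[- 1 in RHS]/(- (1%:C)) -rmorphN.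
  rewrite slice_valD slice_valZ scaleN1r.
  by move: (slice_val J _) (slice_val J _) => u v; rewrite !mxE.
apply: le_lt_trans (slice_val_le _ _ uJ) _.
clear -r0 h0 h1 h2 h3; move: (qexp_sum n _) (qexp _) h0 h1 h2 h3 => u v h0 h1 h2 h3.
rewrite /qn !mxE; lra.
Qed.

Lemma stem_facts V f : axial_open V -> slice_regular V f ->
  [/\ stem_function V (stem f), forall z, iota_domain V z -> qhol (stem f) z & induces V (stem f) f].
Proof.
move=> [sV oV] [F [sF hF iF]]; have [sf fi] := induces_stem sV sF iF; split=> // z Dz.
have [r r0 rP] := iota_domain_open (conj sV oV) Dz.
apply: (qhol_near r0) ((derivable_quatP _ _).1 (hF z Dz)) => w /rP Dw.
exact: stem_unique sV iF Dw.
Qed.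

Lemma slice_regular_of V F : stem_function V F -> (forall z, iota_domain V z -> qhol F z) ->
  slice_regular V (slice_of F).
Proof.
move=> sF hF; exists F; split=> //; last exact: slice_ofP.
by move=> z /hF hz; apply/derivable_quatP.
Qed.

Lemma stem_slice_of V F z : axially_symmetric V -> stem_function V F -> iota_domain V z ->
  stem (slice_of F) z = F z.
Proof. by move=> sV sF; exact: stem_unique sV (slice_ofP sF). Qed.

Lemma eq_on_slices V f g : (forall z J, imunit J -> V (embed J z) -> f (embed J z) = g (embed J z)) ->
  forall q, V q -> f q = g q.
Proof. by move=> h q; have [J uJ {1 2 3}->] := sphere_point_polar q; exact: h. Qed.

Lemma star_log_of V g F : axial_open V -> slice_regular V g -> stem_function V F ->
  (forall z, iota_domain V z -> qhol F z) ->
  (forall z, iota_domain V z -> qexp (F z) = stem g z) -> star_log V g (slice_of F).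
Proof.
move=> oV hg sF hF FE; have [sV _] := oV; split; first exact: slice_regular_of.
have [_ _ ig] := stem_facts oV hg.
have ss : stem_function V (stem (slice_of F)).
  move=> z Dz; rewrite !(stem_slice_of sV sF) //; first exact: sF.
  exact: iota_domain_conj.
apply: eq_on_slices => z J uJ VJ; have Dz : iota_domain V z by exists J.
by rewrite (star_expE sV ss uJ Dz) (stem_slice_of sV sF Dz) FE // (induces_val ig uJ VJ).
Qed.

Lemma sqnormq_ReIm y : sqnormq y =
  (sqnormq (mapq (@complex.Re R) y) - sqnormq (mapq (@complex.Im R) y)) +i*
  (2 * (complex.Re (y 0 0) * complex.Im (y 0 0) + complex.Re (y 0 1) * complex.Im (y 0 1)
    + complex.Re (y 0 2) * complex.Im (y 0 2) + complex.Re (y 0 3) * complex.Im (y 0 3))).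
Proof.
rewrite /sqnormq !mxE; case: (y 0 0) => a0 b0; case: (y 0 1) => a1 b1.
case: (y 0 2) => a2 b2; case: (y 0 3) => a3 b3.
by apply/eqP; rewrite eq_complex /=; apply/andP; split; apply/eqP; ring.
Qed.

Lemma sqnormq_eq0 (q : H) : sqnormq q = 0 -> q = 0.
Proof.
rewrite /sqnormq; have := sqr_ge0 (q 0 0); have := sqr_ge0 (q 0 1).
have := sqr_ge0 (q 0 2); have := sqr_ge0 (q 0 3) => h3 h2 h1 h0 E.
have /eqP : q 0 0 ^+ 2 = 0 by lra.
have /eqP : q 0 1 ^+ 2 = 0 by lra.
have /eqP : q 0 2 ^+ 2 = 0 by lra.
have /eqP : q 0 3 ^+ 2 = 0 by lra.
rewrite !sqrf_eq0 => /eqP e3 /eqP e2 /eqP e1 /eqP e0.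
by apply: quatP; rewrite ?e0 ?e1 ?e2 ?e3 mxE.
Qed.

Lemma slice_val_zero y J : imunit J -> slice_val J y = 0 -> sqnormq y = 0.
Proof.
move=> uJ; have [J0 J1] := imunitP uJ; rewrite /slice_val => /eqP; rewrite addr_eq0 => /eqP E.
have e l : complex.Re (y 0 l) = (- (J * mapq (@complex.Im R) y)) 0 l by rewrite -E mxE.
have := e 0; have := e 1; have := e 2; have := e 3; rewrite !mxE /= ?mxE J0 => r3 r2 r1 r0.
have K (x : R) : x = x * (J 0 1 ^+ 2 + J 0 2 ^+ 2 + J 0 3 ^+ 2) by rewrite J1 mulr1.
rewrite sqnormq_ReIm /sqnormq !mxE r0 r1 r2 r3; apply/eqP; rewrite eq_complex /=.
apply/andP; split; apply/eqP; last by ring.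
rewrite [X in _ - X]K; ring.
Qed.

(** Write y = a + iota b. A vanishing complex norm means |a| = |b| with a orthogonal to b, so for b
    nonzero J = - a b^-1 is an imaginary unit with a + J b = 0. Thus a zero of f^s forces a zero of
    f on the same sphere. *)
Lemma zero_slice_val y : sqnormq y = 0 -> exists2 J, imunit J & slice_val J y = 0.
Proof.
set a := mapq (@complex.Re R) y; set b := mapq (@complex.Im R) y.
rewrite sqnormq_ReIm -/a -/b => /eqP; rewrite eq_complex /= => /andP[/eqP n0 /eqP s0].
have [b0|b0] := eqVneq (sqnormq b) 0.
  have a0 : a = 0 by apply: sqnormq_eq0; move: n0; rewrite b0 subr0.
  exists qi; first exact: imunit_qi.
  by rewrite /slice_val -/a -/b a0 (sqnormq_eq0 b0) mulr0 addr0.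
pose p : H := a * conjq b.
have p0 : p 0 0 = 0.
  have -> : p 0 0 = complex.Re (y 0 0) * complex.Im (y 0 0) + complex.Re (y 0 1) * complex.Im (y 0 1)
    + complex.Re (y 0 2) * complex.Im (y 0 2) + complex.Re (y 0 3) * complex.Im (y 0 3).
    by rewrite /p !mxE /= ?mxE; ring.
  by move/eqP: s0; rewrite mulf_eq0 pnatr_eq0 /= => /eqP.
have pn : sqnormq p = sqnormq b ^+ 2.
  rewrite sqnormqM; have -> : sqnormq (conjq b) = sqnormq b.
    by rewrite /sqnormq !mxE /= !sqrrN.
  by move/eqP: n0; rewrite subr_eq0 expr2 => /eqP ->.
have pp : p * p = (- sqnormq p)%:A.
  move: p p0 {pn b0 n0 s0} => p p0.
  by apply: quatP; rewrite !mxE /= ?mxE /= /sqnormq p0; ring.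
exists ((- (sqnormq b)^-1) *: p).
  rewrite /imunit /= expr2 -scalerAl -scalerAr scalerA pp pn -[_%:A]/(_ *: 1) scalerA.
  have -> : - (sqnormq b)^-1 * - (sqnormq b)^-1 * - sqnormq b ^+ 2 = -1 by field.
  by rewrite scaleN1r.
rewrite /slice_val -/a -/b -scalerAl /p -mulrA mul_conjq mulr_algr scalerA.
by rewrite mulNr mulVf // scaleN1r subrr.
Qed.

Lemma nonvanishing_stem V g z : axially_symmetric V -> induces V (stem g) g ->
  (forall q, V q -> g q <> 0) -> iota_domain V z -> sqnormq (stem g z) != 0.
Proof.
move=> sV ig g0 Dz; apply/eqP => /zero_slice_val[J uJ E].
have VJ := (iota_domainP z sV uJ).1 Dz.
by apply: (g0 _ VJ); rewrite (induces_val ig uJ VJ).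
Qed.

End StarExponential.

(** * The function t / sinh t of cosh t *)

Section ArcCosh.
Variable R : realType.
Local Notation C := R[i].
Local Notation nm := (@Normc.normc R).
Implicit Types (c u w z : C).

(* The plane slit along (-oo, -1], where the inverse of cosh has a principal
   determination. *)
Definition acosh_dom c := ~ (complex.Im c = 0 /\ complex.Re c <= -1).

(* With [c = cosh t], this is [t / sinh t], which is even in [t] and hence a
   holomorphic function of [c]. *)
Definition acoshc c : C := (csinhc (clog (c + sqrtc (c ^+ 2 - 1))))^-1.

(** The equation c = (u + u^-1) / 2 cleared of denominators; u is e^t when c = cosh t. *)
Definition joukowski u c := u ^+ 2 - 2 * c * u + 1 = 0.

Lemma joukowski_neq0 u c : joukowski u c -> u != 0.
Proof.
move=> h; apply/eqP => u0; move: h; rewrite /joukowski u0 expr0n /= mulr0 subr0 add0r.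
by apply/eqP; rewrite oner_eq0.
Qed.

Lemma joukowskiE u c : joukowski u c -> c = (u + u^-1) / 2.
Proof.
move=> h; have u0 := joukowski_neq0 h.
have -> : (u + u^-1) / 2 = c + (u ^+ 2 - 2 * c * u + 1) / (2 * u) by field.
by rewrite h mul0r addr0.
Qed.

Lemma joukowski_sqrt c d : d ^+ 2 = c ^+ 2 - 1 -> joukowski (c + d) c.
Proof.
move=> h; have -> : joukowski (c + d) c = (d ^+ 2 - (c ^+ 2 - 1) = 0).
  by rewrite /joukowski; congr (_ = _); ring.
by rewrite h subrr.
Qed.

Lemma joukowski_inv u u' c : joukowski u c -> joukowski u' c -> u' = u \/ u' = u^-1.
Proof.
move=> h h'; have u0 := joukowski_neq0 h.
have : (u' - u) * (u' - u^-1) = 0.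
  have -> : (u' - u) * (u' - u^-1) = u' ^+ 2 - (u + u^-1) * u' + u * u^-1 by ring.
  rewrite divff // -[RHS]h' (joukowskiE h); congr (_ - _ * _ + _).
  by field.
by move/eqP; rewrite mulf_eq0 !subr_eq0 => /orP[] /eqP; [left|right].
Qed.

(** A root off the slit plane would be a real number a < 0, and then c = (a + a^-1) / 2 <= -1. *)
Lemma joukowski_slit u c : acosh_dom c -> joukowski u c -> slit u.
Proof.
move=> dc h; apply/negPn/negP => /slitPn[i0 r0]; apply: dc.
have u0 := joukowski_neq0 h.
case: u h i0 r0 u0 => a b h /= b0 a0; rewrite b0 in h * => u0.
have an : a < 0.
  by rewrite lt_neqAle a0 andbT; apply: contraNneq u0 => ->.
have -> : c = ((a + a^-1) / 2)%:C.
  by rewrite (joukowskiE h) !rmorphM rmorphD !fmorphV rmorph_nat.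
split=> //=; rewrite ler_pdivrMr // -subr_ge0.
have -> : -1 * 2 - (a + a^-1) = (a + 1) ^+ 2 / (- a) by field; lra.
by rewrite divr_ge0 ?sqr_ge0 // oppr_ge0.
Qed.

(** Replacing u by u^-1 changes the sign of the logarithm, and [csinhc] is even. The value is
    therefore independent of the root selected by [sqrtc], whose discontinuity does no harm. *)
Lemma acoshcE u c : acosh_dom c -> joukowski u c -> acoshc c = (csinhc (clog u))^-1.
Proof.
move=> dc h; rewrite /acoshc.
have h' : joukowski (c + sqrtc (c ^+ 2 - 1)) c by apply: joukowski_sqrt; rewrite sqr_sqrtc.
have su := joukowski_slit dc h.
by have [->//|->] := joukowski_inv h h'; rewrite clogV // csinhcN.
Qed.

Lemma csinhc_clog u : slit u -> clog u != 0 -> csinhc (clog u) = (u - u^-1) / (2 * clog u).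
Proof. by move=> su l0; rewrite /csinhc (negbTE l0) cexpN clogK. Qed.

Lemma clog_eq0 u : slit u -> (clog u == 0) = (u == 1).
Proof.
move=> su; apply/eqP/eqP => [l0|->]; last exact: clog1.
by rewrite -(clogK su) l0 cexp0.
Qed.

Lemma csinhc_clog_neq0 u : slit u -> csinhc (clog u) != 0.
Proof.
move=> su; have [l0|l0] := eqVneq (clog u) 0; first by rewrite /csinhc l0 eqxx oner_eq0.
have u0 := slit_neq0 su.
rewrite csinhc_clog // mulf_neq0 // ?invr_eq0 ?mulf_neq0 ?pnatr_eq0 //.
apply/eqP => E; have : (u - 1) * (u + 1) = 0.
  have -> : (u - 1) * (u + 1) = u * (u - u^-1) by field.
  by rewrite E mulr0.
move/eqP; rewrite mulf_eq0 subr_eq0 addr_eq0 -clog_eq0 // (negbTE l0) /= => /eqP uE.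
by move: su; rewrite uE /slit nmN nm1 /= subrr ltxx.
Qed.

(** With mu = log u one has cosh mu = c and mu = psi(c) sinh mu. These identities solve the
    exponential equation in [principal_log]; the second one is squared because [qexpE] prescribes
    mu^2 only. *)
Lemma acoshc_spec c : acosh_dom c -> exists mu : C,
  [/\ mu ^+ 2 = acoshc c ^+ 2 * (c ^+ 2 - 1), ccosh mu = c & csinhc mu * acoshc c = 1].
Proof.
move=> dc; have h : joukowski (c + sqrtc (c ^+ 2 - 1)) c by apply: joukowski_sqrt; rewrite sqr_sqrtc.
move: (_ + _) h => u h; have su := joukowski_slit dc h; have u0 := slit_neq0 su.
exists (clog u); rewrite (acoshcE dc h); split.
- have s0 := csinhc_clog_neq0 su.
  have [l0|l0] := eqVneq (clog u) 0.
    have /eqP u1 : u == 1 by rewrite -clog_eq0 // l0.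
    by rewrite (joukowskiE h) l0 u1 invr1 expr0n /= divff ?pnatr_eq0 // expr1n subrr mulr0.
  apply: (mulIf (expf_neq0 2 s0)).
  rewrite [RHS]mulrAC -[X in _ = X * _]exprMn mulVf // expr1n mul1r.
  by rewrite csinhc_clog // (joukowskiE h); move: (clog u) l0 => l l0; field; rewrite l0 u0.
- by rewrite /ccosh cexpN clogK // (joukowskiE h).
- by rewrite divff // csinhc_clog_neq0.
Qed.

Lemma acoshc_neq0 c : acosh_dom c -> acoshc c != 0.
Proof.
move=> dc; have [mu [_ _ E]] := acoshc_spec dc.
by apply/eqP => E0; move: E; rewrite E0 mulr0; apply/eqP; rewrite eq_sym oner_eq0.
Qed.

Lemma acosh_dom_conj c : acosh_dom c -> acosh_dom (conjc c).
Proof.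
by move=> dc [] h1 h2; apply: dc; case: c h1 h2 => a b /= /eqP; rewrite oppr_eq0 => /eqP.
Qed.

Lemma csinhc_conj z : csinhc (conjc z) = conjc (csinhc z).
Proof.
rewrite /csinhc; have -> : (conjc z == 0) = (z == 0) by rewrite -!nm_eq0 nm_conj.
case: eqP => _; first by rewrite rmorph1.
have -> : cexp (- conjc z) = conjc (cexp (- z)).
  by rewrite -cexp_conj; congr cexp; case: z.
by rewrite cexp_conj [RHS]fmorph_div [in RHS]rmorphB [in RHS]rmorphM rmorph_nat.
Qed.

Lemma acoshc_conj c : acosh_dom c -> acoshc (conjc c) = conjc (acoshc c).
Proof.
move=> dc; have h : joukowski (c + sqrtc (c ^+ 2 - 1)) c by apply: joukowski_sqrt; rewrite sqr_sqrtc.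
move: (_ + _) h => u h.
have h' : joukowski (conjc u) (conjc c).
  have := congr1 (@conjc R) h; rewrite /joukowski.
  by rewrite rmorph0 rmorphD rmorphB rmorphXn !rmorphM rmorph_nat rmorph1.
by rewrite (acoshcE (acosh_dom_conj dc) h') (acoshcE dc h) clog_conj csinhc_conj fmorphV.
Qed.

Lemma acosh_dom_open c : acosh_dom c ->
  exists2 r : R, 0 < r & forall w, nm (w - c) < r -> acosh_dom w.
Proof.
move=> dc.
(* Shifting by 1 moves the slit (-oo, -1] to (-oo, 0]. *)
have P w : acosh_dom w <-> slit (w + 1).
  split=> [dw|sw [i0 r0]].
    apply/negPn/negP => /slitPn[]; rewrite cImD cReD /= addr0 => h1 h2.
    by apply: dw; split=> //; lra.
  move: sw; rewrite /slit cReD /=; case: w i0 r0 => a b /= -> a1.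
  rewrite addr0 expr0n addr0 sqrtr_sqr ler0_norm; lra.
have [r r0 rP] := slit_open ((P _).1 dc).
by exists r => // w wr; apply/P; apply: rP; rewrite opprD addrACA subrr addr0.
Qed.

Lemma chol_csinhc z : z != 0 -> chol (@csinhc R) z.
Proof.
move=> z0; have zp : 0 < nm z by rewrite nm_gt0.
apply: (@chol_near _ (fun w => (cexp w - cexp (- w)) / (2 * w)) _ _ (nm z)) => //.
  move=> w wz; rewrite /csinhc ifF //; apply/eqP => w0.
  by move: wz; rewrite w0 sub0r nmN ltxx.
apply: chol_div.
- by rewrite mulf_neq0 // pnatr_eq0.
- by apply: cholB; apply: chol_exp; [|apply: cholN]; exact: chol_id.
- by apply: cholM; [exact: chol_cst|exact: chol_id].
Qed.

Lemma ccont_csinhc0 : ccont (@csinhc R) 0.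
Proof.
move=> e e0; have e2 : 0 < e / 2 by lra.
have [r r0 rP] := cder_exp 0 e2; exists r => // t; rewrite subr0 => tr.
have -> : csinhc 0 = 1 :> C by rewrite /csinhc eqxx.
have [->|t0] := eqVneq t 0; first by rewrite /csinhc eqxx subrr nm0.
have h1 := rP t; rewrite subr0 cexp0 mul1r in h1; have {}h1 := h1 tr.
have h2 := rP (- t); rewrite subr0 cexp0 mul1r nmN in h2; have {}h2 := h2 tr.
rewrite /csinhc (negbTE t0).
have -> : (cexp t - cexp (- t)) / (2 * t) - 1 =
  ((cexp t - 1 - t) - (cexp (- t) - 1 - - t)) / (2 * t) by field.
have tp : 0 < nm t by rewrite nm_gt0.
rewrite nmM nmV nmM ltr_pdivrMr; last first.
  by rewrite mulr_gt0 // nm_gt0 pnatr_eq0.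
have -> : nm 2 = 2 by rewrite -(rmorph_nat (real_complex R) 2) nm_real normr_nat.
have := nmD (cexp t - 1 - t) (- (cexp (- t) - 1 - - t)); rewrite nmN.
by nra.
Qed.

(** At c = 1 the square root branches, so the defining formula gives only continuity; holomorphy at
    this point is left to [removable]. *)
Lemma ccont_acoshc1 : ccont acoshc 1.
Proof.
rewrite /acoshc; apply: ccontV; last by apply: csinhc_clog_neq0; rewrite expr1n subrr sqrtc0 addr0 /slit nm1 /=; lra.
apply: (@ccont_comp _ (fun c => clog (c + sqrtc (c ^+ 2 - 1)))); last first.
  by rewrite expr1n subrr sqrtc0 addr0 clog1; exact: ccont_csinhc0.
apply: (@ccont_comp _ (fun c => c + sqrtc (c ^+ 2 - 1))); last first.
  by rewrite expr1n subrr sqrtc0 addr0; apply: ccont_log; rewrite /slit nm1 /=; lra.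
apply: ccontD; first exact: ccont_id.
move=> e e0; rewrite expr1n subrr sqrtc0.
(* For |w - 1| < 1 one has |w^2 - 1| <= 3 |w - 1|, and this has to stay below e^2. *)
exists (Num.min 1 (e ^+ 2 / 3)); first by rewrite lt_min ltr01 divr_gt0 ?exprn_gt0.
move=> w; rewrite lt_min subr0 => /andP[w1]; rewrite ltr_pdivlMr // => we.
rewrite -(@ltr_pXn2r _ 2) ?nnegrE ?nm_ge0 ?(ltW e0) // -nmX sqr_sqrtc.
have -> : w ^+ 2 - 1 = (w - 1) * (w - 1 + 2) by ring.
rewrite nmM; apply: le_lt_trans we; apply: ler_wpM2l; first exact: nm_ge0.
have := nmD (w - 1) 2.
have -> : nm 2 = 2 by rewrite -(rmorph_nat (real_complex R) 2) nm_real normr_nat.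
lra.
Qed.

(** Away from 1, [acoshcE] allows a holomorphic local root of c^2 - 1 in place of [sqrtc], and log u
    is nonzero, so [csinhc] is holomorphic there. *)
Lemma chol_acoshc c : acosh_dom c -> chol acoshc c.
Proof.
suff P w : acosh_dom w -> w != 1 -> chol acoshc w.
  move=> dc; have [->|] := eqVneq c 1; last exact: P.
  have d1 : acosh_dom 1 by case=> _ /=; lra.
  have [r r0 rP] := acosh_dom_open d1.
  by apply: (removable r0 ccont_acoshc1) => z /rP; exact: P.
move=> dw w1.
have [r r0 rP] := acosh_dom_open dw.
have wn : w ^+ 2 - 1 != 0.
  rewrite subr_sqr_1 mulf_neq0 // ?subr_eq0 // addr_eq0; apply/eqP => wE.
  by apply: dw; rewrite wE /= oppr0; split.
have h0 z : nm (z - w) < r -> chol (fun z => z ^+ 2 - 1) z.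
  by move=> _; apply: cholB; [apply: cholX; exact: chol_id|exact: chol_cst].
have [s /andP[s0 sr] [l lP]] := local_log r0 h0 wn.
pose sg z := cexp (l z / 2).
have sg2 z : nm (z - w) < s -> sg z ^+ 2 = z ^+ 2 - 1.
  move=> /lP[_ <-]; rewrite /sg -cexpX; congr cexp; by field.
have hsg z : nm (z - w) < s -> chol (fun z => z + sg z) z.
  move=> /lP[hl _]; apply: cholD; first exact: chol_id.
  apply: chol_exp; apply: chol_div => //; exact: chol_cst.
have js z : nm (z - w) < s -> joukowski (z + sg z) z by move=> /sg2/joukowski_sqrt.
have ws : nm (w - w) < s by rewrite subrr nm0.
have sw := joukowski_slit dw (js w ws).
apply: (@chol_near _ (fun z => (csinhc (clog (z + sg z)))^-1) _ _ s) => //.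
  move=> z zs; apply: acoshcE; last exact: js.
  by apply: rP; apply: lt_le_trans sr.
apply: cholV; first exact: csinhc_clog_neq0.
apply: (@chol_comp _ (fun z => clog (z + sg z))).
  apply: (@chol_comp _ (fun z => z + sg z)); first exact: hsg.
  exact: chol_log.
apply: chol_csinhc; rewrite clog_eq0 //; apply: contra_neq w1 => u1.
by rewrite (joukowskiE (js w ws)) u1 invr1 divff // pnatr_eq0.
Qed.

End ArcCosh.

(** * Germs of vectorial functions *)

Section Tubes.
Variable R : realType.
Local Notation C := R[i].
Local Notation H := (quat R).
Local Notation HC := (quat R[i]).
Local Notation nm := (@Normc.normc R).
Implicit Types (V : set H) (F G : C -> HC) (z w : C) (J q : H).

(** The axially symmetric neighbourhood of a sphere that is cut out by a disc in the stem plane. *)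
Definition tube z (r : R) : set H := [set q | nm (sphere_point q - z) < r].

Lemma nm_conjB z w : 0 <= complex.Im z -> 0 <= complex.Im w -> nm (w - z) <= nm (conjc w - z).
Proof.
move=> z0 w0; rewrite -(@ler_pXn2r _ 2) ?nnegrE ?nm_ge0 //.
rewrite !nm_sqr !cReD !cImD !cReN !cImN; case: z w z0 w0 => a b [c d] /= b0 d0.
by have := mulr_ge0 b0 d0; nra.
Qed.

Lemma tube_embed z r J w : 0 <= complex.Im z -> imunit J ->
  tube z r (embed J w) <-> nm (w - z) < r \/ nm (conjc w - z) < r.
Proof.
move=> z0 uJ; rewrite /tube /= sphere_point_embed //.
have [w0|w0] := lerP 0 (complex.Im w).
  have -> : complex.Re w +i* `|complex.Im w| = w.
    by rewrite ger0_norm //; case: (w).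
  by split=> [|[//|]]; [left|apply: le_lt_trans; exact: nm_conjB].
have -> : complex.Re w +i* `|complex.Im w| = conjc w.
  by rewrite ltr0_norm //; case: (w).
split=> [|[|//]]; first by right.
apply: le_lt_trans; rewrite -{2}(conjcK w); apply: nm_conjB => //.
by case: (w) w0 => a b /=; rewrite oppr_ge0 => /ltW.
Qed.

Lemma tube_iota z r w : 0 <= complex.Im z ->
  iota_domain (tube z r) w <-> nm (w - z) < r \/ nm (conjc w - z) < r.
Proof.
move=> z0; split=> [[J uJ h]|h]; first exact/(tube_embed r w z0 uJ).
by exists qi; [exact: imunit_qi|exact/(tube_embed r w z0 (@imunit_qi R))].
Qed.

Lemma tube_axial_open z r : axial_open (tube z r).
Proof.
split=> [x y I uI + J uJ|].
  by rewrite -!/(embed _ (x +i* y)) /tube /= !sphere_point_embed.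
rewrite openE => q hq; apply: (@sphere_point_cont _ q (fun w => nm (w - z) < r)).
apply/cnbhsP; exists (r - nm (sphere_point q - z)); first by rewrite subr_gt0.
move=> w h; rewrite -[w](subrK (sphere_point q)) -addrA.
by apply: le_lt_trans (nmD _ _) _; rewrite -ltrBrDr.
Qed.

Lemma circle_param (u v : R) : u ^+ 2 + v ^+ 2 = 1 -> exists2 t, u = cos t & v = sin t.
Proof.
move=> uv; have n1 : nm (u +i* v) = 1.
  by apply/eqP; rewrite -(@eqrXn2 _ 2) ?nm_ge0 // nm_sqr /= uv expr1n.
have [[a t] E] : exists z, cexp z = u +i* v by apply: cexp_surj; rewrite -nm_gt0 n1.
have := nm_cexp (a +i* t); rewrite E n1 /= => ea.
by exists t; move: E => /eqP; rewrite eq_complex /= -ea !mul1r => /andP[/eqP + /eqP].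
Qed.

(** Spherical coordinates on the imaginary units, with [qi] at angles (0, 0). *)
Definition sphere_dir (a b : R) : H := mkquat 0 (cos a) (sin a * cos b) (sin a * sin b).

Lemma imunit_dir a b : imunit (sphere_dir a b).
Proof.
have h1 := cos2Dsin2 a; have h2 := cos2Dsin2 b.
have h : cos a ^+ 2 + (sin a * cos b) ^+ 2 + (sin a * sin b) ^+ 2 = 1.
  by rewrite -h1 -[sin a ^+ 2 in RHS]mulr1 -h2; ring.
by rewrite /imunit /= expr2; apply: quatP; rewrite !mxE /=; [rewrite -h| | |]; ring.
Qed.

Lemma sphere_param J : imunit J -> exists a b, J = sphere_dir a b.
Proof.
move=> /imunitP[J0 J1]; pose s := Num.sqrt (J 0 2 ^+ 2 + J 0 3 ^+ 2).
have s2 : s ^+ 2 = J 0 2 ^+ 2 + J 0 3 ^+ 2 by rewrite sqr_sqrtr // addr_ge0 ?sqr_ge0.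
have [a ca sa] : exists2 a, J 0 1 = cos a & s = sin a.
  by apply: circle_param; rewrite s2 addrA.
have [s0|s0] := eqVneq s 0.
  exists a, 0; have := sqr_ge0 (J 0 2); have := sqr_ge0 (J 0 3).
  move: s2; rewrite s0 expr0n /= => s2 h3 h2.
  have /eqP : J 0 2 ^+ 2 = 0 by lra.
  have /eqP : J 0 3 ^+ 2 = 0 by lra.
  rewrite !sqrf_eq0 => /eqP e3 /eqP e2.
  by apply: quatP; rewrite !mxE /= -?sa ?J0 ?ca ?e2 ?e3 ?s0 ?mul0r.
have [b cb sb] : exists2 b, J 0 2 / s = cos b & J 0 3 / s = sin b.
  by apply: circle_param; rewrite !exprMn -mulrDl -s2 exprVn divff // expf_neq0.
by exists a, b; apply: quatP; rewrite !mxE /= -?sa -?cb -?sb ?J0 // mulrC divfK.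
Qed.

Lemma quat_continuous (c : R -> H) (t : R) :
  (forall l, {for t, continuous (fun s : R => c s 0 l)}) -> {for t, continuous c}.
Proof.
move=> h A /qnbhsP[r r0 rA].
have k l : \forall s \near t, `|c t 0 l - c s 0 l| < r.
  by have := h l => /cvgrPdist_lt /(_ _ r0).
apply: filterS (filterI (filterI (k 0) (k 1)) (filterI (k 2) (k 3))) => s [[k0 k1] [k2 k3]].
apply: rA => l; rewrite distrC; case: l => [[|[|[|[|//]]]] il].
- by rewrite (_ : Ordinal il = 0) //; exact: val_inj.
- by rewrite (_ : Ordinal il = 1) //; exact: val_inj.
- by rewrite (_ : Ordinal il = 2) //; exact: val_inj.
- by rewrite (_ : Ordinal il = 3) //; exact: val_inj.
Qed.

Lemma dir_path_continuous (a b x0 x1 y0 y1 t : R) : {for t, continuous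
  (fun s : R => embed (sphere_dir (s * a) (s * b)) ((x0 + s * x1) +i* (y0 + s * y1)))}.
Proof.
have lin (u v : R) : {for t, continuous (fun s : R => u + s * v)}.
  by apply: continuousD; [exact: cst_continuous|apply: continuousM => //; exact: cst_continuous].
have cl (u : R) : {for t, continuous (fun s : R => cos (s * u))}.
  apply: (@continuous_comp _ _ _ (fun s : R => s * u) (@cos R)); last exact: continuous_cos.
  by apply: continuousM => //; exact: cst_continuous.
have sl (u : R) : {for t, continuous (fun s : R => sin (s * u))}.
  apply: (@continuous_comp _ _ _ (fun s : R => s * u) (@sin R)); last exact: continuous_sin.
  by apply: continuousM => //; exact: cst_continuous.
apply: quat_continuous => l.
have ext (f g : R -> R) : (forall s, f s = g s) -> {for t, continuous g} -> {for t, continuous f}.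
  by move=> /funext ->.
apply: (ext _ (fun s => (x0 + s * x1) * (l == 0)%:R + (y0 + s * y1) * sphere_dir (s * a) (s * b) 0 l)).
  by move=> s; rewrite embed_coord //; exact: imunit_dir.
apply: continuousD; first by apply: continuousM => //; exact: cst_continuous.
apply: continuousM => //.
case: l => [[|[|[|[|//]]]] il].
- by apply: (ext _ (fun=> 0)); [move=> s; rewrite mxE|exact: cst_continuous].
- by apply: (ext _ (fun s => cos (s * a))); [move=> s; rewrite mxE|exact: cl].
- apply: (ext _ (fun s => sin (s * a) * cos (s * b))); first by move=> s; rewrite mxE.
  exact: continuousM.
- apply: (ext _ (fun s => sin (s * a) * sin (s * b))); first by move=> s; rewrite mxE.
  exact: continuousM.
Qed.

(** A point is joined to [embed qi z] by moving its sphere point along a segment while its two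
    spherical angles shrink proportionally to 0. *)
Lemma tube_connected z (r : R) : 0 <= complex.Im z -> 0 < r -> connected (tube z r).
Proof.
move=> z0 r0.
have p0 : tube z r (embed qi z).
  by apply/(tube_embed r z z0 (@imunit_qi R)); left; rewrite subrr nm0.
suff -> : tube z r = connected_component (tube z r) (embed qi z).
  exact: component_connected.
apply/seteqP; split; last exact: connected_component_sub.
move=> q hq; have [J uJ qE] := sphere_point_polar q.
have [a [b JE]] := sphere_param uJ.
pose w := sphere_point q.
pose c (s : R) := embed (sphere_dir (s * a) (s * b))
  ((complex.Re z + s * (complex.Re w - complex.Re z)) +i* (complex.Im z + s * (complex.Im w - complex.Im z))).
have ccon : connected (c @` `[(0 : R), 1]%classic).
  apply: connected_continuous_connected; first exact: segment_connected.
  by apply: continuous_subspaceT => t; exact: dir_path_continuous.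
have csub : c @` `[(0 : R), 1]%classic `<=` tube z r.
  move=> _ [t + <-]; rewrite /= in_itv /= => /andP[t0 t1].
  apply/(tube_embed _ _ z0 (imunit_dir _ _)); left.
  have -> : (complex.Re z + t * (complex.Re w - complex.Re z)) +i*
    (complex.Im z + t * (complex.Im w - complex.Im z)) - z = t%:C * (w - z).
    by case: (z) (w) => x y [x' y'] /=; apply/eqP; rewrite eq_complex /=; apply/andP; split; apply/eqP; ring.
  rewrite nmM nm_real ger0_norm //; apply: le_lt_trans hq.
  by rewrite ler_piMl ?nm_ge0.
have c0 : c 0 = embed qi z.
  rewrite /c !mul0r !addr0 /sphere_dir cos0 sin0 !mul0r; by case: (z).
have c1 : c 1 = q.
  rewrite /c !mul1r !(addrC _ (_ - _)) !subrK [RHS]qE -/w JE; by case: (w).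
apply: (connected_component_max _ csub ccon).
  by exists 0 => //; rewrite /= in_itv /= lexx ler01.
by exists 1 => //; rewrite /= in_itv /= lexx ler01.
Qed.

Lemma tube_axial_domain z (r : R) : 0 <= complex.Im z -> 0 < r -> axial_domain (tube z r).
Proof. by move=> z0 r0; split; [exact: tube_axial_open|exact: tube_connected]. Qed.

(* On such a disc the conjugation either moves the disc off itself or
   preserves its real centre. *)
Definition symmetric_disc z (r : R) :=
  [/\ 0 <= complex.Im z, 0 < r & complex.Im z = 0 \/ r <= complex.Im z].

Lemma tube_sub V z : axial_open V -> iota_domain V z -> 0 <= complex.Im z ->
  exists2 r : R, symmetric_disc z r & forall s, s <= r -> tube z s `<=` V /\
    forall w, nm (w - z) < s -> iota_domain V w.
Proof.
move=> oV Dz z0; have [sV _] := oV; have [r r0 rP] := iota_domain_open oV Dz.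
have [z0'|z0'] := eqVneq (complex.Im z) 0.
  exists r; first by split=> //; left.
  move=> s sr; split; last by move=> w ws; apply: rP; exact: lt_le_trans sr.
  move=> q qs; have [J uJ ->] := sphere_point_polar q; apply/(iota_domainP _ sV uJ).
  by apply: rP; exact: lt_le_trans sr.
exists (Num.min r (complex.Im z)).
  by split=> //; [rewrite lt_min r0 lt_neqAle eq_sym z0'|right; rewrite ge_min lexx orbT].
move=> s; rewrite le_min => /andP[sr _]; split; last by move=> w ws; apply: rP; exact: lt_le_trans sr.
move=> q qs; have [J uJ ->] := sphere_point_polar q; apply/(iota_domainP _ sV uJ).
by apply: rP; exact: lt_le_trans sr.
Qed.

Lemma symmetric_disc_le z (r s : R) : symmetric_disc z r -> 0 < s <= r -> symmetric_disc z s.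
Proof.
by move=> [h1 h2 h3] /andP[s0 sr]; split=> //; case: h3 => h3; [left|right; exact: le_trans h3].
Qed.

Definition sym_ext G z (r : R) : C -> HC := fun w =>
  if nm (w - z) < r then G w else mapq (@conjc R) (G (conjc w)).

(** The disc and its mirror image are either disjoint or equal, and in the second case the symmetry
    of G makes the two definitions agree. *)
Lemma sym_extP G z (r : R) : symmetric_disc z r ->
  (forall w, nm (w - z) < r -> qhol G w) ->
  (complex.Im z = 0 -> forall w, nm (w - z) < r -> G (conjc w) = mapq (@conjc R) (G w)) ->
  [/\ stem_function (tube z r) (sym_ext G z r),
      forall w, iota_domain (tube z r) w -> qhol (sym_ext G z r) w &
      forall w, nm (w - z) < r -> sym_ext G z r w = G w].
Proof.
move=> [z0 r0 zr] hG sG.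
have E w : nm (w - z) < r -> sym_ext G z r w = G w by rewrite /sym_ext => ->.
have real w : nm (w - z) < r -> nm (conjc w - z) < r -> complex.Im z = 0.
  case: zr => // zr h1 h2.
  have := Im_le_nm (w - z); have := Im_le_nm (conjc w - z); rewrite !cImD !cImN.
  have -> : complex.Im (conjc w) = - complex.Im w by case: (w).
  have := ler_norm (- (complex.Im w - complex.Im z)).
  by have := ler_norm (- (- complex.Im w - complex.Im z)); rewrite !normrN; lra.
have open w : nm (w - z) < r -> exists2 s : R, 0 < s & forall u, nm (u - w) < s -> nm (u - z) < r.
  move=> h; exists (r - nm (w - z)); first by rewrite subr_gt0.
  move=> u h'; rewrite -[u](subrK w) -addrA.
  by apply: le_lt_trans (nmD _ _) _; rewrite -ltrBrDr.
have S : stem_function (tube z r) (sym_ext G z r).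
  move=> w /(tube_iota r w z0) h; rewrite /sym_ext conjcK.
  have [h1|h1] := boolP (nm (w - z) < r); have [h2|h2] := boolP (nm (conjc w - z) < r) => //.
  - by apply: sG => //; exact: (real w).
  - by rewrite mapq_conjK.
  - by case: h => h; [rewrite h in h1|rewrite h in h2].
split=> // w Dw; have := Dw => /(tube_iota r w z0)[h|h].
  have [s s0 sP] := open _ h; apply: (qhol_near s0) (hG w h) => u /sP; exact: E.
have [s s0 sP] := open _ h.
apply: (qhol_near s0) (qhol_conj (hG _ h)) => u us.
have us' : nm (conjc u - z) < r by apply: sP; rewrite -rmorphB nm_conj.
rewrite -[LHS]mapq_conjK -S ?E //; apply/(tube_iota _ _ z0); by right.
Qed.

End Tubes.

(** * Linear dependence of holomorphic germs *)

Section Germs.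
Variable R : realType.
Local Notation C := R[i].
Local Notation H := (quat R).
Local Notation HC := (quat R[i]).
Local Notation nm := (@Normc.normc R).
Implicit Types (V W : set H) (F G K : C -> HC) (z w : C) (J p q : H).

Lemma near_point z (r : R) : 0 < r -> exists2 w, w != z & nm (w - z) < r.
Proof.
move=> r0; have E : nm (z + (r / 2)%:C - z) = r / 2.
  by rewrite addrC addKr nm_real gtr0_norm // divr_gt0.
exists (z + (r / 2)%:C); last by rewrite E; lra.
by rewrite -subr_eq0 -nm_eq0 E gt_eqF // divr_gt0.
Qed.

Lemma ccont_zero (f : C -> C) z (r : R) : 0 < r -> ccont f z ->
  (forall w, nm (w - z) < r -> w != z -> f w = 0) -> f z = 0.
Proof.
move=> r0 cf h; apply: nm_small => e e0; have [d d0 dP] := cf e e0.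
have [|w wz] := @near_point z (Num.min r d); first by rewrite lt_min r0.
rewrite lt_min => /andP[wr /dP].
by rewrite h // sub0r nmN.
Qed.

Lemma order_cancel F z (r : R) n : 0 < r -> (forall w, nm (w - z) < r -> qhol F w) ->
  (forall w, nm (w - z) < r -> (w - z) ^+ n *: F w = 0) -> forall w, nm (w - z) < r -> F w = 0.
Proof.
move=> r0 hF h.
have h1 w : nm (w - z) < r -> w != z -> F w = 0.
  move=> /h /eqP; rewrite scaler_eq0 expf_eq0 subr_eq0 => /orP[/andP[_ /eqP->]|/eqP->//].
  by rewrite eqxx.
move=> w wr; have [->|/(h1 _ wr)//] := eqVneq w z.
apply/rowP => l; rewrite [RHS]mxE; apply: (@ccont_zero (fun t => F t 0 l) z r r0).
  by apply: chol_cont; apply: hF; rewrite subrr nm0.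
by move=> u ur uz; rewrite h1 // mxE.
Qed.

Lemma ball_sub z w (r : R) : nm (w - z) < r ->
  exists2 s : R, 0 < s & forall u, nm (u - w) < s -> nm (u - z) < r.
Proof.
move=> h; exists (r - nm (w - z)); first by rewrite subr_gt0.
move=> u h'; rewrite -[u](subrK w) -addrA.
by apply: le_lt_trans (nmD _ _) _; rewrite -ltrBrDr.
Qed.

Definition family_zero (I : Type) (A : I -> C -> C) z :=
  exists2 r : R, 0 < r & forall i w, nm (w - z) < r -> A i w = 0.

(** By [order_family], near any point either the whole family vanishes or some member has no zero in
    a punctured disc. Vanishing of the germ is therefore locally constant. *)
Lemma identity_family (I : Type) (A : I -> C -> C) V z z' : axial_domain V ->
  (forall i w, iota_domain V w -> chol (A i) w) ->
  iota_domain V z -> iota_domain V z' -> 0 <= complex.Im z -> 0 <= complex.Im z' ->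
  family_zero A z -> family_zero A z'.
Proof.
move=> dV hA; apply: iota_connected => // u Du; have [[sV oV] _] := dV.
have [r r0 rP] := iota_domain_open (conj sV oV) Du.
have [A0|[n [G [hG AG [i Gi]]]]] := order_family r0 (fun i w wr => hA i w (rP w wr)).
  exists r => // w wr; split=> _; last first.
    by have [s s0 sP] := ball_sub wr; exists s => // i x /sP; exact: A0.
  by exists r.
have ur : nm (u - u) < r by rewrite subrr nm0.
have [s s0 sP] := ccont_neq0 (chol_cont (hG i u ur)) Gi.
have nz w : nm (w - u) < Num.min r s -> w != u -> A i w != 0.
  rewrite lt_min => /andP[wr ws] wu; rewrite AG // mulf_neq0 ?expf_neq0 ?subr_eq0 //.
  rewrite -nm_gt0; apply: le_lt_trans (sP _ ws); rewrite divr_ge0 ?nm_ge0 //.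
have no w : nm (w - u) < Num.min r s -> ~ family_zero A w.
  move=> wr [e e0 eP]; have [wu|wu] := eqVneq w u; last first.
    by have := nz _ wr wu; rewrite eP ?eqxx // subrr nm0.
  subst w; have [|w wu] := @near_point u (Num.min e (Num.min r s)).
    by rewrite !lt_min e0 r0 s0.
  rewrite lt_min => /andP[we /nz/(_ wu)].
  by rewrite eP ?eqxx.
exists (Num.min r s); first by rewrite lt_min r0.
move=> w wr; split=> h; exfalso; [exact: no wr h|apply: (no u) h].
by rewrite subrr nm0 lt_min r0.
Qed.

(** The coefficients must not vanish together at z itself, which is achieved by dividing out a
    common power ([ldep_reduce]). The relation then gives a nontrivial dependence of the values at
    z. *)
Definition ldep F G z := exists (r : R) (A B : C -> C),
  [/\ 0 < r, forall w, nm (w - z) < r -> chol A w /\ chol B w, (A z != 0) || (B z != 0) &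
      forall w, nm (w - z) < r -> A w *: F w + B w *: G w = 0].

Definition gvanish F z := exists2 r : R, 0 < r & forall w, nm (w - z) < r -> F w = 0.

Definition qholg F z := exists2 r : R, 0 < r & forall w, nm (w - z) < r -> qhol F w.

Lemma ldep_sym F G z : ldep F G z -> ldep G F z.
Proof.
move=> [r [A [B [r0 h n E]]]]; exists r, B, A; split=> //.
- by move=> w /h[].
- by rewrite orbC.
- by move=> w /E; rewrite addrC.
Qed.

Lemma ldep_refl F z : ldep F F z.
Proof.
exists 1, (fun=> 1), (fun=> -1); split=> //.
- by move=> w _; split; exact: chol_cst.
- by rewrite oner_eq0.
- by move=> w _; rewrite scaleN1r scale1r subrr.
Qed.

Lemma ldep0 F G z : gvanish F z -> ldep F G z.
Proof.
move=> [r r0 F0]; exists r, (fun=> 1), (fun=> 0); split=> //.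
- by move=> w _; split; exact: chol_cst.
- by rewrite oner_eq0.
- by move=> w /F0 ->; rewrite scaler0 scale0r addr0.
Qed.

Lemma ldep_factor F G z (h : C -> C) (r : R) : 0 < r ->
  (forall w, nm (w - z) < r -> chol h w /\ F w = h w *: G w) -> ldep F G z.
Proof.
move=> r0 hP; exists r, (fun=> -1), h; split=> //.
- by move=> w /hP[]; split=> //; exact: chol_cst.
- by rewrite oppr_eq0 oner_eq0.
- by move=> w /hP[_ ->]; rewrite scaleN1r addNr.
Qed.

Lemma chol_neq0 (f : C -> C) z : chol f z -> f z != 0 ->
  exists2 r : R, 0 < r & forall w, nm (w - z) < r -> f w != 0.
Proof.
move=> hf f0; have [r r0 rP] := ccont_neq0 (chol_cont hf) f0; exists r => // w /rP.
by rewrite -nm_gt0; apply: le_lt_trans; rewrite divr_ge0 ?nm_ge0.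
Qed.

Lemma qholZ (a : C -> C) F z : chol a z -> qhol F z -> qhol (fun w => a w *: F w) z.
Proof.
move=> ha hF l; apply: (@chol_near _ (fun w => a w * F w 0 l) _ _ 1) => //.
  by move=> w _; rewrite mxE.
exact: cholM.
Qed.

Lemma qholD F G z : qhol F z -> qhol G z -> qhol (fun w => F w + G w) z.
Proof.
move=> hF hG l; apply: (@chol_near _ (fun w => F w 0 l + G w 0 l) _ _ 1) => //.
  by move=> w _; rewrite mxE.
exact: cholD.
Qed.

Lemma qhol_scalar (c : C -> C) z : chol c z -> qhol (fun w => (c w)%:A) z.
Proof.
move=> hc l; apply: (@chol_near _ (fun w => c w * (1 : HC) 0 l) _ _ 1) => //.
  by move=> w _; rewrite mxE.
by apply: cholM => //; exact: chol_cst.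
Qed.

(* Two coefficients can be divided by the lowest power of [w - z] occurring in them. *)
Lemma ldep_reduce F G z (r : R) (A B : C -> C) : 0 < r ->
  (forall w, nm (w - z) < r -> [/\ chol A w, chol B w, qhol F w & qhol G w]) ->
  (forall w, nm (w - z) < r -> A w *: F w + B w *: G w = 0) ->
  (forall w, nm (w - z) < r -> A w = 0 /\ B w = 0) \/ ldep F G z.
Proof.
move=> r0 h E; pose P (b : bool) := if b then A else B.
have hP b w : nm (w - z) < r -> chol (P b) w by move=> /h[hA hB _ _]; case: b.
have [P0|[n [K [hK PK [i Ki]]]]] := order_family r0 hP.
  by left=> w wr; split; [exact: (P0 true)|exact: (P0 false)].
right; exists r, (K true), (K false); split=> //.
- by move=> w wr; split; exact: hK.
- by case: i Ki => ->; rewrite ?orbT.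
apply: (order_cancel (n := n)) => // w wr.
  by have [_ _ hF hG] := h w wr; apply: qholD; apply: qholZ => //; exact: hK.
rewrite scalerDr !scalerA -(PK true) // -(PK false) //; exact: E.
Qed.

(** Eliminating G leaves the coefficients A A' and - B B'. If both vanish identically near z, then
    either A' does, and K vanishes near z, or B' does, and G would vanish near z, which is
    excluded. *)
Lemma ldep_trans F G K z : qholg F z -> qholg K z -> ~ gvanish G z ->
  ldep F G z -> ldep G K z -> ldep F K z.
Proof.
move=> [r1 r10 hF] [r2 r20 hK] G0 [r3 [A [B [r30 hAB nAB E]]]] [r4 [A' [B' [r40 hAB' nAB' E']]]].
pose r := Num.min (Num.min r1 r2) (Num.min r3 r4).
have r0 : 0 < r by rewrite !lt_min r10 r20 r30.
have rP w : nm (w - z) < r -> [/\ nm (w - z) < r1, nm (w - z) < r2, nm (w - z) < r3 & nm (w - z) < r4].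
  by rewrite !lt_min => /andP[/andP[-> ->] /andP[-> ->]].
clearbody r.
have z3 : nm (z - z) < r3 by rewrite subrr nm0.
have z4 : nm (z - z) < r4 by rewrite subrr nm0.
have [||h|//] := @ldep_reduce F K z r (fun w => A w * A' w) (fun w => - (B w * B' w)) r0.
- move=> w /rP[/hF ? /hK ? /hAB[? ?] /hAB'[? ?]]; split=> //; first exact: cholM.
  by apply: cholN; exact: cholM.
- move=> w /rP[_ _ /E e /E' e'].
  have -> : (A w * A' w) *: F w = A' w *: (- (B w *: G w)).
    by rewrite mulrC -scalerA; congr (_ *: _); apply/eqP; rewrite -addr_eq0 e.
  have -> : - (B w * B' w) *: K w = B w *: (A' w *: G w).
    rewrite scaleNr -scalerA -scalerN; congr (_ *: _); apply/eqP.
    by rewrite eq_sym -addr_eq0 e'.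
  by rewrite scalerN !scalerA mulrC addNr.
have [Az|Az] := eqVneq (A z) 0; last first.
  have [s s0 sP] := chol_neq0 (hAB z z3).1 Az.
  have A'0 w : nm (w - z) < Num.min r s -> A' w = 0.
    rewrite lt_min => /andP[/h[/eqP + _] /sP]; by rewrite mulf_eq0 => /orP[->|/eqP].
  have zz : nm (z - z) < Num.min r s by rewrite subrr nm0 lt_min r0 s0.
  have B'z : B' z != 0 by move: nAB'; rewrite A'0 // eqxx.
  have [t t0 tP] := chol_neq0 (hAB' z z4).2 B'z.
  apply: ldep_sym; apply: ldep0; exists (Num.min (Num.min r s) t); first by rewrite !lt_min r0 s0.
  move=> w; rewrite lt_min => /andP[wr /tP b0].
  have := wr; rewrite lt_min => /andP[/rP[_ _ _ /E' + _]].
  by rewrite A'0 // scale0r add0r => /eqP; rewrite scaler_eq0 (negbTE b0) => /eqP.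
have Bz : B z != 0 by move: nAB; rewrite Az eqxx.
have [s s0 sP] := chol_neq0 (hAB z z3).2 Bz.
have B'0 w : nm (w - z) < Num.min r s -> B' w = 0.
  rewrite lt_min => /andP[/h[_ /eqP +] /sP]; by rewrite oppr_eq0 mulf_eq0 => /orP[->|/eqP].
have zz : nm (z - z) < Num.min r s by rewrite subrr nm0 lt_min r0 s0.
have A'z : A' z != 0 by move: nAB'; rewrite B'0 // eqxx orbF.
have [t t0 tP] := chol_neq0 (hAB' z z4).1 A'z.
case: G0; exists (Num.min (Num.min r s) t); first by rewrite !lt_min r0 s0.
move=> w; rewrite lt_min => /andP[wr /tP a0].
have := wr; rewrite lt_min => /andP[/rP[_ _ _ /E' + _]].
by rewrite B'0 // scale0r addr0 => /eqP; rewrite scaler_eq0 (negbTE a0) => /eqP.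
Qed.

(** Over a real centre, conjugating the relation gives another one, and the sum of both has
    symmetric coefficients. If the values at z cancel in this sum, they do not once the relation has
    been multiplied by iota. *)
Lemma ldep_coeffs F G z (r0 : R) : symmetric_disc z r0 ->
  (complex.Im z = 0 -> forall w, nm (w - z) < r0 ->
     F (conjc w) = mapq (@conjc R) (F w) /\ G (conjc w) = mapq (@conjc R) (G w)) ->
  ldep F G z -> exists (r : R) (A B : C -> C),
  [/\ 0 < r <= r0, forall w, nm (w - z) < r -> chol A w /\ chol B w, (A z != 0) || (B z != 0),
      forall w, nm (w - z) < r -> A w *: F w + B w *: G w = 0 &
      complex.Im z = 0 -> forall w, A (conjc w) = conjc (A w) /\ B (conjc w) = conjc (B w)].
Proof.
move=> [z0 r00 zr] sFG [r [A [B [r0' hAB nAB E]]]].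
have [zi|zi] := eqVneq (complex.Im z) 0; last first.
  exists (Num.min r0 r), A, B; split=> //; last by move=> z0'; rewrite z0' eqxx in zi.
  - by rewrite lt_min r00 r0' ge_min lexx.
  - by move=> w; rewrite lt_min => /andP[_ /hAB].
  - by move=> w; rewrite lt_min => /andP[_ /E].
have zc : conjc z = z by case: (z) zi => a b /= ->; rewrite oppr0.
have cr w (s : R) : nm (w - z) < s -> nm (conjc w - z) < s.
  by rewrite -{2}zc -rmorphB nm_conj.
have cD (x y : C) : conjc (x + y) = conjc x + conjc y by exact: rmorphD.
have cM (x y : C) : conjc (x * y) = conjc x * conjc y by exact: rmorphM.
have EE w : nm (w - z) < Num.min r0 r ->
    conjc (A (conjc w)) *: F w + conjc (B (conjc w)) *: G w = 0.
  rewrite lt_min => /andP[w0 wr]; have := E _ (cr _ _ wr).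
  have [-> ->] := sFG zi _ w0 => /rowP e; apply/rowP => l; have := congr1 (@conjc R) (e l).
  by rewrite !mxE conjc0 cD !cM !conjcK.
pose Q (c : C) (f : C -> C) w := c * f w + conjc (c * f (conjc w)).
have key (c : C) : (Q c A z != 0) || (Q c B z != 0) -> exists (r : R) (A B : C -> C),
  [/\ 0 < r <= r0, forall w, nm (w - z) < r -> chol A w /\ chol B w, (A z != 0) || (B z != 0),
      forall w, nm (w - z) < r -> A w *: F w + B w *: G w = 0 &
      complex.Im z = 0 -> forall w, A (conjc w) = conjc (A w) /\ B (conjc w) = conjc (B w)].
  move=> nQ; exists (Num.min r0 r), (Q c A), (Q c B); split=> //.
  - by rewrite lt_min r00 r0' ge_min lexx.
  - move=> w; rewrite lt_min => /andP[_ wr]; have [hA hB] := hAB _ wr.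
    have [hA' hB'] := hAB _ (cr _ _ wr).
    have K (f : C -> C) : chol f w -> chol f (conjc w) -> chol (Q c f) w.
      move=> h1 h2; apply: cholD; first by apply: cholM => //; exact: chol_cst.
      apply: (@chol_conj _ (fun u => c * f u)).
      by apply: cholM => //; exact: chol_cst.
    by split; exact: K.
  - move=> w wr; have := wr; rewrite lt_min => /andP[_ /E e].
    have e' := EE _ wr.
    rewrite /Q !cM !scalerDl addrACA -!scalerA -!scalerDr e.
    by move: e' => /= ->; rewrite !scaler0 addr0.
  - by move=> _ w; rewrite /Q conjcK !cD !conjcK; split; rewrite addrC.
have [q1|] := boolP ((Q 1 A z != 0) || (Q 1 B z != 0)); first exact: (key 1).
rewrite negb_or !negbK => /andP[qA qB]; apply: (key 'i).
apply: contraLR nAB; rewrite !negb_or !negbK => /andP[qA' qB'].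
have K (f : C -> C) : Q 1 f z == 0 -> Q 'i f z == 0 -> f z == 0.
  rewrite /Q zc !mul1r; case: (f z) => a b.
  rewrite !eq_complex /= => /andP[/eqP h1 _] /andP[/eqP h2 _].
  by apply/andP; split; apply/eqP; lra.
by apply/andP; split; exact: K.
Qed.

End Germs.

(** * From vectorial functions to germs of stem functions *)

Section VectorialGerms.
Variable R : realType.
Local Notation C := R[i].
Local Notation H := (quat R).
Local Notation HC := (quat R[i]).
Local Notation nm := (@Normc.normc R).
Implicit Types (V W : set H) (f g a b : H -> H) (F G : C -> HC) (z w : C) (J p q : H) (v u : vfun R).

Lemma slice_val0 J : slice_val J 0 = 0 :> H.
Proof.
have e (k : C -> R) : k 0 = 0 -> mapq k (0 : HC) = 0 by move=> k0; apply/rowP => l; rewrite !mxE.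
by rewrite /slice_val !e // mulr0 addr0.
Qed.

Lemma slice_val_comb J (c c' : C) (y y' : HC) : imunit J -> slice_val J (c *: y + c' *: y') =
  embed J c * slice_val J y + embed J c' * slice_val J y'.
Proof. by move=> uJ; rewrite slice_valD !slice_val_scalarM. Qed.

Lemma slice_val_eq0 (y : HC) : (forall J : H, imunit J -> slice_val J y = 0) -> y = 0.
Proof.
move=> h; have := h qi (@imunit_qi R); have := h (- qi) (imunitN (@imunit_qi R)).
rewrite /slice_val mulNr; set a := mapq _ _; set b := qi * _ => h1 h2.
have a0 : a = 0.
  apply/rowP => l; have := congr1 (fun t : H => t 0 l) h1; have := congr1 (fun t : H => t 0 l) h2.
  by move: a b {h1 h2} => a b; rewrite !mxE /=; lra.
have {h1 h2} b0 : b = 0 by move: h2; rewrite a0 add0r.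
have c0 : mapq (@complex.Im R) y = 0.
  have := congr1 (fun t : H => - (qi * t)) b0.
  by rewrite /b mulrA -expr2 (@imunit_qi R) mulN1r opprK mulr0 oppr0.
apply/rowP => l; rewrite [RHS]mxE; apply/eqP; rewrite eq_complex.
have := congr1 (fun t : H => t 0 l) a0; have := congr1 (fun t : H => t 0 l) c0.
by rewrite /a !mxE => -> ->; rewrite !eqxx.
Qed.

Lemma mapq_conj_scalar (c : C) : mapq (@conjc R) (c%:A : HC) = (conjc c)%:A.
Proof. by apply: quatP; rewrite !mxE /= ?mulr1 ?mulr0 ?conjc0. Qed.

Lemma tube_center q (r : R) : 0 < r -> tube (sphere_point q) r q.
Proof. by move=> r0; rewrite /tube /mkset subrr nm0. Qed.

Lemma sphere_pointK z J : 0 <= complex.Im z -> imunit J -> sphere_point (embed J z) = z.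
Proof. by move=> z0 uJ; rewrite sphere_point_embed // ger0_norm //; case: z z0. Qed.

Lemma stem_zero V f z : axially_symmetric V -> (forall q, V q -> f q = 0) ->
  iota_domain V z -> stem f z = 0.
Proof.
move=> sV f0; apply: (stem_unique sV (F := fun=> 0)) => x y J uJ VJ.
by rewrite f0 // -/(slice_val J 0) slice_val0.
Qed.

Lemma slice_regular_sub V W f : W `<=` V -> slice_regular V f -> slice_regular W f.
Proof.
move=> WV [F [sF hF iF]]; have D z : iota_domain W z -> iota_domain V z.
  by move=> [J uJ WJ]; exists J => //; exact: WV.
by exists F; split=> [z /D/sF|z /D/hF|x y J uJ /WV/iF-> //].
Qed.

Lemma vectorial_sub V W f : W `<=` V -> vectorial V f -> vectorial W f.
Proof. by move=> WV [h1 h2]; split; [exact: slice_regular_sub h1|move=> q /WV/h2]. Qed.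

Lemma vectorial_stemP V f : axial_open V -> slice_regular V f ->
  vectorial V f <-> forall z, iota_domain V z -> stem f z 0 0 = 0.
Proof.
move=> oV hf; have [sV _] := oV; have [sf hsf fi] := stem_facts oV hf.
have iC := component_induces 0 sV sf fi.
split=> [[_ f0] z Dz|f0]; last first.
  split=> // q; have [J uJ ->] := sphere_point_polar q => Vq.
  rewrite /scalar_part (induces_val iC uJ Vq) slice_val_scalar f0 ?/embed ?scale0r ?addr0 //.
  by exists J.
have := stem_zero sV f0 Dz; rewrite (stem_unique sV iC Dz) => /rowP/(_ 0).
by rewrite !mxE /= mulr1.
Qed.

Lemma vector_part_induces V g : axial_open V -> slice_regular V g ->
  induces V (fun z => qvec (stem g z)) (vector_part g).
Proof.
move=> oV hg x y J uJ VJ; have [sV _] := oV; have [sg _ ig] := stem_facts oV hg.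
rewrite /vector_part !(component_induces _ sV sg ig uJ VJ).
have := slice_value_sum (qvec (stem g (x +i* y))) J; cbv zeta beta => ->.
have -> : qvec (stem g (x +i* y)) 0 0 = 0 by rewrite mxE.
have -> : qvec (stem g (x +i* y)) 0 1 = stem g (x +i* y) 0 1 by rewrite mxE.
have -> : qvec (stem g (x +i* y)) 0 2 = stem g (x +i* y) 0 2 by rewrite mxE.
have -> : qvec (stem g (x +i* y)) 0 3 = stem g (x +i* y) 0 3 by rewrite mxE.
by rewrite scale0r -/(slice_val J 0) slice_val0 add0r.
Qed.

Lemma stem_vector_part V g z : axial_open V -> slice_regular V g -> iota_domain V z ->
  stem (vector_part g) z = qvec (stem g z).
Proof. by move=> oV hg; have [sV _] := oV; exact: stem_unique sV (vector_part_induces oV hg). Qed.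

Lemma qhol_qvec F z : qhol F z -> qhol (fun w => qvec (F w)) z.
Proof.
move=> hF [[|[|[|[|//]]]] il].
- by apply: (@chol_near _ (fun=> 0) _ _ 1) => //; [move=> w _; rewrite mxE|exact: chol_cst].
- by apply: (@chol_near _ (fun w => F w 0 1) _ _ 1) => // w _; rewrite mxE.
- by apply: (@chol_near _ (fun w => F w 0 2) _ _ 1) => // w _; rewrite mxE.
- by apply: (@chol_near _ (fun w => F w 0 3) _ _ 1) => // w _; rewrite mxE.
Qed.

Lemma qvec_conj (y : HC) : qvec (mapq (@conjc R) y) = mapq (@conjc R) (qvec y).
Proof. by apply: quatP; rewrite !mxE /= ?mxE ?conjc0 ?oppr0. Qed.

Lemma vector_part_vectorial V g : axial_open V -> slice_regular V g -> vectorial V (vector_part g).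
Proof.
move=> oV hg; have [sg hsg ig] := stem_facts oV hg.
have hv : slice_regular V (vector_part g).
  exists (fun z => qvec (stem g z)); split; last exact: vector_part_induces.
  - by move=> z Dz; rewrite sg // qvec_conj.
  - by move=> z /hsg hz; apply/derivable_quatP; exact: qhol_qvec.
apply/(vectorial_stemP oV hv) => z Dz.
by rewrite (stem_vector_part oV hg Dz) mxE.
Qed.

Lemma slice_preserving_of V F (c : C -> C) : (forall z, F z = (c z)%:A) -> stem_function V F ->
  (forall z, iota_domain V z -> chol c z) -> slice_preserving V (slice_of F) /\
  forall z J, imunit J -> V (embed J z) -> slice_of F (embed J z) = embed J (c z).
Proof.
move=> FE sF hc; have E z J : imunit J -> V (embed J z) -> slice_of F (embed J z) = embed J (c z).
  by move=> uJ VJ; rewrite (induces_val (slice_ofP sF) uJ VJ) FE slice_val_scalar.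
split=> //; split.
  apply: (slice_regular_of sF) => z /hc/qhol_scalar.
  by apply: (@qhol_near _ _ _ _ 1).
move=> J q uJ [Vq [x [y qE]]]; have qE' : q = embed J (x +i* y) by [].
by rewrite qE' E -?qE' //; exists (complex.Re (c (x +i* y))), (complex.Im (c (x +i* y))).
Qed.

Lemma slice_preserving_stem V a : axial_open V -> slice_preserving V a ->
  exists c : C -> C, forall z, iota_domain V z -> [/\ chol c z, c (conjc z) = conjc (c z),
    stem a z = (c z)%:A & forall J, imunit J -> a (embed J z) = embed J (c z)].
Proof.
move=> oV pa; have [ra _] := pa; have [sV _] := oV; have [sa ha ia] := stem_facts oV ra.
exists (fun z => stem a z 0 0) => z Dz; split; first exact: ha.
- by rewrite sa // mxE.
- exact: stem_slice_preserving sV pa Dz.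
- move=> J uJ; rewrite (induces_val ia uJ ((iota_domainP z sV uJ).1 Dz)).
  by rewrite -slice_val_scalar -(stem_slice_preserving sV pa Dz).
Qed.

Lemma embed_eq0 J z : imunit J -> embed J z = 0 -> z = 0.
Proof.
move=> uJ E; rewrite -(embedK uJ z) E -[0 in LHS](_ : embed J 0 = 0) ?embedK //.
by rewrite /embed !scale0r addr0.
Qed.

Lemma vfun_at_stem p v : vfun_at p v -> [/\ axial_open v.1, iota_domain v.1 (sphere_point p),
  stem_function v.1 (stem v.2), forall z, iota_domain v.1 z -> qhol (stem v.2) z &
  induces v.1 (stem v.2) v.2].
Proof.
move=> [[oV _] Vp vv]; have [rv _] := vv; have [s h i] := stem_facts oV rv; split=> //.
exact: sphere_point_iota.
Qed.

Lemma vfun_at_qholg p v : vfun_at p v -> qholg (stem v.2) (sphere_point p).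
Proof.
move=> /vfun_at_stem[oV Dz _ hv _]; have [r r0 rP] := iota_domain_open oV Dz.
by exists r => // w /rP/hv.
Qed.

Lemma vanishes_atP p v : vfun_at p v -> vanishes_at p v <-> gvanish (stem v.2) (sphere_point p).
Proof.
move=> hv; have [oV Dz _ _ iv] := vfun_at_stem hv; split.
  move=> [W [[oW _] Wp _ v0]]; have [sW _] := oW.
  have [r r0 rP] := iota_domain_open oW (sphere_point_iota Wp).
  by exists r => // w /rP; exact: stem_zero.
move=> [r r0 v0]; have [s [z0 s0 _] sP] := tube_sub oV Dz (sphere_point_upper p).
have m0 : 0 < Num.min r s by rewrite lt_min r0.
exists (tube (sphere_point p) (Num.min r s)); split.
- exact: tube_axial_domain.
- exact: tube_center.
- by apply: (sP _ _).1; rewrite ge_min lexx orbT.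
move=> q qt; have Vq : v.1 q by apply: (sP _ _).1 qt; rewrite ge_min lexx orbT.
have [J uJ qE] := sphere_point_polar q; rewrite qE in Vq *.
rewrite (induces_val iv uJ Vq) v0 ?slice_val0 //.
by apply: lt_le_trans qt _; rewrite ge_min lexx.
Qed.

(** Slice-preserving coefficients have scalar stem functions. If these vanished near the sphere
    point of p, the identity theorem would make them vanish on all of W; so a common power can be
    divided out. Conversely, symmetric coefficients on a disc extend by reflection to a tube. *)
Lemma vequivP p v u : vfun_at p v -> vfun_at p u ->
  vequiv p v u <-> ldep (stem v.2) (stem u.2) (sphere_point p).
Proof.
move=> hv hu; have [oV Dv sv hhv iv] := vfun_at_stem hv.
have [oU Du su hhu iu] := vfun_at_stem hu; have [sV _] := oV; have [sU _] := oU.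
have z0 := sphere_point_upper p; split.
  move=> [W [dW Wp WVU [a [b [pa pb nab E]]]]]; have [oW _] := dW; have [sW _] := oW.
  have Dz := sphere_point_iota Wp.
  have [A AP] := slice_preserving_stem oW pa; have [B BP] := slice_preserving_stem oW pb.
  have DV w : iota_domain W w -> iota_domain v.1 w by move=> [J uJ /WVU[]]; exists J.
  have DU w : iota_domain W w -> iota_domain u.1 w by move=> [J uJ /WVU[]]; exists J.
  have AB w : iota_domain W w -> A w *: stem v.2 w + B w *: stem u.2 w = 0.
    move=> Dw; apply: slice_val_eq0 => J uJ.
    have WJ := (iota_domainP w sW uJ).1 Dw; have [VJ UJ] := WVU _ WJ.
    rewrite slice_val_comb //; have [_ _ _ <-//] := AP w Dw; have [_ _ _ <-//] := BP w Dw.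
    by have := E _ WJ; rewrite (induces_val iv uJ VJ) (induces_val iu uJ UJ).
  have [r r0 rP] := iota_domain_open oW Dz.
  have [||AB0|//] := @ldep_reduce R (stem v.2) (stem u.2) (sphere_point p) r A B r0.
  - move=> w /rP Dw; have [? _ _ _] := AP w Dw; have [? _ _ _] := BP w Dw.
    by split=> //; [apply: hhv; exact: DV|apply: hhu; exact: DU].
  - by move=> w /rP/AB.
  case: nab => q Wq; pose P (c : bool) := if c then A else B.
  have hP c w : iota_domain W w -> chol (P c) w.
    by move=> Dw; have [? _ _ _] := AP w Dw; have [? _ _ _] := BP w Dw; case: c.
  have P0 : family_zero P (sphere_point p).
    by exists r => // -[] w /AB0[].
  have [J uJ qE] := sphere_point_polar q.
  have Dq := sphere_point_iota Wq.
  have [s s0 sP] := identity_family dW hP Dz Dq z0 (sphere_point_upper q) P0.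
  have ss : nm (sphere_point q - sphere_point q) < s by rewrite subrr nm0.
  have [_ _ _ aE] := AP _ Dq; have [_ _ _ bE] := BP _ Dq.
  rewrite qE aE // bE //; have /= -> := sP true _ ss; have /= -> := sP false _ ss.
  by rewrite /embed !scale0r addr0.
move=> hd; set z := sphere_point p in z0 Dv Du hd *.
have [r1 d1 P1] := tube_sub oV Dv z0; have [r2 [_ r20 _] P2] := tube_sub oU Du z0.
have [_ r10 _] := d1.
have d : symmetric_disc z (Num.min r1 r2).
  by apply: (symmetric_disc_le d1); rewrite lt_min r10 r20 ge_min lexx.
have [|r [A [B [/andP[r0 rr] hAB nAB E sAB]]]] := ldep_coeffs d _ hd.
  move=> _ w; rewrite lt_min => /andP[w1 w2]; split.
    by apply: sv; apply: (P1 r1 (lexx _)).2.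
  by apply: su; apply: (P2 r2 (lexx _)).2.
have dr : symmetric_disc z r by apply: (symmetric_disc_le d); rewrite r0.
have rr1 : r <= r1 by apply: le_trans rr _; rewrite ge_min lexx.
have rr2 : r <= r2 by apply: le_trans rr _; rewrite ge_min lexx orbT.
have key (c : C -> C) : (forall w, nm (w - z) < r -> chol c w) ->
    (complex.Im z = 0 -> forall w, c (conjc w) = conjc (c w)) ->
    exists a, slice_preserving (tube z r) a /\
      forall w J, imunit J -> nm (w - z) < r -> a (embed J w) = embed J (c w).
  move=> hc sc; have [||sF hF FE] := @sym_extP R (fun w => (c w)%:A) z r dr.
  - by move=> w /hc; exact: qhol_scalar.
  - by move=> zi w _; rewrite sc // mapq_conj_scalar.
  have [||pa aE] := @slice_preserving_of (tube z r) (sym_ext (fun w => (c w)%:A) z r)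
      (fun w => sym_ext (fun w => (c w)%:A) z r w 0 0) _ sF.
  - by move=> w; rewrite /sym_ext; case: ifP => _; rewrite ?mapq_conj_scalar !mxE /= ?mulr1.
  - by move=> w /hF.
  exists (slice_of (sym_ext (fun w => (c w)%:A) z r)); split=> // w J uJ wr.
  have tJ : tube z r (embed J w) by apply/(tube_embed r w z0 uJ); left.
  by rewrite aE // FE // !mxE /= mulr1.
have [||a [pa aE]] := key A; [by move=> w /hAB[]|by move=> zi w; have [] := sAB zi w|].
have [||b [pb bE]] := key B; [by move=> w /hAB[]|by move=> zi w; have [] := sAB zi w|].
have tp : tube z r p by exact: tube_center.
exists (tube z r); split=> //.
- exact: tube_axial_domain.
- by move=> q tq; split; [exact: (P1 r rr1).1|exact: (P2 r rr2).1].
exists a, b; split=> //.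
- move=> /(_ p tp) []; have [J uJ ->] := sphere_point_polar p; rewrite -/z.
  have zz : nm (z - z) < r by rewrite subrr nm0.
  rewrite aE // bE // => /(embed_eq0 uJ) Az /(embed_eq0 uJ) Bz.
  by move: nAB; rewrite Az Bz eqxx.
move=> q tq; have Vq := (P1 r rr1).1 _ tq; have Uq := (P2 r rr2).1 _ tq.
have [J uJ qE] := sphere_point_polar q; rewrite qE in Vq Uq *.
rewrite aE // bE // (induces_val iv uJ Vq) (induces_val iu uJ Uq).
by rewrite -slice_val_comb // E // slice_val0.
Qed.

Lemma vclassP p v u : vfun_at p v -> vclass p v u <-> [/\ vfun_at p u,
  ldep (stem v.2) (stem u.2) (sphere_point p) &
  gvanish (stem v.2) (sphere_point p) <-> gvanish (stem u.2) (sphere_point p)].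
Proof.
move=> hv; split=> -[hu h1 h2]; have ev := vanishes_atP hv; have eu := vanishes_atP hu.
  split; [exact: hu|exact: (vequivP hv hu).1 h1|].
  by split=> h; [exact: eu.1 (h2.1 (ev.2 h))|exact: ev.1 (h2.2 (eu.2 h))].
split; [exact: hu|exact: (vequivP hv hu).2 h1|].
by split=> h; [exact: eu.2 (h2.1 (ev.1 h))|exact: ev.2 (h2.2 (eu.1 h))].
Qed.

(** Transitivity of dependence has to pass through a germ that does not vanish. The clause on
    vanishing germs in [vclass] separates the remaining case, in which dependence is automatic. *)
Lemma vclass_eqP p v u : vfun_at p v -> vfun_at p u -> vclass p v = vclass p u <->
  ldep (stem v.2) (stem u.2) (sphere_point p) /\
  (gvanish (stem v.2) (sphere_point p) <-> gvanish (stem u.2) (sphere_point p)).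
Proof.
move=> hv hu; split=> [E|[d n]].
  have : vclass p v u by rewrite E; apply/(vclassP _ hu); split; [exact: hu|exact: ldep_refl|].
  by move/(vclassP _ hv) => [].
have key v' u' : vfun_at p v' -> vfun_at p u' -> ldep (stem v'.2) (stem u'.2) (sphere_point p) ->
    (gvanish (stem v'.2) (sphere_point p) <-> gvanish (stem u'.2) (sphere_point p)) ->
    vclass p v' `<=` vclass p u'.
  move=> hv' hu' d' n' t /(vclassP _ hv')[ht dt nt]; apply/(vclassP _ hu'); split; first exact: ht.
    have [g0|g0] := pselect (gvanish (stem u'.2) (sphere_point p)); first exact: ldep0.
    apply: (ldep_trans (vfun_at_qholg hu') (vfun_at_qholg ht) _ (ldep_sym d') dt).
    by move=> h; exact: g0 (n'.1 h).
  by split=> h; [exact: nt.1 (n'.2 h)|exact: n'.1 (nt.2 h)].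
apply/seteqP; split; first exact: key hv hu d n.
by apply: key hu hv (ldep_sym d) _; split=> h; [exact: n.2 h|exact: n.1 h].
Qed.

Lemma class0P p v : vfun_at p v -> gvanish (stem v.2) (sphere_point p) -> vclass p v = class0 p.
Proof.
move=> hv v0; apply/seteqP; split=> u.
  move=> [hu _ h2]; split; first exact: hu; last first.
    split=> _; first by apply: h2.1; exact/(vanishes_atP hv).
    exists (tube (sphere_point p) 1); split=> //.
      exact: tube_axial_domain (sphere_point_upper p) ltr01.
    by apply: tube_center.
  exists u.1; case: hu => du up [ru _]; split=> //.
  have [|||p1 E1] := @slice_preserving_of u.1 (fun=> (1 : C)%:A) (fun=> 1) _ _.
  - by [].
  - by move=> z _; rewrite mapq_conj_scalar (rmorph1 (@conjc R)).
  - by move=> z _; exact: chol_cst.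
  exists (slice_of (fun=> (1 : C)%:A)), (fun=> 0); split=> //.
  - exact: slice_preserving0.
  - move=> /(_ p up)[+ _]; have [J uJ pE] := sphere_point_polar p; rewrite pE in up *.
    by rewrite E1 // => /(embed_eq0 uJ)/eqP; rewrite oner_eq0.
  - by move=> q _; rewrite mulr0 mul0r addr0.
move=> [hu h1 h2]; apply/(vclassP _ hv).
have u0 : gvanish (stem u.2) (sphere_point p).
  apply/(vanishes_atP hu); apply/h2.
  by case: hu => ? ? _; exists u.1; split.
by split=> //; exact: ldep0.
Qed.

End VectorialGerms.

(** * Vectorial classes and minimal representatives *)

Section VectorialClass.
Variable R : realType.
Local Notation C := R[i].
Local Notation H := (quat R).
Local Notation HC := (quat R[i]).
Local Notation nm := (@Normc.normc R).
Implicit Types (U W : set H) (f g w : H -> H) (F G : C -> HC) (z : C) (J p q : H) (v u : vfun R).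

Lemma vfun_at_move p p' v : vfun_at p v -> v.1 p' -> vfun_at p' v.
Proof. by case. Qed.

Lemma vfun_restrict p v W : vfun_at p v -> axial_open W -> W p ->
  exists v', [/\ vfun_at p v', v'.1 `<=` W & vclass p v' = vclass p v].
Proof.
move=> hv oW Wp; have [oV Dv _ _ _] := vfun_at_stem hv; have z0 := sphere_point_upper p.
have [r1 [_ r10 _] P1] := tube_sub oV Dv z0.
have [r2 [_ r20 _] P2] := tube_sub oW (sphere_point_iota Wp) z0.
have m0 : 0 < Num.min r1 r2 by rewrite lt_min r10.
have s1 : tube (sphere_point p) (Num.min r1 r2) `<=` v.1 by apply: (P1 _ _).1; rewrite ge_min lexx.
have s2 : tube (sphere_point p) (Num.min r1 r2) `<=` W by apply: (P2 _ _).1; rewrite ge_min lexx orbT.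
have hv' : vfun_at p (tube (sphere_point p) (Num.min r1 r2), v.2).
  split; [exact: tube_axial_domain|exact: tube_center|].
  by case: hv => _ _; exact: vectorial_sub.
exists (tube (sphere_point p) (Num.min r1 r2), v.2); split; [exact: hv'|exact: s2|].
by apply/(vclass_eqP hv' hv); split; [exact: ldep_refl|].
Qed.

Variables (V : set H) (om : H -> set (vfun R)).
Hypothesis dV : axial_domain V.
Hypothesis hom : vectorial_class V om.

(** Once a representative at p is shrunk into V, the compatibility condition compares it with a
    representative at every point of its domain. *)
Lemma class_local_rep p : V p -> exists v,
  [/\ vfun_at p v, v.1 `<=` V & forall p', v.1 p' -> om p' = vclass p' v].
Proof.
move=> Vp; have [oV _] := dV.
have loc p' : V p' -> exists v, [/\ vfun_at p' v, v.1 `<=` V & om p' = vclass p' v].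
  move=> Vp'; have [v0 hv0 E0] := hom.1 p' Vp'.
  by have [v [hv vV E]] := vfun_restrict hv0 oV Vp'; exists v; split=> //; rewrite E.
have [v [hv vV E]] := loc p Vp; exists v; split=> // p' vp'.
have [u [hu uV E']] := loc p' (vV _ vp'); rewrite E'; apply/esym.
by apply: (hom.2 p p' v u Vp (vV _ vp') hv vV E hu uV E'); split=> //; case: hu.
Qed.

(** Were the class zero at p, it would be zero on all of V: by the identity theorem a local
    representative vanishes near all spheres of its domain or near none, so being the zero class is
    locally constant. *)
Lemma class_nonvanishing p v : ~ is_class0 V om -> V p -> vfun_at p v -> om p = vclass p v ->
  ~ gvanish (stem v.2) (sphere_point p).
Proof.
move=> hn Vp hv E v0; apply: hn; have [[sV oV] _] := dV.
have uqi := @imunit_qi R.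
(* Indexed by the stem plane through [embed qi], as [iota_connected] requires; [toX] and [ofX] pass
   to the other points of a sphere. *)
pose X z := exists u, [/\ vfun_at (embed qi z) u, om (embed qi z) = vclass (embed qi z) u &
  gvanish (stem u.2) (sphere_point (embed qi z))].
have transfer u a b : vfun_at a u -> u.1 b -> gvanish (stem u.2) (sphere_point a) ->
    gvanish (stem u.2) (sphere_point b).
  move=> hu ub [r r0 u0]; have [oU Du _ hhu _] := vfun_at_stem hu.
  have [dU _ _] := hu.
  have [||s s0 sP] := @identity_family R 'I_4 (fun l t => stem u.2 t 0 l) u.1 (sphere_point a)
      (sphere_point b) dU _ Du (sphere_point_iota ub) (sphere_point_upper a) (sphere_point_upper b).
  - by move=> l t /hhu.
  - by exists r => // l t /u0 ->; rewrite mxE.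
  - by exists s => // t ts; apply/rowP => l; rewrite (sP l t ts) mxE.
have same u u' a : vfun_at a u -> vfun_at a u' -> om a = vclass a u -> om a = vclass a u' ->
    gvanish (stem u.2) (sphere_point a) -> gvanish (stem u'.2) (sphere_point a).
  move=> hu hu' e e'; have [_ [h _]] := (vclass_eqP hu hu').1 (etrans (esym e) e').
  exact: h.
have locX z : iota_domain V z -> exists2 r : R, 0 < r & forall t, nm (t - z) < r -> (X t <-> X z).
  move=> Dz; have Vz := (iota_domainP z sV uqi).1 Dz.
  have [u [hu uV Eu]] := class_local_rep Vz.
  have [dU uz _] := hu; have [[sU oU] _] := dU.
  have [r r0 rP] := iota_domain_open (conj sU oU) ((iota_domainP z sU uqi).2 uz).
  exists r => // t /rP Dt; have ut := (iota_domainP t sU uqi).1 Dt.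
  have hut := vfun_at_move hu ut.
  split=> -[u' [hu' E' v0']]; exists u; split.
  - exact: hu.
  - exact: Eu.
  - exact: transfer hut uz (same _ _ _ hu' hut E' (Eu _ ut) v0').
  - exact: hut.
  - exact: Eu.
  - exact: transfer hu ut (same _ _ _ hu' hu E' (Eu _ uz) v0').
have toX a : V a -> forall u, vfun_at a u -> om a = vclass a u -> gvanish (stem u.2) (sphere_point a) ->
    X (sphere_point a).
  move=> Va u hu Eu u0; have [u' [hu' uV' Eu']] := class_local_rep Va.
  have [[[sU' _] _] ua' _] := hu'; have Ua := sphere_point_iota ua'.
  have ub := (iota_domainP _ sU' uqi).1 Ua.
  exists u'; split; [exact: vfun_at_move hu' ub|exact: Eu'|].
  exact: transfer hu' ub (same _ _ _ hu hu' Eu (Eu' _ ua') u0).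
have ofX a : V a -> X (sphere_point a) -> om a = class0 a.
  move=> Va [u [hu Eu u0]]; have [u' [hu' uV' Eu']] := class_local_rep Va.
  have [[[sU' _] _] ua' _] := hu'; have Ua := sphere_point_iota ua'.
  have ub := (iota_domainP _ sU' uqi).1 Ua.
  have hub := vfun_at_move hu' ub.
  rewrite (Eu' _ ua'); apply: (class0P hu').
  exact: transfer hub ua' (same _ _ _ hu hub Eu (Eu' _ ub) u0).
move=> a Va; apply: (ofX a Va).
apply: (iota_connected dV locX (sphere_point_iota Vp) (sphere_point_iota Va)).
- exact: sphere_point_upper.
- exact: sphere_point_upper.
- exact: (toX p Vp v hv E v0).
Qed.

(** A zero of the stem function at z is a zero of w on the whole sphere of z, or at a real point;
    minimality excludes both. *)
Lemma minrep_stem U w : minimal_rep V om U w ->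
  [/\ axial_open U, U `<=` V, stem_function U (stem w),
      forall z, iota_domain U z -> qhol (stem w) z /\ stem w z 0 0 = 0 &
      forall z, iota_domain U z -> stem w z != 0].
Proof.
move=> [[oU UV vw _] [nr ns]]; have [rw _] := vw; have [sU _] := oU.
have [sw hw iw] := stem_facts oU rw; split=> //.
  by move=> z Dz; split; [exact: hw|exact: (vectorial_stemP oU rw).1].
move=> z Dz; apply/eqP => w0.
have wJ t J : iota_domain U t -> stem w t = 0 -> imunit J -> w (embed J t) = 0.
  move=> Dt wt uJ; rewrite (induces_val iw uJ ((iota_domainP t sU uJ).1 Dt)) wt.
  exact: slice_val0.
have [zi|zi|zi] := ltgtP (complex.Im z) 0.
- have Dc := iota_domain_conj sU Dz.
  have wc : stem w (conjc z) = 0 by rewrite sw // w0; apply/rowP => l; rewrite !mxE conjc0.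
  apply: (ns (complex.Re (conjc z)) (complex.Im (conjc z))).
    by case: (z) zi => a b /=; rewrite oppr_gt0.
  by move=> J uJ; split; [exact/(iota_domainP _ sU uJ)|exact: wJ].
- apply: (ns (complex.Re z) (complex.Im z) zi).
  by move=> J uJ; split; [exact/(iota_domainP _ sU uJ)|exact: wJ].
- have qE : (complex.Re z)%:A = embed qi z :> H by rewrite /embed zi scale0r addr0.
  apply: (nr (complex.Re z)); rewrite qE; last exact: wJ (@imunit_qi R).
  by apply/(iota_domainP _ sU (@imunit_qi R)).
Qed.

Lemma minrep_germ U w p v : minimal_rep V om U w -> U p -> vfun_at p v -> om p = vclass p v ->
  ldep (stem w) (stem v.2) (sphere_point p).
Proof.
move=> [[_ _ _ rep] _] Up hv E; have [W [_ hw E']] := rep p Up.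
exact: ((vclass_eqP hw hv).1 (etrans (esym E') E)).1.
Qed.

Lemma minrep_ldep U w U' w' z : minimal_rep V om U w -> minimal_rep V om U' w' ->
  0 <= complex.Im z -> iota_domain U z -> iota_domain U' z -> ldep (stem w) (stem w') z.
Proof.
move=> m m' z0 Dz Dz'; have uqi := @imunit_qi R.
have [[sU _] _ _ _ _] := minrep_stem m; have [[sU' _] _ _ _ _] := minrep_stem m'.
have Up := (iota_domainP z sU uqi).1 Dz; have Up' := (iota_domainP z sU' uqi).1 Dz'.
have [[_ _ _ rep'] _] := m'; have [W [_ hw E]] := rep' _ Up'.
by have := minrep_germ m Up hw E; rewrite sphere_pointK.
Qed.

(** The quotient has a coordinate without zeros near the centre. That it is still vectorial and,
    over a real centre, conjugation-symmetric follows by cancelling the power, which is itself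
    symmetric there. *)
Lemma minrep_exists p : ~ is_class0 V om -> V p ->
  exists U w, minimal_rep V om U w /\ U p.
Proof.
move=> hn Vp; have [v [hv vV Ev]] := class_local_rep Vp.
have [oU Dz sv hhv _] := vfun_at_stem hv; have z0 := sphere_point_upper p.
have [dU vp vv] := hv; have [rv _] := vv; have v00 := (vectorial_stemP oU rv).1 vv.
set z := sphere_point p in z0 Dz *.
have [r dr P] := tube_sub oU Dz z0; have [_ r0 _] := dr.
have Dr t : nm (t - z) < r -> iota_domain v.1 t by exact: (P r (lexx r)).2.
have hF (l : 'I_4) t : nm (t - z) < r -> chol (fun t => stem v.2 t 0 l) t by move=> /Dr/hhv.
have [F0|[n [K [hK FK [i Ki]]]]] := order_family r0 hF.
  case: (class_nonvanishing hn Vp hv (Ev _ vp)); exists r => // t tr.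
  by apply/rowP => l; rewrite F0 // mxE.
pose G t : HC := \row_l K l t.
have hG t : nm (t - z) < r -> qhol G t.
  move=> tr l; apply: (@chol_near _ (K l) _ _ 1) => //; last exact: hK.
  by move=> t' _; rewrite mxE.
have FG t : nm (t - z) < r -> stem v.2 t = (t - z) ^+ n *: G t.
  by move=> tr; apply/rowP => l; rewrite !mxE FK.
(* The explicit term proves that z lies in its own disc. *)
have [s s0 sP] := chol_neq0 (hK i z (@eq_ind_r _ _ (fun x => nm x < r) (eq_ind_r (fun x => x < r) r0 (@nm0 R)) _ (subrr z))) Ki.
have m0 : 0 < Num.min r s by rewrite lt_min r0.
have mr : Num.min r s <= r by rewrite ge_min lexx.
have dm : symmetric_disc z (Num.min r s) by apply: (symmetric_disc_le dr); rewrite m0.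
have G0 t : nm (t - z) < Num.min r s -> G t != 0.
  rewrite lt_min => /andP[_ /sP Kt]; apply: contra_neq Kt => /rowP/(_ i).
  by rewrite !mxE.
have G00 t : nm (t - z) < r -> G t 0 0 = 0.
  have h : forall t', nm (t' - z) < r -> (G t' 0 0)%:A = 0 :> HC.
    apply: (order_cancel (n := n) r0) => t' t'r.
      by apply: (@qhol_scalar _ (fun x => G x 0 0)); exact: hG.
    have := v00 _ (Dr _ t'r); rewrite FG // mxE => e.
    by rewrite scalerA e scale0r.
  move=> tr.
  by have := h _ tr => /rowP/(_ 0); rewrite [LHS]mxE [X in _ * X]mxE mulr1 [RHS]mxE.
have sG : complex.Im z = 0 -> forall t, nm (t - z) < Num.min r s -> G (conjc t) = mapq (@conjc R) (G t).
  move=> zi t tm; have zc : conjc z = z by case: (z) zi => a b /= ->; rewrite oppr0.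
  have cr x : nm (x - z) < r -> nm (conjc x - z) < r by rewrite -{2}zc -rmorphB nm_conj.
  have tr : nm (conjc t - z) < r by apply: cr; exact: lt_le_trans mr.
  apply/eqP; rewrite -subr_eq0; apply/eqP.
  have cB (a b : C) : conjc (a - b) = conjc a - conjc b by exact: rmorphB.
  have cM (a b : C) : conjc (a * b) = conjc a * conjc b by exact: rmorphM.
  have cX (a : C) k : conjc (a ^+ k) = conjc a ^+ k by exact: rmorphXn.
  have h : forall x, nm (x - z) < r -> G x + (-1) *: mapq (@conjc R) (G (conjc x)) = 0.
    apply: (order_cancel (n := n) r0) => x xr.
      apply: qholD; first exact: hG.
      by apply: qholZ; [exact: chol_cst|apply: qhol_conj; apply: hG; exact: cr].
    rewrite scalerDr -FG // scalerA mulrN1 scaleNr.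
    have -> : (x - z) ^+ n *: mapq (@conjc R) (G (conjc x)) = mapq (@conjc R) (stem v.2 (conjc x)).
      have cx : (x - z) ^+ n = conjc ((conjc x - z) ^+ n).
        by rewrite cX cB conjcK zc.
      rewrite FG; last exact: cr.
      rewrite cx; move: (conjc x - z) (G (conjc x)) => c y.
      by apply/rowP => l; rewrite !mxE cM.
    by rewrite sv ?mapq_conjK ?subrr //; exact: Dr.
  by have := h _ tr; rewrite conjcK scaleN1r.
have [||sG' hG' GE] := @sym_extP R G z (Num.min r s) dm.
- by move=> t tm; apply: hG; exact: lt_le_trans mr.
- exact: sG.
have tV : tube z (Num.min r s) `<=` v.1 by exact: (P _ mr).1.
pose w := slice_of (sym_ext G z (Num.min r s)).
have otube := tube_axial_open z (Num.min r s); have [stube _] := otube.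
have wE t : iota_domain (tube z (Num.min r s)) t -> stem w t = sym_ext G z (Num.min r s) t.
  exact: stem_slice_of.
have wG t : nm (t - z) < Num.min r s -> stem w t = G t.
  by move=> tm; rewrite wE ?GE //; apply/(tube_iota _ _ z0); left.
have wN t : iota_domain (tube z (Num.min r s)) t -> stem w t != 0 /\ stem w t 0 0 = 0.
  move=> Dt; have [tm|tm] := (tube_iota _ _ z0).1 Dt.
    by rewrite wG //; split; [exact: G0|apply: G00; exact: lt_le_trans mr].
  have cE : stem w t = mapq (@conjc R) (G (conjc t)).
    by rewrite wE // -[t in LHS]conjcK sG' ?GE //; apply/(tube_iota _ _ z0); left.
  rewrite cE; split.
    apply: contra_neq (G0 _ tm) => e; rewrite -[LHS]mapq_conjK e.
    by apply/rowP => l; rewrite !mxE conjc0.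
  by rewrite mxE G00 ?conjc0 //; exact: lt_le_trans mr.
have rw : slice_regular (tube z (Num.min r s)) w by exact: slice_regular_of.
have vw : vectorial (tube z (Num.min r s)) w.
  by apply/(vectorial_stemP otube rw) => t /wN[].
have [sw _ iw] := stem_facts otube rw; clearbody w.
have dtube : axial_domain (tube z (Num.min r s)) by exact: tube_axial_domain.
exists (tube z (Num.min r s)), w; split; last exact: tube_center.
split.
  split=> //; first by move=> q /tV/vV.
  move=> p' tp'; exists (tube z (Num.min r s)); split; [by []|by split|].
  have hv' := vfun_at_move hv (tV _ tp').
  have hw' : vfun_at p' (tube z (Num.min r s), w) by split.
  rewrite (Ev _ (tV _ tp')); apply/(vclass_eqP hv' hw') => /=.
  have [e e0 eP] := ball_sub tp'.
  split.
    apply: (@ldep_factor _ _ _ _ (fun t => (t - z) ^+ n) e) => // t /eP tm; split.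
      by apply: cholX; apply: cholB; [exact: chol_id|exact: chol_cst].
    by rewrite wG // FG //; exact: lt_le_trans mr.
  split=> h; exfalso.
    exact: (class_nonvanishing hn (vV _ (tV _ tp')) hv' (Ev _ (tV _ tp')) h).
  have [h' h'0 h'P] := h; have [/negP + _] := wN _ (sphere_point_iota tp'); apply.
  by rewrite h'P // subrr nm0.
have uqi := @imunit_qi R.
split.
  (* At a real point the stem value is real, so a zero of w would be a zero of the stem function. *)
  move=> x tx wx.
  have qE : x%:A = embed qi x%:C :> H by rewrite /embed /= scale0r addr0.
  rewrite qE in tx wx; have Dx : iota_domain (tube z (Num.min r s)) x%:C by exists qi.
  have [/eqP wx0 _] := wN _ Dx; apply: wx0.
  have re : mapq (@conjc R) (stem w x%:C) = stem w x%:C.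
    by have e := sw _ Dx; rewrite conjc_real in e; exact: esym e.
  have im : mapq (@complex.Im R) (stem w x%:C) = 0.
    apply/rowP => l; have := congr1 (fun y : HC => y 0 l) re; rewrite !mxE.
    by case: (stem w x%:C 0 l) => a b [] /=; lra.
  move: wx; rewrite (induces_val iw uqi tx) /slice_val im mulr0 addr0 => re0.
  apply/rowP => l; rewrite [RHS]mxE; apply/eqP; rewrite eq_complex.
  have := congr1 (fun y : H => y 0 l) re0; have := congr1 (fun y : H => y 0 l) im.
  by rewrite !mxE => -> ->; rewrite !eqxx.
(* On a sphere of zeros all slice values vanish, hence so does the stem value. *)
move=> a b b0 h; have [ta _] := h qi uqi.
have Dt : iota_domain (tube z (Num.min r s)) (a +i* b) by exists qi.
have [/eqP w0 _] := wN _ Dt; apply: w0; apply: slice_val_eq0 => J uJ.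
have [tJ wJ] := h J uJ; have e := @induces_val R _ _ _ J (a +i* b) iw uJ tJ.
by rewrite -e; exact: wJ.
Qed.

(** Minimal representatives have no vanishing germs, and zero is dependent on everything, so testing
    against them treats vanishing and nonvanishing vector parts alike. *)
Lemma SR_classP f : ~ is_class0 V om -> slice_regular V f -> SR_class V om f <->
  forall z U w, 0 <= complex.Im z -> iota_domain U z -> minimal_rep V om U w ->
    ldep (stem w) (fun t => qvec (stem f t)) z.
Proof.
move=> hn rf; have [oV _] := dV; have uqi := @imunit_qi R; have [sV _] := oV.
have hvf p : V p -> vfun_at p (V, vector_part f).
  by move=> Vp; split; [exact: dV|exact: Vp|exact: vector_part_vectorial].
have fE z : iota_domain V z -> exists2 r : R, 0 < r & forall t, nm (t - z) < r ->
    stem (vector_part f) t = qvec (stem f t).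
  move=> Dz; have [r r0 rP] := iota_domain_open oV Dz; exists r => // t /rP.
  exact: stem_vector_part.
have near F G K z (r : R) : 0 < r -> (forall t, nm (t - z) < r -> G t = K t) ->
    ldep F G z -> ldep F K z.
  move=> r0 GK [e [A [B [e0 h n E]]]]; exists (Num.min r e), A, B; split=> //.
  - by rewrite lt_min r0.
  - by move=> t; rewrite lt_min => /andP[_ /h].
  - by move=> t; rewrite lt_min => /andP[/GK <- /E].
split=> [[_ cf] z U w z0 Dz m|h].
  have [[sU _] UV _ _ _] := minrep_stem m.
  have Up := (iota_domainP z sU uqi).1 Dz; have Vp := UV _ Up.
  have [r r0 rP] := fE z ((iota_domainP z sV uqi).2 Vp).
  apply: (near _ (stem (vector_part f)) _ _ _ r0 rP).
  have [|v0] := cf _ Vp.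
    have [[_ _ _ rep] _] := m; have [W [_ hw E]] := rep _ Up.
    by rewrite E => /(vclassP _ hw)[_ + _]; rewrite sphere_pointK.
  apply: ldep_sym; apply: ldep0.
  by have := (vanishes_atP (hvf _ Vp)).1 v0; rewrite sphere_pointK.
split=> // p Vp; have [v0|nv0] := pselect (vanishes_at p (V, vector_part f)); [by right|left].
have [U [w [m Up]]] := minrep_exists hn Vp.
have [[_ _ _ rep] _] := m; have [W [_ hw E]] := rep _ Up.
have [_ _ _ _ wN] := minrep_stem m.
rewrite E; apply/(vclassP _ hw); split; first exact: hvf.
  have [r r0 rP] := fE _ (sphere_point_iota Vp).
  apply: (near _ (fun t => qvec (stem f t)) _ _ _ r0); first by move=> t /rP.
  exact: h (sphere_point_upper p) (sphere_point_iota Up) m.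
split=> h'; exfalso.
  have [e e0 eP] := h'; have /negP := wN _ (sphere_point_iota Up); apply.
  by rewrite eP // subrr nm0.
by apply: nv0; exact: (vanishes_atP (hvf _ Vp)).2 h'.
Qed.

End VectorialClass.

(** * Existence of *-logarithms *)

Section Logarithms.
Variable R : realType.
Local Notation C := R[i].
Local Notation H := (quat R).
Local Notation HC := (quat R[i]).
Local Notation nm := (@Normc.normc R).
Implicit Types (U W : set H) (f r w : H -> H) (F : C -> HC) (z : C) (J p q : H) (y : HC).

(** With scalar quaternions as fibre, the symmetric monodromy theorem yields ordinary logarithms
    too. The real value required over a real point is ln t, which is where positivity enters. *)
Lemma scalar_log (V : set H) (c : C -> C) : basic_domain V ->
  (forall z, iota_domain V z -> [/\ chol c z, c z != 0 & c (conjc z) = conjc (c z)]) ->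
  (forall x : R, iota_domain V x%:C -> exists2 t : R, 0 < t & c x%:C = t%:C) ->
  exists L : C -> C, forall z, iota_domain V z ->
    [/\ chol L z, L (conjc z) = conjc (L z) & cexp (L z) = c z].
Proof.
move=> bV hc c0; have [[oV _] _] := bV.
pose Fib z (y : HC) := exists2 l : C, y = l%:A & cexp l = c z.
have [|||||F [sF hF FF]] := @symmetric_monodromy R V Fib 1 bV ltr01.
- move=> z _ _ Dz [l -> lE] [l' -> l'E] h; congr (_%:A).
  apply: cexp_inj_near; last by rewrite lE.
  apply: le_lt_trans h; have := qn_coord (l%:A - l'%:A) 0.
  by rewrite !mxE /= !mulr1.
- move=> z Dz; have [r r0 rP] := iota_domain_open oV Dz.
  have hc' t : nm (t - z) < r -> chol c t by move=> /rP/hc[].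
  have [_ cz _] := hc z Dz.
  have [s /andP[s0 sr] [l lP]] := local_log r0 hc' cz; exists s => // w _ ws [k -> kE].
  (* The constant k - l w is a period of the exponential and moves the local logarithm to the
     prescribed value k at w. *)
  exists (fun t => (l t + (k - l w))%:A); rewrite addrC subrK; split=> // t ts.
  have [hl lE] := lP _ ts; have [_ lwE] := lP _ ws; split.
    by exists (l t + (k - l w)) => //; rewrite cexpD cexpB kE lE lwE divff ?mulr1 // -lwE cexp_neq0.
  by apply: (@qhol_scalar _ (fun x => l x + (k - l w))); apply: cholD => //; exact: chol_cst.
- move=> z _ Dz [l -> lE]; exists (conjc l); first exact: mapq_conj_scalar.
  by have [_ _ ->] := hc z Dz; rewrite cexp_conj lE.
- move=> z Dz; have [_ cz _] := hc z Dz; have [l lE] := cexp_surj cz.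
  by exists (l%:A), l.
- move=> x Dx; have [t t0 tE] := c0 x Dx; exists ((ln t)%:C%:A).
    by exists ((ln t)%:C) => //; rewrite cexp_real lnK // tE.
  by rewrite mapq_conj_scalar conjc_real.
exists (fun z => F z 0 0) => z Dz; split.
- exact: ((derivable_quatP F z).1 (hF z Dz) 0).
- by rewrite sF // mxE.
- by have [l -> lE] := FF z Dz; rewrite !mxE /= mulr1.
Qed.

Lemma qvnorm_qvec y : qvnorm (qvec y) = qvnorm y.
Proof. by rewrite /qvnorm !mxE. Qed.

Lemma qvnormZ (c : C) y : qvnorm (c *: y) = c ^+ 2 * qvnorm y.
Proof. by rewrite /qvnorm !mxE; ring. Qed.

Lemma qvecZ (c : C) y : qvec (c *: y) = c *: qvec y.
Proof. by apply: quatP; rewrite !mxE /= ?mulr0. Qed.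

Lemma conjq_split y : conjq y = (y 0 0)%:A + (-1) *: qvec y.
Proof. by apply: quatP; rewrite !mxE /=; ring. Qed.

Lemma ccosh0 : ccosh 0 = 1 :> C.
Proof. by rewrite /ccosh oppr0 cexp0 -mulr2n -mulr_natr mul1r divff // pnatr_eq0. Qed.

(** The vector part squares to zero, which is the case mu = 0 of the exponential. *)
Lemma qexp_null (l : C) y : qvnorm y = 0 -> qexp (l%:A + qvec y) = cexp l *: (1 + qvec y).
Proof.
move=> n0; have c0 : (l%:A + qvec y) 0 0 = l by rewrite !mxE /= mulr1 addr0.
have cv : qvec (l%:A + qvec y) = qvec y.
  by apply: quatP; rewrite !mxE /= ?mxE /= ?mulr0 ?add0r.
rewrite (@qexpE R _ 0) ?c0 ?cv ?ccosh0 ?/csinhc ?eqxx ?scale1r //.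
have -> : qvnorm (l%:A + qvec y) = qvnorm y.
  by rewrite /qvnorm !mxE /= !mulr0 !add0r.
by rewrite n0 oppr0 expr0n.
Qed.

Lemma qexp_scalar (l : C) : qexp (l%:A : HC) = (cexp l)%:A.
Proof.
have q0 : qvec (0 : HC) = 0 by apply: quatP; rewrite !mxE.
have := @qexp_null l 0; rewrite q0 !addr0; apply.
by rewrite /qvnorm !mxE expr0n !addr0.
Qed.

Lemma stem_ext (V : set H) f f' z : axially_symmetric V -> (forall q, V q -> f q = f' q) ->
  iota_domain V z -> stem f z = stem f' z.
Proof.
move=> sV ff Dz; have h (J : H) : imunit J -> f (embed J z) = f' (embed J z).
  by move=> uJ; apply: ff; exact/(iota_domainP z sV uJ).
have h1 := h _ (@imunit_qi R); have h2 := h _ (imunitN (@imunit_qi R)).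
by case: z {Dz h} h1 h2 => a b; rewrite /embed /stem /= scalerN => -> ->.
Qed.

Lemma real_embed (x : R) J : embed J x%:C = x%:A :> H.
Proof. by rewrite /embed /= scale0r addr0. Qed.

Lemma embedM J (a b : C) : imunit J -> embed J (a * b) = embed J a * embed J b.
Proof.
by move=> uJ; have := slice_val_scalarM a b%:A uJ; rewrite scalerA !slice_val_scalar.
Qed.

Variables (V : set H) (om : H -> set (vfun R)) (g : H -> H).
Hypothesis bV : basic_domain V.
Hypothesis hom : vectorial_class V om.
Hypothesis cg : SR_class V om g.
Hypothesis g0 : forall q, V q -> g q <> 0.

Let dV : axial_domain V. Proof. by case: bV. Qed.
Let oV : axial_open V. Proof. by case: dV. Qed.
Let sV : axially_symmetric V. Proof. by case: oV. Qed.
Let rg : slice_regular V g. Proof. by case: cg. Qed.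
Let uqi : imunit (qi : H). Proof. exact: imunit_qi. Qed.

Lemma stem_sqnormq_neq0 z : iota_domain V z -> sqnormq (stem g z) != 0.
Proof. by have [_ _ ig] := stem_facts oV rg; exact: nonvanishing_stem. Qed.

Lemma class0_log : is_class0 V om ->
  (exists2 f, star_log V g f & SR_class V om f) <->
  (forall q, (V `&` @real_axis R) q -> exists2 t : R, 0 < t & g q = t%:A).
Proof.
move=> om0; split.
  move=> [f [rf fE] /(SR_class0 _ dV om0) pf] q [Vq [x _ qE]].
  rewrite -qE in Vq *.
  have [c cP] := slice_preserving_stem oV pf; have [sf _ _] := stem_facts oV rf.
  have Dx : iota_domain V x%:C by exists qi => //=; rewrite scale0r addr0.
  have [_ cc cE _] := cP _ Dx; rewrite conjc_real in cc.
  have cr : c x%:C = (complex.Re (c x%:C))%:C.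
    by case: (c x%:C) cc => a b [] h; congr Complex; lra.
  exists (expR (complex.Re (c x%:C))); first exact: expR_gt0.
  rewrite -fE // -[X in star_exp f X](real_embed x qi) (star_expE sV sf uqi Dx).
  by rewrite cE qexp_scalar cr cexp_real slice_val_scalar real_embed.
move=> gpos; have pg := (SR_class0 g dV om0).1 cg.
have [c cP] := slice_preserving_stem oV pg.
have [||L LP] := @scalar_log V c bV.
- move=> z Dz; have [hc cc cE gE] := cP z Dz; split=> //.
  apply/eqP => c0; apply: (g0 ((iota_domainP z sV uqi).1 Dz)).
  by rewrite gE // c0 /embed !scale0r addr0.
- move=> x Dx; have [_ _ _ gE] := cP _ Dx; have Vx := (iota_domainP _ sV uqi).1 Dx.
  have [|t t0 tE] := gpos (embed qi x%:C); first by split=> //; exists x => //; rewrite real_embed.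
  exists t => //; rewrite gE // -(real_embed t qi) in tE.
  by rewrite -(embedK uqi (c x%:C)) tE embedK.
have sF : stem_function V (fun z => (L z)%:A).
  by move=> z Dz; have [_ -> _] := LP z Dz; rewrite mapq_conj_scalar.
have [|||pf _] := @slice_preserving_of R V (fun z => (L z)%:A) L; [by []|exact: sF| |].
  by move=> z /LP[].
exists (slice_of (fun z => (L z)%:A)); last exact/(SR_class0 _ dV om0).
apply: star_log_of => //.
  by move=> z Dz; have [hL _ _] := LP z Dz; exact: qhol_scalar.
by move=> z Dz; have [_ _ LE] := LP z Dz; have [_ _ -> _] := cP z Dz; rewrite qexp_scalar LE.
Qed.

Hypothesis hn : ~ is_class0 V om.

(** A holomorphic factor without zeros is absorbed into one coefficient of the linear relation
    satisfied by g_v. *)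
Lemma SR_class_mul f (m : C -> C) : slice_regular V f ->
  (forall z, iota_domain V z -> [/\ chol m z, m z != 0 & qvec (stem f z) = m z *: qvec (stem g z)]) ->
  SR_class V om f.
Proof.
move=> rf hm; apply/(SR_classP dV hom hn rf) => z U w z0 Dz mw.
have := (SR_classP dV hom hn rg).1 cg z U w z0 Dz mw.
have [oU UV _ _ _] := minrep_stem mw.
have [r r0 rP] := iota_domain_open oU Dz.
have DV t : nm (t - z) < r -> iota_domain V t by move=> /rP[J uJ /UV]; exists J.
move=> [e [A [B [e0 h n E]]]]; exists (Num.min r e), A, (fun t => B t / m t); split.
- by rewrite lt_min r0.
- move=> t; rewrite lt_min => /andP[/DV/hm[hm0 m0 _] /h[hA hB]]; split=> //.
  exact: chol_div.
- have [|_ mz _] := hm z; first by apply: DV; rewrite subrr nm0.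
  by case/orP: n => [->//|Bz]; rewrite mulf_neq0 ?invr_eq0 ?orbT.
- move=> t; rewrite lt_min => /andP[/DV/hm[_ m0 ->] /E].
  by rewrite scalerA divfK.
Qed.

(** The common shape of the logarithms given by a formula: the vector part is a scalar multiple of
    that of g, from which membership in the class is inherited. *)
Lemma log_of_multiple (L m : C -> C) :
  (forall z, iota_domain V z -> [/\ chol L z, L (conjc z) = conjc (L z), chol m z, m z != 0 &
     m (conjc z) = conjc (m z)]) ->
  (forall z, iota_domain V z -> qexp ((L z)%:A + m z *: qvec (stem g z)) = stem g z) ->
  exists2 f, star_log V g f & SR_class V om f.
Proof.
move=> hLm E; have [sg hg _] := stem_facts oV rg.
pose F z := (L z)%:A + m z *: qvec (stem g z).
have sF : stem_function V F.
  move=> z Dz; have [_ LE _ _ mE] := hLm z Dz; rewrite /F LE mE sg // qvec_conj -mapq_conj_scalar.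
  move: (qvec _) (L z)%:A (m z) => v u c.
  have cD (a b : C) : conjc (a + b) = conjc a + conjc b by exact: rmorphD.
  have cM (a b : C) : conjc (a * b) = conjc a * conjc b by exact: rmorphM.
  by apply/rowP => l; rewrite !mxE cD cM.
have hF z : iota_domain V z -> qhol F z.
  move=> Dz; have [hL _ hm _ _] := hLm z Dz; apply: qholD; last first.
    by apply: qholZ => //; apply: qhol_qvec; exact: hg.
  exact: qhol_scalar.
exists (slice_of F); first exact: star_log_of.
apply: (@SR_class_mul _ m); first exact: slice_regular_of.
move=> z Dz; have [_ _ hm m0 _] := hLm z Dz; split=> //.
rewrite (stem_slice_of sV sF Dz) /F; move: (stem g z) => v.
by apply: quatP; rewrite !mxE /= ?mxE /= ?mulr0 ?add0r.
Qed.

(** Every sphere of V carries a zero of a minimal representative w. There the stem value of w is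
    nonzero but isotropic, and that of g_v is a multiple of it. Real points are impossible, since w
    has no real zeros. *)
Lemma hull_null z : axial_hull (class_zeros V om) = V -> iota_domain V z ->
  complex.Im z != 0 /\ qvnorm (stem g z) = 0.
Proof.
move=> hull Dz; have Vz := (iota_domainP z sV uqi).1 Dz.
have := Vz; rewrite -{1}hull => -[x [y [I [J [uI uJ [_ [U [w [m Up wp]]]] qE]]]]].
have pE : x%:A + y *: I = embed I (x +i* y) by [].
rewrite pE in Up wp; have qE' : embed qi z = embed J (x +i* y) by [].
pose z1 := sphere_point (embed I (x +i* y)).
have z1E : z1 = complex.Re z +i* `|complex.Im z|.
  by rewrite /z1 -(sphere_point_embed z uqi) qE' !sphere_point_embed.
have [J' uJ' pE'] := sphere_point_polar (embed I (x +i* y)).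
rewrite -/z1 in pE'; rewrite pE' in Up wp.
have [oU UV sw hw wN] := minrep_stem m; have [sU _] := oU.
have D1 := (iota_domainP z1 sU uJ').2 Up.
have [[_ _ vw _] [nr _]] := m; have [rw _] := vw; have [_ _ iw] := stem_facts oU rw.
have i0 : complex.Im z != 0.
  apply/eqP => zi; have E : embed J' z1 = (complex.Re z)%:A.
    by rewrite z1E zi normr0 real_embed.
  by rewrite E in Up wp; exact: nr Up wp.
split=> //.
have n1 : qvnorm (stem w z1) = 0.
  have := slice_val_zero uJ' (etrans (esym (induces_val iw uJ' Up)) wp).
  by rewrite sqnormq_split (hw _ D1).2 expr0n add0r.
have z10 : 0 <= complex.Im z1 by exact: sphere_point_upper.
have [r [A [B [r0 _ n E]]]] := (SR_classP dV hom hn rg).1 cg z1 U w z10 D1 m.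
have zr : nm (z1 - z1) < r by rewrite subrr nm0.
have {}E := E _ zr.
have Bz : B z1 != 0.
  apply/eqP => B0; move: E n; rewrite B0 scale0r addr0 eqxx orbF => /eqP.
  by rewrite scaler_eq0 (negbTE (wN _ D1)) orbF => ->.
have G1 : qvnorm (stem g z1) = 0.
  have e : qvec (stem g z1) = (- A z1 / B z1) *: stem w z1.
    apply: (scalerI Bz); rewrite scalerA mulrCA divff // mulr1 scaleNr.
    by apply/eqP; rewrite -addr_eq0 addrC E.
  by rewrite -qvnorm_qvec e qvnormZ n1 mulr0.
have [zi|zi] := lerP 0 (complex.Im z).
  by rewrite -G1 z1E ger0_norm //; case: (z).
have -> : z = conjc z1 by rewrite z1E ltr0_norm //=; case: (z) => a b /=; rewrite opprK.
have D1' : iota_domain V z1 by exists J' => //; exact: UV.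
have [sg _ _] := stem_facts oV rg; rewrite sg //.
move: (stem g z1) G1 => v G1; have := congr1 (@conjc R) G1; rewrite conjc0 => <-.
have cD (a b : C) : conjc (a + b) = conjc a + conjc b by exact: rmorphD.
have cX (a : C) : conjc (a ^+ 2) = conjc a ^+ 2 by exact: rmorphXn.
by rewrite /qvnorm !mxE !cD !cX.
Qed.

Lemma hull_log : axial_hull (class_zeros V om) = V ->
  exists2 f, star_log V g f & SR_class V om f.
Proof.
move=> hull; have [sg hg _] := stem_facts oV rg.
have c0 z : iota_domain V z -> stem g z 0 0 != 0.
  move=> Dz; have := stem_sqnormq_neq0 Dz; have [_ n0] := hull_null hull Dz.
  by rewrite sqnormq_split n0 addr0 sqrf_eq0.
have cc z : iota_domain V z -> stem g (conjc z) 0 0 = conjc (stem g z 0 0).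
  by move=> Dz; rewrite sg // mxE.
have [||L LP] := @scalar_log V (fun z => stem g z 0 0) bV.
- by move=> z Dz; split; [exact: hg|exact: c0|exact: cc].
(* There are no real points, so the positivity condition is void. *)
- by move=> x Dx; have [] := hull_null hull Dx; rewrite /= eqxx.
apply: (@log_of_multiple L (fun z => (stem g z 0 0)^-1)).
  move=> z Dz; have [hL LE _] := LP z Dz; split=> //.
  - by apply: cholV; [exact: c0|exact: hg].
  - by rewrite invr_eq0 c0.
  - by rewrite cc // fmorphV.
move=> z Dz; have [_ _ LE] := LP z Dz; have [_ n0] := hull_null hull Dz; have cz := c0 z Dz.
rewrite -qvecZ qexp_null ?LE ?qvnormZ ?n0 ?mulr0 // qvecZ.
rewrite [RHS]qsplit; move: (stem g z) cz => v cz; rewrite scalerDr; congr (_ + _).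
by rewrite scalerA divff // scale1r.
Qed.

Lemma star_conj_induces : induces V (fun z => conjq (stem g z)) (star_conj g).
Proof.
have [sg _ ig] := stem_facts oV rg.
move=> x y J uJ VJ; rewrite /star_conj /scalar_part (component_induces 0 sV sg ig uJ VJ).
rewrite (vector_part_induces oV rg uJ VJ) -!/(slice_val J _).
have -> : conjq (stem g (x +i* y)) = (stem g (x +i* y) 0 0)%:A + (-1)%:C *: qvec (stem g (x +i* y)).
  by rewrite conjq_split rmorphN.
by rewrite slice_valD slice_valZ scaleN1r.
Qed.

Lemma stem_symmetrization z : iota_domain V z ->
  stem (symmetrization g) z = (sqnormq (stem g z))%:A.
Proof.
move=> Dz; have [sg hg _] := stem_facts oV rg.
have rc : slice_regular V (star_conj g).
  exists (fun z => conjq (stem g z)); split; last exact: star_conj_induces.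
  - move=> t Dt; rewrite sg //; move: (stem g t) => v.
    have cN (a : C) : conjc (- a) = - conjc a by exact: rmorphN.
    by apply: quatP; rewrite !mxE /= ?mxE ?cN.
  - move=> t Dt; apply/derivable_quatP.
    suff : qhol (fun t => (stem g t 0 0)%:A + (-1) *: qvec (stem g t)) t.
      by apply: (@qhol_near _ _ _ _ 1) => // u _; exact: conjq_split.
    apply: qholD; first by apply: qhol_scalar; exact: hg.
    by apply: qholZ; [exact: chol_cst|apply: qhol_qvec; exact: hg].
rewrite /symmetrization (stem_star sV rg rc Dz) (stem_unique sV star_conj_induces Dz).
exact: mulq_conj.
Qed.

Lemma principal_log r : slice_preserving V r ->
  (forall q, V q -> star r r q = symmetrization g q) ->
  (forall q, (V `&` @real_axis R) q -> exists2 t : R, 0 < t & r q = t%:A) ->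
  (forall q, V q -> ~ exists2 t : R, t <= -1 & scalar_part g q / r q = t%:A) ->
  exists2 f, star_log V g f & SR_class V om f.
Proof.
move=> pr rr rpos nle; have [rr' _] := pr; have [rho rhoP] := slice_preserving_stem oV pr.
have [sg hg ig] := stem_facts oV rg.
have rho2 z : iota_domain V z -> rho z ^+ 2 = sqnormq (stem g z).
  move=> Dz; have [_ _ rE _] := rhoP z Dz.
  have := etrans (esym (stem_star sV rr' rr' Dz)) (etrans (stem_ext sV rr Dz) (stem_symmetrization Dz)).
  rewrite rE; move: (rho z) (sqnormq _) => a b /(congr1 (fun v : HC => v 0 0)).
  by rewrite !mxE /= ?mxE /= !mulr1 !mulr0 !subr0 expr2.
have rho0 z : iota_domain V z -> rho z != 0.
  by move=> Dz; rewrite -sqrf_eq0 rho2 // stem_sqnormq_neq0.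
have rhoc z : iota_domain V z -> rho (conjc z) = conjc (rho z) by move=> /rhoP[].
pose c z := stem g z 0 0 / rho z.
have hc z : iota_domain V z -> chol c z.
  by move=> Dz; have [h _ _ _] := rhoP z Dz; apply: chol_div; [exact: rho0|exact: hg|exact: h].
have cc z : iota_domain V z -> c (conjc z) = conjc (c z).
  by move=> Dz; rewrite /c sg // rhoc // mxE [RHS](fmorph_div (@conjc R)).
(* A value of c on the slit is real, so it is also the value of [scalar_part g / r] at the point
   [embed qi z], which the second inclusion forbids. *)
have dc z : iota_domain V z -> acosh_dom (c z).
  move=> Dz [ci cr]; have Vz := (iota_domainP z sV uqi).1 Dz.
  apply: (nle _ Vz); exists (complex.Re (c z)) => //.
  have [_ _ _ ->//] := rhoP z Dz.
  rewrite /scalar_part (induces_val (component_induces 0 sV sg ig) uqi Vz) slice_val_scalar.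
  have -> : stem g z 0 0 = c z * rho z by rewrite /c divfK // rho0.
  have ur : embed qi (rho z) \is a GRing.unit.
    rewrite unitrE /= -unitrE; apply/unitrP.
    exists (embed qi (rho z)^-1); rewrite -!embedM // mulfV ?mulVf ?rho0 //.
    by rewrite -[1]/(1%:C) real_embed scale1r.
  rewrite embedM // mulrK // -[RHS](real_embed _ qi); congr embed.
  by move: ci; case: (c z) => a b /= ->.
have [||L LP] := @scalar_log V rho bV.
- by move=> z Dz; have [h hcj _ _] := rhoP z Dz; split=> //; exact: rho0.
- move=> x Dx; have [_ _ _ rE] := rhoP _ Dx; have Vx := (iota_domainP _ sV uqi).1 Dx.
  have [|t t0 tE] := rpos (embed qi x%:C); first by split=> //; exists x => //; rewrite real_embed.
  exists t => //; rewrite rE // -(real_embed t qi) in tE.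
  by rewrite -(embedK uqi (rho x%:C)) tE embedK.
apply: (@log_of_multiple L (fun z => acoshc (c z) / rho z)).
  move=> z Dz; have [hL LE _] := LP z Dz; have [hr _ _ _] := rhoP z Dz; split=> //.
  - apply: chol_div => //; first exact: rho0.
    by apply: (@chol_comp _ c); [exact: hc|apply: chol_acoshc; exact: dc].
  - by apply: mulf_neq0; [exact: acoshc_neq0 (dc z Dz)|rewrite invr_eq0 rho0].
  - rewrite cc // acoshc_conj; last exact: dc.
    by rewrite rhoc // [RHS](fmorph_div (@conjc R)).
move=> z Dz; have [_ _ LE] := LP z Dz; have rz := rho0 z Dz.
have [mu [mu2 muc mus]] := acoshc_spec (dc z Dz).
have n2 := rho2 z Dz; rewrite sqnormq_split in n2.
have cE : stem g z 0 0 = c z * rho z by rewrite /c divfK.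
move: (stem g z) (c z) (rho z) (acoshc (c z)) cE n2 rz mu2 muc mus LE => v k s ps cE n2 rz mu2 muc mus LE.
have e0 : ((L z)%:A + (ps / s) *: qvec v) 0 0 = L z by rewrite !mxE /= mulr1 mulr0 addr0.
have ev : qvec ((L z)%:A + (ps / s) *: qvec v) = (ps / s) *: qvec v.
  by apply: quatP; rewrite !mxE /= ?mxE /= ?mulr0 ?add0r.
have en : qvnorm ((L z)%:A + (ps / s) *: qvec v) = (ps / s) ^+ 2 * qvnorm v.
  by rewrite /qvnorm !mxE /= !mulr0 !add0r; ring.
(* The root mu is admissible: g_v^s = r^2 - g_0^2 gives - (psi(c) / r)^2 g_v^s = psi(c)^2 (c^2 -
   1). *)
rewrite (@qexpE R _ mu) ?e0 ?ev ?en ?LE ?muc; last first.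
  have -> : qvnorm v = s ^+ 2 - v 0 0 ^+ 2 by rewrite n2 addrC addKr.
  by rewrite mu2 cE; field.
rewrite [RHS]qsplit cE scalerDr !scalerA; congr (_ *: _ + _); first by rewrite mulrC.
have -> : s * (csinhc mu * (ps / s)) = csinhc mu * ps by field.
by rewrite mus scale1r.
Qed.

End Logarithms.

(** * Logarithms in a class without zeros *)

Section Frames.
Variable R : realType.
Local Notation C := R[i].
Local Notation H := (quat R).
Local Notation HC := (quat R[i]).
Local Notation nm := (@Normc.normc R).
Implicit Types (U W : set H) (f w : H -> H) (F : C -> HC) (z : C) (J p q : H) (y S : HC).

(** Made opaque once its basic identities are proved, so that [ring] and [field] treat it as an
    atom. *)
Let ii : C := 0 +i* 1.
Let i2 : ii * ii = -1.
Proof. by apply/eqP; rewrite eq_complex /=; apply/andP; split; apply/eqP; ring. Qed.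
Let i0 : ii != 0.
Proof. by rewrite eq_complex /= oner_eq0 andbF. Qed.
Let nm_ii : nm ii = 1.
Proof. by rewrite /= expr0n add0r expr1n sqrtr1. Qed.
Let iE (s t : R) : s%:C + ii * t%:C = s +i* t.
Proof. by apply/eqP; rewrite eq_complex /=; apply/andP; split; apply/eqP; ring. Qed.
Let iE' (s t : R) : s%:C - ii * t%:C = conjc (s +i* t).
Proof. by apply/eqP; rewrite eq_complex /=; apply/andP; split; apply/eqP; ring. Qed.
Opaque ii.
Let two0 : 2 != 0 :> C. Proof. by rewrite pnatr_eq0. Qed.

Definition unit_vec S := S 0 0 = 0 /\ qvnorm S = 1.

(** The element a + b S with a + iota b = P and a - iota b = M: its value is P where S acts as iota
    and M where S acts as - iota. *)
Definition frame_val (P M : C) S : HC := ((P + M) / 2)%:A + ((P - M) / (2 * ii)) *: S.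

Lemma frame_val0 (a b : C) S : unit_vec S -> (a%:A + b *: S) 0 0 = a.
Proof. by move=> [S0 _]; rewrite !mxE /= S0 mulr0 addr0 mulr1. Qed.

Lemma frame_val_vec (a b : C) S : unit_vec S -> qvec (a%:A + b *: S) = b *: S.
Proof. by move=> [S0 _]; apply: quatP; rewrite !mxE /= ?S0 ?mulr0 ?add0r. Qed.

Lemma unit_vec_dot (b : C) S : unit_vec S ->
  S 0 1 * (b *: S) 0 1 + S 0 2 * (b *: S) 0 2 + S 0 3 * (b *: S) 0 3 = b.
Proof. by move=> [_ S1]; rewrite -[RHS]mulr1 -S1 /qvnorm !mxE; ring. Qed.

Lemma frame_inj (a a' b b' : C) S : unit_vec S -> a%:A + b *: S = a'%:A + b' *: S ->
  a = a' /\ b = b'.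
Proof.
move=> uS E; split.
  by have := congr1 (fun v : HC => v 0 0) E; rewrite !frame_val0.
have := congr1 (@qvec C) E; rewrite !frame_val_vec // => Ev.
by rewrite -(unit_vec_dot b uS) Ev unit_vec_dot.
Qed.

Lemma frame_val_inj (P M P' M' : C) S : unit_vec S -> frame_val P M S = frame_val P' M' S ->
  P = P' /\ M = M'.
Proof.
move=> uS /(frame_inj uS)[h1 h2].
have {}h1 : P + M = P' + M' by apply: (mulIf (invr_neq0 two0)).
have {}h2 : P - M = P' - M'.
  by apply: (mulIf (invr_neq0 (mulf_neq0 two0 i0))).
have E (a b : C) : a = ((a + b) + (a - b)) / 2 by field.
have E' (a b : C) : b = ((a + b) - (a - b)) / 2 by field.
by split; [rewrite (E P M) h1 h2 -E|rewrite (E' P M) h1 h2 -E'].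
Qed.

Lemma frame_valE (a h : C) S : a%:A + h *: S = frame_val (a + ii * h) (a - ii * h) S.
Proof.
rewrite /frame_val; congr (_%:A + _ *: _); first by field.
by field; rewrite ?i0 ?two0.
Qed.

Lemma qvnorm_frame (a b : C) S : unit_vec S -> qvnorm (a%:A + b *: S) = b ^+ 2.
Proof. by move=> uS; rewrite -qvnorm_qvec frame_val_vec // qvnormZ uS.2 mulr1. Qed.

(* With [N(S) = 1], [S] plays the role of an imaginary unit commuting with [iota]:
   the exponential splits into its values on the two eigenvalues of [S]. *)
Lemma qexp_frame (a b : C) S : unit_vec S ->
  qexp (a%:A + b *: S) = frame_val (cexp (a + ii * b)) (cexp (a - ii * b)) S.
Proof.
move=> uS; rewrite (@qexpE R _ (ii * b)); last first.
  by rewrite qvnorm_frame // exprMn expr2 i2 mulN1r.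
rewrite frame_val0 // frame_val_vec // /frame_val !cexpD scalerDr !scalerA.
rewrite /ccosh mulrA mulrDr; congr (_ + _ *: _).
rewrite /csinhc; case: eqVneq => [h|h].
  have b0 : b = 0 by move/eqP: h; rewrite mulf_eq0 (negbTE i0) => /eqP.
  by rewrite h oppr0 subrr mul0r b0 !mulr0.
have b0 : b != 0 by apply: contra_neq h => ->; rewrite mulr0.
by move: (cexp a) (cexp _) (cexp _) => A P M; field; rewrite ?i0 ?b0.
Qed.

(** The complex coordinates of S have squares adding up to 1, so their moduli add up to at least 1.
    This makes the separation of the fibres independent of S. *)
Lemma unit_vec_qn (b : C) S : unit_vec S -> nm b <= nm ((b *: S) 0 1) + nm ((b *: S) 0 2) + nm ((b *: S) 0 3).
Proof.
move=> [_ S1]; rewrite !mxE !nmM -!mulrDr ler_peMr ?nm_ge0 //.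
have := nmD (S 0 1 ^+ 2 + S 0 2 ^+ 2) (S 0 3 ^+ 2); have := nmD (S 0 1 ^+ 2) (S 0 2 ^+ 2).
rewrite -/(qvnorm S) S1 nm1 !nmX.
have := nm_ge0 (S 0 1); have := nm_ge0 (S 0 2); have := nm_ge0 (S 0 3).
move: (nm _) (nm _) (nm _) (nm (_ + _)) => a b' c d; clear => c0 b0 a0; nra.
Qed.

(** Both a + iota b and a - iota b change by less than 1, a distance at which the exponential is
    injective. *)
Lemma frame_discrete (a b a' b' : C) S : unit_vec S ->
  qn ((a%:A + b *: S) - (a'%:A + b' *: S)) < 1 ->
  qexp (a%:A + b *: S) = qexp (a'%:A + b' *: S) -> a%:A + b *: S = a'%:A + b' *: S.
Proof.
move=> uS h; rewrite (qexp_frame a b uS) (qexp_frame a' b' uS) => /(frame_val_inj uS)[eP eM].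
have {}h : nm (a - a') + nm (b - b') < 1.
  apply: le_lt_trans h.
  have -> : a%:A + b *: S - (a'%:A + b' *: S) = (a - a')%:A + (b - b') *: S.
    by rewrite !scalerBl opprD addrACA.
  rewrite /qn; have -> : ((a - a')%:A + (b - b') *: S) 0 0 = a - a' by exact: frame_val0.
  have V l : l != 0 -> ((a - a')%:A + (b - b') *: S) 0 l = ((b - b') *: S) 0 l.
    move=> l0; rewrite mxE [X in X + _]mxE.
    have -> : (1 : HC) 0 l = 0 by case: l l0 => [[|[|[|[|//]]]] il] //= _; rewrite mxE.
    by rewrite mulr0 add0r.
  by rewrite !V // -!addrA lerD2l !addrA; exact: unit_vec_qn.
have T (c c' : C) : nm (c + c') <= nm c + nm c' by exact: nmD.
have ni : nm (ii * (b - b')) = nm (b - b') by rewrite nmM nm_ii mul1r.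
have h1 : a + ii * b = a' + ii * b'.
  apply: cexp_inj_near eP; apply: le_lt_trans h.
  have -> : a + ii * b - (a' + ii * b') = (a - a') + ii * (b - b') by ring.
  by rewrite -ni; exact: T.
have h2 : a - ii * b = a' - ii * b'.
  apply: cexp_inj_near eM; apply: le_lt_trans h.
  have -> : a - ii * b - (a' - ii * b') = (a - a') + - (ii * (b - b')) by ring.
  by rewrite -ni -(nmN (ii * _)); exact: T.
by rewrite !frame_valE h1 h2.
Qed.

Lemma sqnormq_frame (a h : C) S : unit_vec S ->
  (a + ii * h) * (a - ii * h) = sqnormq (a%:A + h *: S).
Proof.
move=> uS; rewrite sqnormq_split qvnorm_frame // frame_val0 //.
have -> : (a + ii * h) * (a - ii * h) = a ^+ 2 - (ii * ii) * h ^+ 2 by ring.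
by rewrite i2 mulN1r opprK.
Qed.

Lemma qexp_conj y : qexp (mapq (@conjc R) y) = mapq (@conjc R) (qexp y).
Proof.
pose mu := sqrtc (- qvnorm y).
have cD (a b : C) : conjc (a + b) = conjc a + conjc b by exact: rmorphD.
have cN (a : C) : conjc (- a) = - conjc a by exact: rmorphN.
have cM (a b : C) : conjc (a * b) = conjc a * conjc b by exact: rmorphM.
have cX (a : C) k : conjc (a ^+ k) = conjc a ^+ k by exact: rmorphXn.
have cF (a b : C) : conjc (a / b) = conjc a / conjc b by exact: (fmorph_div (@conjc R)).
have c2 : conjc 2 = 2 :> C by exact: (rmorph_nat (@conjc R) 2).
rewrite (@qexpE R _ (conjc mu)); last first.
  by rewrite -cX sqr_sqrtc cN /qvnorm !mxE !cD !cX.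
have -> : qexp y = cexp (y 0 0) *: ((ccosh mu)%:A + csinhc mu *: qvec y) by [].
have ch : ccosh (conjc mu) = conjc (ccosh mu).
  by rewrite /ccosh cF c2 cD -!cexp_conj cN.
rewrite ch csinhc_conj qvec_conj [mapq _ _ 0 0]mxE cexp_conj -mapq_conj_scalar.
move: (cexp _) ((ccosh mu)%:A) (csinhc mu) (qvec y) => a u s v.
by apply/rowP => l; rewrite !mxE cM cD cM.
Qed.

Variables (V : set H) (om : H -> set (vfun R)) (g : H -> H).
Hypothesis bV : basic_domain V.
Hypothesis hom : vectorial_class V om.
Hypothesis cg : SR_class V om g.
Hypothesis g0 : forall q, V q -> g q <> 0.
Hypothesis hn : ~ is_class0 V om.
Hypothesis hZ : class_zeros V om = set0.

Let dV : axial_domain V. Proof. by case: bV. Qed.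
Let oV : axial_open V. Proof. by case: dV. Qed.
Let sV : axially_symmetric V. Proof. by case: oV. Qed.
Let rg : slice_regular V g. Proof. by case: cg. Qed.
Let uqi : imunit (qi : H). Proof. exact: imunit_qi. Qed.

Lemma ldep_multiple F F' z : ldep F F' z -> F z != 0 -> exists c, F' z = c *: F z.
Proof.
move=> [r [A [B [r0 _ n E]]]] Fz; have zr : nm (z - z) < r by rewrite subrr nm0.
have {}E := E _ zr.
have Bz : B z != 0.
  apply/eqP => B0; move: E n; rewrite B0 scale0r addr0 eqxx orbF => /eqP.
  by rewrite scaler_eq0 (negbTE Fz) orbF => ->.
exists (- A z / B z); apply: (scalerI Bz); rewrite scalerA mulrCA divff // mulr1 scaleNr.
by apply/eqP; rewrite -addr_eq0 addrC E.
Qed.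

(** Germ statements are available at sphere points, that is, in the closed upper half-plane;
    symmetry carries their pointwise consequence to the lower one. *)
Lemma multiple_sym U F F' z : axially_symmetric U -> stem_function U F -> stem_function U F' ->
  (forall z, 0 <= complex.Im z -> iota_domain U z -> exists c, F' z = c *: F z) ->
  iota_domain U z -> exists c, F' z = c *: F z.
Proof.
move=> sU sF sF' h Dz; have [zi|zi] := lerP 0 (complex.Im z); first exact: h.
have Dc := iota_domain_conj sU Dz.
have [|c E] := h (conjc z) _ Dc.
  by case: (z) zi => a b /=; rewrite oppr_ge0 => /ltW.
exists (conjc c); rewrite -[z]conjcK sF' // sF // E.
have cM (a b : C) : conjc (a * b) = conjc a * conjc b by exact: rmorphM.
by move: (F _) => v; apply/rowP => l; rewrite !mxE cM.
Qed.

Lemma minrep_multiple U w U' w' z : minimal_rep V om U w -> minimal_rep V om U' w' ->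
  iota_domain U z -> iota_domain U' z -> exists c, stem w' z = c *: stem w z.
Proof.
move=> m m' Dz Dz'; have [[sU _] _ sw _ wN] := minrep_stem m; have [[sU' _] _ sw' _ _] := minrep_stem m'.
have D q : (U `&` U') q -> U q /\ U' q by case.
have sI : axially_symmetric (U `&` U').
  by move=> x y I uI [h1 h2] J uJ; split; [exact: sU h1 _ uJ|exact: sU' h2 _ uJ].
have DI t : iota_domain (U `&` U') t -> iota_domain U t /\ iota_domain U' t.
  by move=> [J uJ [h1 h2]]; split; exists J.
apply: (multiple_sym sI).
- by move=> t /DI[h1 _]; exact: sw.
- by move=> t /DI[_ h2]; exact: sw'.
- move=> t t0 /DI[h1 h2]; apply: ldep_multiple; last exact: wN.
  exact: minrep_ldep m m' t0 h1 h2.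
have h1 := (iota_domainP z sU uqi).1 Dz; have h2 := (iota_domainP z sU' uqi).1 Dz'.
by exists qi.
Qed.

Lemma SR_multiple U w z : minimal_rep V om U w -> iota_domain U z ->
  exists c, qvec (stem g z) = c *: stem w z.
Proof.
move=> m; have [[sU _] UV sw _ wN] := minrep_stem m; have [sg _ _] := stem_facts oV rg.
apply: (@multiple_sym U (stem w) (fun t => qvec (stem g t)) z sU sw).
  move=> t Dt; rewrite -qvec_conj -sg //.
  by have [J uJ UJ] := Dt; exists J => //; exact: UV.
move=> t t0 Dt; apply: (@ldep_multiple (stem w) (fun t => qvec (stem g t))); last exact: wN.
exact: (SR_classP dV hom hn rg).1 cg t U w t0 Dt m.
Qed.

(** The complex line spanned by the class at z. Unlike a normalized S, it involves no choice of
    sign, so the fibre can be defined with it over the whole stem domain. *)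
Definition class_line z y := exists U w c,
  [/\ minimal_rep V om U w, iota_domain U z & y = c *: stem w z].

Lemma minrep_at z : iota_domain V z -> exists U w, minimal_rep V om U w /\ iota_domain U z.
Proof.
move=> Dz; have [U [w [m Up]]] := minrep_exists dV hom hn ((iota_domainP z sV uqi).1 Dz).
by exists U, w; split=> //; exists qi.
Qed.

Lemma class_lineP U w z y : minimal_rep V om U w -> iota_domain U z ->
  class_line z y <-> exists c, y = c *: stem w z.
Proof.
move=> m Dz; split=> [[U' [w' [c [m' Dz' ->]]]]|[c ->]]; last by exists U, w, c.
have [k ->] := minrep_multiple m m' Dz Dz'; by exists (c * k); rewrite scalerA.
Qed.

Lemma class_line_g z : iota_domain V z -> class_line z (qvec (stem g z)).
Proof.
move=> /minrep_at[U [w [m Dz]]]; have [c E] := SR_multiple m Dz; by exists U, w, c.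
Qed.

Lemma class_line_conj z y : class_line z y -> class_line (conjc z) (mapq (@conjc R) y).
Proof.
move=> [U [w [c [m Dz ->]]]]; have [[sU _] _ sw _ _] := minrep_stem m.
exists U, w, (conjc c); split=> //; first exact: iota_domain_conj.
rewrite sw //; have cM (a b : C) : conjc (a * b) = conjc a * conjc b by exact: rmorphM.
by move: (stem w z) => v; apply/rowP => l; rewrite !mxE cM.
Qed.

(** An isotropic stem value of w would produce a zero of w on the sphere of z, hence a point of
    Z(omega). *)
Lemma minrep_norm U w z : minimal_rep V om U w -> iota_domain U z -> qvnorm (stem w z) != 0.
Proof.
move=> m Dz; have [oU UV _ hw _] := minrep_stem m; have [sU _] := oU.
have [[_ _ vw _] _] := m; have [rw _] := vw; have [_ _ iw] := stem_facts oU rw.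
apply/eqP => n0; have : sqnormq (stem w z) = 0.
  by rewrite sqnormq_split n0 (hw z Dz).2 expr0n addr0.
move=> /zero_slice_val[J uJ E]; have UJ := (iota_domainP z sU uJ).1 Dz.
have : class_zeros V om (embed J z).
  split=> //; exists U, w; split=> //.
  by rewrite (induces_val iw uJ UJ).
by rewrite hZ.
Qed.

(** Since w^s has no zeros, it has a holomorphic square root near z, by which w is divided. *)
Lemma class_frame z : iota_domain V z -> exists (r : R) (S : C -> HC), 0 < r /\
  forall t, nm (t - z) < r -> [/\ iota_domain V t, qhol S t, unit_vec (S t) &
    forall y, class_line t y <-> exists c, y = c *: S t].
Proof.
move=> /minrep_at[U [w [m Dz]]]; have [oU UV _ hw _] := minrep_stem m.
have [r r0 rP] := iota_domain_open oU Dz.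
have hN t : nm (t - z) < r -> chol (fun t => qvnorm (stem w t)) t.
  move=> /rP/hw[h _]; apply: cholD; first by apply: cholD; apply: cholX; exact: h.
  by apply: cholX; exact: h.
have [s /andP[s0 sr] [l lP]] := local_log r0 hN (minrep_norm m Dz).
exists s, (fun t => cexp (- (l t / 2)) *: stem w t); split=> // t ts.
have [hl lE] := lP t ts; have Dt : iota_domain U t by apply: rP; exact: lt_le_trans sr.
have [hwt w00] := hw t Dt; have n0 := minrep_norm m Dt; split.
- by have [J uJ UJ] := Dt; exists J => //; exact: UV.
- apply: qholZ => //; apply: chol_exp; apply: cholN; apply: chol_div => //; exact: chol_cst.
- split; first by rewrite mxE w00 mulr0.
  rewrite qvnormZ -lE -cexpX -cexpD -[RHS]cexp0; congr cexp.
  by field.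
move=> y; rewrite (class_lineP y m Dt); split=> -[c ->].
  by exists (c * cexp (l t / 2)); rewrite scalerA -mulrA cexpNr mulr1.
by exists (c * cexp (- (l t / 2))); rewrite scalerA.
Qed.

Definition log_fibre z : set HC := [set y | qexp y = stem g z /\ class_line z (qvec y)].

Lemma fibre_split z y S : (forall y, class_line z y <-> exists c, y = c *: S) ->
  log_fibre z y -> exists b, y = (y 0 0)%:A + b *: S.
Proof. by move=> hS [_ /hS[b E]]; exists b; rewrite {1}(qsplit y) E. Qed.

Lemma fibre_frame z S (a b h : C) : unit_vec S -> (forall y, class_line z y <-> exists c, y = c *: S) ->
  stem g z = (stem g z 0 0)%:A + h *: S ->
  log_fibre z (a%:A + b *: S) <-> cexp (a + ii * b) = stem g z 0 0 + ii * h /\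
    cexp (a - ii * b) = stem g z 0 0 - ii * h.
Proof.
move=> uS hS E; rewrite /log_fibre /= qexp_frame //; split.
  by move=> [+ _]; rewrite {1}E frame_valE => /(frame_val_inj uS).
move=> [-> ->]; split; first by rewrite -frame_valE -E.
by rewrite frame_val_vec //; apply/hS; exists b.
Qed.

(** The coefficient is the bilinear product with S rather than a quotient of coordinates, which
    shows that it is holomorphic wherever S is. *)
Lemma g_frame z S : iota_domain V z -> unit_vec S -> (forall y, class_line z y <-> exists c, y = c *: S) ->
  stem g z = (stem g z 0 0)%:A +
    (S 0 1 * stem g z 0 1 + S 0 2 * stem g z 0 2 + S 0 3 * stem g z 0 3) *: S.
Proof.
move=> Dz uS hS; have [c E] := (hS _).1 (class_line_g Dz).
have Ec l : l != 0 -> stem g z 0 l = (c *: S) 0 l.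
  move=> l0; rewrite -E; case: l l0 => [[|[|[|[|//]]]] il] //= _; rewrite [RHS]mxE /=; congr (stem g z 0 _); exact: val_inj.
by rewrite (Ec 1) // (Ec 2) // (Ec 3) // unit_vec_dot // -E; exact: qsplit.
Qed.

Lemma fibre_discrete z y y' : iota_domain V z -> log_fibre z y -> log_fibre z y' ->
  qn (y - y') < 1 -> y = y'.
Proof.
move=> Dz Fy Fy'; have [r [S [r0 /(_ z)]]] := class_frame Dz.
rewrite subrr nm0 => /(_ r0)[_ _ uS hS].
have [b yE] := fibre_split hS Fy; have [b' yE'] := fibre_split hS Fy'.
have := etrans Fy.1 (esym Fy'.1); move: (y 0 0) (y' 0 0) yE yE' => a a' -> -> e h.
exact: frame_discrete uS h e.
Qed.

Lemma fibre_sections z : iota_domain V z -> exists2 r : R, 0 < r &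
  forall t y, nm (t - z) < r -> log_fibre t y -> exists s : C -> HC, s t = y /\
    forall t', nm (t' - z) < r -> log_fibre t' (s t') /\ qhol s t'.
Proof.
move=> Dz; have [r [S [r0 rP]]] := class_frame Dz; have [_ hg _] := stem_facts oV rg.
pose h t := S t 0 1 * stem g t 0 1 + S t 0 2 * stem g t 0 2 + S t 0 3 * stem g t 0 3.
have hh t : nm (t - z) < r -> chol h t.
  move=> /rP[/hg hgt hSt _ _]; apply: cholD; first apply: cholD; apply: cholM;
    by [exact: hSt|exact: hgt].
have gE t : nm (t - z) < r -> stem g t = (stem g t 0 0)%:A + h t *: S t.
  by move=> /rP[Dt _ uS hS]; exact: g_frame.
have ig t : chol h t -> chol (fun t => ii * h t) t by move=> ?; apply: cholM => //; exact: chol_cst.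
have hP t : nm (t - z) < r -> chol (fun t => stem g t 0 0 + ii * h t) t.
  by move=> tr; have [/hg hgt _ _ _] := rP t tr; apply: cholD; [exact: hgt|apply: ig; exact: hh].
have hM t : nm (t - z) < r -> chol (fun t => stem g t 0 0 - ii * h t) t.
  by move=> tr; have [/hg hgt _ _ _] := rP t tr; apply: cholB; [exact: hgt|apply: ig; exact: hh].
have zr : nm (z - z) < r by rewrite subrr nm0.
(* The product is the stem value of g^s, nonzero because g has no zeros; so both factors have local
   logarithms. *)
have nz : (stem g z 0 0 + ii * h z) * (stem g z 0 0 - ii * h z) != 0.
  have [_ _ uS _] := rP z zr; rewrite (sqnormq_frame _ _ uS) -gE //.
  exact: (stem_sqnormq_neq0 bV cg g0 Dz).
have [nP nM] : stem g z 0 0 + ii * h z != 0 /\ stem g z 0 0 - ii * h z != 0.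
  by move: nz; rewrite mulf_eq0 negb_or => /andP.
have [s1 /andP[s10 s1r] [l l_P]] := local_log r0 hP nP.
have [s2 /andP[s20 s2r] [k k_P]] := local_log r0 hM nM.
exists (Num.min s1 s2); first by rewrite lt_min s10.
move=> t y; rewrite lt_min => /andP[t1 t2] Fy.
have tr : nm (t - z) < r by exact: lt_le_trans s1r.
have [Dt _ uS hS] := rP t tr; have [b yE] := fibre_split hS Fy.
move: (y 0 0) yE Fy => a yE; rewrite {}yE {y} => Fy.
have [e1 e2] := (fibre_frame _ _ uS hS (gE t tr)).1 Fy.
have [_ l_t] := l_P t t1; have [_ k_t] := k_P t t2.
(* Periods of the exponential, by which the two local logarithms are shifted so that the section
   passes through y. *)
pose kp := a + ii * b - l t; pose km := a - ii * b - k t.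
have ekp : cexp kp = 1 by rewrite /kp cexpB e1 l_t divff // -l_t cexp_neq0.
have ekm : cexp km = 1 by rewrite /km cexpB e2 k_t divff // -k_t cexp_neq0.
pose A x := ((l x + kp) + (k x + km)) / 2; pose B x := ((l x + kp) - (k x + km)) / (2 * ii).
have AB x : A x + ii * B x = l x + kp /\ A x - ii * B x = k x + km.
  by rewrite /A /B; move: (l x + kp) (k x + km) => P M; split; field; rewrite ?i0 ?two0.
exists (fun x => (A x)%:A + B x *: S x); split.
  have [h1 h2] := AB t; rewrite frame_valE h1 h2 [RHS]frame_valE /kp /km.
  by congr (frame_val _ _ _); rewrite addrC subrK.
move=> x; rewrite lt_min => /andP[x1 x2]; have xr : nm (x - z) < r by exact: lt_le_trans s1r.
have [Dx hSx uSx hSSx] := rP x xr; have [hl lE] := l_P x x1; have [hk kE] := k_P x x2.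
split.
  apply/(fibre_frame _ _ uSx hSSx (gE x xr)); have [-> ->] := AB x.
  by rewrite (cexpD (l x)) (cexpD (k x)) ekp ekm !mulr1 lE kE.
have hlk : chol (fun x => l x + kp) x /\ chol (fun x => k x + km) x.
  by split; apply: cholD => //; exact: chol_cst.
have [hl' hk'] := hlk.
apply: qholD; first by apply: qhol_scalar; apply: chol_div => //; [exact: cholD|exact: chol_cst].
apply: qholZ => //; apply: chol_div; [exact: mulf_neq0|exact: cholB|exact: chol_cst].
Qed.

Lemma fibre_conj z y : iota_domain V z -> log_fibre z y -> log_fibre (conjc z) (mapq (@conjc R) y).
Proof.
move=> Dz [E L]; have [sg _ _] := stem_facts oV rg; split.
  by rewrite sg // -E qexp_conj.
by rewrite qvec_conj; exact: class_line_conj.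
Qed.

Lemma fibre_nonempty z : iota_domain V z -> exists y, log_fibre z y.
Proof.
move=> Dz; have [r [S [r0 /(_ z)]]] := class_frame Dz.
rewrite subrr nm0 => /(_ r0)[_ _ uS hS]; have gE := g_frame Dz uS hS.
move: (S z 0 1 * _ + _ + _) gE => h gE; have := stem_sqnormq_neq0 bV cg g0 Dz.
rewrite {1}gE -sqnormq_frame // mulf_eq0 negb_or => /andP[/cexp_surj[al alE] /cexp_surj[be beE]].
exists (((al + be) / 2)%:A + ((al - be) / (2 * ii)) *: S (z)).
apply/(fibre_frame _ _ uS hS gE).
have -> : (al + be) / 2 + ii * ((al - be) / (2 * ii)) = al by field; rewrite ?i0 ?two0.
by have -> : (al + be) / 2 - ii * ((al - be) / (2 * ii)) = be by field; rewrite ?i0 ?two0.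
Qed.

Lemma conjc_fix (c : C) : conjc c = c -> exists a : R, c = a%:C.
Proof. by case: c => a b [] h; exists a; congr Complex; lra. Qed.

Lemma real_coord (v : HC) l : mapq (@conjc R) v = v -> exists a : R, v 0 l = a%:C.
Proof.
move=> E; apply: conjc_fix.
by have := congr1 (fun t : HC => t 0 l) E; rewrite mxE.
Qed.

Lemma real_dot S y : mapq (@conjc R) S = S -> mapq (@conjc R) y = y ->
  exists h : R, S 0 1 * y 0 1 + S 0 2 * y 0 2 + S 0 3 * y 0 3 = h%:C.
Proof.
move=> eS ey.
have [s1 ->] := real_coord 1 eS; have [s2 ->] := real_coord 2 eS; have [s3 ->] := real_coord 3 eS.
have [y1 ->] := real_coord 1 ey; have [y2 ->] := real_coord 2 ey; have [y3 ->] := real_coord 3 ey.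
by exists (s1 * y1 + s2 * y2 + s3 * y3); rewrite !rmorphD !rmorphM.
Qed.

(** For a real vector the quadratic form is nonnegative, so when it is nonzero the normalizing
    factor can be taken real. *)
Lemma real_normalize (v : HC) : mapq (@conjc R) v = v -> v 0 0 = 0 -> qvnorm v != 0 ->
  exists2 k : R, k != 0 & unit_vec (k%:C *: v) /\ mapq (@conjc R) (k%:C *: v) = k%:C *: v.
Proof.
move=> ev v0; have [a1 E1] := real_coord 1 ev; have [a2 E2] := real_coord 2 ev.
have [a3 E3] := real_coord 3 ev; pose n := a1 ^+ 2 + a2 ^+ 2 + a3 ^+ 2.
have nE : qvnorm v = n%:C by rewrite /qvnorm E1 E2 E3 !rmorphD !rmorphXn.
rewrite nE fmorph_eq0 => n0.
have np : 0 < n by rewrite lt_neqAle eq_sym n0 !addr_ge0 ?sqr_ge0.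
exists (Num.sqrt n)^-1; first by rewrite invr_eq0 gt_eqF // sqrtr_gt0.
split; last first.
  have cM (c d : C) : conjc (c * d) = conjc c * conjc d by exact: rmorphM.
  by rewrite -[in RHS]ev; apply/rowP => l; rewrite !mxE cM conjc_real.
split; first by rewrite mxE v0 mulr0.
rewrite qvnormZ nE -rmorphXn -rmorphM exprVn sqr_sqrtr ?mulVf ?rmorph1 //; exact: ltW.
Qed.

(** Over a real point S can be chosen real, and then g_0 + iota h and g_0 - iota h are conjugate:
    one logarithm u + iota v of the first solves both equations with the real coefficients u and
    v. *)
Lemma fibre_real (x : R) : iota_domain V x%:C ->
  exists2 y, log_fibre x%:C y & mapq (@conjc R) y = y.
Proof.
move=> Dx; have [U [w [m Ux]]] := minrep_at Dx; have [_ _ sw hw _] := minrep_stem m.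
have [sg _ _] := stem_facts oV rg.
have Sw := sw _ Ux; have Sg := sg _ Dx; rewrite conjc_real in Sw Sg.
have N0 := stem_sqnormq_neq0 bV cg g0 Dx.
have [k k0 [uS Sc]] := real_normalize (esym Sw) (hw _ Ux).2 (minrep_norm m Ux).
have hS y : class_line x%:C y <-> exists c, y = c *: (k%:C *: stem w x%:C).
  split=> [/(class_lineP _ m Ux)[c ->]|[c ->]].
    by exists (c * (k%:C)^-1); rewrite !scalerA -mulrA mulVf ?mulr1 // fmorph_eq0.
  by apply/(class_lineP _ m Ux); exists (c * k%:C); rewrite scalerA.
move: (k%:C *: _) uS Sc hS => S uS Sc hS.
have gE := g_frame Dx uS hS; have [h hE] := real_dot Sc (esym Sg).
have [a aE] := real_coord 0 (esym Sg); rewrite hE in gE.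
move: N0; rewrite {1}gE -sqnormq_frame // mulf_eq0 negb_or => /andP[/cexp_surj[[u v] uvE] _].
have uv : cexp (u%:C + ii * v%:C) = a%:C + ii * h%:C by rewrite iE uvE aE.
exists (u%:C%:A + v%:C *: S).
  apply/(fibre_frame _ _ uS hS gE); rewrite aE; split; first exact: uv.
  by rewrite !iE' cexp_conj -!iE uv.
have cD (c d : C) : conjc (c + d) = conjc c + conjc d by exact: rmorphD.
have cM (c d : C) : conjc (c * d) = conjc c * conjc d by exact: rmorphM.
have cE (c d : C) (y : HC) : mapq (@conjc R) (c%:A + d *: y) = (conjc c)%:A + conjc d *: mapq (@conjc R) y.
  by rewrite -mapq_conj_scalar; move: c%:A => t; apply/rowP => l; rewrite !mxE cD cM.
by rewrite cE Sc (conjc_real u) (conjc_real v).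
Qed.

Theorem empty_zeros_log : exists2 f, star_log V g f & SR_class V om f.
Proof.
have [F [sF hF FF]] := symmetric_monodromy bV ltr01 fibre_discrete fibre_sections fibre_conj
  fibre_nonempty fibre_real.
have qF z : iota_domain V z -> qhol F z by move=> /hF/derivable_quatP.
have rf : slice_regular V (slice_of F) by exact: slice_regular_of.
exists (slice_of F); first by apply: star_log_of => // z /FF[].
apply/(SR_classP dV hom hn rf) => z U w z0 Dz m.
have [oU UV sw hw wN] := minrep_stem m; have [r r0 rP] := iota_domain_open oU Dz.
have DV t : iota_domain U t -> iota_domain V t by move=> [J uJ /UV]; exists J.
(* A coordinate of w without zeros near z exhibits the factor between F_v and w as a holomorphic
   quotient. *)
have [l wl] : exists l, stem w z 0 l != 0.
  apply: contrapT => h; have /negP := wN z Dz; apply; apply/eqP/rowP => l; rewrite [RHS]mxE.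
  by apply/eqP; apply: contrapT => /negP h'; apply: h; exists l.
have [s s0 sP] := chol_neq0 ((hw z Dz).1 l) wl.
have qFU t : iota_domain U t -> qvec (stem (slice_of F) t) = qvec (F t).
  by move=> /DV Dt; rewrite (stem_slice_of sV sF Dt).
apply: ldep_sym; apply: (@ldep_factor _ _ _ _ (fun t => qvec (F t) 0 l / stem w t 0 l) (Num.min r s)).
  by rewrite lt_min r0.
move=> t; rewrite lt_min => /andP[/rP Dt /sP wt]; split.
  by apply: chol_div => //; [apply: qhol_qvec; apply: qF; exact: DV|exact: (hw t Dt).1].
rewrite qFU //; have [c E] := (class_lineP _ m Dt).1 (FF t (DV t Dt)).2.
by rewrite E; move: (stem w t) wt => v wt; rewrite [(c *: v) 0 l]mxE mulfK.
Qed.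

End Frames.

Theorem theorem1p1 (R : realType) (Omega : set (quat R))
    (omega : quat R -> set (vfun R)) (g : quat R -> quat R)
    (Omega_basic : basic_domain Omega)
    (omega_class : vectorial_class Omega omega)
    (g_omega : SR_class Omega omega g)
    (g_neq0 : forall q, Omega q -> g q <> 0) :
  [/\ is_class0 Omega omega ->
        ((exists2 f, star_log Omega g f & SR_class Omega omega f) <->
         (forall q, (Omega `&` @real_axis R) q ->
            exists2 t : R, 0 < t & g q = t%:A)),
      ~ is_class0 Omega omega ->
        class_zeros Omega omega = set0 \/
        axial_hull (class_zeros Omega omega) = Omega ->
        exists2 f, star_log Omega g f & SR_class Omega omega f
    & ~ is_class0 Omega omega ->
        isolated (class_zeros Omega omega) = class_zeros Omega omega ->
        forall r, slice_preserving Omega r ->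
          (forall q, Omega q -> star r r q = symmetrization g q) ->
          (forall q, (Omega `&` @real_axis R) q ->
             exists2 t : R, 0 < t & r q = t%:A) ->
          (forall q, Omega q ->
             ~ exists2 t : R, t <= -1 & scalar_part g q / r q = t%:A) ->
        exists2 f, star_log Omega g f & SR_class Omega omega f].
Proof.
split=> [om0|hn|hn _ r pr rr rpos nle].
- exact: class0_log Omega_basic g_omega g_neq0 om0.
- move=> [hZ|hull]; first exact: empty_zeros_log Omega_basic omega_class g_omega g_neq0 hn hZ.
  exact: hull_log Omega_basic omega_class g_omega g_neq0 hn hull.
- by have := principal_log Omega_basic omega_class g_omega g_neq0 hn pr rr rpos nle.
Qed.
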